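(* Let $(X,\mathcal B(X),\mu)$ be a $\sigma$-finite measure space and let $1\le p_0<p_1\le2$. Given $k\in\mathbb Z_+$, let $\{\mathcal H_s:s\in\mathbb R_+^k\}$ be a family of linear operators defined on $L^{p_0}(X)+L^2(X)$. Suppose that the following conditions are satisfied. (C1) (Maximal estimate) The maximal operator $\mathcal H_*f=\sup_{s\in\mathbb R_+^k}\sup_{|g|\le|f|}|\mathcal H_sg|$ is bounded on $L^{p_1}(X)$. (C2) (Splitting into long and short variations) There exist $L,r\in\mathbb Z_+$ and a family of cubes $\{Q_{\mathbf g}\subseteq\mathbb R_+^k:\mathbf g\in\mathbb Z^r\}$ of the form $$Q_{\mathbf g}=\{s\in\mathbb R_+^k:\mathrm{left}(Q_{\mathbf g})\preceq s\preceq\mathrm{right}(Q_{\mathbf g})\}$$ with some $\mathrm{left}(Q_{\mathbf g}),\mathrm{right}(Q_{\mathbf g})\in\mathbb R_+^k$ satisfying $\mathrm{right}(Q_{\mathbf g})=(1+2^L)\,\mathrm{left}(Q_{\mathbf g})$, and there are fixed parameters $s(\mathbf g)\in Q_{\mathbf g}$, $\mathbf g\in\mathbb Z^r$, for which $$\big\|V^2(\mathcal H_sf:s\in\mathbb R_+^k)\big\|_{L^{p_1}(X)}\lesssim\big\|V^2(\mathcal H_{s(\mathbf g)}f:\mathbf g\in\mathbb Z^r)\big\|_{L^{p_1}(X)}+\Big\|\Big(\sum_{\mathbf g\in\mathbb Z^r}\big|V^2(\mathcal H_sf:s\in Q_{\mathbf g})\big|^2\Big)^{1/2}\Big\|_{L^{p_1}(X)}$$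 holds uniformly in $f\in L^{p_1}(X)$. (C3) (Continuity) Given $f\in L^{p_1}(X)$ and $\mathbf g\in\mathbb Z^r$, the mapping $s\mapsto\mathcal H_sf(x)$ is continuous on $Q_{\mathbf g}$ for $\mu$-almost every $x\in X$. (C4) (Littlewood–Paley decomposition) There exists a family of operators $\{\mathcal S_{\mathbf g}:\mathbf g\in\mathbb Z^r\}$ commuting with each $\mathcal H_s$ such that $$\sum_{\mathbf g\in\mathbb Z^r}\mathcal S_{\mathbf g}=\mathrm{Id}$$ holds in the strong operator topology on $L^2(X)$ and $\mu$-almost everywhere on $X$ for every $f\in L^2(X)$. Furthermore, for every $p\in(p_0,2]$, $$\Big\|\Big(\sum_{\mathbf g\in\mathbb Z^r}|\mathcal S_{\mathbf g}f|^2\Big)^{1/2}\Big\|_{L^p(X)}\lesssim_p\|f\|_{L^p(X)},\qquad f\in L^p(X).\qquad(\mathrm{LP})$$ Moreover, there is a family $\{c_{\mathbf h}:\mathbf h\in\mathbb Z^r\}\subseteq\mathbb R_+$ such that for each $\mathbf h\in\mathbb Z^r$ and every choice of $s_{\mathbf g}\in Q_{\mathbf g}$, $\mathbf g\in\mathbb Z^r$, $$\Big\|\Big(\sum_{\mathbf g\in\mathbb Z^r}|\mathcal H_{s_{\mathbf g}}\mathcal S_{\mathbf g+\mathbf h}f|^2\Big)^{1/2}\Big\|_{L^2(X)}\le c_{\mathbf h}\|f\|_{L^2(X)},\qquad f\in L^2(X),$$ and, for some $\varepsilon\in(0,\frac12)$, $$\sum_{\mathbf h\in\mathbb Z^r}c_{\mathbf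 h}^{(\frac12-\varepsilon)\frac{p_1-p_0}{2-p_0}}<\infty.$$ (C5) (Cancellation condition) For any $K\subseteq[k]$ (including $K=\emptyset$) there is a uniform estimate $$\|\Delta_h^K\mathcal H_s\|_{L^p(X)\to L^p(X)}\lesssim\prod_{i\in K}\frac{h_i}{s_i}$$ for $p\in\{p_0,2\}$, whenever $s,s+h\in Q_{\mathbf g}$ and $\mathbf g\in\mathbb Z^r$. Then the $k$-parameter variation inequality $$\big\|V^2(\mathcal H_sf:s\in\mathbb R_+^k)\big\|_{L^{p_1}(X)}\lesssim\|f\|_{L^{p_1}(X)},\qquad f\in L^{p_1}(X),$$ holds with the implicit constant possibly depending on $p_0,p_1,k,r,L,\varepsilon$ and the implicit constants arising in the assumptions. In particular, one has the $k$-parameter oscillation inequality $$\sup_{I\in\mathfrak S(\mathbb R_+^k)}\big\|O_I^2(\mathcal H_sf:s\in\mathbb R_+^k)\big\|_{L^{p_1}(X)}\lesssim\|f\|_{L^{p_1}(X)},\qquad f\in L^{p_1}(X).$$ Additionally, the two inequalities above hold with $p_1$ replaced by any $p\in[p_1,p_1']$ provided that the set of dual conditions is also satisfied, that is: (C2) and (C3) hold with $p_1$ replaced by every $p\in[p_1,p_1']$; (C1) and (C5) hold with the adjoint operators $\mathcal H_s^*$ in place of $\mathcal H_s$; and (LP) holds for all $p$ in the range $[2,p_0')$.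
   Context: $\mathbb Z_+=\{1,2,\ldots\}$, $\mathbb N=\{0,1,2,\ldots\}$, $\mathbb R_+=(0,\infty)$, $[k]=\{1,\ldots,k\}$, $p'$ is the dual exponent of $p$. For $x,y\in\mathbb R^k$ (or $\mathbb Z^r$): $x\preceq y$ iff $x_i\le y_i$ for all $i$; $x\prec y$ iff $x_i<y_i$ for all $i$. For an index set $\mathbb I$, $\mathfrak S(\mathbb I)$ denotes the set of infinite sequences $I=(I_j)_{j\in\mathbb N}$ in $\mathbb I$ with $I_0\prec I_1\prec\cdots$, and $\mathfrak S_J(\mathbb I)$ the set of finite sequences $I_0\prec I_1\prec\cdots\prec I_J$ in $\mathbb I$. Define $$V^2(a_s(x):s\in\mathbb I)=\sup_{J\in\mathbb Z_+}\sup_{I\in\mathfrak S_J(\mathbb I)}\Big(\sum_{j=1}^J|a_{I_j}(x)-a_{I_{j-1}}(x)|^2\Big)^{1/2},$$ $$O_I^2(a_s(x):s\in\mathbb R_+^k)=\Big(\sum_{j\in\mathbb Z_+}\sup_{s\in\mathbb B_j[I]}|a_s(x)-a_{I_{j-1}}(x)|^2\Big)^{1/2},\qquad \mathbb B_j[I]=\prod_{i=1}^k[I_{(j-1),i},I_{j,i}),$$ where $I_j=(I_{j,1},\ldots,I_{j,k})$. In $V^2(\mathcal H_{s(\mathbf g)}f:\mathbf g\in\mathbb Z^r)$ the family is regarded as indexed by $\mathbf g\in\mathbb Z^r$. Difference operators: with $e_j$ the standard basis vectors of $\mathbb R^k$, $\Delta_h^{\{j\}}a_s=a_{s+h_je_j}-a_s$;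 for $K=\{j_1,\ldots,j_m\}\subseteq[k]$, $\Delta_h^Ka_s=\Delta_h^{\{j_1\}}\circ\cdots\circ\Delta_h^{\{j_m\}}a_s$, and $\Delta_h^\emptyset a_s=a_s$; here $h\in\mathbb R_+^k$, and $\Delta_h^K\mathcal H_s$ is defined by the same formula applied to the operator-valued function $s\mapsto\mathcal H_s$. $A\lesssim B$ means $A\le CB$ for some constant $C$. *)

(* Defs.v *)
From mathcomp Require Import all_boot all_order all_algebra finmap.
From mathcomp Require Import complex.
From mathcomp Require Import all_classical all_reals all_analysis.

Set Implicit Arguments.
Unset Strict Implicit.
Unset Printing Implicit Defensive.

Import Order.TTheory GRing.Theory Num.Theory.
Import numFieldNormedType.Exports.

Local Open Scope classical_set_scope.
Local Open Scope ring_scope.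
Local Open Scope complex_scope.

Section order.
Context {E : numDomainType} {m : nat}.
Implicit Types x y : 'rV[E]_m.

Definition preceq x y := forall i, x ord0 i <= y ord0 i.
Definition prec x y := forall i, x ord0 i < y ord0 i.

(* The set (0, +oo)^m. *)
Definition posorthant : set 'rV[E]_m := [set x | prec 0 x].

Definition inf_chain (D : set 'rV[E]_m) : set (nat -> 'rV[E]_m) :=
  [set I | (forall j, D (I j)) /\ (forall j, prec (I j) (I j.+1))].

(* Only the values I 0, ..., I J of the sequence I matter. *)
Definition fin_chain (D : set 'rV[E]_m) (J : nat) : set (nat -> 'rV[E]_m) :=
  [set I | (forall j, (j <= J)%N -> D (I j)) /\
           (forall j, (j < J)%N -> prec (I j) (I j.+1))].

End order.

Section variation_oscillation.
Context {R : realType}.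

(* For a function that is not known to be measurable, such as x |-> V2 D (a_s x)
   with D uncountable, 'N[mu]_p is taken with the lower integral. *)
Definition V2 {E : numDomainType} {m : nat} (D : set 'rV[E]_m)
    (a : 'rV[E]_m -> R[i]) : \bar R :=
  ereal_sup [set v | exists (J : nat) (I : nat -> 'rV[E]_m),
    [/\ (0 < J)%N, fin_chain D J I &
        v = (Num.sqrt (\sum_(1 <= j < J.+1)
               Normc.normc (a (I j) - a (I j.-1)) ^+ 2))%:E]].

Definition box {k : nat} (I : nat -> 'rV[R]_k) (j : nat) : set 'rV[R]_k :=
  [set s | preceq (I j.-1) s /\ prec s (I j)].

Definition O2 {k : nat} (I : nat -> 'rV[R]_k) (a : 'rV[R]_k -> R[i]) : \bar R :=
  ((\sum_(1 <= j <oo)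
     (ereal_sup [set (Normc.normc (a s - a (I j.-1)))%:E | s in box I j]) ^+ 2)
   `^ 2^-1)%E.

Definition l2sum {r : nat} (a : 'rV[int]_r -> \bar R) : \bar R :=
  ((\esum_(g in [set: 'rV[int]_r]) (a g ^+ 2)) `^ 2^-1)%E.

(* The cube with lower corner l and upper corner (1 + 2 ^ L) l. *)
Definition cube {k : nat} (L : nat) (l : 'rV[R]_k) : set 'rV[R]_k :=
  [set s | [/\ posorthant s, preceq l s & preceq s ((1 + 2 ^+ L) *: l)]].

Definition diff1 {k : nat} (h : 'rV[R]_k) (j : 'I_k) (a : 'rV[R]_k -> R[i]) :
    'rV[R]_k -> R[i] :=
  fun s => a (s + h ord0 j *: delta_mx ord0 j) - a s.

(* The operators diff1 h j commute, so the order of composition is immaterial. *)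
Definition mixed_diff {k : nat} (h : 'rV[R]_k) (K : {set 'I_k})
    (a : 'rV[R]_k -> R[i]) : 'rV[R]_k -> R[i] :=
  foldr (diff1 h) a (enum K).

End variation_oscillation.

Section operators.
Context {R : realType} {d : measure_display} {T : measurableType d}.
Variable mu : {measure set T -> \bar R}.

(* An operator acts on complex-valued functions rather than on classes modulo
   a.e. equality: pointwise suprema over uncountable families depend on the
   choice of representatives, which is thus part of the data. *)
Definition operator := (T -> R[i]) -> (T -> R[i]).

Definition cmeasurable (f : T -> R[i]) :=
  measurable_fun [set: T] (fun x => complex.Re (f x)) /\
  measurable_fun [set: T] (fun x => complex.Im (f x)).

Definition cnorm (p : \bar R) (f : T -> R[i]) : \bar R :=
  'N[mu]_p[(fun x => (Normc.normc (f x))%:E)]%E.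

Definition Lp (p : \bar R) : set (T -> R[i]) :=
  [set f | cmeasurable f /\ (cnorm p f < +oo)%E].

Definition Lp_add (p q : \bar R) : set (T -> R[i]) :=
  [set f | exists f1 f2, [/\ Lp p f1, Lp q f2 & f = (fun x => f1 x + f2 x)]].

(* The union of L^p + L^2 over p0 < p <= 2. *)
Definition Lp_above (p0 : R) : set (T -> R[i]) :=
  [set f | exists p : R, [/\ p0 < p, p <= 2 & Lp_add p%:E 2%:E f]].

Definition linear_operator (D : set (T -> R[i])) (U : operator) :=
  [/\ forall f, D f -> cmeasurable (U f),
      forall f g, D f -> D g -> {ae mu, forall x, f x = g x} ->
        {ae mu, forall x, U f x = U g x} &
      forall (a : R[i]) f g, D f -> D g ->
        {ae mu, forall x, U (fun y => a * f y + g y) x = a * U f x + U g x}].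

(* Commutation is required wherever both V (U f) and U (V f) are defined. *)
Definition commute_on (D : set (T -> R[i])) (U V : operator) :=
  forall f, D f -> D (U f) -> {ae mu, forall x, V (U f) x = U (V f) x}.

Definition cinner (f g : T -> R[i]) : R[i] :=
  Rintegral mu [set: T] (fun x => complex.Re (f x * (g x)^*)) +i*
  Rintegral mu [set: T] (fun x => complex.Im (f x * (g x)^*)).

(* U on L^p and V on L^p' are adjoint to each other. *)
Definition adjoint_on (p : \bar R) (U V : operator) :=
  forall f g, Lp p f -> Lp (hoelder_conjugate p) g ->
    [/\ Lp p (U f), Lp (hoelder_conjugate p) (V g) &
        cinner (U f) g = cinner f (V g)].

Section conditions.
Context {k r : nat}.
Implicit Types (H : 'rV[R]_k -> operator) (S : 'rV[int]_r -> operator).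
Implicit Types (lft sg : 'rV[int]_r -> 'rV[R]_k) (c : 'rV[int]_r -> R).
Implicit Types (p A : R) (L : nat).

Definition maximal H (f : T -> R[i]) (x : T) : \bar R :=
  ereal_sup [set v | exists s g,
    [/\ posorthant s, cmeasurable g,
        forall y, Normc.normc (g y) <= Normc.normc (f y) &
        v = (Normc.normc (H s g x))%:E]].

Definition maximal_estimate p A H :=
  forall f, Lp p%:E f -> ('N[mu]_p%:E[maximal H f] <= A%:E * cnorm p%:E f)%E.

Definition splitting p A L H lft sg :=
  forall f, Lp p%:E f ->
    ('N[mu]_p%:E[(fun x => V2 posorthant (fun s => H s f x))] <=
     A%:E * ('N[mu]_p%:E[(fun x => V2 [set: 'rV[int]_r] (fun g => H (sg g) f x))] +
             'N[mu]_p%:E[(fun x => l2sum (fun g =>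
                           V2 (cube L (lft g)) (fun s => H s f x)))]))%E.

Definition cube_continuity p L H lft :=
  forall f g, Lp p%:E f ->
    {ae mu, forall x, {within cube L (lft g),
      continuous (fun s => H s f x : (R[i] : numFieldType))}}.

(* Convergence of the series over Z^r along some increasing exhaustion of Z^r
   by finite sets, the same for all functions: this is implied by unconditional
   convergence, and by convergence of the partial sums over symmetric cubes. *)
Definition resolution_of_identity S :=
  exists F : nat -> {fset 'rV[int]_r},
    [/\ forall n, (F n `<=` F n.+1)%fset,
        forall g, exists n, g \in F n &
        forall f, Lp 2%:E f ->
          (cnorm 2%:E (fun x => \sum_(g <- F n) S g f x - f x)
             @[n --> \oo] --> 0%E) /\
          {ae mu, forall x,
             (\sum_(g <- F n) S g f x : (R[i] : numFieldType))
               @[n --> \oo] --> (f x : (R[i] : numFieldType))}].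

Definition LP_estimate p A S :=
  forall f, Lp p%:E f ->
    ('N[mu]_p%:E[(fun x => l2sum (fun g => (Normc.normc (S g f x))%:E))] <=
     A%:E * cnorm p%:E f)%E.

Definition almost_orthogonality L H lft S c :=
  forall (h : 'rV[int]_r) (s : 'rV[int]_r -> 'rV[R]_k),
    (forall g, cube L (lft g) (s g)) ->
    forall f, Lp 2%:E f ->
      ('N[mu]_2%:E[(fun x => l2sum (fun g =>
                     (Normc.normc (H (s g) (S (g + h) f) x))%:E))] <=
       (c h)%:E * cnorm 2%:E f)%E.

Definition cancellation p A L H lft :=
  forall (K : {set 'I_k}) (g : 'rV[int]_r) (s h : 'rV[R]_k),
    posorthant h -> cube L (lft g) s -> cube L (lft g) (s + h) ->
    forall f, Lp p%:E f ->
      (cnorm p%:E (fun x => mixed_diff h K (fun s' => H s' f x) s) <=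
       (A * \prod_(i in K) (h ord0 i / s ord0 i))%:E * cnorm p%:E f)%E.

Definition variation_inequality p A H :=
  forall f, Lp p%:E f ->
    ('N[mu]_p%:E[(fun x => V2 posorthant (fun s => H s f x))] <=
     A%:E * cnorm p%:E f)%E.

Definition oscillation_inequality p A H :=
  forall f, Lp p%:E f ->
    (ereal_sup [set 'N[mu]_p%:E[(fun x => O2 I (fun s => H s f x))] |
                I in inf_chain posorthant] <=
     A%:E * cnorm p%:E f)%E.

End conditions.

End operators.

(* Main.v *)
(* On a cube Q_g a continuous function telescopes, at any point, into mixed differences along
   dyadic grids of multi-level n in N^k. By Cauchy-Schwarz with geometric weights, both terms on
   the right of (C2) are therefore dominated by a weighted sum over n of the square functions of
   the differences of H_s f of level n, taken over all g and all grid points; it is enough to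
   bound each of them in L^p with a factor decaying exponentially in |n|.

   Write the l^2-valued operator at level n as a sum over h of its compositions with S_(g+h).
   On L^2, (C5) gives a decay 2^(-|n|/2) and the almost orthogonality in (C4) gives c_h 2^(|n|/2);
   a geometric mean with weights 1/2 + eps, 1/2 - eps gives c_h^(1/2-eps) 2^(-eps |n|). Without
   decay, (C1) on L^p1 with values in l^oo and (C5) on L^p0 with values in l^p0 interpolate to an
   l^2-valued bound on L^q for some q in (p0, p1), which (LP) turns into a bound for every h.
   Interpolating between L^2 and L^q, the exponent of c_h at p = p1 is exactly
   (1/2 - eps)(p1 - p0)/(2 - p0), so that the sum over h converges. For p > 2 the estimate on L^q'
   comes from the adjoint operators.

   The oscillation is at most twice the variation, because box representatives can be
   interleaved with auxiliary points into strictly increasing chains. *)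
Require Import Defs.
From mathcomp Require Import all_boot all_order all_algebra finmap.
From mathcomp Require Import complex.
From mathcomp Require Import all_classical all_reals all_analysis.
From mathcomp Require Import measurable_realfun.
From mathcomp Require Import cyclic separable ring lra.

Set Implicit Arguments.
Unset Strict Implicit.
Unset Printing Implicit Defensive.

Import Order.TTheory GRing.Theory Num.Theory.
Import numFieldNormedType.Exports.

Local Open Scope classical_set_scope.
Local Open Scope ring_scope.
Local Open Scope complex_scope.

(** Two obstacles shape the development: the resolution of the identity acts on L^2 only, and
    variations are not known to be measurable. Every interpolation therefore takes place for
    bilinear forms of finite families tested on step functions, where a form is a polynomial in the
    values of the step functions. A form bound on L^p becomes a square function bound by duality and
    reaches f outside L^2 by truncating f; finite families of cubes and levels exhaust the countable
    ones by monotone convergence. Continuity on cubes replaces suprema over chains by a countable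
    sum of squares, which is measurable and whose integral dominates the lower integral of the
    variation. One auxiliary exponent [Q] (1 - [Q] beyond 2) serves the whole range of p. When p
    moves from p1 to 2 the interpolation parameter grows, and the extra power of c_h is absorbed by
    the bound on c_h that summability provides. All constants are explicit, since they must not
    depend on the space or on the operators. *)

Local Notation nrm := Normc.normc.

(** * The three lines theorem on polynomials *)

Section complex_modulus.
Context {R : realType}.
Implicit Types (z w : R[i]) (x : R).

Lemma nrmE (z : R[i]) : `|z| = (nrm z)%:C.
Proof. by []. Qed.

Lemma nrm_ge0 z : 0 <= nrm z.
Proof. by case: z => a b; exact: sqrtr_ge0. Qed.

Lemma nrm_sqr z : nrm z ^+ 2 = complex.Re z ^+ 2 + complex.Im z ^+ 2.
Proof. by case: z => a b; rewrite /= sqr_sqrtr// addr_ge0 ?sqr_ge0. Qed.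

Lemma nrm_real x : nrm x%:C = `|x|.
Proof. by rewrite /= expr0n/= addr0 sqrtr_sqr. Qed.

Lemma nrmM z w : nrm (z * w) = nrm z * nrm w.
Proof. exact: Normc.normcM. Qed.

Lemma nrm0 : nrm (0 : R[i]) = 0.
Proof. exact: Normc.normc0. Qed.

Lemma nrm1 : nrm (1 : R[i]) = 1.
Proof. exact: Normc.normc1. Qed.

Lemma nrmX z n : nrm (z ^+ n) = nrm z ^+ n.
Proof.
elim: n => [|n ih]; first by rewrite !expr0 nrm1.
by rewrite !exprS nrmM ih.
Qed.

Lemma nrm_prod I (s : seq I) (P : pred I) (F : I -> R[i]) :
  nrm (\prod_(i <- s | P i) F i) = \prod_(i <- s | P i) nrm (F i).
Proof.
apply: (big_morph _ nrmM); exact: nrm1.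
Qed.

Lemma nrmD z w : nrm (z + w) <= nrm z + nrm w.
Proof. exact: le_normcD. Qed.

Lemma nrmN z : nrm (- z) = nrm z.
Proof. exact: normcN. Qed.

Lemma nrmB z w : nrm (z - w) <= nrm z + nrm w.
Proof. by rewrite -(nrmN w) nrmD. Qed.

Lemma nrm_sum I (s : seq I) (P : pred I) (F : I -> R[i]) :
  nrm (\sum_(i <- s | P i) F i) <= \sum_(i <- s | P i) nrm (F i).
Proof.
elim/big_ind2 : _ => //; first by rewrite nrm0.
by move=> z a w b za wb; rewrite (le_trans (nrmD _ _))// lerD.
Qed.

Lemma nrm_conj z : nrm z^* = nrm z.
Proof. by case: z => a b; rewrite /= sqrrN. Qed.

Lemma nrm_eq0 z : (nrm z == 0) = (z == 0).
Proof.
by apply/eqP/eqP => [/Normc.eq0_normc//|->]; rewrite nrm0.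
Qed.

Lemma Re_le_nrm z : complex.Re z <= nrm z.
Proof.
rewrite (le_trans (ler_norm _))// -ler_sqr ?nnegrE ?nrm_ge0//.
by rewrite nrm_sqr real_normK ?num_real// lerDl sqr_ge0.
Qed.

Lemma normr_Re_le_nrm z : `|complex.Re z| <= nrm z.
Proof.
rewrite -ler_sqr ?nnegrE ?nrm_ge0//.
by rewrite nrm_sqr real_normK ?num_real// lerDl sqr_ge0.
Qed.

Lemma normr_Im_le_nrm z : `|complex.Im z| <= nrm z.
Proof.
rewrite -ler_sqr ?nnegrE ?nrm_ge0//.
by rewrite nrm_sqr real_normK ?num_real// lerDr sqr_ge0.
Qed.

Lemma nrm_phase z : exists2 w, nrm w = 1 & z = (nrm z)%:C * w.
Proof.
have [->|z0] := eqVneq z 0; first by exists 1; [exact: nrm1|rewrite nrm0 mul0r].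
have n0 : (nrm z)%:C != 0 by rewrite eq_complex/= eqxx andbT nrm_eq0.
exists (z / (nrm z)%:C); last by rewrite mulrC divfK.
by rewrite nrmM Normc.normcV nrm_real ger0_norm ?nrm_ge0// divff ?nrm_eq0.
Qed.

(** The polynomial X^n - 1 splits over the closed field and is separable in characteristic 0, so it
    has n distinct roots, one of which is primitive. *)
Lemma closed_prim_root_exists n : (0 < n)%N ->
  exists z : R[i], n.-primitive_root z.
Proof.
move=> n_gt0; pose p : {poly R[i]} := 'X^n - 1.
have [r Dp] := closed_field_poly_normal p.
rewrite (monicP _) ?monicXnsubC // scale1r in Dp.
have rn1 : all n.-unity_root r by apply/allP=> z; rewrite -root_prod_XsubC -Dp.
have sz_r : (n < (size r).+1)%N.
  by rewrite -(size_prod_XsubC r id) -Dp size_XnsubC.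
have [|z _ ?] := hasP (has_prim_root n_gt0 rn1 _ sz_r); last by exists z.
by rewrite -separable_prod_XsubC -Dp cyclotomic.separable_Xn_sub_1 // pnatr_eq0 -lt0n.
Qed.

Lemma nrm_prim_root n z : (0 < n)%N -> n.-primitive_root z -> nrm z = 1.
Proof.
move=> n0 /prim_expr_order /(congr1 (@nrm R)); rewrite nrmX nrm1 => /eqP.
by rewrite pexpr_eq1 ?nrm_ge0// => /eqP.
Qed.

End complex_modulus.

(** Exponential growth beats polynomial growth. If q = a / b > 1, Bernoulli's inequality for the
    (c+1)-st root of q makes q^m grow at least like m^(c+1), which the factor of degree c cannot
    follow. This recovers a lossless bound for a quantity from bounds for its powers. *)
Lemma le_of_expr_le_poly (R : realType) (a b : R) (D c : nat) :
  0 <= a -> 0 <= b ->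
  (forall m, a ^+ m <= ((m * D).+1 ^ c)%N%:R * b ^+ m) -> a <= b.
Proof.
move=> a0 b0 hab; rewrite leNgt; apply/negP => ba.
have ap : 0 < a by exact: le_lt_trans ba.
have [b0'|bn0] := eqVneq b 0.
  have := hab 1%N; rewrite b0' expr1 expr1 mulr0 => /(lt_le_trans ap).
  by rewrite ltxx.
have bp : 0 < b by rewrite lt_neqAle eq_sym bn0.
pose q := a / b.
have q1 : 1 < q by rewrite ltr_pdivlMr// mul1r.
have qp : 0 < q by apply: lt_trans q1.
have hq m : q ^+ m <= ((m * D).+1 ^ c)%N%:R.
  by rewrite expr_div_n ler_pdivrMr ?exprn_gt0.
pose s := q `^ (c.+1%:R^-1).
have s1 : 1 < s.
  have -> : 1 = 1 `^ (c.+1%:R^-1) :> R by rewrite powR1.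
  by rewrite /s gt0_ltr_powR ?invr_gt0 ?ltr0n ?nnegrE ?ler01// ltW.
have sq : s ^+ c.+1 = q.
  rewrite -powR_mulrn ?powR_ge0// /s -powRrM mulVf ?pnatr_eq0// powRr1//.
  exact: ltW.
pose e := s - 1.
have e0 : 0 < e by rewrite subr_gt0.
have bern m : 1 + m%:R * e <= s ^+ m.
  elim: m => [|m ih]; first by rewrite mul0r addr0 expr0.
  rewrite exprS (le_trans _ (ler_wpM2l _ ih))//; last by rewrite ltW// (lt_trans ltr01).
  have -> : s = 1 + e by rewrite /e; ring.
  rewrite -natr1.
  have : 0 <= m%:R * e * e by rewrite !mulr_ge0// ltW.
  nra.
(* Chosen so that m D + 1 <= K (1 + m e). Cancelling (1 + m e)^c then leaves 1 + m e <= K^c for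
   every m, which is absurd. *)
pose K : R := 1 + D%:R / e.
have K0 : 0 <= K by rewrite addr_ge0// divr_ge0// ltW.
have key m : 1 + m%:R * e <= K ^+ c.
  have u0 : 0 < 1 + m%:R * e by rewrite ltr_pwDl// mulr_ge0// ltW.
  have h1 : (1 + m%:R * e) ^+ c.+1 <= (K * (1 + m%:R * e)) ^+ c.
    rewrite (@le_trans _ _ (q ^+ m))//.
      rewrite -sq -exprM mulnC exprM lerXn2r ?nnegrE ?bern ?exprn_ge0 ?ltW//.
      exact: lt_trans s1.
    rewrite (le_trans (hq m))// natrX lerXn2r ?nnegrE//; first by rewrite mulr_ge0// ltW.
    rewrite /K -natr1 natrM.
    rewrite (_ : (1 + _) * _ = 1 + m%:R * e + D%:R / e + m%:R * D%:R); last first.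
      by field; rewrite gt_eqF.
    have : 0 <= m%:R * e by rewrite mulr_ge0// ltW.
    have : 0 <= D%:R / e by rewrite divr_ge0// ltW.
    lra.
  move: h1; rewrite exprS exprMn ler_pM2r// exprn_gt0//.
have [m hm] : exists m : nat, K ^+ c / e < m%:R.
  by exists (Num.truncn (K ^+ c / e)).+1; rewrite truncnS_gt.
have := key m; rewrite leNgt => /negP; apply.
by move: hm; rewrite ltr_pdivrMr// => h; rewrite (lt_trans h)// ltrDr.
Qed.

Lemma powR_exprn (R : realType) (a s : R) n : 0 <= a ->
  (a ^+ n) `^ s = (a `^ s) ^+ n.
Proof.
move=> a0.
rewrite -(powR_mulrn _ a0) -(powR_mulrn _ (powR_ge0 a s)).
rewrite -[LHS]powRrM -[RHS]powRrM.
by rewrite (mulrC s).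
Qed.

Section three_lines.
Context {R : realType} {E V : finType}.
Variables (b : E -> R[i]) (d : E -> V -> nat).

Let Phi (x : V -> R[i]) : R[i] := \sum_e b e * \prod_v x v ^+ d e v.

Let D := \max_e \max_v d e v.

Let dD e v : (d e v <= D)%N.
Proof.
rewrite /D (leq_trans _ (leq_bigmax e))//.
exact: (leq_bigmax (F := fun v => d e v)).
Qed.

Let deg m (f : {ffun 'I_m -> E}) (v : V) : nat := \sum_(i < m) d (f i) v.

Let deg_lt m (f : {ffun 'I_m -> E}) v : (deg f v < (m * D).+1)%N.
Proof.
rewrite ltnS /deg (@leq_trans (\sum_(i < m) D)%N)//.
  by apply: leq_sum => i _; exact: dD.
by rewrite sum_nat_const card_ord.
Qed.

(** The multidegree of the monomial that the word f contributes to [Phi ^+ m]. Its entries are at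
    most m D, so at most (m D + 1)^|V| monomials occur. *)
Let typ m (f : {ffun 'I_m -> E}) : {ffun V -> 'I_(m * D).+1} :=
  [ffun v => Ordinal (deg_lt f v)].

Let coef m (s : {ffun V -> 'I_(m * D).+1}) : R[i] :=
  \sum_(f : {ffun 'I_m -> E} | typ f == s) \prod_i b (f i).

Let PhiX m x : Phi x ^+ m = \sum_s coef (m := m) s * \prod_v x v ^+ s v.
Proof.
rewrite -[LHS](_ : \prod_(i < m) Phi x = _); last first.
  by rewrite prodr_const card_ord.
rewrite bigA_distr_bigA/=.
rewrite (partition_big (@typ m) xpredT)//=.
apply: eq_bigr => s _; rewrite mulr_suml.
apply: eq_bigr => f /eqP <-.
rewrite big_split/=; congr (_ * _).
rewrite exchange_big/=; apply: eq_bigr => v _.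
by rewrite ffunE/= /deg expr_sum.
Qed.

(* Averaging over roots of unity isolates a monomial of Phi ^+ m. *)
Let coef_bound m s (r : V -> R) (M : R) : (forall v, 0 <= r v) -> 0 <= M ->
  (forall x, (forall v, nrm (x v) = r v) -> nrm (Phi x) <= M) ->
  nrm (coef (m := m) s) * \prod_v r v ^+ s v <= M ^+ m.
Proof.
(* [N] exceeds every exponent occurring in [Phi ^+ m], so the N-th roots of unity separate the
   monomials. *)
move=> r0 M0 hM; set N := (m * D).+1.
have [z zN] := @closed_prim_root_exists R N isT.
have z1 : nrm z = 1 by apply: nrm_prim_root zN.
have z0 : z != 0 by rewrite -nrm_eq0 z1 oner_neq0.
pose x (k : {ffun V -> 'I_N}) v : R[i] := (r v)%:C * z ^+ k v.
have nx k v : nrm (x k v) = r v.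
  by rewrite nrmM nrmX z1 expr1n mulr1 nrm_real ger0_norm.
pose A := \sum_(k : {ffun V -> 'I_N}) Phi (x k) ^+ m * \prod_v (z ^+ (k v * s v))^-1.
have orth (t : 'I_N) v : \sum_(k < N) z ^+ (k * t) * (z ^+ (k * s v))^-1 =
    if t == s v then N%:R else 0.
  rewrite (eq_bigr (fun k : 'I_N => (z ^+ t / z ^+ s v) ^+ k)); last first.
    by move=> k _; rewrite exprMn exprVn -!exprM ![(k * _)%N]mulnC.
  case: eqP => [->|/eqP ts].
    rewrite divff ?expf_neq0//.
    by under eq_bigr do rewrite expr1n; rewrite sumr_const card_ord.
  set w := (_ / _); have w1 : w != 1.
    apply: contra ts => /eqP w1.
    have : z ^+ t == z ^+ s v by rewrite -[z ^+ t](divfK (expf_neq0 (s v) z0)) -/w w1 mul1r.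
    by rewrite (eq_prim_root_expr zN) !modn_small.
  apply: (mulfI (_ : w - 1 != 0)); first by rewrite subr_eq0.
  rewrite -subrX1 mulr0; apply/eqP; rewrite subr_eq0; apply/eqP.
  by rewrite /w exprMn exprVn -!exprM ![(_ * N)%N]mulnC !exprM (prim_expr_order zN) !expr1n invr1 mulr1.
have AE : A = (N ^ #|V|)%N%:R * (coef s * \prod_v (r v)%:C ^+ s v).
  rewrite /A.
  transitivity (\sum_(k : {ffun V -> 'I_N}) \sum_t
      coef (m := m) t * (\prod_v x k v ^+ t v) * \prod_v z ^- (k v * s v)).
    by apply: eq_bigr => k _; rewrite PhiX mulr_suml.
  rewrite exchange_big/= (bigD1 s)//= [X in _ + X]big1 ?addr0.
    transitivity (\sum_(i : {ffun V -> 'I_N}) (coef s * \prod_v (r v)%:C ^+ s v)).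
      apply: eq_bigr => k _; rewrite -mulrA -big_split/=; congr (_ * _).
      apply: eq_bigr => v _; rewrite exprMn -exprM -mulrA divff ?mulr1//.
      by rewrite expf_neq0.
    by rewrite sumr_const card_ffun card_ord mulr_natl.
  move=> t ts.
  transitivity (coef t * (\prod_v (r v)%:C ^+ t v) *
     \sum_(k : {ffun V -> 'I_N}) \prod_v (z ^+ (k v * t v) * (z ^+ (k v * s v))^-1)).
    rewrite mulr_sumr; apply: eq_bigr => k _.
    rewrite -!mulrA -!big_split/=; congr (_ * _); apply: eq_bigr => v _.
    by rewrite exprMn -exprM mulrA.
  rewrite [X in _ * X](_ : _ = 0) ?mulr0//.
  rewrite -(bigA_distr_bigA (fun v (k : 'I_N) => z ^+ (k * t v) * (z ^+ (k * s v))^-1)).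
  have [v tv] : exists v, t v != s v.
    apply/existsP; apply: contraNT ts; rewrite negb_exists => /forallP h.
    by apply/eqP/ffunP => v; apply/eqP; have := h v; rewrite negbK.
  rewrite (bigD1 v)//= [X in X * _](_ : _ = 0) ?mul0r//.
  by have := orth (t v) v; rewrite (negbTE tv).
have Ab : nrm A <= (N ^ #|V|)%N%:R * M ^+ m.
  rewrite (le_trans (nrm_sum _ _ _))//.
  rewrite (@le_trans _ _ (\sum_(k : {ffun V -> 'I_N}) M ^+ m))//; last first.
    by rewrite sumr_const card_ffun card_ord mulr_natl.
  apply: ler_sum => k _; rewrite nrmM nrm_prod big1 ?mulr1; last first.
    by move=> v _; rewrite Normc.normcV nrmX z1 expr1n invr1.
  by rewrite nrmX lerXn2r ?nnegrE ?nrm_ge0// hM.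
have NV : 0 < (N ^ #|V|)%N%:R :> R by rewrite ltr0n expn_gt0.
rewrite -(ler_pM2l NV) (le_trans _ Ab)// AE.
rewrite !nrmM nrm_prod -[X in _ <= nrm X * _](rmorph_nat (real_complex R)) nrm_real normr_nat.
rewrite ler_pM2l// ler_wpM2l ?nrm_ge0// ler_prod// => v _.
by rewrite exprn_ge0// nrmX nrm_real ger0_norm// lexx.
Qed.

(* Three lines theorem: the maximum modulus over a torus is logarithmically
   convex in the logarithms of the radii. The monomials of Phi ^+ m obey the
   bound, there are polynomially many of them, and m is arbitrary. *)
Lemma three_lines (r0 r1 : V -> R) (M0 M1 t : R) :
  0 <= t -> t <= 1 -> (forall v, 0 <= r0 v) -> (forall v, 0 <= r1 v) ->
  (forall x, (forall v, nrm (x v) = r0 v) ->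
    nrm (\sum_e b e * \prod_v x v ^+ d e v) <= M0) ->
  (forall x, (forall v, nrm (x v) = r1 v) ->
    nrm (\sum_e b e * \prod_v x v ^+ d e v) <= M1) ->
  forall x, (forall v, nrm (x v) = r0 v `^ (1 - t) * r1 v `^ t) ->
    nrm (\sum_e b e * \prod_v x v ^+ d e v) <= M0 `^ (1 - t) * M1 `^ t.
Proof.
move=> t0 t1 r00 r10 h0 h1 x hx.
have M00 : 0 <= M0.
  apply: le_trans (h0 (fun v => (r0 v)%:C) _); first exact: nrm_ge0.
  by move=> v; rewrite nrm_real ger0_norm.
have M10 : 0 <= M1.
  apply: le_trans (h1 (fun v => (r1 v)%:C) _); first exact: nrm_ge0.
  by move=> v; rewrite nrm_real ger0_norm.
apply: (@le_of_expr_le_poly _ _ _ D #|V|).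
- exact: nrm_ge0.
- by rewrite mulr_ge0 ?powR_ge0.
move=> m; rewrite -nrmX -/(Phi x) PhiX.
rewrite (le_trans (nrm_sum _ _ _))//.
set B := (M0 `^ (1 - t) * M1 `^ t) ^+ m.
suff hs s : nrm (coef (m := m) s * \prod_v x v ^+ s v) <= B.
  rewrite (le_trans (ler_sum _ (fun s _ => hs s)))//.
  by rewrite sumr_const card_ffun card_ord mulr_natl.
have p0 (r : V -> R) : (forall v, 0 <= r v) -> 0 <= \prod_v r v ^+ s v.
  by move=> rr; rewrite prodr_ge0// => v _; rewrite exprn_ge0.
have c0 : nrm (coef (m := m) s) * \prod_v r0 v ^+ s v <= M0 ^+ m.
  exact: coef_bound r00 M00 h0.
have c1 : nrm (coef (m := m) s) * \prod_v r1 v ^+ s v <= M1 ^+ m.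
  exact: coef_bound r10 M10 h1.
have prodE : \prod_v nrm (x v ^+ s v) =
    (\prod_v r0 v ^+ s v) `^ (1 - t) * (\prod_v r1 v ^+ s v) `^ t.
  have powRprod (r : V -> R) a : (forall v, 0 <= r v) ->
      (\prod_v r v ^+ s v) `^ a = \prod_v (r v `^ a) ^+ s v.
    move=> rr.
    transitivity (\prod_v (r v ^+ s v) `^ a).
      apply: (big_ind2 (fun (u w : R) => 0 <= u /\ u `^ a = w) _ _ _).2.
      - by split => //; rewrite powR1.
      - move=> u u' w w' [uu <-] [ww <-]; split; first exact: mulr_ge0.
        by rewrite powRM.
      - by move=> v _; split => //; rewrite exprn_ge0.
    by apply: eq_bigr => v _; exact: powR_exprn.
  rewrite !powRprod// -big_split/=; apply: eq_bigr => v _.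
  by rewrite nrmX hx exprMn.
rewrite nrmM (nrm_prod _ _ (fun v => x v ^+ s v)) prodE.
have := nrm_ge0 (coef s).
move: c0 c1.
move: (nrm (coef s)) => c c0 c1 cge0.
have := p0 r1 r10.
have := p0 r0 r00.
move: c0 c1.
move: (\prod_v r0 v ^+ s v) (\prod_v r1 v ^+ s v) => P0 P1 c0 c1 P00 P10.
have -> : c * (P0 `^ (1 - t) * P1 `^ t) =
   (c * P0) `^ (1 - t) * (c * P1) `^ t.
  rewrite !powRM ?P00 ?P10// mulrACA -powRD ?subrK ?oner_eq0//.
  by rewrite powRr1.
have -> : B = (M0 ^+ m) `^ (1 - t) * (M1 ^+ m) `^ t.
  by rewrite (powR_exprn _ _ M00) (powR_exprn _ _ M10) -exprMn.
by rewrite ler_pM ?powR_ge0// ge0_ler_powR ?nnegrE ?subr_ge0// ?mulr_ge0 ?P00 ?P10 ?exprn_ge0.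
Qed.

End three_lines.

(** * Lower integrals and complex integrals *)

Section lower_integral.
Context d (T : measurableType d) (R : realType) (mu : {measure set T -> \bar R}).
Local Open Scope ereal_scope.
Import HBNNSimple.

(* The integral of a nonnegative function is a supremum over the simple
   functions below it, measurable or not. *)
Lemma ae_le_lower_integral (f g : T -> \bar R) :
  (forall x, 0 <= f x) -> (forall x, 0 <= g x) ->
  {ae mu, forall x, f x <= g x} -> \int[mu]_x f x <= \int[mu]_x g x.
Proof.
move=> f0 g0 [N [mN N0 fgN]].
rewrite (ge0_integralTE _ f0) (ge0_integralTE _ g0).
apply: ge_ereal_sup => _ [h hf <-].
have mNC : measurable (~` N) by exact: measurableC.
(* Cutting h off on the null set keeps its integral and brings it below g everywhere. *)
pose h' := proj_nnsfun h mNC.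
apply: (@le_trans _ _ (sintegral mu h')); last first.
  apply: ereal_sup_ubound; exists h' => // x.
  rewrite /h'/= mindicE; have [xN|xN] := boolP (x \in ~` N).
    rewrite mulr1 (le_trans (hf x))//.
    apply: contrapT => /negP fg; rewrite inE in xN; apply: xN.
    by apply: fgN; apply/negP.
  by rewrite mulr0.
rewrite -!integralT_nnsfun.
rewrite le_eqVlt; apply/orP; left; apply/eqP.
apply: ge0_ae_eq_integral => //.
- exact: measurableT_comp.
- exact: measurableT_comp.
- by move=> x _; rewrite lee_fin.
- by move=> x _; rewrite lee_fin.
exists N; split => //.
move=> x /= hx; apply: contrapT => xN; apply: hx => _.
by rewrite /h' /= mindicE mem_set// mulr1.
Qed.

Lemma le_lower_integral (f g : T -> \bar R) :
  (forall x, 0 <= f x) -> (forall x, f x <= g x) ->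
  \int[mu]_x f x <= \int[mu]_x g x.
Proof.
move=> f0 fg; apply: ae_le_lower_integral => //.
  by move=> x; rewrite (le_trans (f0 x)).
exact: aeW.
Qed.

(** Division by c carries the simple functions below c f to simple functions below f; f may be any
    nonnegative function, measurable or not. *)
Lemma lower_integralZl (c : R) (f : T -> \bar R) : (0 < c)%R ->
  (forall x, 0 <= f x) ->
  \int[mu]_x (c%:E * f x) <= c%:E * \int[mu]_x f x.
Proof.
move=> c0 f0.
have cf0 x : 0 <= c%:E * f x by rewrite mule_ge0// lee_fin ltW.
rewrite (ge0_integralTE _ f0) (ge0_integralTE _ cf0).
apply: ge_ereal_sup => _ [h hf <-].
have ci0 : (0 <= c^-1)%R by rewrite invr_ge0 ltW.
pose h' := scale_nnsfun h ci0.
have -> : sintegral mu h = c%:E * sintegral mu h'.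
  rewrite -sintegralrM; apply: eq_sintegral => x /=.
  by rewrite mulrA mulfV ?mul1r// gt_eqF.
rewrite lee_pmul2l ?lte_fin//; apply: ereal_sup_ubound; exists h' => // x /=.
by rewrite EFinM lee_pdivrMl.
Qed.

End lower_integral.

Section complex_functions.
Context d (T : measurableType d) (R : realType).
Implicit Types f g : T -> R[i].

Lemma cmeasurable_cst (c : R[i]) : cmeasurable (fun _ : T => c).
Proof. by split. Qed.

Lemma cmeasurableD f g : cmeasurable f -> cmeasurable g ->
  cmeasurable (fun x => f x + g x).
Proof.
move=> [f1 f2] [g1 g2]; split.
  rewrite [X in measurable_fun _ X](_ : _ = (fun x => complex.Re (f x) + complex.Re (g x))).
    exact: measurable_funD.
  by apply/funext => x; case: (f x) (g x) => [a b] [a' b'].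
rewrite [X in measurable_fun _ X](_ : _ = (fun x => complex.Im (f x) + complex.Im (g x))).
  exact: measurable_funD.
by apply/funext => x; case: (f x) (g x) => [a b] [a' b'].
Qed.

Lemma cmeasurableM f g : cmeasurable f -> cmeasurable g ->
  cmeasurable (fun x => f x * g x).
Proof.
move=> [f1 f2] [g1 g2]; split.
  rewrite [X in measurable_fun _ X](_ : _ = (fun x =>
    complex.Re (f x) * complex.Re (g x) - complex.Im (f x) * complex.Im (g x))).
    by apply: measurable_funB; exact: measurable_funM.
  by apply/funext => x; case: (f x) (g x) => [a b] [a' b'].
rewrite [X in measurable_fun _ X](_ : _ = (fun x =>
    complex.Re (f x) * complex.Im (g x) + complex.Im (f x) * complex.Re (g x))).
  by apply: measurable_funD; exact: measurable_funM.
by apply/funext => x; case: (f x) (g x) => [a b] [a' b'].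
Qed.

Lemma cmeasurableZ (c : R[i]) f : cmeasurable f -> cmeasurable (fun x => c * f x).
Proof. by move=> mf; apply: cmeasurableM => //; exact: cmeasurable_cst. Qed.

Lemma cmeasurableB f g : cmeasurable f -> cmeasurable g ->
  cmeasurable (fun x => f x - g x).
Proof.
move=> mf mg; rewrite (_ : (fun _ => _) = (fun x => f x + (-1) * g x)).
  by apply: cmeasurableD => //; exact: cmeasurableZ.
by apply/funext => x; rewrite mulN1r.
Qed.

Lemma cmeasurable_conj f : cmeasurable f -> cmeasurable (fun x => (f x)^*).
Proof.
move=> [f1 f2]; split.
  by rewrite (_ : (fun _ => _) = (fun x => complex.Re (f x)))//; apply/funext => x; case: (f x).
rewrite (_ : (fun _ => _) = (fun x => - complex.Im (f x))).
  exact: measurable_funN.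
by apply/funext => x; case: (f x).
Qed.

Lemma cmeasurable_sum I (s : seq I) (P : pred I) (F : I -> T -> R[i]) :
  (forall i, P i -> cmeasurable (F i)) ->
  cmeasurable (fun x => \sum_(i <- s | P i) F i x).
Proof.
move=> mF; elim: s => [|i s ih].
  by under eq_fun do rewrite big_nil; exact: cmeasurable_cst.
have [Pi|Pi] := boolP (P i); under eq_fun do rewrite big_cons ?Pi ?(negbTE Pi)//.
  by apply: cmeasurableD => //; exact: mF.
exact: ih.
Qed.

Lemma cmeasurable_real (f : T -> R) : measurable_fun setT f ->
  cmeasurable (fun x => (f x)%:C).
Proof. by move=> mf; split => //=; exact: measurable_cst. Qed.

Lemma measurable_nrm f : cmeasurable f ->
  measurable_fun setT (fun x => nrm (f x)).
Proof.
move=> [f1 f2]; rewrite (_ : (fun _ => _) = (fun x =>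
   (complex.Re (f x) ^+ 2 + complex.Im (f x) ^+ 2) `^ 2^-1)).
  apply: (measurableT_comp (measurable_powR _)).
  by apply: measurable_funD; apply: measurable_funX.
apply/funext => x; rewrite powR12_sqrt ?addr_ge0 ?sqr_ge0//.
by rewrite -nrm_sqr sqrtr_sqr ger0_norm ?nrm_ge0.
Qed.

Lemma measurable_nrmp f (p : R) : cmeasurable f ->
  measurable_fun setT (fun x => nrm (f x) `^ p).
Proof.
by move=> mf; apply: (measurableT_comp (measurable_powR _)); exact: measurable_nrm.
Qed.

End complex_functions.

Section complex_integral.
Context d (T : measurableType d) (R : realType) (mu : {measure set T -> \bar R}).
Implicit Types f g h : T -> R[i].

Definition cintegrable h :=
  cmeasurable h /\ (\int[mu]_x (nrm (h x))%:E < +oo)%E.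

Definition cintegral h : R[i] :=
  Rintegral mu setT (fun x => complex.Re (h x)) +i*
  Rintegral mu setT (fun x => complex.Im (h x)).

Lemma cinnerE f g : cinner mu f g = cintegral (fun x => f x * (g x)^*).
Proof. by []. Qed.

Lemma cintegrable_Re h : cintegrable h ->
  mu.-integrable setT (fun x => (complex.Re (h x))%:E).
Proof.
move=> [[m1 m2] hoo]; apply/integrableP; split; first exact/measurable_EFinP.
apply: le_lt_trans hoo; apply: le_lower_integral => x; first exact: abse_ge0.
by rewrite lee_fin normr_Re_le_nrm.
Qed.

Lemma cintegrable_Im h : cintegrable h ->
  mu.-integrable setT (fun x => (complex.Im (h x))%:E).
Proof.
move=> [[m1 m2] hoo]; apply/integrableP; split; first exact/measurable_EFinP.
apply: le_lt_trans hoo; apply: le_lower_integral => x; first exact: abse_ge0.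
by rewrite lee_fin normr_Im_le_nrm.
Qed.

Lemma cintegrableD f g : cintegrable f -> cintegrable g ->
  cintegrable (fun x => f x + g x).
Proof.
move=> [mf fo] [mg go]; split; first exact: cmeasurableD.
apply: (@le_lt_trans _ _ (\int[mu]_x ((nrm (f x))%:E + (nrm (g x))%:E))%E).
  apply: le_lower_integral => x; rewrite ?lee_fin ?nrm_ge0//.
  exact: nrmD.
rewrite ge0_integralD//=; first by rewrite lte_add_pinfty.
- by move=> x _; rewrite lee_fin nrm_ge0.
- by apply/measurable_EFinP; exact: measurable_nrm.
- by move=> x _; rewrite lee_fin nrm_ge0.
- by apply/measurable_EFinP; exact: measurable_nrm.
Qed.

Lemma cintegrableZ (c : R[i]) f : cintegrable f -> cintegrable (fun x => c * f x).
Proof.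
move=> [mf fo]; split; first exact: cmeasurableZ.
rewrite (eq_integral (fun x => (nrm c)%:E * (nrm (f x))%:E)%E); last first.
  by move=> x _; rewrite nrmM EFinM.
rewrite ge0_integralZl_EFin//=.
- by rewrite lte_mul_pinfty// lee_fin nrm_ge0.
- by move=> x _; rewrite lee_fin nrm_ge0.
- by apply/measurable_EFinP; exact: measurable_nrm.
- exact: nrm_ge0.
Qed.

Lemma cintegralD f g : cintegrable f -> cintegrable g ->
  cintegral (fun x => f x + g x) = cintegral f + cintegral g.
Proof.
move=> fi gi; rewrite /cintegral; apply/eqP; rewrite eq_complex/=.
rewrite -!RintegralD//; [|exact: cintegrable_Im|exact: cintegrable_Im|
  exact: cintegrable_Re|exact: cintegrable_Re].
apply/andP; split; apply/eqP; apply: eq_Rintegral => x _;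
  by case: (f x) (g x) => [a b] [a' b'].
Qed.

Lemma cintegralZ (c : R[i]) f : cintegrable f ->
  cintegral (fun x => c * f x) = c * cintegral f.
Proof.
move=> fi; rewrite /cintegral; apply/eqP; rewrite eq_complex/=.
case: c => a b /=.
have iR (r : R) := integrableZl (measurableT : measurable (setT : set T)) r (cintegrable_Re fi).
have iI (r : R) := integrableZl (measurableT : measurable (setT : set T)) r (cintegrable_Im fi).
have cR := cintegrable_Re fi; have cI := cintegrable_Im fi.
rewrite -!RintegralZl// -RintegralB// -?RintegralD//; try by [exact: iR|exact: iI].
apply/andP; split; apply/eqP; apply: eq_Rintegral => x _;
  by case: (f x) => [a' b'].
Qed.

Lemma cintegral0 : cintegral (fun=> 0) = 0.
Proof. by rewrite /cintegral/= Rintegral_cst// mul0r. Qed.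

Lemma cintegrable0 : cintegrable (fun=> 0).
Proof.
split; first exact: cmeasurable_cst.
by under eq_integral do rewrite nrm0; rewrite integral0.
Qed.

Lemma cintegrable_sum I (s : seq I) (P : pred I) (F : I -> T -> R[i]) :
  (forall i, P i -> cintegrable (F i)) ->
  cintegrable (fun x => \sum_(i <- s | P i) F i x).
Proof.
move=> iF; elim: s => [|i s ih].
  by under eq_fun do rewrite big_nil; exact: cintegrable0.
have [Pi|Pi] := boolP (P i); under eq_fun do rewrite big_cons ?Pi ?(negbTE Pi)//.
  by apply: cintegrableD => //; exact: iF.
exact: ih.
Qed.

Lemma cintegral_sum I (s : seq I) (P : pred I) (F : I -> T -> R[i]) :
  (forall i, P i -> cintegrable (F i)) ->
  cintegral (fun x => \sum_(i <- s | P i) F i x) =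
  \sum_(i <- s | P i) cintegral (F i).
Proof.
move=> iF; elim: s => [|i s ih].
  by rewrite big_nil; under eq_fun do rewrite big_nil; exact: cintegral0.
rewrite big_cons; have [Pi|Pi] := boolP (P i).
  under eq_fun do rewrite big_cons Pi.
  by rewrite cintegralD ?ih//; [exact: iF|exact: cintegrable_sum].
by under eq_fun do rewrite big_cons (negbTE Pi).
Qed.

(** Multiplying h by the conjugate phase of its integral makes the integral real, hence equal to the
    integral of a real part, which the modulus dominates. *)
Lemma nrm_cintegral_le h : cintegrable h ->
  ((nrm (cintegral h))%:E <= \int[mu]_x (nrm (h x))%:E)%E.
Proof.
move=> hi; have [w w1 hw] := nrm_phase (cintegral h).
have hE : (nrm (cintegral h)) = complex.Re (cintegral (fun x => w^* * h x)).
  rewrite (cintegralZ _ hi) {2}hw mulrCA (mulrC (w^*)) -sqr_normc nrmE w1.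
  by rewrite expr1n mulr1.
rewrite hE /= /Rintegral fineK; last first.
  exact: integrable_fin_num (cintegrable_Re (cintegrableZ _ hi)).
apply: le_trans; first by apply: le_trans (lee_abs _) (le_abse_integral _ _ _) => //;
  apply/measurable_EFinP; have [[]] := cintegrableZ w^* hi.
apply: le_lower_integral => x; first exact: abse_ge0.
by rewrite lee_fin (le_trans (normr_Re_le_nrm _))// nrmM nrm_conj w1 mul1r.
Qed.

Lemma ae_eq_cintegral f g : cmeasurable f -> cmeasurable g ->
  {ae mu, forall x, f x = g x} -> cintegral f = cintegral g.
Proof.
move=> [f1 f2] [g1 g2] fg; rewrite /cintegral/Rintegral; congr (fine _ +i* fine _).
  apply: ae_eq_integral => //; try exact/measurable_EFinP.
  by apply: filterS fg => x + _ => ->.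
apply: ae_eq_integral => //; try exact/measurable_EFinP.
by apply: filterS fg => x + _ => ->.
Qed.

Lemma cintegral_conj f : cintegrable f ->
  cintegral (fun x => (f x)^*) = (cintegral f)^*.
Proof.
move=> fi; rewrite /cintegral/=; congr (_ +i* _).
  by apply: eq_Rintegral => x _; case: (f x).
rewrite -mulN1r -RintegralZl//; last exact: cintegrable_Im.
by apply: eq_Rintegral => x _; case: (f x) => a b /=; rewrite mulN1r.
Qed.

End complex_integral.

(** * Young's and Hoelder's inequalities, power integrals *)

Section powers.
Context {R : realType}.

(** Writing the second factor as b^(1 - 1/p), rather than as a member of L^p', covers p = 1, where
    the exponent vanishes. The free parameter M is the scale that turns Young's inequality into
    Hoelder's. *)
Lemma young_powR (M p z b : R) : 0 < M -> 1 <= p -> 0 <= z -> 0 <= b ->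
  z * b `^ (1 - p^-1) <= M * (p^-1 * (z / M) `^ p + (1 - p^-1) * b).
Proof.
move=> M0 p1 z0 b0; have p0 : 0 < p by exact: lt_le_trans p1.
have zM0 : 0 <= z / M by rewrite divr_ge0// ltW.
have -> : z = M * (z / M) by rewrite mulrC divfK// gt_eqF.
rewrite -mulrA ler_pM2l// [M * (z / M)]mulrC mulfK ?gt_eqF//.
move: (z / M) zM0 => {z0}z z0.
have [->|pn1] := eqVneq p 1.
  by rewrite invr1 subrr mul0r addr0 powRr0 mulr1 mul1r powRr1.
have p1' : 1 < p by rewrite lt_neqAle eq_sym pn1.
have q0 : 0 < 1 - p^-1 by rewrite subr_gt0 invf_lt1.
have bq0 : 0 <= b `^ (1 - p^-1) by exact: powR_ge0.
have := @conjugate_powR R z (b `^ (1 - p^-1)) p (1 - p^-1)^-1 z0 bq0 p0.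
rewrite invr_gt0 q0 invrK addrC subrK => /(_ isT erefl).
rewrite -powRrM mulfV ?gt_eqF// powRr1// => h.
by rewrite (le_trans h)// (mulrC p^-1) (mulrC b).
Qed.

Lemma prod_pow_pred1 (V : finType) (x : V -> R[i]) (v0 : V) :
  \prod_v x v ^+ (v == v0) = x v0.
Proof.
rewrite (bigD1 v0)//= eqxx expr1 big1 ?mulr1// => v /negbTE ->.
by rewrite expr0.
Qed.

End powers.

Section real_integrals.
Context d (T : measurableType d) (R : realType) (mu : {measure set T -> \bar R}).
Implicit Types f g : T -> R.
Local Open Scope ereal_scope.

Lemma int_ge0 f : (forall x, 0 <= f x)%R -> 0 <= \int[mu]_x (f x)%:E.
Proof. by move=> f0; apply: integral_ge0 => x _; rewrite lee_fin. Qed.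

Lemma int_le f g : (forall x, 0 <= f x)%R -> (forall x, f x <= g x)%R ->
  \int[mu]_x (f x)%:E <= \int[mu]_x (g x)%:E.
Proof.
move=> f0 fg; apply: le_lower_integral => x; first by rewrite lee_fin.
by rewrite lee_fin.
Qed.

Lemma intZ (a : R) f : (0 <= a)%R -> (forall x, 0 <= f x)%R ->
  measurable_fun setT f ->
  \int[mu]_x (a * f x)%:E = a%:E * \int[mu]_x (f x)%:E.
Proof.
move=> a0 f0 mf; under eq_integral do rewrite EFinM.
rewrite ge0_integralZl_EFin//; first by move=> x _; rewrite lee_fin.
exact/measurable_EFinP.
Qed.

Lemma intD f g : (forall x, 0 <= f x)%R -> (forall x, 0 <= g x)%R ->
  measurable_fun setT f -> measurable_fun setT g ->
  \int[mu]_x (f x + g x)%:E = \int[mu]_x (f x)%:E + \int[mu]_x (g x)%:E.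
Proof.
move=> f0 g0 mf mg; under eq_integral do rewrite EFinD.
rewrite ge0_integralD//.
- by move=> x _; rewrite lee_fin.
- exact/measurable_EFinP.
- by move=> x _; rewrite lee_fin.
- exact/measurable_EFinP.
Qed.

Lemma int_lin (a b : R) f g : (0 <= a)%R -> (0 <= b)%R ->
  (forall x, 0 <= f x)%R -> (forall x, 0 <= g x)%R ->
  measurable_fun setT f -> measurable_fun setT g ->
  \int[mu]_x (a * f x + b * g x)%:E =
  a%:E * \int[mu]_x (f x)%:E + b%:E * \int[mu]_x (g x)%:E.
Proof.
move=> a0 b0 f0 g0 mf mg; rewrite intD ?intZ//.
- by move=> x; rewrite mulr_ge0.
- by move=> x; rewrite mulr_ge0.
- exact: measurable_funM.
- exact: measurable_funM.
Qed.

Lemma int_sum (I : Type) (s : seq I) (f : I -> T -> R) :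
  (forall i x, 0 <= f i x)%R -> (forall i, measurable_fun setT (f i)) ->
  \int[mu]_x (\sum_(i <- s) f i x)%:E = \sum_(i <- s) \int[mu]_x (f i x)%:E.
Proof.
move=> f0 mf; rewrite -ge0_integral_sum//.
- by apply: eq_integral => x _; rewrite sumEFin.
- by move=> i; exact/measurable_EFinP.
- by move=> i x _; rewrite lee_fin.
Qed.

End real_integrals.

Section power_integral.
Context d (T : measurableType d) (R : realType) (mu : {measure set T -> \bar R}).
Implicit Types f g : T -> R[i].

Definition pint (p : R) f : \bar R := (\int[mu]_x (nrm (f x) `^ p)%:E)%E.

Lemma pint_ge0 p f : (0 <= pint p f)%E.
Proof. by apply: integral_ge0 => x _; rewrite lee_fin powR_ge0. Qed.

Lemma Lnorm_poweR (p : R) (F : T -> \bar R) : 0 < p ->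
  ('N[mu]_p%:E[F] = (\int[mu]_x (`|F x| `^ p)) `^ p^-1)%E.
Proof. by move=> p0; rewrite unlock. Qed.

Lemma cnorm_poweR (p : R) f : 0 < p -> cnorm mu p%:E f = (pint p f `^ p^-1)%E.
Proof.
move=> p0; rewrite /cnorm (Lnorm_poweR _ p0).
suff -> : (\int[mu]_x (`|(nrm (f x))%:E| `^ p))%E = pint p f by [].
by apply: eq_integral => x _; rewrite /= ger0_norm ?nrm_ge0.
Qed.

Lemma Lp_cmeasurable (p : \bar R) f : Lp mu p f -> cmeasurable f.
Proof. by case. Qed.

Lemma Lp_pint (p : R) f : 0 < p -> Lp mu p%:E f -> (pint p f < +oo)%E.
Proof.
move=> p0 [_]; rewrite (cnorm_poweR _ p0) => h.
by apply: lty_poweRy h; rewrite gt_eqF// invr_gt0.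
Qed.

Lemma pint_Lp (p : R) f : 0 < p -> cmeasurable f -> (pint p f < +oo)%E ->
  Lp mu p%:E f.
Proof. by move=> p0 mf h; split => //; rewrite (cnorm_poweR _ p0) poweR_lty. Qed.

Lemma Lnorm_leP (p C : R) (F : T -> \bar R) f : 0 < p -> 0 <= C ->
  ('N[mu]_p%:E[F] <= C%:E * cnorm mu p%:E f)%E <->
  (\int[mu]_x (`|F x| `^ p) <= (C `^ p)%:E * pint p f)%E.
Proof.
move=> p0 C0; rewrite Lnorm_poweR// cnorm_poweR//.
have I0 : (0 <= \int[mu]_x (`|F x| `^ p))%E.
  by apply: integral_ge0 => x _; exact: poweR_ge0.
have K : (C%:E * pint p f `^ p^-1 = ((C `^ p)%:E * pint p f) `^ p^-1)%E.
  rewrite poweRM ?lee_fin ?powR_ge0 ?pint_ge0//.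
  by rewrite poweR_EFin -powRrM mulfV ?gt_eqF// powRr1.
have J0 : (0 <= (C `^ p)%:E * pint p f)%E.
  by rewrite mule_ge0 ?lee_fin ?powR_ge0 ?pint_ge0.
rewrite K; split => h; last first.
  by rewrite gt0_ler_poweR ?invr_ge0 ?(ltW p0)// in_itv/= ?leey ?andbT.
have := @gt0_ler_poweR R p (ltW p0) _ _ _ _ h.
rewrite !in_itv/= !leey !poweR_ge0 => /(_ isT isT).
by rewrite -!poweRrM mulVf ?gt_eqF// !poweRe1.
Qed.

Lemma cnorm_leP (p C : R) f g : 0 < p -> 0 <= C ->
  (cnorm mu p%:E f <= C%:E * cnorm mu p%:E g)%E <->
  (pint p f <= (C `^ p)%:E * pint p g)%E.
Proof.
move=> p0 C0.
suff -> : pint p f = (\int[mu]_x (`|(nrm (f x))%:E| `^ p))%E by exact: Lnorm_leP.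
by apply: eq_integral => x _; rewrite /= ger0_norm ?nrm_ge0.
Qed.

Lemma Lp0 (p : R) : 0 < p -> Lp mu p%:E (fun=> 0 : R[i]).
Proof.
move=> p0; apply: (pint_Lp p0); first exact: cmeasurable_cst.
by rewrite /pint; under eq_integral do rewrite nrm0 powR0 ?gt_eqF//; rewrite integral0.
Qed.

Lemma powRD_le (p a b : R) : 0 < p -> 0 <= a -> 0 <= b ->
  (a + b) `^ p <= 2 `^ p * (a `^ p + b `^ p).
Proof.
move=> p0 a0 b0; have h (u v : R) : 0 <= u -> u <= v -> (u + v) `^ p <= 2 `^ p * v `^ p.
  move=> u0 uv; have v0 : 0 <= v by exact: le_trans uv.
  rewrite -powRM// ge0_ler_powR ?nnegrE ?addr_ge0 ?mulr_ge0// ?(ltW p0)//.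
  by rewrite mulr_natl mulr2n lerD2r.
have [ab|/ltW ba] := leP a b.
  rewrite (le_trans (h _ _ a0 ab))// ler_wpM2l ?powR_ge0// lerDr powR_ge0//.
by rewrite addrC (le_trans (h _ _ b0 ba))// ler_wpM2l ?powR_ge0// lerDl powR_ge0.
Qed.

Lemma Lp_lin (p : R) (c : R[i]) f g : 0 < p ->
  Lp mu p%:E f -> Lp mu p%:E g -> Lp mu p%:E (fun x => c * f x + g x).
Proof.
move=> p0 hf hg.
have mf := Lp_cmeasurable hf; have mg := Lp_cmeasurable hg.
have fo := Lp_pint p0 hf; have go := Lp_pint p0 hg.
apply: (pint_Lp p0); first by apply: cmeasurableD => //; exact: cmeasurableZ.
have m1 := measurable_nrmp p mf; have m2 := measurable_nrmp p mg.
apply: (@le_lt_trans _ _ (\int[mu]_x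
    ((2 * nrm c) `^ p * nrm (f x) `^ p + 2 `^ p * nrm (g x) `^ p)%:E)%E).
  apply: int_le => x; rewrite ?powR_ge0//.
  rewrite (@le_trans _ _ ((nrm (c * f x) + nrm (g x)) `^ p))//.
    by rewrite ge0_ler_powR ?nnegrE ?nrm_ge0 ?addr_ge0 ?nrm_ge0 ?nrmD// ltW.
  rewrite (le_trans (powRD_le p0 (nrm_ge0 _) (nrm_ge0 _)))// mulrDr.
  by rewrite nrmM -powRM ?mulr_ge0 ?nrm_ge0// mulrA powRM ?mulr_ge0 ?nrm_ge0.
rewrite int_lin ?powR_ge0//; try by move=> x; exact: powR_ge0.
by rewrite lte_add_pinfty// lte_mul_pinfty// ?lee_fin ?powR_ge0.
Qed.

Lemma pint2E f : pint 2 f = (\int[mu]_x (nrm (f x) ^+ 2)%:E)%E.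
Proof. by apply: eq_integral => x _; rewrite powR_mulrn ?nrm_ge0. Qed.

Lemma cintegrableM2 f g : Lp mu 2%:E f -> Lp mu 2%:E g ->
  cintegrable mu (fun x => f x * (g x)^*).
Proof.
move=> hf hg; have p0 : 0 < 2 :> R by [].
have mf := Lp_cmeasurable hf; have mg := Lp_cmeasurable hg.
have := Lp_pint p0 hf; have := Lp_pint p0 hg; rewrite !pint2E => go fo.
split; first by apply: cmeasurableM => //; exact: cmeasurable_conj.
have m1 : measurable_fun setT (fun x => nrm (f x) ^+ 2).
  by apply: measurable_funX; exact: measurable_nrm.
have m2 : measurable_fun setT (fun x => nrm (g x) ^+ 2).
  by apply: measurable_funX; exact: measurable_nrm.
apply: (@le_lt_trans _ _ (\int[mu]_x (nrm (f x) ^+ 2 + nrm (g x) ^+ 2)%:E)%E).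
  apply: int_le => x; rewrite ?nrm_ge0//.
  rewrite nrmM nrm_conj; have := nrm_ge0 (f x); have := nrm_ge0 (g x).
  by move: (nrm (f x)) (nrm (g x)) => a b; have := sqr_ge0 (a - b); nra.
rewrite intD//; try by move=> x; exact: sqr_ge0.
by rewrite lte_add_pinfty.
Qed.

End power_integral.

Section holder.
Context d (T : measurableType d) (R : realType) (mu : {measure set T -> \bar R}).
Local Open Scope ereal_scope.

Lemma holder_sum (E : finType) (z b : E -> T -> R) (p a c : R) :
  (1 <= p)%R -> (0 < a)%R -> (0 < c)%R ->
  (forall e x, (0 <= z e x)%R) -> (forall e x, (0 <= b e x)%R) ->
  (forall e, measurable_fun setT (z e)) -> (forall e, measurable_fun setT (b e)) ->
  \sum_e \int[mu]_x (z e x `^ p)%:E <= a%:E ->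
  \sum_e \int[mu]_x (b e x)%:E <= c%:E ->
  \sum_e \int[mu]_x (z e x * b e x `^ (1 - p^-1))%:E <=
    (a `^ p^-1 * c `^ (1 - p^-1))%:E.
Proof.
move=> p1 a0 c0 z0 b0 mz mb hz hb; have p0 : (0 < p)%R by exact: lt_le_trans p1.
(* At this scale the two terms of Young's inequality add up to M c, with weights 1/p and 1 - 1/p,
   and M c is the bound to be proved. *)
pose M := ((a / c) `^ p^-1)%R.
have M0 : (0 < M)%R by rewrite powR_gt0// divr_gt0.
pose k1 := (M * (p^-1 * M^-1 `^ p))%R; pose k2 := (M * (1 - p^-1))%R.
have k10 : (0 <= k1)%R by rewrite /k1 !mulr_ge0 ?powR_ge0 ?invr_ge0 ?(ltW p0)// ltW.
have k20 : (0 <= k2)%R by rewrite /k2 mulr_ge0 ?subr_ge0 ?invf_le1// ltW.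
have mzp e : measurable_fun setT (fun x => z e x `^ p)%R.
  exact: (measurableT_comp (measurable_powR _)).
apply: (@le_trans _ _ (\sum_e (k1%:E * \int[mu]_x (z e x `^ p)%:E +
    k2%:E * \int[mu]_x (b e x)%:E))).
  apply: lee_sum => e _.
  rewrite -int_lin//; last by move=> x; exact: powR_ge0.
  apply: int_le => x; first by rewrite mulr_ge0 ?powR_ge0.
  rewrite (le_trans (young_powR M0 p1 (z0 e x) (b0 e x)))//.
  rewrite mulrDr /k1 /k2 !mulrA lerD2r// powRM ?invr_ge0 ?(ltW M0)//.
  by rewrite le_eqVlt; apply/orP; left; apply/eqP; ring.
have i1 e : 0 <= \int[mu]_x (z e x `^ p)%:E.
  by apply: integral_ge0 => x _; rewrite lee_fin powR_ge0.
have i2 e : 0 <= \int[mu]_x (b e x)%:E.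
  by apply: integral_ge0 => x _; rewrite lee_fin.
rewrite big_split/= -!ge0_sume_distrr//.
apply: (@le_trans _ _ (k1%:E * a%:E + k2%:E * c%:E)).
  by apply: leeD; apply: lee_wpmul2l; rewrite ?lee_fin.
rewrite -!EFinM -EFinD lee_fin /k1 /k2.
have MpE : (M^-1 `^ p = c / a)%R.
  rewrite -(powR_inv1 (ltW M0)) -powRrM mulN1r powRN /M -powRrM mulVf ?gt_eqF//.
  by rewrite powRr1 ?divr_ge0 ?(ltW a0) ?(ltW c0)// invf_div.
rewrite MpE.
have -> : (M * (p^-1 * (c / a)) * a + M * (1 - p^-1) * c = M * c)%R.
  by field; rewrite !gt_eqF.
rewrite /M powRM ?invr_ge0 ?(ltW a0) ?(ltW c0)// -mulrA ler_wpM2l ?powR_ge0//.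
have -> : (c^-1 = c `^ (-1))%R by rewrite powR_inv1 ?(ltW c0).
rewrite -powRrM mulN1r -{2}(powRr1 (ltW c0)) -powRD ?(gt_eqF c0) ?implybT//.
by rewrite addrC.
Qed.

End holder.

(** * Interpolation of bilinear forms *)

Section step_functions.
Context d (T : measurableType d) (R : realType) (mu : {measure set T -> \bar R}).
Context (A : finType) (idx : T -> A).

Definition fin_indexed := forall a, measurable (idx @^-1` [set a]).

Definition fin_cell (a : A) := (mu (idx @^-1` [set a]) < +oo)%E.

(** A cell of infinite measure is replaced by 0, so that [cell a] lies in every L^p. The step
    functions in use vanish on such cells. *)
Definition cell (a : A) : T -> R[i] :=
  fun t => if (idx t == a) && `[< fin_cell a >] then 1 else 0.

Hypothesis midx : fin_indexed.

Lemma measurable_comp_idx d' (T' : measurableType d') (h : A -> T') :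
  measurable_fun setT (h \o idx).
Proof.
move=> _ Y mY; rewrite setTI.
rewrite (_ : _ @^-1` _ = \bigcup_(a in [set a | Y (h a)]) (idx @^-1` [set a])).
  by apply: fin_bigcup_measurable => // a _; exact: midx.
apply/seteqP; split => [t /= ht|t /= [a ha /= ta]]; first by exists (idx t).
by rewrite /preimage/= ta.
Qed.

Lemma cmeasurable_comp_idx (x : A -> R[i]) : cmeasurable (x \o idx).
Proof.
split.
  exact: (measurable_comp_idx (fun a => complex.Re (x a) : measurableTypeR R)).
exact: (measurable_comp_idx (fun a => complex.Im (x a) : measurableTypeR R)).
Qed.

Lemma step_sum_cell (x : A -> R[i]) : (forall a, x a != 0 -> fin_cell a) ->
  x \o idx = (fun t => \sum_a x a * cell a t).
Proof.
move=> hx; apply/funext => t /=; rewrite (bigD1 (idx t))//= big1 ?addr0.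
  rewrite /cell eqxx/=; have [->|x0] := eqVneq (x (idx t)) 0; first by rewrite mul0r.
  by rewrite asboolT ?mulr1//; exact: hx.
by move=> a; rewrite /cell eq_sym => /negbTE -> /=; rewrite mulr0.
Qed.

Lemma step_int_lty (h : A -> R) : (forall a, 0 <= h a) ->
  (forall a, h a != 0 -> fin_cell a) ->
  (\int[mu]_t (h (idx t))%:E < +oo)%E.
Proof.
move=> h0 hx.
rewrite (_ : (fun t => _) = (fun t => (\sum_a h a * \1_(idx @^-1` [set a]) t)%:E)); last first.
  apply/funext => t; rewrite (bigD1 (idx t))//= big1 ?addr0.
    by rewrite indicE mem_set//= mulr1.
  move=> a at'; rewrite indicE memNset ?mulr0// => /= e.
  by rewrite e eqxx in at'.
rewrite int_sum; last 2 first.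
  by move=> a t; rewrite mulr_ge0// indicE.
  by move=> a; apply: measurable_funM => //; exact: measurable_indic.
apply: lte_sum_pinfty => a _.
rewrite intZ//.
rewrite integral_indic//.
rewrite setIT; have [->|ha] := eqVneq (h a) 0; first by rewrite mul0e.
by rewrite lte_mul_pinfty// ?lee_fin//; exact: hx.
Qed.

Lemma Lp_comp_idx (x : A -> R[i]) (p : R) : 0 < p ->
  (forall a, x a != 0 -> fin_cell a) -> Lp mu p%:E (x \o idx).
Proof.
move=> p0 hx; apply: (pint_Lp p0); first exact: cmeasurable_comp_idx.
apply: (@step_int_lty (fun a => nrm (x a) `^ p)) => a; first exact: powR_ge0.
by rewrite powR_eq0 (gt_eqF p0) andbT nrm_eq0; exact: hx.
Qed.

Lemma cell_comp a : cell a = (fun b => if (b == a) && `[< fin_cell a >] then 1 else 0) \o idx.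
Proof. by []. Qed.

Lemma Lp_cell (p : R) a : 0 < p -> Lp mu p%:E (cell a).
Proof.
move=> p0; rewrite cell_comp; apply: Lp_comp_idx => // b.
by case: ifPn => [/andP[/eqP-> /asboolP//]|_]; rewrite eqxx.
Qed.

End step_functions.

Section linear_operators.
Context d (T : measurableType d) (R : realType) (mu : {measure set T -> \bar R}).
Implicit Types (f g : T -> R[i]) (U : (T -> R[i]) -> (T -> R[i])).

Definition L2bounded U := linear_operator mu (Lp mu 2%:E) U /\
  exists2 C : R, 0 <= C & forall f, Lp mu 2%:E f -> (pint mu 2 (U f) <= C%:E * pint mu 2 f)%E.

Let two0 : 0 < 2 :> R. Proof. by []. Qed.

Lemma L2bounded_Lp U f : L2bounded U -> Lp mu 2%:E f -> Lp mu 2%:E (U f).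
Proof.
move=> [[mU _ _] [C C0 hC]] hf; apply: (pint_Lp two0); first exact: mU.
apply: le_lt_trans (hC _ hf) _; rewrite lte_mul_pinfty ?lee_fin//.
exact: Lp_pint.
Qed.

Lemma L2_lin (c : R[i]) f g : Lp mu 2%:E f -> Lp mu 2%:E g ->
  Lp mu 2%:E (fun x => c * f x + g x).
Proof. exact: Lp_lin. Qed.

Lemma L2_sum I (s : seq I) (c : I -> R[i]) (F : I -> T -> R[i]) :
  (forall i, Lp mu 2%:E (F i)) ->
  Lp mu 2%:E (fun x => \sum_(i <- s) c i * F i x).
Proof.
move=> hF; elim: s => [|i s ih].
  by under eq_fun do rewrite big_nil; exact: Lp0.
by under eq_fun do rewrite big_cons; exact: L2_lin.
Qed.

Lemma linear_operator0 U : linear_operator mu (Lp mu 2%:E) U ->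
  {ae mu, forall x, U (fun=> 0) x = 0}.
Proof.
move=> [mU aeU lU].
have z2 := @Lp0 _ _ _ mu _ two0.
have := lU (-1) _ _ z2 z2; apply: filterS => x.
by under eq_fun do rewrite mulr0 addr0; move=> ->; rewrite mulN1r addNr.
Qed.

Lemma linear_operator_sum U I (s : seq I) (c : I -> R[i]) (F : I -> T -> R[i]) :
  linear_operator mu (Lp mu 2%:E) U -> (forall i, Lp mu 2%:E (F i)) ->
  {ae mu, forall x, U (fun y => \sum_(i <- s) c i * F i y) x =
    \sum_(i <- s) c i * U (F i) x}.
Proof.
move=> lU hF; elim: s => [|i s ih].
  have := linear_operator0 lU; apply: filterS => x e.
  rewrite big_nil -[RHS]e; congr (U _ x).
  by apply/funext => y; rewrite big_nil.
have [mU aeU lU'] := lU.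
have := lU' (c i) _ _ (hF i) (L2_sum s c hF).
apply: filterS2 ih => x e1 e2.
rewrite big_cons -e1 -e2; congr (U _ x).
by apply/funext => y; rewrite big_cons.
Qed.

Lemma cinner_sum2 I J (s : seq I) (s' : seq J) (c : I -> R[i]) (c' : J -> R[i])
  (F : I -> T -> R[i]) (G : J -> T -> R[i]) :
  (forall i, Lp mu 2%:E (F i)) -> (forall j, Lp mu 2%:E (G j)) ->
  cinner mu (fun x => \sum_(i <- s) c i * F i x) (fun x => \sum_(j <- s') c' j * G j x) =
  \sum_(i <- s) \sum_(j <- s') c i * (c' j)^* * cinner mu (F i) (G j).
Proof.
move=> hF hG; rewrite cinnerE.
have iFG i j : cintegrable mu (fun x => F i x * (G j x)^*) by exact: cintegrableM2.
transitivity (cintegral mu (fun x => \sum_(i <- s) \sum_(j <- s')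
    (c i * (c' j)^*) * (F i x * (G j x)^*))).
  congr cintegral; apply/funext => x; rewrite rmorph_sum/= big_distrl/=.
  apply: eq_bigr => i _; rewrite big_distrr/=; apply: eq_bigr => j _.
  by rewrite rmorphM/= mulrACA.
rewrite cintegral_sum; last first.
  by move=> i _; apply: cintegrable_sum => j _; exact: cintegrableZ.
apply: eq_bigr => i _; rewrite cintegral_sum; last first.
  by move=> j _; exact: cintegrableZ.
by apply: eq_bigr => j _; rewrite cintegralZ.
Qed.

Lemma ae_eq_cinner f f' g : cmeasurable f -> cmeasurable f' -> cmeasurable g ->
  {ae mu, forall x, f x = f' x} -> cinner mu f g = cinner mu f' g.
Proof.
move=> mf mf' mg e; rewrite !cinnerE; apply: ae_eq_cintegral.
- by apply: cmeasurableM => //; exact: cmeasurable_conj.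
- by apply: cmeasurableM => //; exact: cmeasurable_conj.
- by apply: filterS e => x ->.
Qed.

Lemma cinnerC f g : Lp mu 2%:E f -> Lp mu 2%:E g ->
  cinner mu g f = (cinner mu f g)^*.
Proof.
move=> hf hg; rewrite !cinnerE -cintegral_conj; last exact: cintegrableM2.
by congr cintegral; apply/funext => x; rewrite rmorphM/= conjcK mulrC.
Qed.

Lemma nrm_cinner_le f g : cintegrable mu (fun x => f x * (g x)^*) ->
  ((nrm (cinner mu f g))%:E <= \int[mu]_x (nrm (f x) * nrm (g x))%:E)%E.
Proof.
move=> h; rewrite cinnerE (le_trans (nrm_cintegral_le h))//.
by apply: int_le => x; rewrite ?nrm_ge0// nrmM nrm_conj.
Qed.

End linear_operators.

Section forms.
Context d (T : measurableType d) (R : realType) (mu : {measure set T -> \bar R}).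
Context (E G1 G2 : finType) (s : E -> G1) (t : E -> G2).
Context (U : E -> (T -> R[i]) -> (T -> R[i])).

(** The index maps [s] and [t] let one component of the input, or of the test family, serve several
    operators: the operators at the grid points of one cube share the input component of that
    cube. *)
Definition form (f : G1 -> T -> R[i]) (phi : G2 -> T -> R[i]) : R[i] :=
  \sum_e cinner mu (U e (f (s e))) (phi (t e)).

Hypothesis UL : forall e, L2bounded mu (U e).

Context (A B : finType) (idx : T -> A) (idx' : T -> B).
Hypothesis midx : fin_indexed idx.
Hypothesis midx' : fin_indexed idx'.

Lemma form_step (x : G1 -> A -> R[i]) (y : G2 -> B -> R[i]) :
  (forall g a, x g a != 0 -> fin_cell mu idx a) ->
  (forall g b, y g b != 0 -> fin_cell mu idx' b) ->
  form (fun g => x g \o idx) (fun g => y g \o idx') =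
  \sum_e \sum_a \sum_b x (s e) a * (y (t e) b)^* *
    cinner mu (U e (cell mu idx a)) (cell mu idx' b).
Proof.
move=> hx hy; apply: eq_bigr => e _.
have ha a : Lp mu 2%:E (cell mu idx a) by exact: Lp_cell.
have hb b : Lp mu 2%:E (cell mu idx' b) by exact: Lp_cell.
rewrite -cinner_sum2//; last by move=> a; exact: L2bounded_Lp.
rewrite -step_sum_cell; last exact: hy.
have [[mU aeU lU] _] := UL e.
have mx := Lp_comp_idx midx (ltr0Sn R 1) (hx (s e)).
apply: ae_eq_cinner.
- exact: mU.
- by apply: cmeasurable_sum => a _; apply: cmeasurableZ; exact: mU.
- exact: cmeasurable_comp_idx.
by rewrite (step_sum_cell (hx (s e))); exact: linear_operator_sum.
Qed.

(** On step functions the form is a polynomial in the values [x g a] and the conjugates of the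
    values [y g b]; each monomial contains one variable of either kind. The three lines theorem
    applies to this polynomial, with the prescribed moduli as radii. *)
Lemma form_three_lines (x : G1 -> A -> R[i]) (y : G2 -> B -> R[i])
  (r0 r1 : G1 -> A -> R) (u0 u1 : G2 -> B -> R) (th M0 M1 : R) :
  0 <= th -> th <= 1 ->
  (forall g a, 0 <= r0 g a) -> (forall g a, 0 <= r1 g a) ->
  (forall g b, 0 <= u0 g b) -> (forall g b, 0 <= u1 g b) ->
  (forall g a, r0 g a != 0 -> fin_cell mu idx a) ->
  (forall g a, r1 g a != 0 -> fin_cell mu idx a) ->
  (forall g b, u0 g b != 0 -> fin_cell mu idx' b) ->
  (forall g b, u1 g b != 0 -> fin_cell mu idx' b) ->
  (forall g a, nrm (x g a) = r0 g a `^ (1 - th) * r1 g a `^ th) ->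
  (forall g b, nrm (y g b) = u0 g b `^ (1 - th) * u1 g b `^ th) ->
  (forall x' y', (forall g a, nrm (x' g a) = r0 g a) ->
     (forall g b, nrm (y' g b) = u0 g b) ->
     nrm (form (fun g => x' g \o idx) (fun g => y' g \o idx')) <= M0) ->
  (forall x' y', (forall g a, nrm (x' g a) = r1 g a) ->
     (forall g b, nrm (y' g b) = u1 g b) ->
     nrm (form (fun g => x' g \o idx) (fun g => y' g \o idx')) <= M1) ->
  nrm (form (fun g => x g \o idx) (fun g => y g \o idx')) <=
    M0 `^ (1 - th) * M1 `^ th.
Proof.
move=> th0 th1 r00 r10 u00 u10 fr0 fr1 fu0 fu1 hx hy h0 h1.
(* If both radii vanish, a nonzero product would need 1 - th = th = 0, since a power of 0 is nonzero
   only for the exponent 0. *)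
have zz (I : Type) (r r' : I -> R) (F : I -> R[i]) (P : I -> Prop) :
    (forall i, r i != 0 -> P i) -> (forall i, r' i != 0 -> P i) ->
    (forall i, nrm (F i) = r i `^ (1 - th) * r' i `^ th) ->
    forall i, F i != 0 -> P i.
  move=> p1 p2 hF i; rewrite -nrm_eq0 hF mulf_eq0 negb_or !powR_eq0 !negb_and.
  have [ri|ri _] := eqVneq (r i) 0; last exact: p1.
  have [r'i|r'i _] := eqVneq (r' i) 0; last exact: p2.
  rewrite /= !negbK subr_eq0 => /andP[/eqP <- /eqP].
  by move=> /eqP; rewrite oner_eq0.
pose V : finType := (G1 * A + G2 * B)%type.
pose W : finType := (E * A * B)%type.
pose b (e : W) := cinner mu (U e.1.1 (cell mu idx e.1.2)) (cell mu idx' e.2).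
pose v1 (e : W) : V := inl (s e.1.1, e.1.2).
pose v2 (e : W) : V := inr (t e.1.1, e.2).
pose dd (e : W) (v : V) := ((v == v1 e) + (v == v2 e))%N.
pose X (x : G1 -> A -> R[i]) (y : G2 -> B -> R[i]) (v : V) : R[i] :=
  match v with inl p => x p.1 p.2 | inr p => (y p.1 p.2)^* end.
have formE x' y' : (forall g a, x' g a != 0 -> fin_cell mu idx a) ->
  (forall g b, y' g b != 0 -> fin_cell mu idx' b) ->
  form (fun g => x' g \o idx) (fun g => y' g \o idx') =
  \sum_e b e * \prod_v X x' y' v ^+ dd e v.
  move=> hx' hy'; rewrite form_step// pair_bigA/= pair_bigA/=.
  apply: eq_bigr => e _; rewrite mulrC; congr (_ * _).
  under eq_bigr do rewrite exprD.
  by rewrite big_split/= !prod_pow_pred1.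
pose rho (r : G1 -> A -> R) (u : G2 -> B -> R) (v : V) : R :=
  match v with inl p => r p.1 p.2 | inr p => u p.1 p.2 end.
have ends r u M : (forall g a, r g a != 0 -> fin_cell mu idx a) ->
    (forall g b, u g b != 0 -> fin_cell mu idx' b) ->
    (forall x' y', (forall g a, nrm (x' g a) = r g a) ->
     (forall g b, nrm (y' g b) = u g b) ->
     nrm (form (fun g => x' g \o idx) (fun g => y' g \o idx')) <= M) ->
    forall z : V -> R[i], (forall v, nrm (z v) = rho r u v) ->
    nrm (\sum_e b e * \prod_v z v ^+ dd e v) <= M.
  move=> fr fu hM z hz.
  pose x' g a := z (inl (g, a)); pose y' g b := (z (inr (g, b)))^*.
  have -> : z = X x' y'.
    by apply/funext => -[[g a]|[g c]] //=; rewrite /y' conjcK.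
  have hx' g a : nrm (x' g a) = r g a by rewrite /x' hz.
  have hy' g c : nrm (y' g c) = u g c by rewrite /y' nrm_conj hz.
  rewrite -formE; first exact: hM.
    by move=> g a; rewrite -nrm_eq0 hx'; exact: fr.
  by move=> g c; rewrite -nrm_eq0 hy'; exact: fu.
rewrite formE; last 2 first.
- by move=> g; apply: zz (fr0 g) (fr1 g) (hx g).
- by move=> g; apply: zz (fu0 g) (fu1 g) (hy g).
apply: (@three_lines _ W V b dd (rho r0 u0) (rho r1 u1)) => //.
- by case=> p /=.
- by case=> p /=.
- exact: ends.
- exact: ends.
- by case=> p /=; rewrite ?nrm_conj.
Qed.

End forms.

Lemma convex_gt0 (R : realType) (t a b : R) : 0 <= t -> t <= 1 -> 0 < a -> 0 < b ->
  0 < (1 - t) * a + t * b.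
Proof.
move=> t0 t1 a0 b0; have [->|tn0] := eqVneq t 0.
  by rewrite subr0 mul1r mul0r addr0.
rewrite ltr_wpDl ?mulr_ge0 ?subr_ge0 ?(ltW a0)// mulr_gt0//.
by rewrite lt_neqAle eq_sym tn0.
Qed.

Lemma holder_int d (T : measurableType d) (R : realType)
  (mu : {measure set T -> \bar R}) (z b : T -> R) (p M : R) :
  1 <= p -> 0 < M -> (forall x, 0 <= z x) -> (forall x, 0 <= b x) ->
  measurable_fun setT z -> measurable_fun setT b ->
  (\int[mu]_x (z x `^ p)%:E <= (M `^ p)%:E)%E ->
  (\int[mu]_x (b x)%:E <= 1)%E ->
  (\int[mu]_x (z x * b x `^ (1 - p^-1))%:E <= M%:E)%E.
Proof.
move=> p1 M0 z0 b0 mz mb hz hb.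
have Mp : 0 < M `^ p by rewrite powR_gt0.
have := @holder_sum _ T R mu 'I_1 (fun=> z) (fun=> b) p (M `^ p) 1 p1 Mp ltr01.
move=> /(_ (fun=> z0) (fun=> b0) (fun=> mz) (fun=> mb)).
rewrite !big_ord1 -powRrM mulfV ?gt_eqF ?(lt_le_trans ltr01)// powRr1 ?(ltW M0)//.
by rewrite powR1 mulr1; apply.
Qed.

Section spread.
Context {R : realType} {G : finType}.
Variable n : G -> R.
Hypothesis n0 : forall g, 0 <= n g.

Definition sqsum := \sum_g n g ^+ 2.
(** The unit vector of l^2 in the direction of n; it vanishes when n = 0, because 0 / 0 = 0. *)
Definition frac g := n g / sqsum `^ 2^-1.

Lemma sqsum_ge0 : 0 <= sqsum.
Proof. by apply: sumr_ge0 => g _; exact: sqr_ge0. Qed.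

Lemma frac_ge0 g : 0 <= frac g.
Proof. by rewrite divr_ge0// powR_ge0. Qed.

Lemma sqsum_eq0 g : sqsum = 0 -> n g = 0.
Proof.
move=> /eqP; rewrite psumr_eq0; last by move=> *; exact: sqr_ge0.
by move=> /allP /(_ g (mem_index_enum _)) /implyP /(_ isT); rewrite sqrf_eq0 => /eqP.
Qed.

Lemma sqsum_neq0 : sqsum != 0 -> exists g, n g != 0.
Proof.
move=> S0; apply/existsP; apply: contraNT S0; rewrite negb_exists => /forallP h.
rewrite /sqsum big1// => g _; have := h g; rewrite negbK => /eqP ->.
by rewrite expr0n.
Qed.

Lemma frac_sqr_sum : \sum_g frac g ^+ 2 = (sqsum != 0)%:R.
Proof.
have [S0|S0] /= := eqVneq sqsum 0.
  by rewrite big1// => g _; rewrite /frac (sqsum_eq0 g S0) mul0r expr0n.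
under eq_bigr do rewrite /frac expr_div_n.
rewrite -mulr_suml -/sqsum -powR_mulrn ?powR_ge0// -powRrM mulVf//.
by rewrite powRr1 ?sqsum_ge0// divff.
Qed.

Lemma frac_sqr_sum_le1 : \sum_g frac g ^+ 2 <= 1.
Proof. by rewrite frac_sqr_sum; case: (_ != _). Qed.

Lemma mul_frac g : sqsum `^ 2^-1 * frac g = n g.
Proof.
have [S0|S0] := eqVneq sqsum 0.
  by rewrite /frac (sqsum_eq0 g S0) mul0r mulr0.
by rewrite /frac mulrC divfK// powR_eq0 negb_and S0.
Qed.

End spread.

Section form_bounds.
Context d (T : measurableType d) (R : realType) (mu : {measure set T -> \bar R}).

Definition nrm2 (G : finType) (f : G -> T -> R[i]) (t : T) : R :=
  \sum_g nrm (f g t) ^+ 2.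

Lemma nrm2_ge0 (G : finType) (f : G -> T -> R[i]) t : 0 <= nrm2 f t.
Proof. by apply: sumr_ge0 => g _; exact: sqr_ge0. Qed.

(* The closed unit ball of L^p(l^2) with p = P^-1. *)
Definition ball2 (G : finType) (P : R) (f : G -> T -> R[i]) :=
  (\int[mu]_t (nrm2 f t `^ (2 * P)^-1)%:E <= 1)%E.

Context (E G1 G2 : finType) (s : E -> G1) (t : E -> G2).
Context (U : E -> (T -> R[i]) -> (T -> R[i])).

(* Boundedness of the bilinear form on L^p(l^2) x L^p'(l^2) with p = P^-1, tested on step
   functions only: Riesz-Thorin then needs nothing but polynomials in finitely many variables. *)
Definition form_bound (P M : R) :=
  forall (A B : finType) (idx : T -> A) (idx' : T -> B),
  fin_indexed idx -> fin_indexed idx' ->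
  forall (x : G1 -> A -> R[i]) (y : G2 -> B -> R[i]),
  (forall g a, x g a != 0 -> fin_cell mu idx a) ->
  (forall g b, y g b != 0 -> fin_cell mu idx' b) ->
  ball2 P (fun g => x g \o idx) -> ball2 (1 - P) (fun g => y g \o idx') ->
  nrm (form mu s t U (fun g => x g \o idx) (fun g => y g \o idx')) <= M.

Hypothesis UL : forall e, L2bounded mu (U e).

Section interpolation.
Variables (P0 P1 th : R).
Hypotheses (th0 : 0 <= th) (th1 : th <= 1).

(** The modulus at the endpoint Q: the direction of the vector [x _ a] is kept, and its l^2 norm is
    replaced by its power of exponent Q / P. The function integrated in [ball2] is then literally
    the same at every endpoint, so membership in the unit ball is preserved. *)
Let rr (G A : finType) (x : G -> A -> R[i]) (P Q : R) g a : R :=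
  (sqsum (fun g => nrm (x g a)) `^ (2 * P)^-1) `^ Q * frac (fun g => nrm (x g a)) g.

Let rr_ge0 (G A : finType) (x : G -> A -> R[i]) P Q g a : 0 <= rr x P Q g a.
Proof. by rewrite /rr mulr_ge0 ?powR_ge0// frac_ge0// => ?; exact: nrm_ge0. Qed.

Let rr_interp (G A : finType) (x : G -> A -> R[i]) (P Q0 Q1 : R) g a :
  0 < P -> P = (1 - th) * Q0 + th * Q1 ->
  nrm (x g a) = rr x P Q0 g a `^ (1 - th) * rr x P Q1 g a `^ th.
Proof.
move=> P0' PE; rewrite /rr.
pose n g' : R := nrm (x g' a); have n0 g' : 0 <= n g' by exact: nrm_ge0.
rewrite -/n -[LHS](mul_frac n g) !(powRM _ (powR_ge0 _ _) (frac_ge0 n0 g)).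
rewrite mulrACA -[(_ `^ Q0) `^ _]powRrM -[(_ `^ Q1) `^ _]powRrM.
have thn : (1 - th + th == 0) = false by rewrite subrK oner_eq0.
rewrite -[frac n g `^ _ * _]powRD ?thn// subrK [frac n g `^ 1]powRr1 ?frac_ge0//.
have [S0|S0] := eqVneq (sqsum n) 0.
  by rewrite /frac (@sqsum_eq0 _ _ n g S0) mul0r !mulr0.
congr (_ * _); rewrite -powRD; last by rewrite powR_eq0 (negbTE S0)/= implybT.
rewrite (mulrC Q0) (mulrC Q1) -PE -powRrM; congr (_ `^ _).
by rewrite invfM -mulrA mulVf ?mulr1// gt_eqF.
Qed.

Let rr_sqsum (G A : finType) (x x' : G -> A -> R[i]) (P Q : R) :
  0 < P -> 0 < Q -> (forall g a, nrm (x' g a) = rr x P Q g a) -> forall a,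
  (\sum_g nrm (x' g a) ^+ 2) `^ (2 * Q)^-1 = (\sum_g nrm (x g a) ^+ 2) `^ (2 * P)^-1.
Proof.
move=> P0' Q0 hx' a; under eq_bigr do rewrite hx' /rr exprMn.
rewrite -mulr_sumr frac_sqr_sum.
rewrite -[in RHS]/(sqsum (fun g => nrm (x g a))).
set S := sqsum _; have [->|S0] /= := eqVneq S 0.
  by rewrite mulr0 !powR0// gt_eqF// invr_gt0 mulr_gt0.
rewrite mulr1 -powR_mulrn ?powR_ge0// -powRrM -[LHS]powRrM.
have -> : Q * (2 / (2 * Q)) = 1 by field; rewrite gt_eqF.
by rewrite powRr1 ?powR_ge0.
Qed.

Let rr_fin (G A : finType) (x : G -> A -> R[i]) (P Q : R) (idx : T -> A) :
  0 < P -> 0 < Q ->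
  (forall g a, x g a != 0 -> fin_cell mu idx a) ->
  forall g a, rr x P Q g a != 0 -> fin_cell mu idx a.
Proof.
move=> P0' Q0 hx g a; rewrite /rr mulf_eq0 negb_or => /andP[_].
rewrite /frac mulf_eq0 negb_or => /andP[+ _].
by rewrite nrm_eq0; exact: hx.
Qed.

(* Riesz-Thorin for l^2-valued functions. *)
Lemma form_bound_interpolation (M0 M1 : R) :
  0 < P0 -> P0 < 1 -> 0 < P1 -> P1 < 1 ->
  form_bound P0 M0 -> form_bound P1 M1 ->
  form_bound ((1 - th) * P0 + th * P1) (M0 `^ (1 - th) * M1 `^ th).
Proof.
move=> P00 P01 P10 P11 h0 h1; set P := _ + _.
have Pg0 : 0 < P by exact: convex_gt0.
have Pl1 : 0 < 1 - P.
  rewrite (_ : 1 - P = (1 - th) * (1 - P0) + th * (1 - P1)); last by rewrite /P; ring.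
  by rewrite convex_gt0// subr_gt0.
move=> A B idx idx' midx midx' x y hx hy bx byy.
have Q0 : 0 < 1 - P0 by rewrite subr_gt0.
have Q1 : 0 < 1 - P1 by rewrite subr_gt0.
have ends (Q M : R) : 0 < Q -> Q < 1 -> form_bound Q M ->
  forall x' y', (forall g a, nrm (x' g a) = rr x P Q g a) ->
  (forall g b, nrm (y' g b) = rr y (1 - P) (1 - Q) g b) ->
  nrm (form mu s t U (fun g => x' g \o idx) (fun g => y' g \o idx')) <= M.
  move=> Qg0 Qlt1 hQ x' y' hx' hy'; have Q'0 : 0 < 1 - Q by rewrite subr_gt0.
  apply: (hQ _ _ _ _ midx midx').
  - by move=> g a; rewrite -nrm_eq0 hx'; exact: rr_fin.
  - by move=> g a; rewrite -nrm_eq0 hy'; exact: rr_fin.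
  - apply: le_trans bx; rewrite le_eqVlt; apply/orP; left; apply/eqP.
    by apply: eq_integral => u _; rewrite /nrm2/= (rr_sqsum Pg0 Qg0 hx').
  - apply: le_trans byy; rewrite le_eqVlt; apply/orP; left; apply/eqP.
    by apply: eq_integral => u _; rewrite /nrm2/= (rr_sqsum Pl1 Q'0 hy').
apply: (form_three_lines UL midx midx' (x := x) (y := y) (r0 := rr x P P0) (r1 := rr x P P1)
  (u0 := rr y (1 - P) (1 - P0)) (u1 := rr y (1 - P) (1 - P1))) .
- exact: th0.
- exact: th1.
- exact: rr_ge0.
- exact: rr_ge0.
- exact: rr_ge0.
- exact: rr_ge0.
- exact: rr_fin.
- exact: rr_fin.
- exact: rr_fin.
- exact: rr_fin.
- by move=> g a; exact: rr_interp.
- by move=> g b; apply: rr_interp => //; rewrite /P; ring.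
- exact: ends.
- exact: ends.
Qed.

End interpolation.

Section maximal_interpolation.
Variables (p0 p1 Minf M : R) (Ds Dt : nat).
Hypotheses (hp0 : 1 <= p0) (hp01 : p0 < p1) (hp1 : p1 <= 2).
Hypotheses (Minf0 : 0 < Minf) (M0 : 0 < M) (Ds0 : (0 < Ds)%N) (Dt0 : (0 < Dt)%N).
Hypothesis hDs : forall g, (#|[pred e | s e == g]| <= Ds)%N.
Hypothesis hDt : forall g, (#|[pred e | t e == g]| <= Dt)%N.
Hypothesis maxU : forall (f0 : T -> R[i]) (F : E -> T -> R[i]),
  Lp mu p1%:E f0 -> (forall e, cmeasurable (F e)) ->
  (forall e u, nrm (F e u) <= nrm (f0 u)) ->
  exists Z : T -> R, [/\ measurable_fun setT Z, forall u, 0 <= Z u,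
    forall e u, nrm (U e (F e) u) <= Z u &
    (\int[mu]_u (Z u `^ p1)%:E <= (Minf `^ p1)%:E * pint mu p1 f0)%E].
Hypothesis boundU : forall e f, Lp mu p0%:E f -> Lp mu 2%:E f ->
  (pint mu p0 (U e f) <= (M `^ p0)%:E * pint mu p0 f)%E.

Let sum_fiber (G : finType) (r : E -> G) (D : nat) (w : G -> R) :
  (forall g, 0 <= w g) -> (forall g, (#|[pred e | r e == g]| <= D)%N) ->
  \sum_e w (r e) <= D%:R * \sum_g w g.
Proof.
move=> w0 hD; rewrite (partition_big r xpredT)//= mulr_sumr.
apply: ler_sum => g _.
rewrite (eq_bigr (fun=> w g)); last by move=> e /eqP ->.
rewrite sumr_const -[X in X <= _]mulr_natl ler_wpM2r// ler_nat.
exact: hD.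
Qed.

(* A maximal inequality is an l^oo-valued bound on L^p1, and uniform boundedness on L^p0 is an
   l^p0-valued one; with the parameter th = p0 / 2 they interpolate to an l^2-valued bound. *)
Lemma maximal_form_bound (th := p0 / 2) :
  form_bound ((1 - th) / p1 + th / p0)
    ((Dt%:R * Minf) `^ (1 - th) *
     ((M `^ p0 * Ds%:R) `^ p0^-1 * Dt%:R `^ (1 - p0^-1)) `^ th).
Proof.
have p0g : 0 < p0 by exact: lt_le_trans hp0.
have p1g : 0 < p1 by exact: lt_trans hp01.
have thg : 0 < th by rewrite /th divr_gt0.
have thl : th < 1 by rewrite /th ltr_pdivrMr// mul1r (lt_le_trans hp01).
have thn : 0 < 1 - th by rewrite subr_gt0.
have p0i : p0^-1 <= 1 by rewrite invf_le1.
have p1i : 0 < 1 - p1^-1 by rewrite subr_gt0 invf_lt1// (le_lt_trans hp0).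
(* This identity dictates the choice of [th]: interpolating l^oo and l^p0 gives l^2 exactly when th
   / p0 = 1/2. *)
have th2 : th / p0 = 2^-1 by rewrite /th mulrAC divff ?mul1r// gt_eqF.
set P := _ + _.
have Pg0 : 0 < P by rewrite /P addr_gt0// divr_gt0.
have Pl1 : 0 < 1 - P.
  have h1 : p1^-1 < 1 by rewrite invf_lt1// (le_lt_trans hp0).
  have h2 : 2^-1 <= th by rewrite /th -[leLHS]mul1r ler_wpM2r// invr_ge0.
  rewrite /P th2 subr_gt0 -ltrBrDr (_ : 1 - 2^-1 = 2^-1); last first.
    by rewrite {1}(splitr 1) mul1r addrK.
  rewrite (@lt_le_trans _ _ (1 - th))//; first by rewrite -[ltRHS]mulr1 ltr_pM2l.
  by rewrite lerBlDr {1}(splitr 1) mul1r lerD2l.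
move=> A B idx idx' midx midx' x y hx hy bx byy.
pose nx a g : R := nrm (x g a); pose ny b g : R := nrm (y g b).
have nx0 a g : 0 <= nx a g by exact: nrm_ge0.
have ny0 b g : 0 <= ny b g by exact: nrm_ge0.
pose rho a := sqsum (nx a) `^ (2 * P)^-1.
pose sig b := sqsum (ny b) `^ (2 * (1 - P))^-1.
have rho0 a : 0 <= rho a by exact: powR_ge0.
have sig0 b : 0 <= sig b by exact: powR_ge0.
have rho_fin a : rho a != 0 -> fin_cell mu idx a.
  rewrite /rho powR_eq0 negb_and negbK => /orP[|/eqP e]; last first.
    by have := @invr_gt0 R (2 * P); rewrite e mulr_gt0// ltxx.
  by move=> /sqsum_neq0[g]; rewrite /nx nrm_eq0; exact: hx.
have sig_fin b : sig b != 0 -> fin_cell mu idx' b.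
  rewrite /sig powR_eq0 negb_and negbK => /orP[|/eqP e]; last first.
    by have := @invr_gt0 R (2 * (1 - P)); rewrite e mulr_gt0// ltxx.
  by move=> /sqsum_neq0[g]; rewrite /ny nrm_eq0; exact: hy.
have m_rho : measurable_fun setT (rho \o idx) by exact: measurable_comp_idx.
have m_sig : measurable_fun setT (sig \o idx') by exact: measurable_comp_idx.
have i_rho : (\int[mu]_u (rho (idx u))%:E <= 1)%E by exact: bx.
have i_sig : (\int[mu]_u (sig (idx' u))%:E <= 1)%E by exact: byy.
(* At the first endpoint the input is bounded in L^p1(l^oo) and the test family in L^p1'(l^1); at
   the second they lie in L^p0(l^p0) and its dual. The squares of [frac] sum to at most 1 and
   distribute the mass over the index g. In [u1] the indicator matters when p0 = 1: there the
   exponent is 0 and powers of 0 equal 1. *)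
pose r0 g a := (x g a != 0)%:R * rho a `^ p1^-1.
pose r1 g a := (rho a * frac (nx a) g ^+ 2) `^ p0^-1.
pose u0 g b := sig b `^ (1 - p1^-1) * frac (ny b) g ^+ 2.
pose u1 g b := (y g b != 0)%:R * (sig b * frac (ny b) g ^+ 2) `^ (1 - p0^-1).
have form_le (x' : G1 -> A -> R[i]) (y' : G2 -> B -> R[i]) :
    (forall g a, x' g a != 0 -> fin_cell mu idx a) ->
    (forall g b, y' g b != 0 -> fin_cell mu idx' b) ->
    ((nrm (form mu s t U (fun g => x' g \o idx) (fun g => y' g \o idx')))%:E <=
     \sum_e \int[mu]_u (nrm (U e (x' (s e) \o idx) u) * nrm (y' (t e) (idx' u)))%:E)%E.
  move=> hx' hy'; apply: (@le_trans _ _ (\sum_e nrm (cinner mu (U e (x' (s e) \o idx)) (y' (t e) \o idx')))%:E).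
    by rewrite lee_fin nrm_sum.
  rewrite -sumEFin; apply: lee_sum => e _; apply: nrm_cinner_le.
  apply: cintegrableM2; last by apply: Lp_comp_idx => //; exact: hy'.
  by apply: L2bounded_Lp => //; apply: Lp_comp_idx => //; exact: hx'.
have mUx (x' : G1 -> A -> R[i]) : (forall g a, x' g a != 0 -> fin_cell mu idx a) ->
    forall e, measurable_fun setT (fun u => nrm (U e (x' (s e) \o idx) u)).
  move=> hx' e; apply: measurable_nrm; have [[mU _ _] _] := UL e.
  by apply: mU; apply: Lp_comp_idx => //; exact: hx'.
have my (y' : G2 -> B -> R[i]) g : measurable_fun setT (fun u => nrm (y' g (idx' u))).
  by apply: measurable_nrm; exact: cmeasurable_comp_idx.
apply: (form_three_lines UL midx midx' (x := x) (y := y) (r0 := r0) (r1 := r1) (u0 := u0) (u1 := u1)).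
- exact: ltW.
- exact: ltW.
- by move=> g a; rewrite mulr_ge0 ?powR_ge0.
- by move=> g a; exact: powR_ge0.
- by move=> g a; rewrite mulr_ge0 ?powR_ge0 ?sqr_ge0.
- by move=> g a; rewrite mulr_ge0 ?powR_ge0.
- by move=> g a; rewrite /r0; have [|xa] := eqVneq (x g a) 0;
    rewrite ?mul0r ?eqxx// => _; exact: hx xa.
- move=> g a; rewrite /r1 powR_eq0 mulf_eq0 !negb_and negb_or.
  rewrite invr_eq0 (gt_eqF p0g)/= orbF => /andP[ra _]; exact: rho_fin.
- move=> g b; rewrite /u0 mulf_eq0 negb_or powR_eq0 negb_and (gt_eqF p1i)/= orbF.
  by move=> /andP[sb _]; exact: sig_fin.
- by move=> g b; rewrite /u1; have [|yb] := eqVneq (y g b) 0;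
    rewrite ?mul0r ?eqxx// => _; exact: hy yb.
- move=> g a; rewrite /r0 /r1.
  have [x0|x0] /= := eqVneq (x g a) 0.
    by rewrite x0 nrm0 mul0r powR0 ?mul0r// gt_eqF.
  rewrite mul1r -[LHS](mul_frac (nx a) g).
  have S0 : sqsum (nx a) != 0.
    by apply: contra x0 => /eqP/(@sqsum_eq0 _ _ (nx a) g)/eqP; rewrite /nx nrm_eq0.
  rewrite -[X in _ = _ * X]powRrM (mulrC p0^-1) th2 powRM ?sqr_ge0//.
  rewrite powR_exprn ?frac_ge0// -powR_mulrn ?powR_ge0//.
  rewrite -[(frac _ g `^ _) `^ _]powRrM mulVf// powRr1 ?frac_ge0// mulrA.
  congr (_ * _); rewrite -powRrM -powRD; last by rewrite powR_eq0 (negbTE S0)/= implybT.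
  rewrite /rho -powRrM; congr (_ `^ _).
  have -> : p1^-1 * (1 - th) + 2^-1 = P by rewrite /P th2 mulrC.
  by rewrite invfM -mulrA mulVf ?mulr1// gt_eqF.
- move=> g b; rewrite /u0 /u1.
  have [y0|y0] /= := eqVneq (y g b) 0.
    by rewrite y0 nrm0 mul0r powR0 ?mulr0// gt_eqF.
  rewrite mul1r -[LHS](mul_frac (ny b) g).
  have S0 : sqsum (ny b) != 0.
    by apply: contra y0 => /eqP/(@sqsum_eq0 _ _ (ny b) g)/eqP; rewrite /ny nrm_eq0.
  have S1 : sqsum (ny b) `^ 2^-1 != 0 by rewrite powR_eq0 (negbTE S0).
  have f0 : 0 < frac (ny b) g.
    rewrite /frac divr_gt0//; last by rewrite lt_neqAle eq_sym S1 powR_ge0.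
    by rewrite lt_neqAle ny0 andbT eq_sym /ny nrm_eq0.
  have s0 : 0 < sig b by rewrite /sig powR_gt0// lt_neqAle eq_sym S0 sqsum_ge0.
  rewrite -[X in _ = _ * X]powRrM.
  have F20 : 0 <= frac (ny b) g ^+ 2 by exact: sqr_ge0.
  rewrite (powRM _ (powR_ge0 _ _) F20) (powRM _ (sig0 b) F20) mulrACA.
  rewrite -[(sig b `^ _) `^ _]powRrM -!powRD; last 2 first.
    by rewrite expf_eq0/= (gt_eqF f0) implybT.
    by rewrite (gt_eqF s0) implybT.
  congr (_ * _).
    rewrite /sig -powRrM; congr (_ `^ _).
    have -> : (1 - p1^-1) * (1 - th) + (1 - p0^-1) * th = 1 - P.
      by rewrite /P; ring.
    by rewrite invfM -mulrA mulVf ?mulr1// gt_eqF.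
  have -> : 1 - th + (1 - p0^-1) * th = 2^-1.
    have -> : (1 - p0^-1) * th = th - th / p0 by ring.
    by rewrite th2 addrA subrK {1}(splitr 1) mul1r addrK.
  by rewrite powR_exprn ?ltW// -powR_mulrn ?powR_ge0// -powRrM mulVf// powRr1// ltW.
- move=> x' y' hx' hy'.
  have fx' g a : x' g a != 0 -> fin_cell mu idx a.
    rewrite -nrm_eq0 hx' /r0; have [|xa] := eqVneq (x g a) 0.
      by rewrite mul0r eqxx.
    by move=> _; exact: hx xa.
  have fy' g b : y' g b != 0 -> fin_cell mu idx' b.
    rewrite -nrm_eq0 hy' /u0 mulf_eq0 negb_or powR_eq0 negb_and (gt_eqF p1i)/= orbF.
    by move=> /andP[sb _]; exact: sig_fin.
  (* One scalar function dominates all components of the input, so a single use of the maximal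
     estimate controls all the operators at once. *)
  pose f0 u := (rho (idx u) `^ p1^-1)%:C : R[i].
  have pf0 : pint mu p1 f0 = (\int[mu]_u (rho (idx u))%:E)%E.
    apply: eq_integral => u _; rewrite nrm_real ger0_norm ?powR_ge0//.
    by rewrite -powRrM mulVf ?gt_eqF// powRr1.
  have hf0 : Lp mu p1%:E f0.
    apply: (pint_Lp p1g).
      by apply: (cmeasurable_comp_idx midx (fun a => (rho a `^ p1^-1)%:C)).
    by rewrite pf0 (le_lt_trans i_rho)// ltry.
  have [e|e u|Z [mZ Z0 hZ iZ]] := maxU (F := fun e => x' (s e) \o idx) hf0.
  - exact: cmeasurable_comp_idx.
  - rewrite hx' /r0 nrm_real ger0_norm ?powR_ge0//.
    by rewrite ler_piMl ?powR_ge0//; case: (_ != _).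
  have := form_le _ _ fx' fy'; rewrite -int_sum; last 2 first.
  - by move=> e u; rewrite mulr_ge0 ?nrm_ge0.
  - by move=> e; apply: measurable_funM; [exact: mUx|exact: my].
  move=> h; rewrite -lee_fin; apply: (le_trans h).
  apply: (@le_trans _ _ (\int[mu]_u (Dt%:R * (Z u * sig (idx' u) `^ (1 - p1^-1)))%:E)%E).
    apply: int_le => u; first by apply: sumr_ge0 => e _; rewrite mulr_ge0 ?nrm_ge0.
    apply: (@le_trans _ _ (\sum_e Z u * u0 (t e) (idx' u))).
      by apply: ler_sum => e _; rewrite hy' ler_wpM2r ?hZ// mulr_ge0 ?powR_ge0 ?sqr_ge0.
    rewrite -mulr_sumr mulrCA ler_wpM2l// /u0 -mulr_sumr [leRHS]mulrC ler_wpM2l ?powR_ge0//.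
    apply: le_trans (sum_fiber (w := fun g => frac (ny (idx' u)) g ^+ 2) _ hDt) _.
      by move=> g; exact: sqr_ge0.
    by rewrite ler_piMr ?frac_sqr_sum_le1.
  rewrite intZ//; last 2 first.
  - by move=> u; rewrite mulr_ge0 ?powR_ge0.
  - by apply: measurable_funM => //; apply: (measurableT_comp (measurable_powR _)).
  rewrite EFinM lee_wpmul2l ?lee_fin//.
  apply: (holder_int (b := sig \o idx')) => //.
  - by rewrite (le_trans hp0)// ltW.
  - by move=> u; exact: sig0.
  rewrite (le_trans iZ)// pf0 -[leRHS]mule1.
  by apply: lee_wpmul2l; rewrite ?lee_fin ?powR_ge0.
- move=> x' y' hx' hy'.
  have fx' g a : x' g a != 0 -> fin_cell mu idx a.
    rewrite -nrm_eq0 hx' /r1 powR_eq0 mulf_eq0 !negb_and negb_or.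
    rewrite invr_eq0 (gt_eqF p0g)/= orbF => /andP[ra _]; exact: rho_fin.
  have fy' g b : y' g b != 0 -> fin_cell mu idx' b.
    rewrite -nrm_eq0 hy' /u1; have [|yb] := eqVneq (y g b) 0.
      by rewrite mul0r eqxx.
    by move=> _; exact: hy yb.
  rewrite -lee_fin; apply: (le_trans (form_le _ _ fx' fy')).
  pose b e u := sig (idx' u) * frac (ny (idx' u)) (t e) ^+ 2.
  have b0 e u : 0 <= b e u by rewrite mulr_ge0 ?sqr_ge0.
  have mb e : measurable_fun setT (b e).
    exact: (measurable_comp_idx midx' (fun c => sig c * frac (ny c) (t e) ^+ 2)).
  apply: (@le_trans _ _ (\sum_e \int[mu]_u (nrm (U e (x' (s e) \o idx) u) * b e u `^ (1 - p0^-1))%:E)%E).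
    apply: lee_sum => e _; apply: int_le => u; first by rewrite mulr_ge0 ?nrm_ge0.
    rewrite ler_wpM2l ?nrm_ge0// hy' /u1 ler_piMl ?powR_ge0//.
    by case: (_ != _).
  apply: holder_sum => //.
  - by rewrite mulr_gt0 ?powR_gt0 ?ltr0n.
  - by rewrite ltr0n.
  - by move=> e u; exact: nrm_ge0.
  - exact: mUx.
  - pose c g a := rho a * frac (nx a) g ^+ 2.
    have c0 g a : 0 <= c g a by rewrite mulr_ge0 ?sqr_ge0.
    have mc g : measurable_fun setT (fun u => c g (idx u)) by exact: measurable_comp_idx.
    apply: (@le_trans _ _ (\sum_e (M `^ p0)%:E * \int[mu]_u (c (s e) (idx u))%:E)%E).
      apply: lee_sum => e _; apply: le_trans (boundU e _ _) _.
      + by apply: Lp_comp_idx => //; exact: fx'.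
      + by apply: Lp_comp_idx => //; exact: fx'.
      rewrite lee_wpmul2l ?lee_fin ?powR_ge0//; apply: int_le => u; first exact: powR_ge0.
      by rewrite hx' /r1 -powRrM mulVf ?gt_eqF// powRr1// c0.
    rewrite -ge0_sume_distrr; last by move=> e _; apply: int_ge0.
    rewrite EFinM lee_wpmul2l ?lee_fin ?powR_ge0// -int_sum//.
    apply: (@le_trans _ _ (\int[mu]_u (Ds%:R * rho (idx u))%:E)%E).
      apply: int_le => u; first by apply: sumr_ge0.
      apply: le_trans (sum_fiber (w := fun g => c g (idx u)) _ hDs) _ => //.
      rewrite ler_wpM2l// /c -mulr_sumr ler_piMr ?frac_sqr_sum_le1//.
    by rewrite intZ// -[leRHS]mule1 lee_wpmul2l ?lee_fin.
  - rewrite -int_sum//.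
    apply: (@le_trans _ _ (\int[mu]_u (Dt%:R * sig (idx' u))%:E)%E).
      apply: int_le => u; first by apply: sumr_ge0.
      apply: le_trans (sum_fiber (w := fun g => sig (idx' u) * frac (ny (idx' u)) g ^+ 2) _ hDt) _.
        by move=> g; rewrite mulr_ge0 ?sqr_ge0.
      rewrite ler_wpM2l// -mulr_sumr ler_piMr ?frac_sqr_sum_le1//.
    by rewrite intZ// -[leRHS]mule1 lee_wpmul2l ?lee_fin.
Qed.

End maximal_interpolation.

End form_bounds.

(** * Approximation by step functions *)

Lemma nrm_le_ReIm (R : realType) (z : R[i]) :
  nrm z <= `|complex.Re z| + `|complex.Im z|.
Proof.
rewrite -ler_sqr ?nnegrE ?nrm_ge0 ?addr_ge0// nrm_sqr sqrrD.
rewrite !real_normK ?num_real//.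
by rewrite lerD2r lerDl mulrn_wge0// mulr_ge0.
Qed.

Section power_limit.
Context {R : realType}.

Lemma cvg_powR (u : nat -> R) (y s : R) : 0 < s -> 0 <= y ->
  (forall n, 0 <= u n) -> u n @[n --> \oo] --> y ->
  u n `^ s @[n --> \oo] --> y `^ s.
Proof.
move=> s0 y0 u0 uy; have [y0'|yn0] := eqVneq y 0; last first.
  have yp : 0 < y by rewrite lt_neqAle eq_sym yn0.
  have c : {for y, continuous (fun a : R => a `^ s)}.
    apply: differentiable_continuous; apply/derivable1_diffP.
    by apply: derivable_powR; rewrite in_itv/= andbT.
  exact: (cvg_comp u (fun a => a `^ s) uy c).
rewrite y0' powR0 ?gt_eqF// in uy *.
apply/cvgrPdist_le => e e0.
have es0 : 0 < e `^ s^-1 by exact: powR_gt0.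
move/cvgrPdist_le : uy => /(_ _ es0); apply: filterS => n.
rewrite !sub0r !normrN (ger0_norm (u0 n)) ger0_norm ?powR_ge0// => h.
have := @ge0_ler_powR R s (ltW s0) _ _ (u0 n) (ltW es0) h.
by rewrite -powRrM mulVf ?gt_eqF// powRr1// ltW.
Qed.

End power_limit.

Section rounding.
Context {R : realType}.

(* Rounding of the positive part of u to a multiple of 2^-n, capped at n. *)
Definition qround (n : nat) (u : R) : R :=
  \sum_(i < n * 2 ^ n) (i.+1%:R / 2 ^+ n <= u)%R%:R / 2 ^+ n.

Let p2 n : 0 < 2 ^+ n :> R. Proof. by rewrite exprn_gt0. Qed.

Let sum_lt (m N : nat) : (\sum_(i < N) (i < m)%N = minn m N)%N.
Proof.
elim: N => [|N ih]; first by rewrite big_ord0 minn0.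
rewrite big_ord_recr/= ih; case: ltnP => h /=.
  by rewrite (minn_idPr h) addn1.
by rewrite (minn_idPl (leqW h)) addn0.
Qed.

Lemma qroundE n u : 0 <= u ->
  qround n u = (minn (Num.truncn (u * 2 ^+ n)) (n * 2 ^ n))%:R / 2 ^+ n.
Proof.
move=> u0; rewrite /qround -mulr_suml; congr (_ / _).
rewrite -sum_lt natr_sum; apply: eq_bigr => i _.
by rewrite ler_pdivrMr// truncn_gt_nat.
Qed.

Lemma qround_le0 n u : u <= 0 -> qround n u = 0.
Proof.
move=> u0; rewrite /qround big1// => i _.
rewrite leNgt (le_lt_trans u0) ?divr_gt0//=.
by rewrite mul0r.
Qed.

Lemma qround_ge0 n u : 0 <= qround n u.
Proof. by apply: sumr_ge0 => i _; rewrite divr_ge0// ltW. Qed.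

Lemma qround_le n u : 0 <= u -> qround n u <= u.
Proof.
move=> u0; rewrite qroundE// ler_pdivrMr//.
apply: (@le_trans _ _ (Num.truncn (u * 2 ^+ n))%:R).
  by rewrite ler_nat geq_minl.
by rewrite truncn_le mulr_ge0// ltW.
Qed.

Lemma qround_ge n u : 0 <= u -> u <= n%:R -> u - qround n u <= (2 ^+ n)^-1.
Proof.
move=> u0 un; rewrite qroundE// lerBlDr.
have v0 : 0 <= u * 2 ^+ n by rewrite mulr_ge0// ltW.
rewrite (minn_idPl _); last first.
  rewrite -(ler_nat R) (le_trans (_ : _ <= u * 2 ^+ n))//.
    by rewrite truncn_le.
  by rewrite natrM natrX ler_pM2r.
rewrite -[X in X + _]mul1r -mulrDl ler_pdivlMr//.
by rewrite nat1r ltW// truncnS_gt.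
Qed.

Definition sround n (u : R) := qround n u - qround n (- u).

(** Rounding goes towards 0, so the rounded value has the sign of u and a smaller modulus. The
    second inequality lets a function be tested against its own rounding without loss; see
    [nrm_round_at_Re]. *)
Lemma sroundP n (u : R) : `|sround n u| <= `|u| /\ sround n u ^+ 2 <= u * sround n u.
Proof.
rewrite /sround; have [u0|/ltW u0] := leP 0 u.
  rewrite (@qround_le0 n (- u)) ?oppr_le0// subr0 !ger0_norm ?qround_ge0//.
  by rewrite qround_le// expr2 ler_wpM2r ?qround_ge0// qround_le.
have Nu0 : 0 <= - u by rewrite oppr_ge0.
rewrite (qround_le0 n u0) sub0r normrN (ger0_norm (qround_ge0 _ _)) (ler0_norm u0).
by rewrite qround_le// sqrrN mulrN -mulNr expr2 ler_wpM2r ?qround_ge0// qround_le.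
Qed.

Lemma sround_dist n (u : R) : `|u| <= n%:R -> `|u - sround n u| <= (2 ^+ n)^-1.
Proof.
rewrite /sround; have [u0|/ltW u0] := leP 0 u.
  rewrite (@qround_le0 n (- u)) ?oppr_le0// subr0 (ger0_norm u0) => un.
  by rewrite ger0_norm ?subr_ge0 ?qround_le// qround_ge.
have Nu0 : 0 <= - u by rewrite oppr_ge0.
rewrite (qround_le0 n u0) sub0r opprK (ler0_norm u0) => un.
rewrite -normrN opprD ger0_norm ?subr_ge0 ?qround_le//.
exact: qround_ge.
Qed.

Lemma cvg_sround (u : R) : sround n u @[n --> \oo] --> u.
Proof.
apply/cvgrPdist_le => e e0.
have [N hN] : exists N : nat, `|u| <= N%:R.
  by exists (Num.truncn `|u|).+1; rewrite ltW// truncnS_gt.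
have : (2^-1 : R) ^+ n @[n --> \oo] --> (0 : R).
  by apply: cvg_expr; rewrite ger0_norm ?invr_ge0// invf_lt1// ltr1n.
move/cvgrPdist_le => /(_ e e0) h.
near=> n; apply: (le_trans (sround_dist _)).
  by rewrite (le_trans hN)// ler_nat; near: n; exact: nbhs_infty_ge.
have : `|0 - 2^-1 ^+ n| <= e :> R by near: n.
by rewrite sub0r normrN exprVn ger0_norm// invr_ge0 exprn_ge0.
Unshelve. all: by end_near.
Qed.

End rounding.

Section step_approximation.
Context d (T : measurableType d) (R : realType)
  (mu : {sigma_finite_measure set T -> \bar R}).

Lemma fin_indexed_ffun (V : finType) (B : V -> set T) :
  (forall v, measurable (B v)) ->
  fin_indexed (fun t => [ffun v => `[< B v t >]]).
Proof.
move=> mB a.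
rewrite (_ : _ @^-1` _ = \bigcap_(v in [set: V]) (if a v then B v else ~` B v)).
  apply: fin_bigcap_measurable => // v _.
  by case: (a v) => //; exact: measurableC.
apply/seteqP; split => [t /= <- v _|t h /=].
  by rewrite ffunE; case: asboolP.
apply/ffunP => v; rewrite ffunE; have := h v I.
by case: (a v) => Bt; [apply/asboolP|apply/asboolP].
Qed.

Context (G : finType) (f : G -> T -> R[i]).
Hypothesis mf : forall g, cmeasurable (f g).

Definition round_at (X : nat -> set T) n g t : R[i] :=
  if t \in X n then sround n (complex.Re (f g t)) +i* sround n (complex.Im (f g t))
  else 0.

Lemma nrm_round_at_le X n g t : nrm (round_at X n g t) <= nrm (f g t).
Proof.
rewrite /round_at; case: ifP => _; last by rewrite nrm0 nrm_ge0.
rewrite -ler_sqr ?nnegrE ?nrm_ge0// !nrm_sqr/=.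
have [h1 _] := sroundP n (complex.Re (f g t)).
have [h2 _] := sroundP n (complex.Im (f g t)).
by rewrite lerD// -[X in X <= _]real_normK ?num_real// -[X in _ <= X]real_normK ?num_real//
  lerXn2r ?nnegrE.
Qed.

Lemma nrm_round_at_Re X n g t :
  nrm (round_at X n g t) ^+ 2 <= complex.Re (f g t * (round_at X n g t)^*).
Proof.
rewrite /round_at; case: ifP => _; last first.
  by rewrite nrm0 expr0n; case: (f g t) => a b /=; rewrite oppr0 !mulr0 subr0.
rewrite nrm_sqr.
have [_ h1] := sroundP n (complex.Re (f g t)).
have [_ h2] := sroundP n (complex.Im (f g t)).
by case: (f g t) h1 h2 => a b /= h1 h2; rewrite mulrN opprK lerD.
Qed.

(** A rounded function depends on finitely many threshold tests only, and their outcomes form the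
    index. The entry [None] records membership in [X n]; where it fails the value is 0, so nonzero
    values live on cells of finite measure. *)
Lemma round_at_step X n : measurable (X n) -> (mu (X n) < +oo)%E ->
  exists (A : finType) (idx : T -> A) (x : G -> A -> R[i]),
  [/\ fin_indexed idx, forall g a, x g a != 0 -> fin_cell mu idx a &
      forall g, round_at X n g = x g \o idx].
Proof.
move=> mX Xoo; pose N := (n * 2 ^ n)%N.
pose V : finType := option (G * (bool * bool) * 'I_N).
pose part (c : bool * bool) (z : R[i]) : R :=
  let u := if c.1 then complex.Re z else complex.Im z in if c.2 then u else - u.
pose B (v : V) : set T := match v with
  | None => X n
  | Some (g, c, i) => [set t | i.+1%:R / 2 ^+ n <= part c (f g t)]
  end.
have mB v : measurable (B v).
  case: v => [[[g c] i]|//] /=.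
  have mp : measurable_fun setT (fun t => part c (f g t)).
    have [m1 m2] := mf g.
    by case: c => [[] []] //=; apply: measurable_funN.
  have mc : measurable_fun setT (cst (i.+1%:R / 2 ^+ n : R) : T -> R).
    exact: measurable_cst.
  have := measurable_fun_ler mc mp.
  move=> /(_ measurableT [set true] I); rewrite setTI.
  by congr measurable; apply/seteqP; split => t /=.
pose idx (t : T) : {ffun V -> bool} := [ffun v => `[< B v t >]].
pose q (a : {ffun V -> bool}) g (c : bool * bool) : R :=
  \sum_(i < N) (a (Some (g, c, i)))%:R / 2 ^+ n.
pose x g (a : {ffun V -> bool}) : R[i] := if a None then
  (q a g (true, true) - q a g (true, false)) +i*
  (q a g (false, true) - q a g (false, false)) else 0.
exists {ffun V -> bool}, idx, x; split.
- exact: fin_indexed_ffun.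
- move=> g a; rewrite /x; case: ifP => [aN _|]; last by rewrite eqxx.
  apply: le_lt_trans Xoo; apply: le_measure; rewrite ?inE//.
    exact: (fin_indexed_ffun mB).
  by move=> t /= ta; move: aN; rewrite -ta ffunE => /asboolP.
- move=> g; apply/funext => t; rewrite /round_at /x /= ffunE /=.
  have -> : (t \in X n) = `[< X n t >] by apply/idP/asboolP; rewrite inE.
  case: ifP => // _; rewrite /sround.
  by congr ((_ - _) +i* (_ - _)); apply: eq_bigr => i _; rewrite ffunE/= asboolb.
Qed.

Lemma exhaustion : exists X : nat -> set T,
  [/\ forall n, measurable (X n), forall n, (mu (X n) < +oo)%E &
      forall t, \forall n \near \oo, X n t].
Proof.
have /sigma_finiteP[X [XT ndX hX]] := @sigma_finiteT _ T R mu.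
exists X; split => [n|n|t]; [by have [] := hX n|by have [] := hX n|].
have [n _ Xnt] : (\bigcup_i X i) t by rewrite -XT.
exists n => // m /= nm.
by move/subsetPset : (ndX _ _ nm); apply.
Qed.

Lemma cvg_round_at X g t : (\forall n \near \oo, X n t) ->
  nrm (f g t - round_at X n g t) @[n --> \oo] --> (0 : R).
Proof.
move=> hX.
have cR := @cvg_sround R (complex.Re (f g t)).
have cI := @cvg_sround R (complex.Im (f g t)).
have h : `|complex.Re (f g t) - sround n (complex.Re (f g t))| +
    `|complex.Im (f g t) - sround n (complex.Im (f g t))| @[n --> \oo] --> (0 : R).
  rewrite -[X in _ --> X](addr0 (0 : R)); apply: cvgD.
    by rewrite -(@normr0 R R) -(subrr (complex.Re (f g t))); apply: cvg_norm; apply: cvgB => //; exact: cvg_cst.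
  by rewrite -(@normr0 R R) -(subrr (complex.Im (f g t))); apply: cvg_norm; apply: cvgB => //; exact: cvg_cst.
apply: (squeeze_cvgr _ (cvg_cst 0) h).
near=> n; rewrite nrm_ge0/= /round_at mem_set; last by near: n.
rewrite (le_trans (nrm_le_ReIm _))//.
by case: (f g t) => a b /=.
Unshelve. all: by end_near.
Qed.

Lemma cvg_nrm_round_at X g t : (\forall n \near \oo, X n t) ->
  nrm (round_at X n g t) @[n --> \oo] --> nrm (f g t).
Proof.
move=> /(cvg_round_at g) h; apply/cvgrPdist_le => e e0.
move/cvgrPdist_le : h => /(_ e e0); apply: filterS => n.
rewrite sub0r normrN ger0_norm ?nrm_ge0// => h; rewrite (le_trans _ h)//.
rewrite ler_norml; apply/andP; split; last first.
  by rewrite lerBlDr (le_trans _ (nrmD _ _))// subrK.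
rewrite lerBrDl lerBlDr; have := nrmB (f g t) (f g t - round_at X n g t).
by rewrite opprB addrC subrK addrC.
Qed.

(** Dominated convergence for the roundings, with majorant 4 |f|^2. Besides convergence, the
    pointwise bound by f is retained: it keeps the approximants in the same unit balls for all
    exponents at once. *)
Lemma step_approx_L2 (e : R) : 0 < e -> (forall g, Lp mu 2%:E (f g)) ->
  exists (A : finType) (idx : T -> A) (x : G -> A -> R[i]),
  [/\ fin_indexed idx, forall g a, x g a != 0 -> fin_cell mu idx a,
      forall g t, nrm (x g (idx t)) <= nrm (f g t) &
      forall g, (pint mu 2 (fun t => (f g t - x g (idx t))%R) <= e%:E)%E].
Proof.
move=> e0 hf; have [X [mX Xoo hX]] := exhaustion.
have lim g : (\int[mu]_t ((nrm (f g t - round_at X n g t) ^+ 2)%:E))%E @[n --> \oo] --> 0%E.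
  have m2 (h : T -> R[i]) : cmeasurable h -> measurable_fun setT (fun t => (nrm (h t) ^+ 2)%:E).
    by move=> mh; apply/measurable_EFinP; apply: measurable_funX; exact: measurable_nrm.
  have mr n : cmeasurable (round_at X n g).
    have [A [idx [x [mi _ ->]]]] := round_at_step (mX n) (Xoo n).
    exact: cmeasurable_comp_idx.
  have := @dominated_convergence _ T R mu setT measurableT
    (fun n t => (nrm (f g t - round_at X n g t) ^+ 2)%:E) (cst 0%E)
    (fun t => (4 * nrm (f g t) ^+ 2)%:E).
  case => [n|||||_ _].
  - by apply: m2; apply: cmeasurableB.
  - exact: measurable_cst.
  - apply: aeW => t _; apply/fine_cvgP; split; first exact: nearW.
    have := cvgM (cvg_round_at g (hX t)) (cvg_round_at g (hX t)).
    by rewrite mulr0; apply.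
  - apply/integrableP; split.
      by apply/measurable_EFinP; apply: measurable_funM => //; apply: measurable_funX;
        apply: measurable_nrm; exact: mf.
    rewrite (eq_integral (fun t => (4 * nrm (f g t) ^+ 2)%:E)); last first.
      by move=> t _; rewrite gee0_abs// lee_fin mulr_ge0// sqr_ge0.
    rewrite intZ//; last 2 first.
      by move=> t; exact: sqr_ge0.
      by apply: measurable_funX; apply: measurable_nrm; exact: mf.
    rewrite lte_mul_pinfty// ?lee_fin// -pint2E; exact: Lp_pint.
  - apply: aeW => t n _; rewrite gee0_abs ?lee_fin ?sqr_ge0//.
    rewrite (_ : 4 = 2 ^+ 2) -?exprMn ?lerXn2r ?nnegrE ?mulr_ge0 ?nrm_ge0//.
      rewrite (le_trans (nrmB _ _))// mulr_natl mulr2n lerD2l.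
      exact: nrm_round_at_le.
    by rewrite expr2 -natrM.
  - by rewrite integral0.
have [n hn] : exists n, forall g, (\int[mu]_t ((nrm (f g t - round_at X n g t) ^+ 2)%:E) <= e%:E)%E.
  have : \forall n \near \oo, forall g, g \in enum G ->
      (\int[mu]_t ((nrm (f g t - round_at X n g t) ^+ 2)%:E) <= e%:E)%E.
    elim: (enum G) => [|g s ih]; first by apply: nearW.
    move/fine_cvgP : (lim g) => [lf /cvgrPdist_le /(_ e e0) lg].
    near=> n => g'; rewrite inE => /predU1P[->|]; last by move: g'; near: n.
    have fn : (\int[mu]_t ((nrm (f g t - round_at X n g t) ^+ 2)%:E))%E \is a fin_num by near: n.
    have : `|0 - fine (\int[mu]_t ((nrm (f g t - round_at X n g t) ^+ 2)%:E))%E| <= e by near: n.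
    rewrite sub0r normrN ger0_norm; first by rewrite -lee_fin fineK.
    by apply/fine_ge0/int_ge0 => t; exact: sqr_ge0.
  move=> [n _ h]; exists n => g; apply: h => //=.
  by rewrite mem_enum.
have [A [idx [x [mi fx rx]]]] := round_at_step (mX n) (Xoo n).
exists A, idx, x; split => //.
- by move=> g t; have := nrm_round_at_le X n g t; rewrite rx.
- by move=> g; rewrite pint2E; have := hn g; rewrite rx.
Unshelve. all: by end_near.
Qed.

End step_approximation.

Section L2_families.
Context d (T : measurableType d) (R : realType)
  (mu : {sigma_finite_measure set T -> \bar R}).
Implicit Types (f g : T -> R[i]).

Lemma nrm_cinner_CS f g (a b : R) : 0 < a -> 0 < b ->
  Lp mu 2%:E f -> Lp mu 2%:E g ->
  (pint mu 2 f <= a%:E)%E -> (pint mu 2 g <= b%:E)%E ->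
  nrm (cinner mu f g) <= a `^ 2^-1 * b `^ 2^-1.
Proof.
move=> a0 b0 hf hg fa gb; rewrite -lee_fin.
apply: (le_trans (nrm_cinner_le (cintegrableM2 hf hg))).
have e2 : 1 - 2^-1 = 2^-1 :> R by field.
have mf := measurable_nrm (Lp_cmeasurable hf).
have mg := measurable_nrm (Lp_cmeasurable hg).
have := @holder_sum _ _ _ mu unit (fun _ x => nrm (f x)) (fun _ x => nrm (g x) ^+ 2) 2 a b
  (ler1n _ 2) a0 b0 (fun _ x => nrm_ge0 (f x)) (fun _ x => sqr_ge0 (nrm (g x)))
  (fun=> mf) (fun=> measurable_funX 2 mg).
rewrite !(big_pred1 tt)//; try by case.
rewrite -pint2E e2 => /(_ fa gb); congr (_ <= _)%E; apply: eq_integral => x _.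
by rewrite -powR_mulrn ?nrm_ge0// -powRrM mulfV// powRr1 ?nrm_ge0.
Qed.

Lemma L2_sub f g : Lp mu 2%:E f -> Lp mu 2%:E g -> Lp mu 2%:E (fun x => f x - g x).
Proof.
move=> hf hg; have := L2_lin (-1) hg hf.
by under [in X in X -> _]eq_fun do rewrite mulN1r addrC.
Qed.

Lemma L2bounded_comp U V : L2bounded mu U -> L2bounded mu V -> L2bounded mu (U \o V).
Proof.
move=> UL VL; have [[U1 U2 U3] [C C0 hC]] := UL; have [[V1 V2 V3] [D D0 hD]] := VL.
have LV f : Lp mu 2%:E f -> Lp mu 2%:E (V f) by exact: L2bounded_Lp.
split; first split.
- by move=> f /LV; exact: U1.
- by move=> f g hf hg e; apply: U2; [exact: LV|exact: LV|exact: V2].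
- move=> a f g hf hg.
  have h1 := U3 a _ _ (LV _ hf) (LV _ hg).
  have h2 : {ae mu, forall x, U (V (fun y => a * f y + g y)) x =
      U (fun y => a * V f y + V g y) x}.
    by apply: U2; [exact/LV/L2_lin|apply: L2_lin; exact: LV|exact: V3].
  by apply: filterS2 h1 h2 => x /= h1 ->.
- exists (C * D); rewrite ?mulr_ge0// => f hf /=.
  rewrite (le_trans (hC _ (LV _ hf)))// EFinM -muleA lee_wpmul2l ?lee_fin//.
  exact: hD.
Qed.

Lemma cinnerBl f f' g : Lp mu 2%:E f -> Lp mu 2%:E f' -> Lp mu 2%:E g ->
  cinner mu (fun x => f x - f' x) g = cinner mu f g - cinner mu f' g.
Proof.
move=> hf hf' hg; rewrite !cinnerE.
have i1 := cintegrableM2 hf hg; have i2 := cintegrableM2 hf' hg.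
rewrite -mulN1r -cintegralZ// -cintegralD//; last exact: cintegrableZ.
by congr cintegral; apply/funext => x; rewrite mulN1r mulrBl.
Qed.

Lemma cinnerBr f g g' : Lp mu 2%:E f -> Lp mu 2%:E g -> Lp mu 2%:E g' ->
  cinner mu f (fun x => g x - g' x) = cinner mu f g - cinner mu f g'.
Proof.
move=> hf hg hg'; rewrite (cinnerC (L2_sub hg hg') hf) cinnerBl//.
by rewrite (cinnerC hg hf) (cinnerC hg' hf) -rmorphB.
Qed.

Lemma cinnerZl (c : R[i]) f g : Lp mu 2%:E f -> Lp mu 2%:E g ->
  cinner mu (fun x => c * f x) g = c * cinner mu f g.
Proof.
move=> hf hg; rewrite !cinnerE -cintegralZ; last exact: cintegrableM2.
by congr cintegral; apply/funext => x; rewrite mulrA.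
Qed.

Lemma L2boundedB U f g : L2bounded mu U -> Lp mu 2%:E f -> Lp mu 2%:E g ->
  {ae mu, forall x, U (fun y => f y - g y) x = U f x - U g x}.
Proof.
move=> [[U1 U2 U3] _] hf hg; have := U3 (-1) _ _ hg hf; apply: filterS => x.
rewrite mulN1r [RHS]addrC => <-.
by congr (U _ x); apply/funext => y; rewrite mulN1r addrC.
Qed.

Lemma L2boundedZ U (c : R[i]) f : L2bounded mu U -> Lp mu 2%:E f ->
  {ae mu, forall x, U (fun y => c * f y) x = c * U f x}.
Proof.
move=> [UL _] hf; have U0 := linear_operator0 UL; have [_ _ U3] := UL.
have := U3 c f (fun=> 0) hf (@Lp0 _ _ _ mu 2 (ltr0n _ 2)).
apply: filterS2 U0 => x e; rewrite e addr0 => <-.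
by congr (U _ x); apply/funext => y; rewrite addr0.
Qed.

Lemma L2Z (c : R[i]) f : Lp mu 2%:E f -> Lp mu 2%:E (fun x => c * f x).
Proof.
move=> hf; have := L2_lin c hf (@Lp0 _ _ _ mu 2 (ltr0n _ 2)).
by under [in X in X -> _]eq_fun do rewrite addr0.
Qed.

Lemma pint_le (p : R) f g : 0 <= p -> (forall x, nrm (f x) <= nrm (g x)) ->
  (pint mu p f <= pint mu p g)%E.
Proof.
move=> p0 fg; apply: int_le => x; first exact: powR_ge0.
by apply: ge0_ler_powR; rewrite ?nnegrE ?nrm_ge0.
Qed.

Lemma le_ball2 (G : finType) (P : R) (f g : G -> T -> R[i]) : 0 <= P ->
  (forall e x, nrm (f e x) <= nrm (g e x)) -> ball2 mu P g -> ball2 mu P f.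
Proof.
move=> P0 fg; apply: le_trans; apply: int_le => x; first exact: powR_ge0.
apply: ge0_ler_powR; rewrite ?nnegrE ?nrm2_ge0 ?invr_ge0 ?mulr_ge0//.
by apply: ler_sum => e _; rewrite lerXn2r ?nnegrE ?nrm_ge0.
Qed.

End L2_families.

Lemma fin_upper_bound (R : realType) (E : finType) (C : E -> R) :
  exists2 M : R, 0 < M & forall e, C e <= M.
Proof.
exists (1 + \sum_e `|C e|); first by rewrite ltr_wpDr// sumr_ge0.
move=> e; rewrite (bigD1 e)//= (le_trans (ler_norm _))// addrCA lerDl.
by rewrite addr_ge0// sumr_ge0.
Qed.

Section L2_form.
Context d (T : measurableType d) (R : realType)
  (mu : {sigma_finite_measure set T -> \bar R}).
Context (E G1 G2 : finType) (s : E -> G1) (t : E -> G2).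
Context (U : E -> (T -> R[i]) -> (T -> R[i])).
Hypothesis UL : forall e, L2bounded mu (U e).

Lemma L2_pint_ub (G : finType) (f : G -> T -> R[i]) :
  (forall g, Lp mu 2%:E (f g)) ->
  exists2 b : R, 0 < b & forall g, (pint mu 2 (f g) <= b%:E)%E.
Proof.
move=> hf; have [b b0 hb] := fin_upper_bound (fun g => fine (pint mu 2 (f g))).
exists b => // g; have := hb g; rewrite -lee_fin fineK//.
by rewrite ge0_fin_numE ?pint_ge0//; apply: Lp_pint.
Qed.

Lemma L2bounded_ub : exists2 C : R, 0 < C & forall e f, Lp mu 2%:E f ->
  (pint mu 2 (U e f) <= C%:E * pint mu 2 f)%E.
Proof.
have /choice[C hC] e : exists C : R, forall f, Lp mu 2%:E f ->
    (pint mu 2 (U e f) <= C%:E * pint mu 2 f)%E.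
  by have [_ [C _ hC]] := UL e; exists C.
have [M M0 hM] := fin_upper_bound C; exists M => // e f hf.
by rewrite (le_trans (hC e f hf))// lee_wpmul2r ?pint_ge0// lee_fin.
Qed.

Lemma form_sub_le (C b eps : R) (f f' : G1 -> T -> R[i]) (phi phi' : G2 -> T -> R[i]) :
  0 < C -> 0 < b -> 0 < eps ->
  (forall e h, Lp mu 2%:E h -> (pint mu 2 (U e h) <= C%:E * pint mu 2 h)%E) ->
  (forall g, Lp mu 2%:E (f g)) -> (forall g, Lp mu 2%:E (f' g)) ->
  (forall g, Lp mu 2%:E (phi g)) -> (forall g, Lp mu 2%:E (phi' g)) ->
  (forall g, pint mu 2 (f' g) <= b%:E)%E -> (forall g, pint mu 2 (phi g) <= b%:E)%E ->
  (forall g, pint mu 2 (fun x => f g x - f' g x)%R <= eps%:E)%E ->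
  (forall g, pint mu 2 (fun x => phi g x - phi' g x)%R <= eps%:E)%E ->
  nrm (form mu s t U f phi - form mu s t U f' phi') <=
    #|E|%:R * (2 * (C * b) `^ 2^-1 * eps `^ 2^-1).
Proof.
move=> C0 b0 e0 hC hf hf' hp hp' fb pb df dp.
rewrite /form -sumrB (le_trans (nrm_sum _ _ _))// -sum1_card natr_sum mulr_suml.
apply: ler_sum => e _; rewrite mul1r.
have UL2 h : Lp mu 2%:E h -> Lp mu 2%:E (U e h) by exact: L2bounded_Lp.
rewrite (_ : _ - _ = cinner mu (U e (fun x => f (s e) x - f' (s e) x)) (phi (t e)) +
    cinner mu (U e (f' (s e))) (fun x => phi (t e) x - phi' (t e) x)); last first.
  rewrite (cinnerBr (UL2 _ (hf' _)) (hp _) (hp' _)).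
  rewrite (ae_eq_cinner _ _ _ (L2boundedB (UL e) (hf (s e)) (hf' (s e)))).
  - by rewrite (cinnerBl (UL2 _ (hf _)) (UL2 _ (hf' _)) (hp _)); ring.
  - by apply: Lp_cmeasurable; apply/UL2/L2_sub.
  - by apply: cmeasurableB; apply: Lp_cmeasurable; exact: UL2.
  - exact: Lp_cmeasurable.
rewrite (le_trans (nrmD _ _))// -mulrA mulr_natl mulr2n.
have Cb (h : T -> R[i]) (a : R) : Lp mu 2%:E h -> 0 < a -> (pint mu 2 h <= a%:E)%E ->
    (pint mu 2 (U e h) <= (C * a)%:E)%E.
  move=> hh a0 ha; rewrite (le_trans (hC e _ hh))// EFinM.
  by rewrite lee_wpmul2l// lee_fin ltW.
apply: lerD.
  have [C0' b0' e0'] := And3 (ltW C0) (ltW b0) (ltW e0).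
  rewrite powRM// mulrAC -powRM//.
  apply: nrm_cinner_CS => //; rewrite ?mulr_gt0//; first exact/UL2/L2_sub.
  by apply: Cb => //; exact: L2_sub.
apply: nrm_cinner_CS => //; rewrite ?mulr_gt0//; [exact: UL2|exact: L2_sub|].
exact: Cb.
Qed.

(** The form of finitely many operators is continuous on L^2, and the step approximants, being
    pointwise smaller than f and phi, stay in the balls. The modulus of continuity depends on the
    operators, but it disappears in the limit. *)
Lemma form_bound_L2 (P M : R) (f : G1 -> T -> R[i]) (phi : G2 -> T -> R[i]) :
  0 < P -> P < 1 -> form_bound mu s t U P M ->
  (forall g, Lp mu 2%:E (f g)) -> (forall g, Lp mu 2%:E (phi g)) ->
  ball2 mu P f -> ball2 mu (1 - P) phi ->
  nrm (form mu s t U f phi) <= M.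
Proof.
move=> P0 P1 hM hf hp bf bp; apply/ler_addgt0Pr => e e0.
have [C C0 hC] := L2bounded_ub.
have [b1 b10 hb1] := L2_pint_ub hf; have [b2 b20 hb2] := L2_pint_ub hp.
pose b : R := b1 + b2; have b0 : 0 < b by rewrite addr_gt0.
pose K : R := #|E|%:R * (2 * (C * b) `^ 2^-1).
have K0 : 0 <= K by rewrite mulr_ge0// mulr_ge0// powR_ge0.
pose dl : R := e / (K + 1).
have dl0 : 0 < dl by rewrite divr_gt0// ltr_wpDl.
have dl20 : 0 < dl ^+ 2 by rewrite exprn_gt0.
have [A [idx [x [mi fx xf dx]]]] := step_approx_L2 (fun g => Lp_cmeasurable (hf g)) dl20 hf.
have [B [idx' [y [mi' fy yp dy]]]] := step_approx_L2 (fun g => Lp_cmeasurable (hp g)) dl20 hp.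
have Lx g : Lp mu 2%:E (x g \o idx) by exact: (Lp_comp_idx mi (ltr0n _ 2) (fx g)).
have Ly g : Lp mu 2%:E (y g \o idx') by exact: (Lp_comp_idx mi' (ltr0n _ 2) (fy g)).
have h : nrm (form mu s t U (fun g => x g \o idx) (fun g => y g \o idx')) <= M.
  have bx := le_ball2 (ltW P0) xf bf.
  have P1' : 0 <= 1 - P by rewrite subr_ge0 ltW.
  exact: (hM _ _ _ _ mi mi' _ _ fx fy bx (le_ball2 P1' yp bp)).
have hd := @form_sub_le C b (dl ^+ 2) f (fun g => x g \o idx) phi (fun g => y g \o idx') C0 b0 dl20
  hC hf Lx hp Ly.
rewrite -[X in nrm X](subrK (form mu s t U (fun g => x g \o idx) (fun g => y g \o idx'))).
rewrite (le_trans (nrmD _ _))// addrC lerD// (le_trans (hd _ _ _ _))//.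
- move=> g; apply: (le_trans (pint_le mu (ler0n _ 2) (xf g))).
  by rewrite (le_trans (hb1 g))// lee_fin lerDl ltW.
- by move=> g; rewrite (le_trans (hb2 g))// lee_fin lerDr ltW.
- rewrite -powR_mulrn ?(ltW dl0)// -powRrM mulfV// powRr1 ?(ltW dl0)// mulrA -/K /dl.
  by rewrite mulrA ler_pdivrMr ?ltr_wpDl// mulrDr mulr1 mulrC lerDl (ltW e0).
Qed.

End L2_form.

(** * Duality for l^2-valued functions *)

Section duality.
Context d (T : measurableType d) (R : realType)
  (mu : {sigma_finite_measure set T -> \bar R}).
Context (W : finType) (u : W -> T -> R[i]) (P C : R).
Hypotheses (P0 : 0 < P) (P1 : P < 1) (C0 : 0 <= C).
Hypothesis mu_ : forall w, cmeasurable (u w).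
Hypothesis iu : forall w (A : finType) (idx : T -> A) (y : A -> R[i]),
  fin_indexed idx -> (forall a, y a != 0 -> fin_cell mu idx a) ->
  cintegrable mu (fun t => u w t * (y (idx t))^*).
Hypothesis bu : forall (A : finType) (idx : T -> A) (y : W -> A -> R[i]),
  fin_indexed idx -> (forall w a, y w a != 0 -> fin_cell mu idx a) ->
  ball2 mu (1 - P) (fun w => y w \o idx) ->
  nrm (\sum_w cinner mu (u w) (y w \o idx)) <= C.

Let measurable_nrm2 (f : W -> T -> R[i]) : (forall w, cmeasurable (f w)) ->
  measurable_fun setT (nrm2 f).
Proof.
move=> mf; apply: (@measurable_sum _ _ _ _ _ _ (fun w t => nrm (f w t) ^+ 2)) => w.
by apply: measurable_funX; exact: measurable_nrm.
Qed.

Let Re_mul_conj_real (a b : R[i]) (c : R) :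
  complex.Re (a * (b * c%:C)^*) = complex.Re (a * b^*) * c.
Proof. by case: a b => [a1 a2] [b1 b2] /=; ring. Qed.

Let powR_conj (V m : R) : 0 <= V -> 0 < m ->
  (V * (V `^ ((2 * P)^-1 - 1) * m `^ (P - 1)) ^+ 2) `^ (2 * (1 - P))^-1 =
  m^-1 * V `^ (2 * P)^-1.
Proof.
move=> V0 m0; have P1' : 0 < 1 - P by rewrite subr_gt0.
have [->|Vn0] := eqVneq V 0.
  by rewrite mul0r !powR0 ?mulr0// gt_eqF// invr_gt0 mulr_gt0.
have Vp : 0 < V by rewrite lt_neqAle eq_sym Vn0.
rewrite exprMn mulrA powRM ?mulr_ge0 ?exprn_ge0 ?powR_ge0//.
rewrite -[X in X * V `^ _ ^+ 2]powRr1// -!powR_mulrn ?powR_ge0// -!powRrM.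
rewrite -powRD; last by rewrite Vn0 implybT.
rewrite -!powRrM mulrC; congr (_ * _).
  rewrite -(powR_inv1 (ltW m0)); congr (_ `^ _); field.
  by rewrite gt_eqF.
by congr (_ `^ _); field; rewrite !gt_eqF.
Qed.

(** With V the squared l^2 norm of a rounding x of u and m the integral of V^(1/(2P)), the test
    family y = V^(1/(2P) - 1) m^(P - 1) x is the classical norming element of the dual ball. Its
    pairing with u is at least m^P because x tests u without loss. *)
Let step_dual_le (A : finType) (idx : T -> A) (x : W -> A -> R[i]) :
  fin_indexed idx -> (forall w a, x w a != 0 -> fin_cell mu idx a) ->
  (forall w t, nrm (x w (idx t)) ^+ 2 <= complex.Re (u w t * (x w (idx t))^*)) ->
  (\int[mu]_t (nrm2 (fun w => x w \o idx) t `^ (2 * P)^-1)%:E <= (C `^ P^-1)%:E)%E.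
Proof.
move=> mi fx ux; set V := nrm2 _; set I := (\int[mu]_t _)%E.
pose S a := sqsum (fun w => nrm (x w a)).
have S0 a : 0 <= S a by exact: sqsum_ge0.
have VS t : V t = S (idx t) by [].
have fS a : S a != 0 -> fin_cell mu idx a.
  by move=> /sqsum_neq0[w]; rewrite nrm_eq0; exact: fx.
have e0 : 0 < (2 * P)^-1 by rewrite invr_gt0 mulr_gt0.
have Ioo : (I < +oo)%E.
  apply: (@step_int_lty _ _ _ mu A idx mi (fun a => S a `^ (2 * P)^-1)) => a.
    exact: powR_ge0.
  by rewrite powR_eq0 (gt_eqF e0) andbT; exact: fS.
have I0 : (0 <= I)%E by apply: int_ge0 => t; exact: powR_ge0.
have If : I \is a fin_num by rewrite ge0_fin_numE.
pose m : R := fine I; have Im : I = m%:E by rewrite fineK.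
have [m0|mn0] := eqVneq m 0; first by rewrite Im m0 lee_fin powR_ge0.
have mp : 0 < m by rewrite lt_neqAle eq_sym mn0 -lee_fin -Im.
pose q a : R := S a `^ ((2 * P)^-1 - 1) * m `^ (P - 1).
have q0 a : 0 <= q a by rewrite mulr_ge0 ?powR_ge0.
pose y w a : R[i] := x w a * (q a)%:C.
have fy w a : y w a != 0 -> fin_cell mu idx a.
  by rewrite mulf_eq0 negb_or => /andP[+ _]; exact: fx.
have mS (h : A -> R) : measurable_fun setT (fun t => h (idx t)).
  exact: (measurable_comp_idx mi (fun a => h a : measurableTypeR R)).
have by_ : ball2 mu (1 - P) (fun w => y w \o idx).
  rewrite /ball2 (_ : (fun t => _) = (fun t => (m^-1 * S (idx t) `^ (2 * P)^-1)%:E)).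
    rewrite intZ ?invr_ge0 ?(ltW mp)//; last first.
    - exact: (mS (fun a => S a `^ (2 * P)^-1)).
    - by move=> t; exact: powR_ge0.
    by rewrite [X in (_ * X)%E]Im -EFinM mulVf.
  apply/funext => t; congr (_%:E); rewrite -powR_conj//; congr (_ `^ _).
  rewrite /S /sqsum mulr_suml; apply: eq_bigr => w _.
  by rewrite /= nrmM exprMn nrm_real ger0_norm.
have := bu mi fy by_.
have : m `^ P <= complex.Re (\sum_w cinner mu (u w) (y w \o idx)).
  rewrite -lee_fin raddf_sum/=.
  have iw w := iu w mi (fy w).
  have fz w a : nrm (x w a) ^+ 2 * q a != 0 -> fin_cell mu idx a.
    by rewrite mulf_eq0 sqrf_eq0 nrm_eq0 negb_or => /andP[+ _]; exact: fx.
  have z0 w a : 0 <= nrm (x w a) ^+ 2 * q a by rewrite mulr_ge0// sqr_ge0.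
  apply: (@le_trans _ _ (\sum_w \int[mu]_t (nrm (x w (idx t)) ^+ 2 * q (idx t))%:E)%E).
    rewrite -int_sum//; last first.
      by move=> w; exact: (mS (fun a => nrm (x w a) ^+ 2 * q a)).
    rewrite (_ : (fun t => _) = (fun t => (m `^ (P - 1) * S (idx t) `^ (2 * P)^-1)%:E)).
      rewrite intZ ?powR_ge0//; last first.
      - exact: (mS (fun a => S a `^ (2 * P)^-1)).
      - by move=> t; exact: powR_ge0.
      rewrite [X in (_ * X)%E]Im -EFinM lee_fin -[m in _ * m]powRr1 ?(ltW mp)//.
      by rewrite -powRD ?subrK// mn0 implybT.
    apply/funext => t; congr (_%:E); rewrite -mulr_suml -/(sqsum _) -/(S (idx t)) /q.
    have [->|Sn0] := eqVneq (S (idx t)) 0; first by rewrite mul0r powR0 ?mulr0 ?gt_eqF.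
    rewrite mulrA mulrC; congr (_ * _).
    by rewrite -[X in X * _]powRr1// -powRD ?Sn0 ?implybT// addrC subrK.
  rewrite -sumEFin; apply: lee_sum => w _.
  rewrite /Rintegral fineK; last first.
    exact: (integrable_fin_num measurableT (cintegrable_Re (iw w))).
  apply: le_integral => //; [|exact: cintegrable_Re|].
    apply/integrableP; split.
      by apply/measurable_EFinP; exact: (mS (fun a => nrm (x w a) ^+ 2 * q a)).
    rewrite (eq_integral (fun t => (nrm (x w (idx t)) ^+ 2 * q (idx t))%:E)); last first.
      by move=> t _; rewrite gee0_abs ?lee_fin.
    exact: (step_int_lty mi (z0 w) (fz w)).
  move=> t _; rewrite lee_fin /y/=.
  by rewrite Re_mul_conj_real ler_wpM2r.
move=> h1 h2; have h : m `^ P <= C := le_trans h1 (le_trans (Re_le_nrm _) h2).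
rewrite Im lee_fin -[m]powRr1 ?(ltW mp)// -(mulfV (lt0r_neq0 P0)) powRrM.
by apply: ge0_ler_powR; rewrite ?nnegrE ?powR_ge0 ?invr_ge0 ?(ltW P0).
Qed.

(** The roundings vanish outside sets of finite measure, so their norms are finite beforehand and
    [step_dual_le] may divide by them. Fatou's lemma carries the bound over to u. *)
Lemma dual_test : (\int[mu]_t (nrm2 u t `^ (2 * P)^-1)%:E <= (C `^ P^-1)%:E)%E.
Proof.
have [X [mX Xoo hX]] := exhaustion mu.
pose v n w := round_at u X n w.
have e0 : 0 < (2 * P)^-1 by rewrite invr_gt0 mulr_gt0.
have hv n : (\int[mu]_t (nrm2 (v n) t `^ (2 * P)^-1)%:E <= (C `^ P^-1)%:E)%E.
  have [A [idx [x [mi fx rx]]]] := round_at_step mu_ (mX n) (Xoo n).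
  have -> : v n = (fun w => x w \o idx) by apply/funext => w; exact: rx.
  apply: step_dual_le => // w t; have := nrm_round_at_Re u X n w t.
  by rewrite rx.
have mv n : measurable_fun setT (fun t => (nrm2 (v n) t `^ (2 * P)^-1)%:E).
  apply/measurable_EFinP; apply: (measurableT_comp (measurable_powR _)).
  apply: measurable_nrm2 => w.
  have [A [idx [x [mi fx rx]]]] := round_at_step mu_ (mX n) (Xoo n).
  by rewrite /v rx; exact: cmeasurable_comp_idx.
have := @fatou _ _ _ mu setT measurableT (fun n t => (nrm2 (v n) t `^ (2 * P)^-1)%:E) mv
  (fun n t _ => powR_ge0 _ _).
rewrite (eq_integral (fun t => (nrm2 u t `^ (2 * P)^-1)%:E)); last first.
  move=> t _; rewrite (cvg_limn_einf_sup (l := (nrm2 u t `^ (2 * P)^-1)%:E))//.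
  apply: cvg_EFin; first exact: nearW.
  apply: cvg_powR => //; [exact: nrm2_ge0|by move=> n; exact: nrm2_ge0|].
  rewrite /nrm2; apply: cvg_big => [|w _]; first exact: add_continuous.
  have cw : nrm (v n w t) @[n --> \oo] --> nrm (u w t).
    by apply: cvg_nrm_round_at; exact: hX.
  exact: (cvgM cw cw).
move=> h; apply: (le_trans h); rewrite limn_einf_lim; apply: lime_le.
  exact: is_cvg_einfs.
apply: nearW => n; apply: le_trans (hv n).
by apply: ereal_inf_lbound; exists n => /=.
Qed.

End duality.

(** * Forms composed with a resolution of the identity *)

Section scaled_forms.
Context d (T : measurableType d) (R : realType)
  (mu : {sigma_finite_measure set T -> \bar R}).
Context (E G1 G2 : finType) (s : E -> G1) (t : E -> G2).
Context (U : E -> (T -> R[i]) -> (T -> R[i])).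
Hypothesis UL : forall e, L2bounded mu (U e).

Lemma formZ (c : R[i]) (f : G1 -> T -> R[i]) (phi : G2 -> T -> R[i]) :
  (forall g, Lp mu 2%:E (f g)) -> (forall g, Lp mu 2%:E (phi g)) ->
  form mu s t U (fun g x => c * f g x) phi = c * form mu s t U f phi.
Proof.
move=> hf hp; rewrite /form mulr_sumr; apply: eq_bigr => e _.
have UL2 h : Lp mu 2%:E h -> Lp mu 2%:E (U e h) by exact: L2bounded_Lp.
rewrite -cinnerZl; [|exact: UL2|exact: hp].
apply: (ae_eq_cinner _ _ _ (L2boundedZ c (UL e) (hf (s e)))); apply: Lp_cmeasurable.
- exact/UL2/L2Z.
- exact/L2Z/UL2.
- exact: hp.
Qed.

Lemma measurable_nrm2 (G : finType) (f : G -> T -> R[i]) :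
  (forall g, cmeasurable (f g)) -> measurable_fun setT (nrm2 f).
Proof.
move=> mf; apply: (@measurable_sum _ _ _ _ _ _ (fun g t => nrm (f g t) ^+ 2)) => g.
by apply: measurable_funX; exact: measurable_nrm.
Qed.

Lemma int_nrm2Z (G : finType) (f : G -> T -> R[i]) (c : R) (e : R) :
  (forall g, cmeasurable (f g)) -> 0 <= c ->
  (\int[mu]_x (nrm2 (fun g x => c%:C * f g x) x `^ (2 * e)^-1)%:E =
   (c `^ e^-1)%:E * \int[mu]_x (nrm2 f x `^ (2 * e)^-1)%:E)%E.
Proof.
move=> mf c0; rewrite -intZ ?powR_ge0//; last first.
- apply: (measurableT_comp (measurable_powR _)); exact: measurable_nrm2.
- by move=> x; exact: powR_ge0.
apply: eq_integral => x _; congr (_%:E).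
rewrite (_ : nrm2 _ _ = c ^+ 2 * nrm2 f x); last first.
  by rewrite /nrm2 mulr_sumr; apply: eq_bigr => g _; rewrite nrmM nrm_real exprMn real_normK ?num_real.
rewrite powRM ?exprn_ge0 ?nrm2_ge0// -powR_mulrn// -powRrM; congr (_ `^ _ * _).
by rewrite invfM mulrA mulfV ?mul1r.
Qed.

Lemma form_bound_scaled (P M a : R) (f : G1 -> T -> R[i]) (phi : G2 -> T -> R[i]) :
  0 < P -> P < 1 -> form_bound mu s t U P M -> 0 < a ->
  (forall g, Lp mu 2%:E (f g)) -> (forall g, Lp mu 2%:E (phi g)) ->
  (\int[mu]_x (nrm2 f x `^ (2 * P)^-1)%:E <= (a `^ P^-1)%:E)%E -> ball2 mu (1 - P) phi ->
  nrm (form mu s t U f phi) <= a * M.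
Proof.
move=> P0 P1 hM a0 hf hp bf bp.
have ai0 : 0 <= a^-1 by rewrite invr_ge0 ltW.
have h : nrm (form mu s t U (fun g x => (a^-1)%:C * f g x) phi) <= M.
  apply: (form_bound_L2 UL P0 P1 hM _ hp _ bp); first by move=> g; exact: L2Z.
  rewrite /ball2 int_nrm2Z//; last by move=> g; exact: Lp_cmeasurable (hf g).
  apply: (le_trans (lee_wpmul2l _ bf)); first by rewrite lee_fin powR_ge0.
  by rewrite -EFinM -powRM ?(ltW a0)// mulVf ?gt_eqF// powR1.
move: h; rewrite formZ// nrmM nrm_real ger0_norm// mulrC ler_pdivrMr//.
by rewrite mulrC.
Qed.

End scaled_forms.

Section littlewood_paley_classes.
Context d (T : measurableType d) (R : realType)
  (mu : {sigma_finite_measure set T -> \bar R}).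
Context (W G : finType) (ga : W -> G).
Context (U : W -> (T -> R[i]) -> (T -> R[i])) (S : G -> (T -> R[i]) -> (T -> R[i])).
Hypotheses (UL : forall w, L2bounded mu (U w)) (SL : forall g, L2bounded mu (S g)).

Let one (w : W) := tt.
Let TT w := U w \o S (ga w).

(** The Littlewood-Paley estimate puts the family of all S_g f, used as the input of the form, into
    a ball of radius A. *)
Lemma form_bound_LP (Q M A : R) : 0 < Q -> Q < 1 -> 0 < A ->
  form_bound mu ga id U Q M ->
  (forall f, Lp mu 2%:E f -> Lp mu (Q^-1)%:E f ->
    (\int[mu]_x (nrm2 (fun g => S g f) x `^ (2 * Q)^-1)%:E <=
     (A `^ Q^-1)%:E * pint mu Q^-1 f)%E) ->
  form_bound mu one id TT Q (A * M).
Proof.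
move=> Q0 Q1 A0 hM hA X Y idx idx' mi mi' x y fx fy bx by_.
have Lx : Lp mu 2%:E (x tt \o idx) by exact: (Lp_comp_idx mi (ltr0n _ 2) (fx tt)).
have Ly g : Lp mu 2%:E (y g \o idx') by exact: (Lp_comp_idx mi' (ltr0n _ 2) (fy g)).
have Qi0 : 0 < Q^-1 by rewrite invr_gt0.
have LQ : Lp mu (Q^-1)%:E (x tt \o idx) by exact: (Lp_comp_idx mi Qi0 (fx tt)).
apply: (form_bound_scaled UL Q0 Q1 hM A0 (f := fun g => S g (x tt \o idx)) (phi := fun g => y g \o idx')).
- by move=> g; exact: L2bounded_Lp.
- exact: Ly.
- apply: (le_trans (hA _ Lx LQ)).
  have A1 : (0 <= (A `^ Q^-1)%:E)%E by rewrite lee_fin powR_ge0.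
  rewrite -[leRHS]mule1; apply: (lee_wpmul2l A1).
  apply: le_trans bx; rewrite le_eqVlt; apply/orP; left; apply/eqP.
  apply: eq_integral => u _; rewrite /nrm2 (big_pred1 tt)//.
  by rewrite -powR_mulrn ?nrm_ge0// -powRrM invfM mulrA mulfV ?mul1r.
- exact: by_.
Qed.

Lemma form_bound_half (M : R) : 0 < M ->
  (forall f, Lp mu 2%:E f ->
    (\sum_w pint mu 2 (TT w f) <= (M ^+ 2)%:E * pint mu 2 f)%E) ->
  form_bound mu one id TT 2^-1 M.
Proof.
move=> M0 hM X Y idx idx' mi mi' x y fx fy bx by_.
have Lx : Lp mu 2%:E (x tt \o idx) by exact: (Lp_comp_idx mi (ltr0n _ 2) (fx tt)).
have Ly g : Lp mu 2%:E (y g \o idx') by exact: (Lp_comp_idx mi' (ltr0n _ 2) (fy g)).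
have LT w : Lp mu 2%:E (TT w (x tt \o idx)).
  by apply: (L2bounded_Lp (UL w)); apply: (L2bounded_Lp (SL _)).
have e2 : 1 - 2^-1 = 2^-1 :> R by field.
have e1 : (2 * 2^-1)^-1 = 1 :> R by rewrite mulfV// invr1.
have hx : (pint mu 2 (x tt \o idx) <= 1)%E.
  apply: le_trans bx; rewrite le_eqVlt; apply/orP; left; apply/eqP.
  rewrite pint2E; apply: eq_integral => u _; rewrite /nrm2 (big_pred1 tt)//.
  by rewrite e1 powRr1// sqr_ge0.
rewrite -lee_fin; apply: (@le_trans _ _ (\sum_w \int[mu]_u (nrm (TT w (x tt \o idx) u) * nrm (y w (idx' u)))%:E)%E).
  apply: (@le_trans _ _ (\sum_w nrm (cinner mu (TT w (x tt \o idx)) (y w \o idx')))%:E).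
    by rewrite lee_fin nrm_sum.
  rewrite -sumEFin; apply: lee_sum => w _; apply: nrm_cinner_le.
  exact: cintegrableM2.
have M2 : 0 < M ^+ 2 by rewrite exprn_gt0.
have mT w := measurable_nrm (Lp_cmeasurable (LT w)).
have my w := measurable_nrm (Lp_cmeasurable (Ly w)).
have := @holder_sum _ _ _ mu W (fun w u => nrm (TT w (x tt \o idx) u))
  (fun w u => nrm (y w (idx' u)) ^+ 2) 2 (M ^+ 2) 1 (ler1n _ 2) M2 ltr01
  (fun _ _ => nrm_ge0 _) (fun _ _ => sqr_ge0 _) mT (fun w => measurable_funX 2 (my w)).
have h1 : (\sum_w \int[mu]_u (nrm (TT w (x tt \o idx) u) `^ 2)%:E <= (M ^+ 2)%:E)%E.
  apply: (le_trans (hM _ Lx)).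
  by rewrite -[leRHS]mule1 lee_wpmul2l// lee_fin ltW.
have h2 : (\sum_w \int[mu]_u (nrm (y w (idx' u)) ^+ 2)%:E <= 1)%E.
  rewrite -int_sum; last 2 first.
  - by move=> w u; exact: sqr_ge0.
  - by move=> w; exact: (measurable_funX 2 (my w)).
  apply: le_trans by_; rewrite le_eqVlt; apply/orP; left; apply/eqP.
  by apply: eq_integral => u _; rewrite e2 e1 powRr1// nrm2_ge0.
move=> /(_ h1 h2); rewrite e2 powR1 mulr1 -powR_mulrn ?(ltW M0)// -powRrM mulfV//.
rewrite powRr1 ?(ltW M0)//; apply: le_trans; apply: lee_sum => w _.
rewrite le_eqVlt; apply/orP; left; apply/eqP; apply: eq_integral => u _.
by rewrite -powR_mulrn ?nrm_ge0// -powRrM mulfV// powRr1 ?nrm_ge0.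
Qed.

End littlewood_paley_classes.

Lemma sum_shift_fset (V : zmodType) (M : zmodType) (F K : {fset V}) (c : V) (a : V -> M) :
  (forall g, g \in F -> g - c \in K) ->
  \sum_(g <- F) a g = \sum_(h <- K) if c + h \in F then a (c + h) else 0.
Proof.
move=> FK; rewrite -big_mkcond/= -[RHS]big_filter.
rewrite -(big_map (fun h => c + h) xpredT a); apply: perm_big.
apply: uniq_perm; first exact: fset_uniq.
  by rewrite map_inj_uniq; [exact/filter_uniq/fset_uniq|exact: addrI].
move=> g; apply/idP/mapP => [gF|[h + ->]]; last by rewrite mem_filter => /andP[].
exists (g - c); last by rewrite addrC subrK.
by rewrite mem_filter addrC subrK gF FK.
Qed.

Lemma poweR_half_le (R : realType) (a : \bar R) (e : R) : (0 <= a)%E -> 0 <= e ->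
  (a `^ 2^-1 <= e%:E)%E -> (a <= (e ^+ 2)%:E)%E.
Proof.
case: a => [a a0 e0| _ _|//]; last by rewrite poweRyr ?invr_eq0.
rewrite poweR_EFin !lee_fin => h.
rewrite -[a]powRr1// -(mulVf (lt0r_neq0 (ltr0n R 2))) powRrM powR_mulrn ?powR_ge0//.
by rewrite lerXn2r ?nnegrE ?powR_ge0.
Qed.

Section resolution.
Context d (T : measurableType d) (R : realType)
  (mu : {sigma_finite_measure set T -> \bar R}).
Context (r : nat) (W : finType) (io : W -> 'rV[int]_r).
Context (U : W -> (T -> R[i]) -> (T -> R[i])) (S : 'rV[int]_r -> (T -> R[i]) -> (T -> R[i])).
Hypotheses (UL : forall w, L2bounded mu (U w)) (SL : forall g, L2bounded mu (S g)).

Let one (w : W) := tt.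

(** In a partial sum of the resolution the index g is written as [io w + h], separately for each w.
    The shifts h then range over a finite set common to all w; terms with [io w + h] outside the
    partial sum are removed by zeroing that component of the test family, which does not leave its
    ball. The partial sums converge in L^2, where the form is continuous. *)
Lemma form_bound_resolution (P C : R) (Ch : 'rV[int]_r -> R) : 0 < P -> P < 1 ->
  resolution_of_identity mu S ->
  (forall h, form_bound mu one id (fun w => U w \o S (io w + h)) P (Ch h)) ->
  (forall K : {fset 'rV[int]_r}, \sum_(h <- K) Ch h <= C) ->
  form_bound mu one id U P C.
Proof.
move=> P0 P1 [F [_ _ hF]] hC hK A B idx idx' mi mi' x y fx fy bx by_.
pose f := x tt \o idx; pose phi w := y w \o idx'.
have Lf : Lp mu 2%:E f by exact: (Lp_comp_idx mi (ltr0n _ 2) (fx tt)).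
have Lp_ g : Lp mu 2%:E (phi g) by exact: (Lp_comp_idx mi' (ltr0n _ 2) (fy g)).
pose fn n u := \sum_(g <- F n) S g f u.
have LS g : Lp mu 2%:E (S g f) by exact: L2bounded_Lp.
have Lfn n : Lp mu 2%:E (fn n).
  have := L2_sum (F n) (fun=> 1) LS.
  by under eq_fun do under eq_bigr do rewrite mul1r.
have ef : (fun u : unit => x u \o idx) = (fun=> f) by apply/funext => -[].
rewrite ef.
have bf n : nrm (form mu one id U (fun=> fn n) phi) <= C.
  pose K : {fset 'rV[int]_r} := [fset g - io w | g in F n, w in [set: W]%SET]%fset.
  have FK w g : g \in F n -> g - io w \in K.
    by move=> gF; apply/imfset2P; exists g => //; exists w => //=; rewrite inE.
  pose ph h w : T -> R[i] := if io w + h \in F n then phi w else fun=> 0.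
  have -> : form mu one id U (fun=> fn n) phi =
      \sum_(h <- K) form mu one id (fun w => U w \o S (io w + h)) (fun=> f) (ph h).
    rewrite /form exchange_big/=; apply: eq_bigr => w _.
    rewrite (ae_eq_cinner (f' := fun u => \sum_(g <- F n) 1 * U w (S g f) u)); first last.
    - have [lU _] := UL w; have := linear_operator_sum (F n) (fun=> 1) lU LS.
      rewrite (_ : (fun y => _) = fn n) //; apply/funext => u.
      by apply: eq_bigr => g _; rewrite mul1r.
    - exact: Lp_cmeasurable (Lp_ w).
    - by apply: Lp_cmeasurable; apply: L2_sum => g; exact: L2bounded_Lp.
    - by apply: Lp_cmeasurable; exact: L2bounded_Lp.
    have := @cinner_sum2 _ _ _ mu _ unit (F n) [:: tt] (fun=> 1) (fun=> 1)
      (fun g => U w (S g f)) (fun=> phi w) (fun g => L2bounded_Lp (UL w) (LS g)) (fun=> Lp_ w).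
    under [X in cinner _ _ X = _ -> _]eq_fun do rewrite big_seq1 mul1r.
    move=> ->; transitivity (\sum_(g <- F n) cinner mu (U w (S g f)) (phi w)).
      by apply: eq_bigr => g _; rewrite big_seq1 mul1r rmorph1 mul1r.
    rewrite (@sum_shift_fset _ _ (F n) K (io w)); last exact: FK.
    apply: eq_bigr => h _; rewrite /ph; case: ifP => // _.
    by rewrite cinnerE; under eq_fun do rewrite rmorph0 mulr0; rewrite cintegral0.
  rewrite (le_trans (nrm_sum _ _ _))// (le_trans _ (hK K))//.
  apply: ler_sum => h _; pose y' w b := if io w + h \in F n then y w b else 0.
  have -> : ph h = (fun w => y' w \o idx').
    by apply/funext => w; apply/funext => u; rewrite /ph /y' /=; case: ifP.
  have fy' w b : y' w b != 0 -> fin_cell mu idx' b.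
    by rewrite /y'; case: ifP; [move=> _; exact: fy|rewrite eqxx].
  have P1' : 0 <= 1 - P by rewrite subr_ge0 ltW.
  have yy' w u : nrm ((y' w \o idx') u) <= nrm ((y w \o idx') u).
    by rewrite /y' /=; case: ifP => // _; rewrite nrm0 nrm_ge0.
  rewrite -ef; exact: (hC h _ _ _ _ mi mi' _ _ fx fy' bx (le_ball2 P1' yy' by_)).
apply/ler_addgt0Pr => e e0.
have [c c0 hc] := L2bounded_ub UL.
have [b1 b10 hb1] := L2_pint_ub (fun _ : unit => Lf); have [b2 b20 hb2] := L2_pint_ub Lp_.
pose b : R := b1 + b2; have b0 : 0 < b by rewrite addr_gt0.
pose k : R := #|W|%:R * (2 * (c * b) `^ 2^-1).
have k0 : 0 <= k by rewrite mulr_ge0// mulr_ge0// powR_ge0.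
pose dl : R := e / (k + 1).
have dl0 : 0 < dl by rewrite divr_gt0// ltr_wpDl.
have dl20 : 0 < dl ^+ 2 by rewrite exprn_gt0.
have [n hn] : exists n, (pint mu 2 (fun u => (fn n u - f u)%R) <= (dl ^+ 2)%:E)%E.
  have [cf _] := hF _ Lf; move/fine_cvgP : cf => [ff /cvgrPdist_le /(_ _ dl0) fl].
  near \oo => n; exists n.
  have fn1 : cnorm mu 2%:E (fun u => fn n u - f u) \is a fin_num by near: n.
  have : `|0 - fine (cnorm mu 2%:E (fun u => fn n u - f u))| <= dl by near: n.
  rewrite sub0r normrN => h.
  apply: poweR_half_le; [exact: pint_ge0|exact: ltW|].
  rewrite -(@cnorm_poweR _ _ _ mu 2)//.
  by rewrite -(fineK fn1) lee_fin (le_trans (ler_norm _)).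
have hd := @form_sub_le _ _ _ mu W unit W one id U UL c b (dl ^+ 2) (fun=> fn n) (fun=> f) phi phi
  c0 b0 dl20 (fun e h => hc e h) (fun=> Lfn n) (fun=> Lf) Lp_ Lp_.
rewrite -[X in nrm X](subrK (form mu one id U (fun=> fn n) phi)).
apply: (le_trans (nrmD _ _)); rewrite addrC; apply: (lerD (bf n)).
rewrite -nrmN opprB; apply: (le_trans (hd _ _ _ _)).
- by move=> _; rewrite (le_trans (hb1 tt))// lee_fin lerDl ltW.
- by move=> g; rewrite (le_trans (hb2 g))// lee_fin lerDr ltW.
- by move=> _; exact: hn.
- move=> g; rewrite pint2E; under eq_integral do rewrite subrr nrm0 expr0n/=.
  by rewrite integral0 lee_fin ltW.
- rewrite -powR_mulrn ?(ltW dl0)// -powRrM mulfV// powRr1 ?(ltW dl0)// mulrA -/k /dl.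
  by rewrite mulrA ler_pdivrMr ?ltr_wpDl// mulrDr mulr1 mulrC lerDl (ltW e0).
Unshelve. all: by end_near.
Qed.

End resolution.

(** * From forms to square functions *)

Section truncation.
Context d (T : measurableType d) (R : realType) (mu : {measure set T -> \bar R}).
Implicit Types (f g u : T -> R[i]).

Lemma holder_prod (z b : T -> R) (p a c : R) :
  1 <= p -> 0 < a -> 0 < c -> (forall x, 0 <= z x) -> (forall x, 0 <= b x) ->
  measurable_fun setT z -> measurable_fun setT b ->
  (\int[mu]_x (z x `^ p)%:E <= a%:E)%E -> (\int[mu]_x (b x)%:E <= c%:E)%E ->
  (\int[mu]_x (z x * b x `^ (1 - p^-1))%:E <= (a `^ p^-1 * c `^ (1 - p^-1))%:E)%E.
Proof.
move=> p1 a0 c0 z0 b0 mz mb za bc.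
have := @holder_sum _ _ _ mu unit (fun=> z) (fun=> b) p a c p1 a0 c0
  (fun=> z0) (fun=> b0) (fun=> mz) (fun=> mb).
by rewrite !(big_pred1 tt)//; exact.
Qed.

Lemma cintegralB f g : cintegrable mu f -> cintegrable mu g ->
  cintegral mu (fun x => f x - g x) = cintegral mu f - cintegral mu g.
Proof.
move=> i1 i2; rewrite -mulN1r -cintegralZ// -cintegralD//; last exact: cintegrableZ.
by congr cintegral; apply/funext => x; rewrite mulN1r.
Qed.

(* For q = 1 the exponent 1 - 1/q vanishes and powR 0 0 = 1. *)
Lemma step_pairing_le (A : finType) (idx : T -> A) (y : A -> R[i]) (q : R) : 1 <= q ->
  fin_indexed idx -> (forall a, y a != 0 -> fin_cell mu idx a) ->
  exists2 K : R, 0 <= K & forall u (a : R), cmeasurable u -> 0 < a ->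
    (pint mu q u <= a%:E)%E ->
    (\int[mu]_t (nrm (u t) * nrm (y (idx t)))%:E <= (K * a `^ q^-1)%:E)%E.
Proof.
move=> q1 mi fy; have [Y Y0 hY] := fin_upper_bound (fun a => nrm (y a)).
pose b t : R := (y (idx t) != 0)%:R.
have b0 t : 0 <= b t by [].
have mb : measurable_fun setT b.
  exact: (measurable_comp_idx mi (fun a => (y a != 0)%:R : measurableTypeR R)).
have boo : (\int[mu]_t (b t)%:E < +oo)%E.
  apply: (@step_int_lty _ _ _ mu A idx mi (fun a => (y a != 0)%:R)) => // a.
  by have [_|yn0 _] := eqVneq (y a) 0; [rewrite eqxx|exact: fy].
have bf : (\int[mu]_t (b t)%:E)%E \is a fin_num.
  by rewrite ge0_fin_numE//; exact: int_ge0.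
pose c : R := 1 + fine (\int[mu]_t (b t)%:E)%E.
have c0 : 0 < c by rewrite ltr_wpDr// fine_ge0//; exact: int_ge0.
exists (Y * c `^ (1 - q^-1)) => [|u a um a0 ha]; first by rewrite mulr_ge0 ?powR_ge0 ?ltW.
have mu_ := measurable_nrm um.
have hb : (\int[mu]_t (b t)%:E <= c%:E)%E by rewrite -(fineK bf) lee_fin lerDr.
have := holder_prod q1 a0 c0 (fun t => nrm_ge0 (u t)) b0 mu_ mb ha hb => h.
rewrite -mulrA EFinM [c `^ _ * _]mulrC.
apply: (@le_trans _ _ (Y%:E * \int[mu]_t (nrm (u t) * b t `^ (1 - q^-1))%:E)%E).
  rewrite -intZ ?(ltW Y0)//; last first.
  - apply: measurable_funM => //; exact: (measurableT_comp (measurable_powR _)).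
  - by move=> t; rewrite mulr_ge0 ?nrm_ge0 ?powR_ge0.
  apply: int_le => t; first by rewrite mulr_ge0 ?nrm_ge0.
  rewrite /b; have [->|_] := eqVneq (y (idx t)) 0; rewrite [in X in _ <= X]/=.
    by rewrite nrm0 mulr0 mulr_ge0 ?(ltW Y0)// mulr_ge0 ?nrm_ge0 ?powR_ge0.
  by rewrite powR1 mulr1 mulrC ler_wpM2r ?nrm_ge0.
by rewrite lee_pmul2l ?lte_fin.
Qed.

Lemma cintegrable_step (A : finType) (idx : T -> A) (y : A -> R[i]) (q : R) u : 1 <= q ->
  fin_indexed idx -> (forall a, y a != 0 -> fin_cell mu idx a) ->
  Lp mu q%:E u -> cintegrable mu (fun t => u t * (y (idx t))^*).
Proof.
move=> q1 mi fy hu; have q0 : 0 < q by exact: lt_le_trans q1.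
have [K K0 hK] := step_pairing_le q1 mi fy.
have um := Lp_cmeasurable hu.
split; first by apply: cmeasurableM => //; apply: cmeasurable_conj; exact: cmeasurable_comp_idx.
have uf : pint mu q u \is a fin_num by rewrite ge0_fin_numE ?pint_ge0//; exact: Lp_pint.
have a0 : 0 < 1 + fine (pint mu q u) by rewrite ltr_wpDr// fine_ge0// pint_ge0.
apply: (@le_lt_trans _ _ _ _ _ _ (ltry (K * (1 + fine (pint mu q u)) `^ q^-1))).
rewrite (eq_integral (fun t => (nrm (u t) * nrm (y (idx t)))%:E)); last first.
  by move=> t _; rewrite nrmM nrm_conj.
by apply: hK => //; rewrite -(fineK uf) lee_fin lerDr.
Qed.

Lemma Lp_pairing (p p' : R) f g : 1 < p -> p^-1 + p'^-1 = 1 -> Lp mu p%:E f -> Lp mu p'%:E g ->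
  (\int[mu]_t (nrm (f t) * nrm (g t))%:E < +oo)%E.
Proof.
move=> p1 pp' hf hg; have p0 : 0 < p by exact: lt_trans p1.
have pi0 : 0 < 1 - p^-1 by rewrite subr_gt0 invf_lt1.
have e : p'^-1 = 1 - p^-1 by rewrite -pp' addrC addKr.
have p'0 : 0 < p' by rewrite -invr_gt0 e.
have ub (q : R) h : 0 < q -> Lp mu q%:E h -> exists2 a : R, 0 < a & (pint mu q h <= a%:E)%E.
  move=> q0 hh; have hf' : pint mu q h \is a fin_num by rewrite ge0_fin_numE ?pint_ge0//; exact: Lp_pint.
  exists (1 + fine (pint mu q h)); first by rewrite ltr_wpDr// fine_ge0// pint_ge0.
  by rewrite -{1}(fineK hf') lee_fin lerDr.
have [a a0 ha] := ub _ _ p0 hf; have [c c0 hc] := ub _ _ p'0 hg.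
have mf := measurable_nrm (Lp_cmeasurable hf).
have mg := measurable_nrmp p' (Lp_cmeasurable hg).
have := holder_prod (ltW p1) a0 c0 (fun t => nrm_ge0 (f t)) (fun t => powR_ge0 (nrm (g t)) p') mf mg ha hc.
rewrite (eq_integral (fun t => (nrm (f t) * nrm (g t))%:E)); last first.
  by move=> t _; rewrite -powRrM -e mulfV ?gt_eqF// powRr1 ?nrm_ge0.
by move=> h; apply: le_lt_trans h (ltry _).
Qed.

Lemma powR_shift (x q p : R) : x != 0 -> x `^ q = x `^ (q - p) * x `^ p.
Proof. by move=> x0; rewrite -powRD ?subrK// x0 implybT. Qed.

Definition cut (B : set T) f : T -> R[i] := fun t => f t * (\1_B t : R)%:C.

Lemma cmeasurable_cut B f : measurable B -> cmeasurable f -> cmeasurable (cut B f).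
Proof.
move=> mB mf; apply: cmeasurableM => //; apply: cmeasurable_real.
exact: measurable_indic.
Qed.

Lemma cutE B f t : cut B f t = if t \in B then f t else 0.
Proof. by rewrite /cut indicE; case: ifP => _; rewrite ?mulr1 ?mulr0. Qed.

Lemma nrm_cut_le B f t : nrm (cut B f t) <= nrm (f t).
Proof. by rewrite cutE; case: ifP => // _; rewrite nrm0 nrm_ge0. Qed.

Lemma sub_cut B f t : f t - cut B f t = cut (~` B) f t.
Proof. by rewrite !cutE in_setC; case: (t \in B); rewrite ?subrr ?subr0. Qed.

Lemma pint_cut_le B f (p q a : R) : measurable B -> cmeasurable f -> 0 <= a -> 0 < q ->
  (forall t, B t -> nrm (f t) `^ q <= a * nrm (f t) `^ p) ->
  (pint mu q (cut B f) <= a%:E * pint mu p f)%E.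
Proof.
move=> mB mf a0 q0 h; rewrite -intZ//; last 2 first.
- by move=> t; exact: powR_ge0.
- exact: measurable_nrmp.
apply: int_le => t; first exact: powR_ge0.
rewrite cutE; case: ifPn => [tB|_]; first by apply: h; rewrite inE in tB.
by rewrite nrm0 powR0 ?gt_eqF// mulr_ge0 ?powR_ge0.
Qed.

Lemma measurable_nrm_gt f (c : R) : cmeasurable f -> measurable [set t | c < nrm (f t)].
Proof.
move=> /measurable_nrm mf.
have := mf measurableT `]c, +oo[%classic (measurable_itv _); rewrite setTI.
by congr measurable; apply/seteqP; split => t /=; rewrite in_itv/= andbT.
Qed.

End truncation.

Lemma limr_le_cst (R : realType) (u : nat -> R) (l c : R) :
  u m @[m --> \oo] --> l -> (forall m, u m <= c) -> l <= c.
Proof.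
move=> ul uc; rewrite -(cvg_lim _ ul)//; apply: limr_le; first by apply: cvgP ul.
exact: nearW.
Qed.

(** * Square functions of f outside L^2 *)

Section weak_approximation.
Context d (T : measurableType d) (R : realType)
  (mu : {sigma_finite_measure set T -> \bar R}).
Context (W : finType) (U : W -> (T -> R[i]) -> (T -> R[i])).
Implicit Types (f : T -> R[i]).

(* A bound for the form controls U on L^2 only; this is what transfers it to f outside L^2. *)
Definition weakly_approximable f :=
  [/\ forall w, cmeasurable (U w f),
      forall w (A : finType) (idx : T -> A) (y : A -> R[i]), fin_indexed idx ->
        (forall a, y a != 0 -> fin_cell mu idx a) ->
        cintegrable mu (fun t => U w f t * (y (idx t))^*) &
      exists g : nat -> T -> R[i], [/\ forall m, Lp mu 2%:E (g m),
        forall m t, nrm (g m t) <= nrm (f t) &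
        forall w (A : finType) (idx : T -> A) (y : A -> R[i]), fin_indexed idx ->
          (forall a, y a != 0 -> fin_cell mu idx a) ->
          nrm (cinner mu (U w (g m)) (y \o idx) - cinner mu (U w f) (y \o idx))
            @[m --> \oo] --> (0 : R)]].

Hypothesis UL : forall w, L2bounded mu (U w).

(** By duality it is enough to pair the U_w f with step functions, and there f may be replaced by
    its L^2 approximants, to which the form bound applies. The small e keeps the scale of the input
    positive even when f = 0. *)
Lemma square_function_bound (P M : R) f : 0 < P -> P < 1 -> 0 <= M ->
  form_bound mu (fun _ : W => tt) id U P M -> Lp mu (P^-1)%:E f -> weakly_approximable f ->
  (\int[mu]_t (nrm2 (fun w => U w f) t `^ (2 * P)^-1)%:E <= (M `^ P^-1)%:E * pint mu P^-1 f)%E.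
Proof.
move=> P0 P1 M0 hM hf [mUf iUf [g [Lg gf cg]]].
have Pi0 : 0 < P^-1 by rewrite invr_gt0.
have ff : pint mu P^-1 f \is a fin_num by rewrite ge0_fin_numE ?pint_ge0//; exact: Lp_pint.
have pf0 : 0 <= fine (pint mu P^-1 f) by rewrite fine_ge0// pint_ge0.
have key (e : R) : 0 < e -> (\int[mu]_t (nrm2 (fun w => U w f) t `^ (2 * P)^-1)%:E <=
    (M `^ P^-1 * (fine (pint mu P^-1 f) + e))%:E)%E.
  move=> e0; pose b := fine (pint mu P^-1 f) + e.
  have b0 : 0 < b by rewrite ltr_wpDl.
  pose a := b `^ P; have a0 : 0 < a by exact: powR_gt0.
  have ab : a `^ P^-1 = b by rewrite /a -powRrM mulfV ?gt_eqF// powRr1// ltW.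
  rewrite -/b -ab -powRM ?(ltW a0)//.
  apply: (dual_test P0 P1 (mulr_ge0 M0 (ltW a0)) mUf iUf) => A idx y mi fy by_.
  have Ly w : Lp mu 2%:E (y w \o idx) by exact: (Lp_comp_idx mi (ltr0n _ 2) (fy w)).
  have lim : nrm (\sum_w cinner mu (U w f) (y w \o idx)) -
      \sum_w nrm (cinner mu (U w (g m)) (y w \o idx) - cinner mu (U w f) (y w \o idx))
      @[m --> \oo] --> nrm (\sum_w cinner mu (U w f) (y w \o idx)) - \sum_(w : W) 0.
    apply: cvgB; first exact: cvg_cst.
    apply: cvg_big => [|w _]; first exact: add_continuous.
    exact: (cg w A idx (y w) mi (fy w)).
  rewrite (big1_eq _ (fun=> true)) subr0 in lim.
  apply: (limr_le_cst lim) => m.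
  have hm : nrm (form mu (fun _ : W => tt) id U (fun=> g m) (fun w => y w \o idx)) <= a * M.
    apply: (form_bound_scaled UL P0 P1 hM a0 (fun=> Lg m) Ly _ by_).
    have e1 t : (nrm2 (fun _ : unit => g m) t `^ (2 * P)^-1) = nrm (g m t) `^ P^-1.
      rewrite /nrm2 (big_pred1 tt)// -powR_mulrn ?nrm_ge0// -powRrM.
      by rewrite invfM mulrA mulfV ?mul1r.
    under eq_integral do rewrite e1.
    apply: (le_trans (pint_le mu (ltW Pi0) (gf m))).
    by rewrite -(fineK ff) lee_fin ab lerDl ltW.
  rewrite mulrC lerBlDr; apply: (le_trans _ (lerD hm (lexx _))).
  rewrite /form addrC.
  rewrite -[X in nrm X](subrK (\sum_w cinner mu (U w (g m)) (y w \o idx))).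
  apply: (le_trans (nrmD _ _)); rewrite lerD2r -sumrB.
  apply: (le_trans (nrm_sum _ _ _)); apply: ler_sum => w _.
  by rewrite -nrmN opprB.
rewrite -(fineK ff) -EFinM.
apply/lee_addgt0Pr => e e0; have M1 : 0 < M `^ P^-1 + 1 by rewrite ltr_wpDl// powR_ge0.
apply: (le_trans (key (e / (M `^ P^-1 + 1)) _)); first by rewrite divr_gt0.
rewrite -EFinD lee_fin mulrDr lerD2l mulrCA ger_pMr//.
by rewrite ler_pdivrMr// mul1r lerDl.
Qed.

Section low_exponents.
Variables (p0 p M : R).
Hypotheses (hp0 : 1 <= p0) (hp0p : p0 < p) (hp2 : p <= 2) (M0 : 0 < M).
Hypothesis Ulin : forall w, linear_operator mu (Lp_add mu p0%:E 2%:E) (U w).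
Hypothesis Ubd : forall w f, Lp mu p0%:E f -> (pint mu p0 (U w f) <= M%:E * pint mu p0 f)%E.

Let p0g : 0 < p0. Proof. exact: lt_le_trans hp0. Qed.
Let pg : 0 < p. Proof. exact: lt_trans hp0p. Qed.

(** The approximants are f cut down to |f| <= m + 1; they lie in L^2 because p <= 2. The removed
    tall part tends to 0 in L^p0, since p > p0, and so does its image by boundedness on L^p0; step
    functions pair continuously with L^p0. *)
Lemma weakly_approximable_low f : Lp mu p%:E f -> weakly_approximable f.
Proof.
move=> hf; have mf := Lp_cmeasurable hf.
pose N m : R := m.+1%:R; have N0 m : 0 < N m by rewrite ltr0n.
have N1 m : 1 <= N m by rewrite ler1n.
pose B m := [set t | N m < nrm (f t)].
have mB m : measurable (B m) by exact: measurable_nrm_gt.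
have fp : pint mu p f \is a fin_num by rewrite ge0_fin_numE ?pint_ge0//; exact: Lp_pint.
have Lg m : Lp mu 2%:E (cut (~` B m) f).
  have mc : cmeasurable (cut (~` B m) f) by apply: cmeasurable_cut => //; exact: measurableC.
  apply: pint_Lp => //; apply: (@le_lt_trans _ _ ((N m `^ (2 - p))%:E * pint mu p f)%E).
    apply: pint_cut_le => //; [exact: measurableC|exact: powR_ge0|].
    move=> t /negP; rewrite -leNgt => h; have [->|fn0] := eqVneq (nrm (f t)) 0.
      by rewrite powR0// mulr_ge0 ?powR_ge0.
    rewrite (powR_shift _ p)// ler_wpM2r ?powR_ge0//.
    by apply: ge0_ler_powR; rewrite ?nnegrE ?nrm_ge0 ?subr_ge0 ?(ltW (N0 m)).
  by rewrite -(fineK fp) -EFinM ltry.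
have hcut m : (pint mu p0 (cut (B m) f) <= (N m `^ (p0 - p))%:E * pint mu p f)%E.
  apply: pint_cut_le => //; first exact: powR_ge0.
  move=> t h; have ft : 0 < nrm (f t) by exact: lt_trans h.
  rewrite (powR_shift _ p) ?gt_eqF// ler_wpM2r ?powR_ge0// -[p0 - p]opprB !powRN lef_pV2 ?posrE ?powR_gt0//.
  by apply: ge0_ler_powR; rewrite ?nnegrE ?nrm_ge0 ?subr_ge0 ?(ltW (N0 m)) ?(ltW h) ?(ltW hp0p).
have Lcut m : Lp mu p0%:E (cut (B m) f).
  apply: pint_Lp => //; first exact: cmeasurable_cut.
  by apply: (le_lt_trans (hcut m)); rewrite -(fineK fp) -EFinM ltry.
have z0 : Lp mu p0%:E (fun=> 0) by exact: Lp0.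
have z2 : Lp mu 2%:E (fun=> 0) by exact: Lp0.
have Dg m : Lp_add mu p0%:E 2%:E (cut (~` B m) f).
  by exists (fun=> 0), (cut (~` B m) f); split => //; apply/funext => x; rewrite add0r.
have Dc m : Lp_add mu p0%:E 2%:E (cut (B m) f).
  by exists (cut (B m) f), (fun=> 0); split => //; apply/funext => x; rewrite addr0.
have fE m : f = (fun t => 1 * cut (B m) f t + cut (~` B m) f t).
  by apply/funext => t; rewrite mul1r -sub_cut addrC subrK.
have Df : Lp_add mu p0%:E 2%:E f.
  exists (cut (B 0%N) f), (cut (~` B 0%N) f); split => //.
  by rewrite {1}(fE 0%N); apply/funext => t; rewrite mul1r.
have mU w h : Lp_add mu p0%:E 2%:E h -> cmeasurable (U w h).
  by have [h1 _ _] := Ulin w; exact: h1.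
have UE w m : {ae mu, forall t, U w f t = U w (cut (B m) f) t + U w (cut (~` B m) f) t}.
  have [_ _ h3] := Ulin w; have := h3 1 _ _ (Dc m) (Dg m).
  by rewrite -(fE m); apply: filterS => t ->; rewrite mul1r.
have LUc w m : Lp mu p0%:E (U w (cut (B m) f)).
  apply: pint_Lp => //; first exact: mU.
  apply: (le_lt_trans (Ubd w (Lcut m))).
  rewrite lte_mul_pinfty ?lee_fin ?(ltW M0)//; exact: Lp_pint.
have LUg w m : Lp mu 2%:E (U w (cut (~` B m) f)) by exact: L2bounded_Lp.
have i1 w m (A : finType) (idx : T -> A) (y : A -> R[i]) : fin_indexed idx ->
    (forall a, y a != 0 -> fin_cell mu idx a) ->
    cintegrable mu (fun t => U w (cut (B m) f) t * (y (idx t))^*).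
  by move=> mi fy; apply: (cintegrable_step hp0 mi fy).
have i2 w m (A : finType) (idx : T -> A) (y : A -> R[i]) : fin_indexed idx ->
    (forall a, y a != 0 -> fin_cell mu idx a) ->
    cintegrable mu (fun t => U w (cut (~` B m) f) t * (y (idx t))^*).
  by move=> mi fy; apply: (cintegrable_step (ler1n _ 2) mi fy).
have iU w (A : finType) (idx : T -> A) (y : A -> R[i]) : fin_indexed idx ->
    (forall a, y a != 0 -> fin_cell mu idx a) ->
    cintegrable mu (fun t => U w f t * (y (idx t))^*).
  move=> mi fy; have [m12 i12] := cintegrableD (i1 w 0%N _ _ y mi fy) (i2 w 0%N _ _ y mi fy).
  have my : cmeasurable (fun t => (y (idx t))^*).
    by apply: cmeasurable_conj; exact: cmeasurable_comp_idx.
  have mUy : cmeasurable (fun t => U w f t * (y (idx t))^*).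
    by apply: cmeasurableM => //; exact: mU.
  split=> //; apply: le_lt_trans i12; rewrite le_eqVlt; apply/orP; left; apply/eqP.
  apply: ae_eq_integral => //.
  - by apply/measurable_EFinP; exact: measurable_nrm.
  - by apply/measurable_EFinP; exact: measurable_nrm.
  - by have := UE w 0%N; apply: filterS => t -> _; rewrite mulrDl.
split => //; first by move=> w; exact: mU.
exists (fun m => cut (~` B m) f); split => // [m t|w A idx y mi fy].
  exact: nrm_cut_le.
have [K K0 hK] := step_pairing_le hp0 mi fy.
pose c := fine (pint mu p f) + 1.
have c0 : 0 < c by rewrite ltr_wpDl// fine_ge0// pint_ge0.
have hd m : nrm (cinner mu (U w (cut (~` B m) f)) (y \o idx) - cinner mu (U w f) (y \o idx)) <=
    K * (M * ((N m)^-1 `^ (p - p0) * c)) `^ p0^-1.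
  have e1 : cinner mu (U w f) (y \o idx) = cintegral mu (fun t =>
      U w (cut (B m) f) t * (y (idx t))^* + U w (cut (~` B m) f) t * (y (idx t))^*).
    rewrite cinnerE; apply: ae_eq_cintegral.
    - by have [] := iU w _ _ y mi fy.
    - by have [] := cintegrableD (i1 w m _ _ y mi fy) (i2 w m _ _ y mi fy).
    - by have := UE w m; apply: filterS => t /= ->; rewrite mulrDl.
  rewrite e1 cintegralD; [|exact: i1|exact: i2].
  rewrite cinnerE opprD addrCA subrr addr0 nrmN -lee_fin.
  apply: (le_trans (nrm_cintegral_le (i1 w m _ _ y mi fy))).
  rewrite (eq_integral (fun t => (nrm (U w (cut (B m) f) t) * nrm (y (idx t)))%:E)); last first.
    by move=> t _; rewrite nrmM nrm_conj.
  have Ni : 0 < (N m)^-1 by rewrite invr_gt0.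
  apply: hK; first exact: mU.
    by rewrite !mulr_gt0// powR_gt0.
  apply: (le_trans (Ubd w (Lcut m))); rewrite EFinM.
  apply: lee_wpmul2l; first by rewrite lee_fin ltW.
  apply: (le_trans (hcut m)); rewrite EFinM.
  rewrite -[(N m)^-1]powR_inv1 ?(ltW (N0 m))// -powRrM mulN1r opprB.
  apply: lee_wpmul2l; first by rewrite lee_fin powR_ge0.
  by rewrite -(fineK fp) lee_fin lerDl.
have lim : K * (M * ((N m)^-1 `^ (p - p0) * c)) `^ p0^-1 @[m --> \oo] --> (0 : R).
  have p0i : 0 < p0^-1 by rewrite invr_gt0.
  have h1 : (N m)^-1 `^ (p - p0) @[m --> \oo] --> (0 : R) `^ (p - p0).
    apply: cvg_powR => //; rewrite ?subr_gt0//; first by move=> m; rewrite invr_ge0 ltW.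
    exact: cvg_harmonic.
  rewrite powR0 ?subr_eq0 ?gt_eqF// in h1.
  have h2 : M * ((N m)^-1 `^ (p - p0) * c) @[m --> \oo] --> M * (0 * c).
    by apply: cvgM; [exact: cvg_cst|apply: cvgM => //; exact: cvg_cst].
  rewrite mul0r mulr0 in h2.
  have h3 : (M * ((N m)^-1 `^ (p - p0) * c)) `^ p0^-1 @[m --> \oo] --> (0 : R) `^ p0^-1.
    apply: cvg_powR => // m.
    by rewrite mulr_ge0 ?(ltW M0)// mulr_ge0 ?powR_ge0// ltW.
  rewrite powR0 ?gt_eqF// in h3.
  rewrite -[X in _ --> X](mulr0 K); apply: cvgM => //; exact: cvg_cst.
apply: (squeeze_cvgr _ (cvg_cst 0) lim); apply: nearW => m.
by apply/andP; split; [exact: nrm_ge0|exact: hd].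
Qed.

End low_exponents.

Section high_exponents.
Variables (p p' : R) (U' : W -> (T -> R[i]) -> (T -> R[i])).
Hypotheses (hp2 : 2 <= p) (hpp' : p^-1 + p'^-1 = 1).
Hypothesis adj : forall w f g, Lp mu p%:E f -> Lp mu p'%:E g ->
  [/\ Lp mu p%:E (U w f), Lp mu p'%:E (U' w g) & cinner mu (U w f) g = cinner mu f (U' w g)].

Let pg : 0 < p. Proof. exact: lt_le_trans hp2. Qed.
Let p1 : 1 < p. Proof. by apply: lt_le_trans hp2; rewrite ltr1n. Qed.

(** For p >= 2 it is the small values that leave L^2, so f is cut down to |f| > 1 / (m + 1). The
    adjoint moves the operator to the step function, with image in L^p', and dominated convergence
    applies to the pairing with f. *)
Lemma weakly_approximable_high f : Lp mu p%:E f -> weakly_approximable f.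
Proof.
move=> hf; have mf := Lp_cmeasurable hf.
have p'0 : 0 < p'.
  rewrite -invr_gt0 (_ : p'^-1 = 1 - p^-1) ?subr_gt0 ?invf_lt1//.
  by rewrite -hpp' addrC addKr.
pose N m : R := m.+1%:R^-1; have N0 m : 0 < N m by rewrite invr_gt0 ltr0n.
pose B m := [set t | N m < nrm (f t)].
have mB m : measurable (B m) by exact: measurable_nrm_gt.
have mg m : cmeasurable (cut (B m) f) by exact: cmeasurable_cut.
have fp : pint mu p f \is a fin_num by rewrite ge0_fin_numE ?pint_ge0//; exact: Lp_pint.
have Lg m : Lp mu 2%:E (cut (B m) f).
  apply: pint_Lp => //; apply: (@le_lt_trans _ _ ((N m `^ (2 - p))%:E * pint mu p f)%E).
    apply: pint_cut_le => //; first exact: powR_ge0.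
    move=> t h; have ft : 0 < nrm (f t) by exact: lt_trans h.
    rewrite (powR_shift _ p) ?gt_eqF// ler_wpM2r ?powR_ge0// -[2 - p]opprB !powRN lef_pV2 ?posrE ?powR_gt0//.
    by apply: ge0_ler_powR; rewrite ?nnegrE ?nrm_ge0 ?subr_ge0 ?(ltW (N0 m)) ?(ltW h).
  by rewrite -(fineK fp) -EFinM ltry.
have Lgp m : Lp mu p%:E (cut (B m) f).
  apply: pint_Lp => //; apply: (@le_lt_trans _ _ (pint mu p f)); last exact: Lp_pint.
  by apply: pint_le; [exact: ltW|exact: nrm_cut_le].
have Ly (A : finType) (idx : T -> A) (y : A -> R[i]) : fin_indexed idx ->
    (forall a, y a != 0 -> fin_cell mu idx a) -> Lp mu p'%:E (y \o idx).
  by move=> mi fy; exact: Lp_comp_idx.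
have LU w : Lp mu p%:E (U w f) by have [] := adj w hf (@Lp0 _ _ _ mu p' p'0).
split => [w|w A idx y mi fy|].
- exact: Lp_cmeasurable.
- exact: (cintegrable_step (ltW p1) mi fy).
exists (fun m => cut (B m) f); split => // [m t|w A idx y mi fy].
  exact: nrm_cut_le.
have [_ Lu eu] := adj w hf (Ly _ _ _ mi fy).
have em m : cinner mu (U w (cut (B m) f)) (y \o idx) = cinner mu (cut (B m) f) (U' w (y \o idx)).
  by have [] := adj w (Lgp m) (Ly _ _ _ mi fy).
under eq_fun do rewrite em eu; set u := U' w _ in Lu *.
have mu_ := Lp_cmeasurable Lu.
have ip h : Lp mu p%:E h -> cintegrable mu (fun t => h t * (u t)^*).
  move=> hh; split; first by apply: cmeasurableM; [exact: Lp_cmeasurable hh|exact: cmeasurable_conj].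
  rewrite (eq_integral (fun t => (nrm (h t) * nrm (u t))%:E)); last first.
    by move=> t _; rewrite nrmM nrm_conj.
  exact: (Lp_pairing p1 hpp').
pose F m t := (nrm (cut (B m) f t - f t) * nrm (u t))%:E.
have mF m : measurable_fun setT (F m).
  apply/measurable_EFinP; apply: measurable_funM; apply: measurable_nrm => //.
  exact: cmeasurableB.
have := @dominated_convergence _ T R mu setT measurableT F (cst 0%E)
  (fun t => (nrm (f t) * nrm (u t))%:E) mF.
case=> [||||_ _ lim].
- exact: measurable_cst.
- apply: aeW => t _; apply: cvg_near_cst.
  have [f0|fn0] := eqVneq (f t) 0.
    by apply: nearW => m; rewrite /F cutE f0 if_same subrr nrm0 mul0r.
  have fp0 : 0 < nrm (f t) by rewrite lt_neqAle nrm_ge0 eq_sym nrm_eq0 fn0.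
  have /cvgrPdist_lt/(_ _ fp0) := @cvg_harmonic R; apply: filterS => m.
  rewrite sub0r normrN ger0_norm ?invr_ge0// => h.
  by rewrite /F cutE mem_set// subrr nrm0 mul0r.
- apply/integrableP; split.
    by apply/measurable_EFinP; apply: measurable_funM; exact: measurable_nrm.
  rewrite (eq_integral (fun t => (nrm (f t) * nrm (u t))%:E)); last first.
    by move=> t _; rewrite gee0_abs// lee_fin mulr_ge0 ?nrm_ge0.
  exact: (Lp_pairing p1 hpp').
- apply: aeW => t m _; rewrite /F gee0_abs ?lee_fin ?mulr_ge0 ?nrm_ge0//.
  by rewrite ler_wpM2r ?nrm_ge0// -nrmN opprB sub_cut nrm_cut_le.
rewrite integral0 in lim; move/fine_cvgP : lim => [lf lim].
apply: (squeeze_cvgr _ (cvg_cst 0) lim); near=> m.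
apply/andP; split; first exact: nrm_ge0.
rewrite !cinnerE -cintegralB; [|exact: ip|exact: ip].
have fm : (\int[mu]_t F m t)%E \is a fin_num by near: m.
rewrite -lee_fin fineK//.
have id : cintegrable mu (fun t => cut (B m) f t * (u t)^* - f t * (u t)^*).
  rewrite (_ : (fun t => _) = (fun t => cut (B m) f t * (u t)^* + -1 * (f t * (u t)^*))).
    by apply: cintegrableD; [exact: ip|apply: cintegrableZ; exact: ip].
  by apply/funext => t; rewrite mulN1r.
apply: (le_trans (nrm_cintegral_le id)); rewrite le_eqVlt; apply/orP; left; apply/eqP.
by apply: eq_integral => t _; rewrite /F -mulrBl nrmM nrm_conj.
Unshelve. all: by end_near.
Qed.

End high_exponents.

End weak_approximation.

Lemma sum_fset_le_esum (R : realType) (I : choiceType) (a : I -> \bar R) (K : {fset I}) :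
  (forall i, 0 <= a i)%E -> (\sum_(h <- K) a h <= \esum_(h in [set: I]) a h)%E.
Proof.
move=> a0; rewrite /esum; apply: ereal_sup_ubound => /=.
exists [set` K]; first by split => //; exact: finite_fset.
by rewrite fsbig_finite//= set_fsetK.
Qed.

Lemma sqr_powR (R : realType) (u v : R) : 0 <= u -> (u ^+ 2) `^ v = (u `^ v) ^+ 2.
Proof.
by move=> u0; rewrite !expr2 powRM.
Qed.

Lemma min_le_powR (R : realType) (a b s : R) : 0 < a -> 0 < b -> 0 <= s -> s <= 1 ->
  Num.min a b <= a `^ s * b `^ (1 - s).
Proof.
move=> a0 b0 s0 s1; have m0 : 0 < Num.min a b by rewrite lt_min a0.
have -> : Num.min a b = Num.min a b `^ s * Num.min a b `^ (1 - s).
  rewrite -powRD; last by rewrite (gt_eqF m0) implybT.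
  by rewrite addrC subrK powRr1// ltW.
apply: ler_pM; rewrite ?powR_ge0//; apply: ge0_ler_powR; rewrite ?nnegrE ?subr_ge0 ?(ltW a0) ?(ltW b0) ?(ltW m0)//.
  by rewrite ge_min lexx.
by rewrite ge_min lexx orbT.
Qed.

Lemma form_bound_le d (T : measurableType d) (R : realType) (mu : {measure set T -> \bar R})
  (E G1 G2 : finType) (s : E -> G1) (t : E -> G2) (U : E -> (T -> R[i]) -> (T -> R[i]))
  (P M M' : R) : M <= M' -> form_bound mu s t U P M -> form_bound mu s t U P M'.
Proof.
move=> MM hM A B idx idx' mi mi' x y fx fy bx by_.
exact: (le_trans (hM _ _ _ _ mi mi' _ _ fx fy bx by_) MM).
Qed.

(** * Interpolation and summation over shifts at one level *)

Section class_estimate.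
Context d (T : measurableType d) (R : realType)
  (mu : {sigma_finite_measure set T -> \bar R}).
Context (r : nat) (W G : finType) (ga : W -> G) (io : G -> 'rV[int]_r).
Context (U : W -> (T -> R[i]) -> (T -> R[i])) (S : 'rV[int]_r -> (T -> R[i]) -> (T -> R[i])).
Hypotheses (UL : forall w, L2bounded mu (U w)) (SL : forall g, L2bounded mu (S g)).
Hypothesis SR : resolution_of_identity mu S.
Variables (Q tau t eps M A X Y B : R) (c : 'rV[int]_r -> R).
Hypotheses (Q0 : 0 < Q) (Q1 : Q < 1) (t0 : 0 < t) (ttau : t <= tau) (tau1 : tau <= 1).
Hypotheses (eps0 : 0 < eps) (eps1 : eps < 2^-1) (M0 : 0 < M) (A0 : 0 < A).
Hypotheses (X0 : 0 < X) (Y0 : 0 < Y) (c0 : forall h, 0 < c h).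
Hypothesis hM : form_bound mu ga id U Q M.
Hypothesis hA : forall h f, Lp mu 2%:E f -> Lp mu (Q^-1)%:E f ->
  (\int[mu]_x (nrm2 (fun g => S (io g + h) f) x `^ (2 * Q)^-1)%:E <=
   (A `^ Q^-1)%:E * pint mu Q^-1 f)%E.
Hypothesis hX : forall h f, Lp mu 2%:E f ->
  (\sum_w pint mu 2 (U w (S (io (ga w) + h) f)) <= (X ^+ 2)%:E * pint mu 2 f)%E.
Hypothesis hY : forall h f, Lp mu 2%:E f ->
  (\sum_w pint mu 2 (U w (S (io (ga w) + h) f)) <= ((Y * c h) ^+ 2)%:E * pint mu 2 f)%E.
Hypothesis hB : (\esum_(h in [set: 'rV[int]_r]) (c h `^ ((2^-1 - eps) * t))%:E <= B%:E)%E.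

(** [P] runs between the auxiliary exponent [Q] and 1/2. The series in [c] is assumed to converge at
    the parameter [t] only; a larger [tau] is reached through the boundedness of [c]. *)
Let P := (1 - tau) * Q + tau * 2^-1.
Let Z := X `^ (2^-1 + eps) * Y `^ (2^-1 - eps).

Let tau0 : 0 < tau. Proof. exact: lt_le_trans ttau. Qed.
Let Z0 : 0 < Z. Proof. by rewrite mulr_gt0// powR_gt0. Qed.
Let P0 : 0 < P.
Proof. by apply: convex_gt0 => //; exact: ltW. Qed.
Let P1 : P < 1.
Proof.
rewrite -subr_gt0 (_ : 1 - P = (1 - tau) * (1 - Q) + tau * 2^-1); last by rewrite /P; field.
by apply: convex_gt0 => //; [exact: ltW|rewrite subr_gt0].
Qed.

Let sum_le_B (K : {fset 'rV[int]_r}) : \sum_(h <- K) c h `^ ((2^-1 - eps) * t) <= B.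
Proof.
rewrite -lee_fin; apply: le_trans hB; rewrite -sumEFin.
by apply: sum_fset_le_esum => h; rewrite lee_fin powR_ge0.
Qed.

Let c_le h : c h `^ ((2^-1 - eps) * t) <= B.
Proof. by have := sum_le_B [fset h]%fset; rewrite big_seq_fset1. Qed.

Let form_half h : form_bound mu (fun _ : W => tt) id (fun w => U w \o S (io (ga w) + h)) 2^-1
  (Z * c h `^ (2^-1 - eps)).
Proof.
have Zc : 0 < Z * c h `^ (2^-1 - eps) by rewrite mulr_gt0// powR_gt0.
apply: (form_bound_half (ga := ga) UL (S := fun g => S (io g + h))) => // f hf.
have hf2 : pint mu 2 f \is a fin_num by rewrite ge0_fin_numE ?pint_ge0//; exact: Lp_pint.
have := hX h hf; have := hY h hf; rewrite /=; set s := (\sum_w _)%E => sY sX.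
apply: (@le_trans _ _ (Order.min ((X ^+ 2)%:E * pint mu 2 f) (((Y * c h) ^+ 2)%:E * pint mu 2 f))%E).
  by rewrite le_min sX.
rewrite -(fineK hf2) -!EFinM -EFin_min lee_fin -minr_pMl; last first.
  by rewrite fine_ge0// pint_ge0.
apply: ler_wpM2r; first by rewrite fine_ge0// pint_ge0.
have Yc : 0 < Y * c h by rewrite mulr_gt0.
have e1 : 2^-1 + eps <= 1.
  by rewrite -lerBrDl (_ : 1 - 2^-1 = 2^-1); [exact: ltW|field].
have e0 : 0 <= 2^-1 + eps by rewrite addr_ge0// ltW.
have e2 : 1 - (2^-1 + eps) = 2^-1 - eps by field.
have X20 : 0 < X ^+ 2 by rewrite exprn_gt0.
have Y20 : 0 < (Y * c h) ^+ 2 by rewrite exprn_gt0.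
apply: (le_trans (min_le_powR X20 Y20 e0 e1)); rewrite e2.
have -> : Z * c h `^ (2^-1 - eps) = X `^ (2^-1 + eps) * (Y * c h) `^ (2^-1 - eps).
  by rewrite /Z powRM ?ltW// mulrA.
by rewrite (sqr_powR _ (ltW X0)) (sqr_powR _ (ltW Yc)) -exprMn.
Qed.

Let B0 : 0 < B. Proof. by apply: lt_le_trans (c_le 0); rewrite powR_gt0. Qed.

Lemma class_estimate_form :
  form_bound mu (fun _ : W => tt) id U P
    ((A * M) `^ (1 - tau) * Z `^ tau * (B `^ ((tau - t) / t) * B)).
Proof.
pose D := (A * M) `^ (1 - tau) * Z `^ tau.
have D0 : 0 <= D by rewrite mulr_ge0 ?powR_ge0.
have half0 : 0 < 2^-1 :> R by rewrite invr_gt0.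
have half1 : 2^-1 < 1 :> R by rewrite invf_lt1// ltr1n.
have Z1 h : form_bound mu (fun _ : W => tt) id (fun w => U w \o S (io (ga w) + h)) P
    (D * B `^ ((tau - t) / t) * c h `^ ((2^-1 - eps) * t)).
  have TL w : L2bounded mu (U w \o S (io (ga w) + h)) by exact: L2bounded_comp.
  have hQ := form_bound_LP (ga := ga) UL (S := fun g => S (io g + h)) (fun g => SL _) Q0 Q1 A0 hM (hA h).
  apply: form_bound_le (form_bound_interpolation TL (ltW tau0) tau1 Q0 Q1 half0 half1 hQ (form_half h)).
  rewrite [X in _ * X <= _](powRM _ (ltW Z0) (powR_ge0 _ _)) mulrA -/D -[leRHS]mulrA ler_wpM2l//.
  (* The exponent of c_h exceeds the summable one by (1/2 - eps)(tau - t). As a term of the series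
     is at most B, the excess factor is at most B^((tau - t) / t). *)
  rewrite -powRrM -[tau in X in X <= _](subrK t) mulrDr powRD; last first.
    by rewrite (gt_eqF (c0 h)) implybT.
  rewrite ler_wpM2r ?powR_ge0//.
  rewrite (_ : (2^-1 - eps) * (tau - t) = (2^-1 - eps) * t * ((tau - t) / t)); last first.
    by field; rewrite gt_eqF.
  rewrite [X in X <= _]powRrM; apply: ge0_ler_powR; rewrite ?nnegrE ?powR_ge0 ?(ltW B0) ?c_le//.
  by rewrite divr_ge0 ?subr_ge0// ltW.
apply: (form_bound_resolution UL SL P0 P1 SR Z1) => K.
rewrite -mulr_sumr -[leRHS]mulrA mulrA -mulrA ler_wpM2l//.
by rewrite ler_wpM2l ?powR_ge0.
Qed.

Lemma class_estimate f : Lp mu (P^-1)%:E f -> weakly_approximable mu U f ->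
  (\int[mu]_x (nrm2 (fun w => U w f) x `^ (2 * P)^-1)%:E <=
   (((A * M) `^ (1 - tau) * Z `^ tau * (B `^ ((tau - t) / t) * B)) `^ P^-1)%:E *
   pint mu P^-1 f)%E.
Proof.
move=> hf wf; apply: (square_function_bound UL P0 P1 _ class_estimate_form hf wf).
by rewrite !mulr_ge0 ?powR_ge0// ltW.
Qed.

End class_estimate.

(** * Dyadic mixed differences *)

Section signed_sums.
Context d (T : measurableType d) (R : realType) (mu : {measure set T -> \bar R}).
Context (I : eqType).
Implicit Types (H : I -> (T -> R[i]) -> (T -> R[i])) (f g : T -> R[i]).

(** A mixed difference is stored as a list of points with boolean signs, so that linearity, adjoints
    and pointwise bounds all follow by induction on the list. *)
Definition signed_sum H (s : seq (bool * I)) : (T -> R[i]) -> (T -> R[i]) :=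
  fun f x => \sum_(q <- s) (-1) ^+ q.1 * H q.2 f x.

Lemma linear_operator_sub (D D' : set (T -> R[i])) U : D' `<=` D ->
  linear_operator mu D U -> linear_operator mu D' U.
Proof.
move=> DD [h1 h2 h3]; split => [f Df|f g Df Dg|a f g Df Dg].
- exact/h1/DD.
- by apply: h2; exact: DD.
- by apply: h3; exact: DD.
Qed.

Lemma linear_operator_signed_sum D H s :
  (forall q, q \in s -> linear_operator mu D (H q.2)) ->
  linear_operator mu D (signed_sum H s).
Proof.
elim: s => [|q s ih] hs.
  rewrite (_ : signed_sum H [::] = (fun _ _ => 0)); last first.
    by apply/funext => f; apply/funext => x; rewrite /signed_sum big_nil.
  split => [f _|f g _ _ _|a f g _ _]; first exact: cmeasurable_cst.
    exact: aeW.
  by apply: aeW => x; rewrite mulr0 addr0.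
have [i1 i2 i3] := ih (fun q' h => hs q' (@mem_behead _ (q :: s) _ h)).
have [h1 h2 h3] := hs q (mem_head _ _).
rewrite (_ : signed_sum H (q :: s) =
    (fun f x => (-1) ^+ q.1 * H q.2 f x + signed_sum H s f x)); last first.
  by apply/funext => f; apply/funext => x; rewrite /signed_sum big_cons.
split => [f Df|f g Df Dg e|a f g Df Dg].
- by apply: cmeasurableD; [apply/cmeasurableZ/h1|exact: i1].
- by apply: filterS2 (h2 _ _ Df Dg e) (i2 _ _ Df Dg e) => x -> ->.
- by apply: filterS2 (h3 a _ _ Df Dg) (i3 a _ _ Df Dg) => x -> ->; ring.
Qed.

Lemma nrm_sign (b : bool) (z : R[i]) : nrm ((-1) ^+ b * z) = nrm z.
Proof. by case: b; rewrite ?expr0 ?mul1r ?expr1 ?mulN1r ?nrmN. Qed.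

Lemma nrm_signed_sum_le H s f x (M : R) :
  (forall q, q \in s -> nrm (H q.2 f x) <= M) ->
  nrm (signed_sum H s f x) <= (size s)%:R * M.
Proof.
rewrite /signed_sum; elim: s => [|q s ih] hs.
  by rewrite big_nil nrm0 mul0r.
rewrite big_cons /= -addn1 natrD mulrDl mul1r addrC.
apply: (le_trans (nrmD _ _)); apply: lerD; first by apply: ih => r' h; apply: hs; rewrite inE h orbT.
by rewrite nrm_sign; apply: hs; rewrite mem_head.
Qed.

(** Cauchy-Schwarz, by induction on the list. In the induction step, n times the gap is a square
    plus a multiple of the gap in the induction hypothesis; n = 0 is treated apart. *)
Lemma nrm_signed_sum_sqr H s f x :
  nrm (signed_sum H s f x) ^+ 2 <= (size s)%:R * \sum_(q <- s) nrm (H q.2 f x) ^+ 2.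
Proof.
have h : nrm (signed_sum H s f x) <= \sum_(q <- s) nrm (H q.2 f x).
  rewrite /signed_sum (le_trans (nrm_sum _ _ _))//.
  by apply: ler_sum => q _; rewrite nrm_sign.
apply: (@le_trans _ _ ((\sum_(q <- s) nrm (H q.2 f x)) ^+ 2)).
  by rewrite lerXn2r ?nnegrE ?nrm_ge0// sumr_ge0// => q _; exact: nrm_ge0.
elim: s {h} => [|q s ih]; first by rewrite !big_nil expr0n mul0r.
rewrite !big_cons [size (_ :: _)]/= -[(size s).+1]addn1 natrD.
set a := nrm _; set S1 := \sum_(_ <- _) _ in ih *; set S2 := \sum_(_ <- _) _ in ih *.
set n : R := (size s)%:R in ih *.
have S20 : 0 <= S2 by apply: sumr_ge0 => j _; exact: sqr_ge0.
have [n0|n0] := eqVneq n 0.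
  have S1e : S1 = 0.
    by apply/eqP; rewrite -sqrf_eq0 eq_le sqr_ge0 andbT (le_trans ih)// n0 mul0r.
  by rewrite S1e n0 addr0 add0r mul1r lerDl.
have np : 0 < n by rewrite lt_neqAle eq_sym n0 ler0n.
rewrite -subr_ge0 -(pmulr_rge0 _ np).
have -> : n * ((n + 1) * (a ^+ 2 + S2) - (a + S1) ^+ 2) =
  (n * a - S1) ^+ 2 + (n + 1) * (n * S2 - S1 ^+ 2) by ring.
by rewrite addr_ge0 ?sqr_ge0// mulr_ge0 ?subr_ge0// addr_ge0// ltW.
Qed.

Lemma signed_sum_adjoint (p p' : R) H H' s : 1 < p -> p^-1 + p'^-1 = 1 ->
  (forall q f g, q \in s -> Lp mu p%:E f -> Lp mu p'%:E g ->
    [/\ Lp mu p%:E (H q.2 f), Lp mu p'%:E (H' q.2 g) &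
        cinner mu (H q.2 f) g = cinner mu f (H' q.2 g)]) ->
  forall f g, Lp mu p%:E f -> Lp mu p'%:E g ->
    [/\ Lp mu p%:E (signed_sum H s f), Lp mu p'%:E (signed_sum H' s g) &
        cinner mu (signed_sum H s f) g = cinner mu f (signed_sum H' s g)].
Proof.
move=> p1 pp' + f g hf hg; have p0 : 0 < p by exact: lt_trans p1.
have p'0 : 0 < p'.
  rewrite -invr_gt0 (_ : p'^-1 = 1 - p^-1) ?subr_gt0 ?invf_lt1//.
  by rewrite -pp' addrC addKr.
have ip u v : Lp mu p%:E u -> Lp mu p'%:E v -> cintegrable mu (fun t => u t * (v t)^*).
  move=> hu hv; split.
    by apply: cmeasurableM; [exact: Lp_cmeasurable hu|exact/cmeasurable_conj/(Lp_cmeasurable hv)].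
  rewrite (eq_integral (fun t => (nrm (u t) * nrm (v t))%:E)); last first.
    by move=> t _; rewrite nrmM nrm_conj.
  exact: (Lp_pairing p1 pp').
elim: s => [|q s ih] hs.
  have e F u : signed_sum F [::] u = (fun=> 0).
    by apply/funext => x; rewrite /signed_sum big_nil.
  rewrite !e; split; [exact: Lp0|exact: Lp0|].
  rewrite !cinnerE; congr cintegral; apply/funext => x.
  by rewrite rmorph0 mulr0 mul0r.
have [i1 i2 i3] := ih (fun q' f g h => hs q' f g (@mem_behead _ (q :: s) _ h)).
have [h1 h2 h3] := hs q f g (mem_head _ _) hf hg.
have e F u : signed_sum F (q :: s) u = (fun x => (-1) ^+ q.1 * F q.2 u x + signed_sum F s u x).
  by apply/funext => x; rewrite /signed_sum big_cons.
rewrite !e; split; [exact: Lp_lin|exact: Lp_lin|].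
move: h3 i3; rewrite !cinnerE => h3 i3.
transitivity (cintegral mu (fun x => (-1) ^+ q.1 * (H q.2 f x * (g x)^*) +
    signed_sum H s f x * (g x)^*)).
  by congr cintegral; apply/funext => x; rewrite mulrDl mulrA.
transitivity (cintegral mu (fun x => (-1) ^+ q.1 * (f x * (H' q.2 g x)^*) +
    f x * (signed_sum H' s g x)^*)).
  rewrite !cintegralD ?cintegralZ ?h3 ?i3//; try exact: ip; try (apply: cintegrableZ; exact: ip).
congr cintegral; apply/funext => x.
rewrite rmorphD rmorphM mulrDr mulrCA; congr (_ * _ + _).
by rewrite rmorphXn rmorphN1.
Qed.

End signed_sums.

Section difference_points.
Context (R : realType) (k : nat).
Implicit Types (h s : 'rV[R]_k) (l : seq 'I_k).

Fixpoint diff_points h l s : seq (bool * 'rV[R]_k) :=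
  if l is j :: l' then
    diff_points h l' (s + h ord0 j *: delta_mx ord0 j) ++
    [seq (~~ q.1, q.2) | q <- diff_points h l' s]
  else [:: (false, s)].

Lemma size_diff_points h l s : size (diff_points h l s) = (2 ^ size l)%N.
Proof.
elim: l s => //= j l ih s.
by rewrite size_cat size_map !ih addnn -mul2n expnS.
Qed.

Lemma mixed_diffE h (K : {set 'I_k}) (a : 'rV[R]_k -> R[i]) s :
  mixed_diff h K a s = \sum_(q <- diff_points h (enum K) s) (-1) ^+ q.1 * a q.2.
Proof.
rewrite /mixed_diff; elim: (enum K) s => [|j l ih] s /=.
  by rewrite big_seq1 expr0 mul1r.
rewrite /diff1 !ih big_cat/= big_map -sumrN; congr (_ + _).
by apply: eq_bigr => q _; rewrite /= signrN mulNr.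
Qed.

(** All points of a mixed difference lie between its two extreme corners, and cubes are
    order-convex; hence every evaluation point stays in the cube. *)
Lemma diff_points_between h l s q : uniq l -> (forall i, 0 <= h ord0 i) ->
  q \in diff_points h l s ->
  forall i, s ord0 i <= q.2 ord0 i <= s ord0 i + (if i \in l then h ord0 i else 0).
Proof.
move=> + h0; elim: l s q => [|j l ih] s q /=.
  by rewrite inE => _ /eqP -> i; rewrite addr0 lexx.
move=> /andP[jl ul]; rewrite mem_cat => /orP[|/mapP[q' ]].
  move=> /(ih _ _ ul) + i => /(_ i); rewrite !mxE eqxx/= inE.
  have [->|ij] := eqVneq i j.
    rewrite (negbTE jl) mulr1 addr0 => /andP[h1 h2].
    by rewrite h2 andbT (le_trans _ h1)// lerDl.
  by rewrite mulr0 addr0 orFb.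
move=> /(ih _ _ ul) hq -> i /=; have /andP[-> h2] := hq i.
rewrite andTb (le_trans h2)// lerD2l in_cons; have [il|_] := boolP (i \in l).
  by rewrite orbT.
by case: ifP.
Qed.

End difference_points.

Section l2sums.
Context d (T : measurableType d) (R : realType) (mu : {measure set T -> \bar R}).
Context (r : nat).

Lemma nrm2_le_esum (G : finType) (j : G -> 'rV[int]_r) (F : 'rV[int]_r -> T -> R[i]) x :
  injective j ->
  ((nrm2 (fun g => F (j g)) x)%:E <=
   \esum_(g in [set: 'rV[int]_r]) ((nrm (F g x))%:E ^+ 2))%E.
Proof.
move=> ij; apply: le_trans (sum_fset_le_esum [fset j g | g in G]%fset _); last first.
  by move=> g; rewrite -EFin_expe lee_fin sqr_ge0.
rewrite /nrm2 -sumEFin big_imfset/=; last by move=> g g' _ _; exact: ij.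
by rewrite big_enum/=; apply: lee_sum => g _; rewrite EFin_expe.
Qed.

Lemma l2sum_finite (G : finType) (j : G -> 'rV[int]_r) (F : 'rV[int]_r -> T -> R[i])
  (Q A : R) f : injective j -> 0 < Q -> 0 <= A ->
  ('N[mu]_(Q^-1)%:E[(fun x => l2sum (fun g => (nrm (F g x))%:E))] <=
     A%:E * cnorm mu (Q^-1)%:E f)%E ->
  (\int[mu]_x (nrm2 (fun g => F (j g)) x `^ (2 * Q)^-1)%:E <=
   (A `^ Q^-1)%:E * pint mu Q^-1 f)%E.
Proof.
move=> ij Q0 A0; have Qi : 0 < Q^-1 by rewrite invr_gt0.
move/(Lnorm_leP _ _ _ Qi A0); apply: le_trans; apply: le_lower_integral => x.
  by rewrite lee_fin powR_ge0.
have e0 : (0 <= \esum_(g in [set: 'rV[int]_r]) ((nrm (F g x))%:E ^+ 2))%E.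
  by apply: esum_ge0 => g _; rewrite -EFin_expe lee_fin sqr_ge0.
rewrite /l2sum gee0_abs ?poweR_ge0// -poweRrM -invfM -poweR_EFin.
have Q2 : 0 <= (2 * Q)^-1 by rewrite invr_ge0 mulr_ge0// ltW.
move: e0 (nrm2_le_esum F x ij); move: (\esum_(g in _) _)%E => E E0 h.
by apply: gt0_ler_poweR => //; rewrite in_itv/= ?lee_fin ?nrm2_ge0 ?E0 leey.
Qed.

End l2sums.

Section dyadic_differences.
Context (R : realType) (k L : nat).
Implicit Types (l : 'rV[R]_k) (n : {ffun 'I_k -> nat}).

Definition weight n : nat := \sum_i n i.
Definition grid n := {dffun forall i : 'I_k, 'I_(2 ^ n i)}.

(** The i-th side of the cube, of length 2^L l_i, is cut into 2^(n i) intervals, and grid points are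
    lower corners of cells. The index [v i] stops at 2^(n i) - 1, so a grid point plus a step is
    still in the cube. *)
Definition step_size l n : 'rV[R]_k := \row_i (l ord0 i * (2 ^+ L / 2 ^+ n i)).
Definition grid_point l n (v : grid n) : 'rV[R]_k :=
  \row_i (l ord0 i * (1 + 2 ^+ L * (v i)%:R / 2 ^+ n i)).
Definition positive_level n : {set 'I_k} := [set i | (0 < n i)%N].

Lemma card_grid n : #|{: grid n}| = (2 ^ weight n)%N.
Proof.
rewrite card_dep_ffun foldrE big_map big_enum/= /weight expn_sum.
by apply: eq_bigr => i _; rewrite card_ord.
Qed.

Let p2 m : 0 < 2 ^+ m :> R. Proof. by rewrite exprn_gt0. Qed.

Lemma posorthant_step_size l n : posorthant l -> posorthant (step_size l n).
Proof.
move=> l0 i; have := l0 i; rewrite !mxE => li.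
by rewrite mulr_gt0// divr_gt0.
Qed.

Lemma grid_point_cube l n (v : grid n) : posorthant l ->
  cube L l (grid_point l v) /\ cube L l (grid_point l v + step_size l n).
Proof.
move=> l0; have lp i : 0 < l ord0 i by have := l0 i; rewrite mxE.
have hv i : (v i)%:R + 1 <= 2 ^+ n i :> R by rewrite natr1 -natrX ler_nat ltn_ord.
have v0 i : 0 <= (v i)%:R / 2 ^+ n i :> R by rewrite divr_ge0// ltW.
have vh i : ((v i)%:R + 1) / 2 ^+ n i <= 1 :> R by rewrite ler_pdivrMr// mul1r.
have le1 i : 1 <= 1 + 2 ^+ L * (v i)%:R / 2 ^+ n i :> R.
  by rewrite lerDl -mulrA mulr_ge0// ltW.
have le2 i : 1 + 2 ^+ L * (v i)%:R / 2 ^+ n i + 2 ^+ L / 2 ^+ n i <= 1 + 2 ^+ L :> R.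
  rewrite -addrA lerD2l -mulrDl -[X in _ * _ + X]mulr1 -mulrDr -mulrA.
  by rewrite ger_pMr.
have h0 i : 0 <= 2 ^+ L / 2 ^+ n i :> R by rewrite divr_ge0// ltW.
split; split => i; rewrite !mxE.
- by rewrite mulr_gt0// (lt_le_trans ltr01).
- by rewrite -[leLHS]mulr1 ler_pM2l.
- by rewrite [leRHS]mulrC ler_pM2l// (le_trans _ (le2 i))// lerDl.
- by rewrite -mulrDr mulr_gt0// (lt_le_trans ltr01)// ler_wpDr.
- by rewrite -mulrDr -[leLHS]mulr1 ler_pM2l// ler_wpDr.
- by rewrite -mulrDr [leRHS]mulrC ler_pM2l.
Qed.

Lemma cube_between l s s' (q : 'rV[R]_k) : cube L l s -> cube L l s' ->
  (forall i, s ord0 i <= q ord0 i <= s' ord0 i) -> cube L l q.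
Proof.
move=> [s1 s2 s3] [s1' s2' s3'] h; split => i; have /andP[h1 h2] := h i.
- exact: lt_le_trans (s1 i) h1.
- exact: le_trans (s2 i) h1.
- exact: le_trans h2 (s3' i).
Qed.

Definition grid_points l n (v : grid n) : seq (bool * 'rV[R]_k) :=
  diff_points (step_size l n) (enum (positive_level n)) (grid_point l v).

Lemma size_grid_points l n (v : grid n) :
  size (grid_points l v) = (2 ^ #|positive_level n|)%N.
Proof. by rewrite size_diff_points -cardE. Qed.

Lemma grid_points_cube l n (v : grid n) q : posorthant l ->
  q \in grid_points l v -> cube L l q.2.
Proof.
move=> l0 hq; have [c1 c2] := grid_point_cube v l0.
have h0 i : 0 <= step_size l n ord0 i.
  by apply: ltW; have := posorthant_step_size n l0 i; rewrite mxE.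
apply: (cube_between c1 c2) => i.
have /andP[-> h] := diff_points_between (enum_uniq _) h0 hq i.
rewrite mxE (le_trans h)// lerD2l; case: ifP => // _; exact: h0.
Qed.

(** The coordinates of a grid point are at least those of l, so each ratio is at most 2^L / 2^(n i).
    Directions of level 0 are not differenced, but they contribute nothing to the weight either, so
    the whole factor 2^-(weight n) is gained. *)
Lemma prod_step_ratio_le l n (v : grid n) : posorthant l ->
  \prod_(i in positive_level n) (step_size l n ord0 i / grid_point l v ord0 i) <=
  (2 ^+ L) ^+ k / 2 ^+ weight n.
Proof.
move=> l0; have lp i : 0 < l ord0 i by have := l0 i; rewrite mxE.
have v1 i : 1 <= 1 + 2 ^+ L * (v i)%:R / 2 ^+ n i :> R.
  by rewrite lerDl -mulrA mulr_ge0 ?divr_ge0 ?ler0n// ltW.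
have vp i : 0 < 1 + 2 ^+ L * (v i)%:R / 2 ^+ n i :> R by exact: lt_le_trans (v1 i).
apply: (@le_trans _ _ (\prod_(i in positive_level n) (2 ^+ L / 2 ^+ n i))).
  apply: ler_prod => i _; rewrite !mxE.
  rewrite divr_ge0 ?mulr_ge0 ?(ltW (lp i)) ?(ltW (vp i)) ?divr_ge0 ?(ltW (p2 _))//=.
  rewrite invfM mulrACA divff ?gt_eqF// mul1r ler_piMr ?divr_ge0 ?(ltW (p2 _))//.
  by rewrite invf_le1.
rewrite big_split/=; apply: ler_pM.
- by apply: prodr_ge0 => i _; exact: ltW.
- by apply: prodr_ge0 => i _; rewrite invr_ge0 ltW.
- rewrite prodr_const; apply: ler_weXn2l; first exact: exprn_ege1 (ler1n _ 2).
  by rewrite -[leqRHS]card_ord max_card.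
- rewrite /weight -prodrXr -prodfV big_mkcond/=; apply: ler_prod => i _.
  rewrite inE; case: (n i) => [|m] /=; first by rewrite expr0 invr1 ler01 lexx.
  by rewrite lexx invr_ge0 ltW.
Qed.

End dyadic_differences.

Lemma card_fst_fiber (A B : finType) (a : A) : #|[pred e : A * B | e.1 == a]| = #|B|.
Proof.
rewrite -[RHS]mul1n -(card1 a) -cardX; apply: eq_card => -[x y].
by rewrite !inE andbT.
Qed.

(** * Mixed difference operators and their form bounds *)

Section dyadic_operators.
Context d (T : measurableType d) (R : realType) (mu : {sigma_finite_measure set T -> \bar R}).
Context (k r L : nat) (lft : 'rV[int]_r -> 'rV[R]_k) (p0 p1 A1 A5 : R).
Context (H : 'rV[R]_k -> (T -> R[i]) -> (T -> R[i])).
Hypotheses (hp0 : 1 <= p0) (hp01 : p0 < p1) (hp1 : p1 <= 2).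
Hypothesis lft0 : forall g, posorthant (lft g).
Hypothesis Hlin : forall s, posorthant s -> linear_operator mu (Lp_add mu p0%:E 2%:E) (H s).
Hypothesis Hmax : maximal_estimate mu p1 A1 H.
Hypothesis Hc0 : cancellation mu p0 A5 L H lft.
Hypothesis Hc2 : cancellation mu 2 A5 L H lft.

Definition dyadic_op (g : 'rV[int]_r) n (v : grid n) : (T -> R[i]) -> (T -> R[i]) :=
  fun f x => mixed_diff (step_size L (lft g) n) (positive_level n)
    (fun s => H s f x) (grid_point L (lft g) v).

Lemma dyadic_opE g n (v : grid n) : dyadic_op g v = signed_sum H (grid_points L (lft g) v).
Proof. by apply/funext => f; apply/funext => x; rewrite /dyadic_op mixed_diffE. Qed.

Let p0g : 0 < p0. Proof. exact: lt_le_trans hp0. Qed.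
Let p1g : 0 < p1. Proof. exact: lt_trans hp01. Qed.

(** The power of 2^L is the loss in [prod_step_ratio_le], and in [maximal_const] the factor 2^k
    bounds the number of points of a mixed difference. Replacing A by |A| + 1 makes both constants
    positive whatever the sign of A. *)
Definition cancel_const (A5 : R) : R := (`|A5| + 1) * (2 ^+ L) ^+ k.
Definition maximal_const (A1 : R) : R := (2 ^ k)%:R * (`|A1| + 1).

Lemma cancel_const_gt0 a : 0 < cancel_const a.
Proof. by rewrite mulr_gt0 ?exprn_gt0// ltr_wpDl. Qed.

Lemma maximal_const_gt0 a : 0 < maximal_const a.
Proof. by rewrite mulr_gt0 ?ltr_wpDl// ltr0n expn_gt0. Qed.

Lemma dyadic_op_linear g n (v : grid n) :
  linear_operator mu (Lp_add mu p0%:E 2%:E) (dyadic_op g v).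
Proof.
rewrite dyadic_opE; apply: linear_operator_signed_sum => q hq; apply: Hlin.
by have [] := grid_points_cube (lft0 g) hq.
Qed.

Lemma dyadic_op_pint q g n (v : grid n) f : 0 < q -> cancellation mu q A5 L H lft ->
  Lp mu q%:E f ->
  (pint mu q (dyadic_op g v f) <= ((cancel_const A5 / 2 ^+ weight n) `^ q)%:E * pint mu q f)%E.
Proof.
move=> q0 hc hf; have [c1 c2] := grid_point_cube L v (lft0 g).
have b0 : 0 <= cancel_const A5 / 2 ^+ weight n.
  by rewrite divr_ge0 ?exprn_ge0// ltW// cancel_const_gt0.
apply/(cnorm_leP _ _ _ q0 b0).
apply: (le_trans (hc (positive_level n) g _ _ (posorthant_step_size L n (lft0 g)) c1 c2 f hf)).
have nf : (0 <= cnorm mu q%:E f)%E by rewrite cnorm_poweR// poweR_ge0.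
apply: lee_wpmul2r => //; rewrite lee_fin.
have r0 : 0 <= \prod_(i in positive_level n)
    (step_size L (lft g) n ord0 i / grid_point L (lft g) v ord0 i).
  apply: prodr_ge0 => i _; have := posorthant_step_size L n (lft0 g) i.
  have [c11 _ _] := c1; have := c11 i; rewrite [(0 : 'rV_k) _ _]mxE => h1 h2.
  by rewrite divr_ge0 ?(ltW h1) ?(ltW h2).
apply: (@le_trans _ _ ((`|A5| + 1) * \prod_(i in positive_level n)
    (step_size L (lft g) n ord0 i / grid_point L (lft g) v ord0 i))).
  by rewrite ler_wpM2r// (le_trans (ler_norm _))// lerDl.
rewrite /cancel_const -mulrA ler_wpM2l ?addr_ge0//.
exact: prod_step_ratio_le (lft0 g).
Qed.

Lemma Lp2_Lp_add f : Lp mu 2%:E f -> Lp_add mu p0%:E 2%:E f.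
Proof.
move=> hf; exists (fun=> 0), f; split => //; first exact: Lp0.
by apply/funext => x; rewrite add0r.
Qed.

Lemma dyadic_op_L2bounded g n (v : grid n) : L2bounded mu (dyadic_op g v).
Proof.
split.
  exact: linear_operator_sub (@Lp2_Lp_add) (dyadic_op_linear g v).
exists ((cancel_const A5 / 2 ^+ weight n) `^ 2); first exact: powR_ge0.
by move=> f hf; exact: (dyadic_op_pint g v (ltr0n _ 2) Hc2 hf).
Qed.

Lemma Lp_Lp_add q f : p0 < q -> q <= 2 -> Lp mu q%:E f -> Lp_add mu p0%:E 2%:E f.
Proof.
move=> q0 q2 hf; have qg : 0 < q by exact: lt_trans q0.
have mf := Lp_cmeasurable hf.
pose B := [set t | 1 < nrm (f t)]; have mB : measurable B by exact: measurable_nrm_gt.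
exists (cut B f), (cut (~` B) f); split.
- apply: pint_Lp => //; first exact: cmeasurable_cut.
  apply: (@le_lt_trans _ _ (1%:E * pint mu q f)%E); last by rewrite mul1e; exact: Lp_pint.
  apply: pint_cut_le => // t h; rewrite mul1r; apply: ler_powR; exact: ltW.
- have mB' : measurable (~` B) by exact: measurableC.
  apply: pint_Lp => //; first exact: cmeasurable_cut.
  apply: (@le_lt_trans _ _ (1%:E * pint mu q f)%E); last by rewrite mul1e; exact: Lp_pint.
  apply: pint_cut_le => // t /negP; rewrite -leNgt mul1r => h.
  have [->|fn0] := eqVneq (nrm (f t)) 0; first by rewrite !powR0 ?gt_eqF.
  rewrite (powR_shift _ q)// -[leRHS]mul1r ler_wpM2r ?powR_ge0//.
  apply: (@le_trans _ _ (1 `^ (2 - q))); last by rewrite powR1.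
  by apply: ge0_ler_powR; rewrite ?nnegrE ?nrm_ge0 ?subr_ge0.
- by apply/funext => t; rewrite -sub_cut addrC subrK.
Qed.

Lemma measurable_bigmax (E : Type) (s : seq E) (F : E -> T -> R) :
  (forall e, measurable_fun setT (F e)) ->
  measurable_fun setT (fun t => \big[Num.max/0]_(e <- s) F e t).
Proof.
move=> mF; elim: s => [|e s ih].
  by under eq_fun do rewrite big_nil; exact: measurable_cst.
by under eq_fun do rewrite big_cons; exact: measurable_maxr.
Qed.

(** The maximal function is not known to be measurable; the maximum of finitely many moduli is, and
    it lies below 2^k times the maximal function. It therefore serves as the majorant [Z]. *)
Lemma dyadic_op_maximal n (W : finType) (w : W -> 'rV[int]_r * grid n)
  (f0 : T -> R[i]) (F : W -> T -> R[i]) :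
  Lp mu p1%:E f0 -> (forall e, cmeasurable (F e)) ->
  (forall e u, nrm (F e u) <= nrm (f0 u)) ->
  exists Z : T -> R, [/\ measurable_fun setT Z, forall u, 0 <= Z u,
    forall e u, nrm (dyadic_op (w e).1 (w e).2 (F e) u) <= Z u &
    (\int[mu]_u (Z u `^ p1)%:E <= (maximal_const A1 `^ p1)%:E * pint mu p1 f0)%E].
Proof.
move=> hf0 mF Ff; pose Y e u : R := nrm (dyadic_op (w e).1 (w e).2 (F e) u).
have LF e : Lp_add mu p0%:E 2%:E (F e).
  apply: (@Lp_Lp_add p1) => //; apply: pint_Lp => //.
  apply: le_lt_trans (Lp_pint p1g hf0); apply: pint_le (Ff e); exact: ltW.
exists (fun u => \big[Num.max/0]_e Y e u); split.
- apply: measurable_bigmax => e; apply: measurable_nrm.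
  by have [h _ _] := dyadic_op_linear (w e).1 (w e).2; exact: h.
- by move=> u; exact: bigmax_ge_id.
- by move=> e u; apply: (le_bigmax _ (fun e => Y e u)).
have pc : (2 ^ k)%:R != 0 :> R by rewrite pnatr_eq0 expn_eq0.
have a0 : 0 <= `|A1| + 1 by rewrite addr_ge0.
have hM : ('N[mu]_p1%:E[maximal H f0] <= (`|A1| + 1)%:E * cnorm mu p1%:E f0)%E.
  apply: (le_trans (Hmax hf0)); apply: lee_wpmul2r.
    by rewrite cnorm_poweR// poweR_ge0.
  by rewrite lee_fin (le_trans (ler_norm _))// lerDl.
move/(Lnorm_leP _ _ _ p1g a0) : hM => hM.
have one0 : posorthant (const_mx 1 : 'rV[R]_k) by move=> i; rewrite !mxE.
have m0 u : (0 <= maximal H f0 u)%E.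
  apply: (@le_trans _ _ (nrm (H (const_mx 1) (fun=> 0) u))%:E); first by rewrite lee_fin nrm_ge0.
  apply: ereal_sup_ubound; exists (const_mx 1), (fun=> 0).
  split; [exact: one0|by split; exact: measurable_cst| |by []].
  by move=> y; rewrite nrm0 nrm_ge0.
have YM e u (M : R) : maximal H f0 u = M%:E -> Y e u <= (2 ^ k)%:R * M.
  move=> uM; have M0 : 0 <= M by rewrite -lee_fin -uM.
  rewrite /Y dyadic_opE; apply: (@le_trans _ _ ((size (grid_points L (lft (w e).1) (w e).2))%:R * M)).
    apply: nrm_signed_sum_le => q hq; rewrite -lee_fin -uM; apply: ereal_sup_ubound.
    exists q.2, (F e); split => //.
    by have [] := grid_points_cube (lft0 _) hq.
  rewrite ler_wpM2r// ler_nat size_grid_points leq_pexp2l//.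
  by rewrite -[leqRHS]card_ord max_card.
rewrite /maximal_const powRM// EFinM -muleA.
apply: (@le_trans _ _ (((2 ^ k)%:R `^ p1)%:E * \int[mu]_x (`|maximal H f0 x| `^ p1))%E); last first.
  by apply: lee_wpmul2l => //; rewrite lee_fin powR_ge0.
apply: (le_trans _ (lower_integralZl _ _ _)); last 2 first.
- by rewrite powR_gt0// ltr0n expn_gt0.
- by move=> u; exact: poweR_ge0.
apply: le_lower_integral => u; first by rewrite lee_fin powR_ge0.
have := m0 u; case uM : (maximal H f0 u) => [M| |]// M0.
  rewrite gee0_abs// poweR_EFin -EFinM lee_fin -powRM//.
  apply: ge0_ler_powR; rewrite ?nnegrE ?(ltW p1g) ?mulr_ge0 ?bigmax_ge_id//.
  by apply: bigmax_le; [rewrite mulr_ge0|move=> e _; exact: YM].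
by rewrite poweRyr ?gt_eqF// gt0_muley ?leey// lte_fin powR_gt0// ltr0n expn_gt0.
Qed.

Section class_forms.
Context (G : finType) (io : G -> 'rV[int]_r) (n : {ffun 'I_k -> nat}).
Let W : finType := (G * grid n)%type.
Let U (w : W) := dyadic_op (io w.1) w.2.
Let th := p0 / 2.
Let D : R := 2 ^+ weight n.

Let D1 : 1 <= D. Proof. by rewrite /D; apply: exprn_ege1; rewrite ler1n. Qed.
Let D0 : 0 < D. Proof. exact: lt_le_trans ltr01 D1. Qed.
Let th0 : 0 < th. Proof. by rewrite /th divr_gt0. Qed.
Let th1 : 0 < 1 - th.
Proof. by rewrite subr_gt0 /th ltr_pdivrMr// mul1r (lt_le_trans hp01). Qed.

Let Ulin w : L2bounded mu (U w). Proof. exact: dyadic_op_L2bounded. Qed.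

Let Umax f0 (F : W -> T -> R[i]) : Lp mu p1%:E f0 -> (forall e, cmeasurable (F e)) ->
  (forall e u, nrm (F e u) <= nrm (f0 u)) ->
  exists Z : T -> R, [/\ measurable_fun setT Z, forall u, 0 <= Z u,
    forall e u, nrm (U e (F e) u) <= Z u &
    (\int[mu]_u (Z u `^ p1)%:E <= (maximal_const A1 `^ p1)%:E * pint mu p1 f0)%E].
Proof. exact: (dyadic_op_maximal (fun w : W => (io w.1, w.2))). Qed.

Let Ubd (e : W) f : Lp mu p0%:E f -> Lp mu 2%:E f ->
  (pint mu p0 (U e f) <= ((cancel_const A5 / D) `^ p0)%:E * pint mu p0 f)%E.
Proof. by move=> hf _; exact: dyadic_op_pint. Qed.

Let card_fst g : (#|[pred e : W | e.1 == g]| <= 2 ^ weight n)%N.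
Proof.
by rewrite card_fst_fiber card_grid.
Qed.

Let card_id (w : W) : (#|[pred e : W | e == w]| <= 1)%N.
Proof. by rewrite (@eq_card _ _ (pred1 w)) ?card1// => e; rewrite !inE. Qed.

Let gN0 : (0 < 2 ^ weight n)%N. Proof. by rewrite expn_gt0. Qed.
Let DE : (2 ^ weight n)%:R = D. Proof. by rewrite natrX. Qed.
Let c0 := cancel_const_gt0 A5.
Let m0 := maximal_const_gt0 A1.
Let M0 : 0 < cancel_const A5 / D. Proof. by rewrite divr_gt0. Qed.

(** Each cube feeds its component to D = 2^(weight n) operators. Their l^p0 sum costs D^(1/p0), and
    the gain 1 / D of each operator pays for it because p0 >= 1: the bound is uniform in the
    level. *)
Lemma class_form_direct :
  form_bound mu (fun w : W => w.1) id U ((1 - th) / p1 + th / p0)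
    (maximal_const A1 `^ (1 - th) * cancel_const A5 `^ th).
Proof.
apply: form_bound_le (maximal_form_bound (s := fun w : W => w.1) (t := id) Ulin hp0 hp01 hp1 m0 M0 gN0
  (ltnSn 0) card_fst card_id Umax Ubd).
rewrite DE mul1r ler_wpM2l ?powR_ge0// powR1 mulr1.
apply: ge0_ler_powR; rewrite ?nnegrE ?powR_ge0 ?(ltW th0) ?(ltW c0)//.
rewrite -[leRHS]powRr1 ?(ltW c0)// -[X in _ <= _ `^ X](mulfV (lt0r_neq0 p0g)) [leRHS]powRrM.
have DD : D <= D `^ p0 by rewrite -[leLHS]powRr1 ?(ltW D0)//; exact: ler_powR.
apply: ge0_ler_powR; rewrite ?nnegrE ?mulr_ge0 ?powR_ge0 ?invr_ge0 ?(ltW p0g) ?(ltW D0)//.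
rewrite powRM ?(ltW c0) ?invr_ge0 ?(ltW D0)// -mulrA ler_piMr ?powR_ge0//.
rewrite -powR_inv1 ?(ltW D0)// -powRrM mulN1r powRN mulrC ler_pdivrMr ?mul1r//.
exact: powR_gt0.
Qed.

(** Here D operators share a component of the test family. The maximal endpoint contributes D^(1 -
    th), the other one D^(- th / p0) = D^(-1/2), and the total exponent (1 - p0) / 2 is not
    positive. *)
Lemma class_form_dual :
  form_bound mu id (fun w : W => w.1) U ((1 - th) / p1 + th / p0)
    (maximal_const A1 `^ (1 - th) * cancel_const A5 `^ th).
Proof.
apply: form_bound_le (maximal_form_bound (s := id) (t := fun w : W => w.1) Ulin hp0 hp01 hp1 m0 M0
  (ltnSn 0) gN0 card_id card_fst Umax Ubd).
rewrite DE mulr1 -powRrM mulfV ?gt_eqF// powRr1 ?(ltW M0)//.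
have Di0 : 0 <= D^-1 by rewrite invr_ge0 ltW.
rewrite (powRM _ (ltW D0) (ltW m0)) (powRM _ (ltW M0) (powR_ge0 _ _)).
rewrite (powRM _ (ltW c0) Di0) -powRrM [D `^ (1 - th) * _]mulrC -!mulrA.
rewrite ler_wpM2l ?powR_ge0// mulrCA ler_piMr ?powR_ge0//.
rewrite -powR_inv1 ?(ltW D0)// -powRrM mulN1r.
rewrite -!powRD; try by rewrite (gt_eqF D0) implybT.
rewrite (_ : 1 - th + _ = (1 - p0) / 2); last by rewrite /th; field; rewrite gt_eqF.
rewrite -[leRHS](@powRr0 R D); apply: ler_powR => //.
by rewrite pmulr_lle0 ?invr_gt0// subr_le0.
Qed.

End class_forms.

End dyadic_operators.

(** * Decay in the level over a finite family of cubes *)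

Section class_bounds.
Context d (T : measurableType d) (R : realType) (mu : {sigma_finite_measure set T -> \bar R}).
Context (k r L : nat) (lft : 'rV[int]_r -> 'rV[R]_k) (p0 A5 a2 aQ B eps t tau Q M : R).
Context (H : 'rV[R]_k -> (T -> R[i]) -> (T -> R[i])) (S : 'rV[int]_r -> (T -> R[i]) -> (T -> R[i])).
Context (c : 'rV[int]_r -> R).
Hypotheses (hp0 : 1 <= p0) (hp02 : p0 < 2).
Hypothesis lft0 : forall g, posorthant (lft g).
Hypothesis Hlin : forall s, posorthant s -> linear_operator mu (Lp_add mu p0%:E 2%:E) (H s).
Hypothesis Hc2 : cancellation mu 2 A5 L H lft.
Hypothesis Slin : forall g, linear_operator mu (Lp_above mu p0) (S g).
Hypothesis SR : resolution_of_identity mu S.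
Hypothesis LP2 : LP_estimate mu 2 a2 S.
Hypothesis LPQ : LP_estimate mu Q^-1 aQ S.
Hypothesis c0 : forall h, 0 < c h.
Hypothesis AO : almost_orthogonality mu L H lft S c.
Hypotheses (Q0 : 0 < Q) (Q1 : Q < 1) (t0 : 0 < t) (ttau : t <= tau) (tau1 : tau <= 1).
Hypotheses (eps0 : 0 < eps) (eps1 : eps < 2^-1) (M0 : 0 < M).
Hypothesis hB : (\esum_(h in [set: 'rV[int]_r]) (c h `^ ((2^-1 - eps) * t))%:E <= B%:E)%E.

Lemma sum_pint2 (G : finType) (F : G -> T -> R[i]) : (forall g, cmeasurable (F g)) ->
  (\sum_g pint mu 2 (F g) = \int[mu]_x (nrm2 F x `^ (2 * 2^-1)^-1)%:E)%E.
Proof.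
move=> mF; under eq_bigr do rewrite pint2E.
rewrite -int_sum; last 2 first.
- by move=> g x; exact: sqr_ge0.
- by move=> g; apply: measurable_funX; exact: measurable_nrm.
by apply: eq_integral => x _; rewrite mulfV// invr1 powRr1// nrm2_ge0.
Qed.

Let ub (a : R) := `|a| + 1.
Let ub0 a : 0 < ub a. Proof. by rewrite ltr_wpDl. Qed.

Let LP_ub q a : 0 < q -> LP_estimate mu q a S -> LP_estimate mu q (ub a) S.
Proof.
move=> q0 h f hf; apply: (le_trans (h f hf)); apply: lee_wpmul2r.
  by rewrite cnorm_poweR// poweR_ge0.
by rewrite lee_fin (le_trans (ler_norm _))// lerDl.
Qed.

Lemma LP_finite (G : finType) (j : G -> 'rV[int]_r) (Q' a : R) f : injective j -> 0 < Q' ->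
  LP_estimate mu Q'^-1 a S -> Lp mu (Q'^-1)%:E f ->
  (\int[mu]_x (nrm2 (fun g => S (j g) f) x `^ (2 * Q')^-1)%:E <=
   (ub a `^ Q'^-1)%:E * pint mu Q'^-1 f)%E.
Proof.
move=> ij Q'0 h hf; apply: (@l2sum_finite _ _ _ mu r G j (fun g => S g f)) => //.
  exact: ltW.
by apply: LP_ub => //; rewrite invr_gt0.
Qed.

Let half0 : 0 < 2^-1 :> R. Proof. by rewrite invr_gt0. Qed.

Let L2_above f : Lp mu 2%:E f -> Lp_above mu p0 f.
Proof.
move=> hf; exists 2; split => //; exists f, (fun=> 0); split => //; first exact: Lp0.
by apply/funext => x; rewrite addr0.
Qed.

Let Sm g f : Lp mu 2%:E f -> cmeasurable (S g f).
Proof. by move=> /L2_above; have [h _ _] := Slin g; exact: h. Qed.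

Lemma sum_pint2_LP (G : finType) (j : G -> 'rV[int]_r) f : injective j -> Lp mu 2%:E f ->
  (\sum_g pint mu 2 (S (j g) f) <= (ub a2 `^ 2)%:E * pint mu 2 f)%E.
Proof.
move=> ij hf; rewrite sum_pint2; last by move=> g; exact: Sm.
have := @LP_finite G j 2^-1 a2 f ij half0; rewrite invrK; exact.
Qed.

(** The square function at p = 2, restricted to the single index g. *)
Lemma S_L2bounded g : L2bounded mu (S g).
Proof.
split; first exact: (linear_operator_sub (@L2_above) (Slin g)).
exists (ub a2 `^ 2); first exact: powR_ge0.
move=> f hf; have ij : injective (fun _ : unit => g) by move=> [] [].
by have := sum_pint2_LP ij hf; rewrite (big_pred1 tt).
Qed.

Section one_class.
Context (G : finType) (io : G -> 'rV[int]_r) (n : {ffun 'I_k -> nat}).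
Hypothesis ioI : injective io.
Let W : finType := (G * grid n)%type.
Let U (w : W) := dyadic_op L lft H (io w.1) w.2.
Let D : R := 2 ^+ weight n.
Let D0 : 0 < D. Proof. by rewrite exprn_gt0. Qed.

Let shiftI h : injective (fun g => io g + h).
Proof. by move=> g g' /addIr/ioI. Qed.

Let U_L2 w : L2bounded mu (U w). Proof. exact: (dyadic_op_L2bounded hp0 lft0 Hlin Hc2). Qed.

(* There are D = 2 ^ weight n grid points and each operator gains 1 / D, so the square root
   of the sum of squares gains D ^ (-1/2); in the almost orthogonal bound it loses D ^ (1/2). *)
Lemma class_cancellation h f : Lp mu 2%:E f ->
  (\sum_(w : W) pint mu 2 (U w (S (io w.1 + h) f)) <=
   ((cancel_const k L A5 * ub a2 * D `^ (- 2^-1)) ^+ 2)%:E * pint mu 2 f)%E.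
Proof.
move=> hf; set b := cancel_const k L A5.
have b0 : 0 < b by exact: cancel_const_gt0.
apply: (@le_trans _ _ (\sum_(w : W) ((b / D) `^ 2)%:E * pint mu 2 (S (io w.1 + h) f))%E).
  apply: lee_sum => w _; apply: (dyadic_op_pint lft0 _ _ _ Hc2) => //.
  exact: (L2bounded_Lp (S_L2bounded _)).
rewrite -ge0_sume_distrr; last by move=> w _; exact: pint_ge0.
rewrite -(pair_bigA _ (fun g (v : grid n) => pint mu 2 (S (io g + h) f)))/=.
have pf : pint mu 2 f \is a fin_num by rewrite ge0_fin_numE ?pint_ge0//; exact: Lp_pint.
have hS := sum_pint2_LP (@shiftI h) hf.
rewrite exchange_big/=; apply: (@le_trans _ _ (((b / D) `^ 2)%:E *
    \sum_(v : grid n) (ub a2 `^ 2 * fine (pint mu 2 f))%:E)%E).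
  apply: lee_wpmul2l; first by rewrite lee_fin powR_ge0.
  by apply: lee_sum => v _; rewrite EFinM fineK.
rewrite sumEFin sumr_const card_grid -{2}(fineK pf) -!EFinM lee_fin.
rewrite -[X in _ * X]mulr_natl natrX -/D mulrA mulrA ler_wpM2r ?fine_ge0 ?pint_ge0//.
rewrite !powR_mulrn ?(ltW (ub0 _)) ?divr_ge0 ?(ltW b0) ?(ltW D0)//.
rewrite !exprMn -[(D `^ _) ^+ 2]powR_mulrn ?powR_ge0// -powRrM mulNr mulVf// powR_inv1 ?(ltW D0)//.
rewrite le_eqVlt; apply/orP; left; apply/eqP; field.
by rewrite gt_eqF.
Qed.

(** For a fixed cell v and position j, the j-th points of the mixed differences in the different
    cubes form an admissible choice of s_g, so almost orthogonality bounds their sum by c_h^2.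
    Cauchy-Schwarz over the at most 2^k positions costs the square of their number, and the D cells
    cost D. *)
Lemma class_orthogonality h f : Lp mu 2%:E f ->
  (\sum_(w : W) pint mu 2 (U w (S (io w.1 + h) f)) <=
   (((2 ^ k)%:R * D `^ 2^-1 * c h) ^+ 2)%:E * pint mu 2 f)%E.
Proof.
move=> hf; pose N := (2 ^ #|positive_level n|)%N.
have NK : (N <= 2 ^ k)%N.
  by rewrite leq_pexp2l// -[leqRHS]card_ord max_card.
have pf : pint mu 2 f \is a fin_num by rewrite ge0_fin_numE ?pint_ge0//; exact: Lp_pint.
have pf0 : 0 <= fine (pint mu 2 f) by rewrite fine_ge0// pint_ge0.
pose s (v : grid n) (j : 'I_N) g :=
  (nth (false, grid_point L (lft g) v) (grid_points L (lft g) v) j).2.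
have sC v j g : cube L (lft g) (s v j g).
  apply: (grid_points_cube (lft0 g)); apply: mem_nth.
  by rewrite size_grid_points.
pose F v j g := H (s v j g) (S (g + h) f).
have mF v j g : cmeasurable (F v j g).
  have [p1 _ _] := sC v j g; have [h1 _ _] := Hlin p1.
  apply: h1; apply: Lp2_Lp_add => //.
  exact: L2bounded_Lp (S_L2bounded _) hf.
have hF v j : (\sum_g pint mu 2 (F v j (io g)) <= ((c h) ^+ 2)%:E * pint mu 2 f)%E.
  rewrite sum_pint2; last by move=> g; exact: mF.
  rewrite -powR_mulrn ?(ltW (c0 h))//.
  have := @l2sum_finite _ _ _ mu r G io (F v j) 2^-1 (c h) f ioI half0 (ltW (c0 h)).
  rewrite invrK; apply; exact: (AO h (sC v j) hf).
have hU g v : (pint mu 2 (U (g, v) (S (io g + h) f)) <= N%:R%:E * \sum_(j < N) pint mu 2 (F v j (io g)))%E.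
  rewrite !pint2E; under eq_bigr do rewrite pint2E.
  have mF2 j : measurable_fun setT (fun x => nrm (F v j (io g) x) ^+ 2).
    by apply: measurable_funX; apply: measurable_nrm; exact: mF.
  have F20 j x : 0 <= nrm (F v j (io g) x) ^+ 2 by exact: sqr_ge0.
  rewrite -int_sum// -intZ//; last 2 first.
  - by move=> x; apply: sumr_ge0 => j _.
  - exact: measurable_sum.
  apply: int_le => x; first exact: sqr_ge0.
  rewrite /U dyadic_opE/=; apply: (le_trans (nrm_signed_sum_sqr _ _ _ _)).
  rewrite size_grid_points ler_wpM2l//.
  rewrite (big_nth (false, grid_point L (lft (io g)) v)) size_grid_points big_mkord.
  by apply: ler_sum.
rewrite -(pair_bigA _ (fun g (v : grid n) => pint mu 2 (U (g, v) (S (io g + h) f))))/=.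
apply: (@le_trans _ _ (\sum_(g : G) \sum_(v : grid n) (N%:R%:E * \sum_(j < N) pint mu 2 (F v j (io g))))%E).
  by apply: lee_sum => g _; apply: lee_sum => v _; exact: hU.
rewrite exchange_big/=.
apply: (@le_trans _ _ (\sum_(v : grid n) (N%:R * (N%:R * (c h ^+ 2 * fine (pint mu 2 f))))%:E)%E).
  apply: lee_sum => v _; rewrite -ge0_sume_distrr; last first.
    by move=> g _; apply: sume_ge0 => j _; exact: pint_ge0.
  rewrite EFinM; apply: lee_wpmul2l => //; rewrite exchange_big/=.
  rewrite [leRHS](_ : _ = (\sum_(j < N) (c h ^+ 2 * fine (pint mu 2 f))%:E)%E); last first.
    by rewrite sumEFin sumr_const card_ord mulr_natl.
  by apply: lee_sum => j _; rewrite EFinM fineK.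
rewrite sumEFin sumr_const card_grid -(fineK pf) -!EFinM lee_fin.
rewrite [fine (fine _)%:E]/= -[X in X <= _]mulr_natl natrX -/D !mulrA ler_wpM2r//.
rewrite !exprMn -[(D `^ _) ^+ 2]powR_mulrn ?powR_ge0// -powRrM mulVf// powRr1 ?(ltW D0)//.
have NN : N%:R ^+ 2 <= (2 ^ k)%:R ^+ 2 :> R by rewrite lerXn2r ?nnegrE// ler_nat.
rewrite (_ : D * _ * _ * _ * _ = D * c h ^+ 2 * N%:R ^+ 2); last by ring.
rewrite (_ : _ * D * _ = D * c h ^+ 2 * (2 ^ k)%:R ^+ 2); last by ring.
by rewrite ler_wpM2l// mulr_ge0 ?sqr_ge0// ltW.
Qed.

Hypothesis hform : form_bound mu (fun w : W => w.1) id U Q M.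

Let P := (1 - tau) * Q + tau * 2^-1.

(** The factors come from the exponent [Q], from L^2 and from the sum over the shifts; the decay in
    the level is kept apart. *)
Definition class_const : R :=
  (ub aQ * M) `^ (1 - tau) *
  ((cancel_const k L A5 * ub a2) `^ (2^-1 + eps) * (2 ^ k)%:R `^ (2^-1 - eps)) `^ tau *
  (B `^ ((tau - t) / t) * B).

(** On L^2 the power of D is -1/2 with weight 1/2 + eps against 1/2 with weight 1/2 - eps, in total
    -eps. The interpolation parameter multiplies it by tau. *)
Lemma class_bound f : Lp mu (P^-1)%:E f -> weakly_approximable mu U f ->
  (\int[mu]_x (nrm2 (fun w => U w f) x `^ (2 * P)^-1)%:E <=
   ((class_const * D `^ (- (eps * tau))) `^ P^-1)%:E * pint mu P^-1 f)%E.
Proof.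
have b0 : 0 < cancel_const k L A5 by exact: cancel_const_gt0.
have X0 : 0 < cancel_const k L A5 * ub a2 * D `^ (- 2^-1) by rewrite !mulr_gt0 ?powR_gt0.
have Y0 : 0 < (2 ^ k)%:R * D `^ 2^-1 by rewrite mulr_gt0 ?powR_gt0// ltr0n expn_gt0.
have hA h f0 : Lp mu 2%:E f0 -> Lp mu (Q^-1)%:E f0 ->
    (\int[mu]_x (nrm2 (fun g => S (io g + h) f0) x `^ (2 * Q)^-1)%:E <=
     (ub aQ `^ Q^-1)%:E * pint mu Q^-1 f0)%E.
  by move=> _ hf0; exact: (LP_finite (@shiftI h) Q0 LPQ hf0).
move=> hf wf.
have := class_estimate U_L2 S_L2bounded SR Q0 Q1 t0 ttau tau1 eps0 eps1 (ub0 aQ) X0 Y0 c0 hform hA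
  class_cancellation class_orthogonality hB hf wf.
rewrite -/P; suff -> : ((cancel_const k L A5 * ub a2 * D `^ (- 2^-1)) `^ (2^-1 + eps) *
    ((2 ^ k)%:R * D `^ 2^-1) `^ (2^-1 - eps)) `^ tau =
    ((cancel_const k L A5 * ub a2) `^ (2^-1 + eps) * (2 ^ k)%:R `^ (2^-1 - eps)) `^ tau *
    D `^ (- (eps * tau)).
  suff -> : class_const * D `^ (- (eps * tau)) = (ub aQ * M) `^ (1 - tau) *
    (((cancel_const k L A5 * ub a2) `^ (2^-1 + eps) * (2 ^ k)%:R `^ (2^-1 - eps)) `^ tau *
     D `^ (- (eps * tau))) * (B `^ ((tau - t) / t) * B) by [].
  by rewrite /class_const mulrAC -!mulrA.
have e1 : 0 <= D `^ (- 2^-1) by exact: powR_ge0.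
have e2 : 0 <= D `^ 2^-1 by exact: powR_ge0.
have n0 : 0 <= (2 ^ k)%:R :> R by [].
have ba0 : 0 <= cancel_const k L A5 * ub a2 by rewrite mulr_ge0// ltW.
rewrite (powRM _ ba0 e1) (powRM _ n0 e2) mulrACA.
rewrite -[(D `^ (- 2^-1)) `^ _]powRrM -[(D `^ 2^-1) `^ _]powRrM -powRD; last first.
  by rewrite (gt_eqF D0) implybT.
rewrite [LHS]powRM ?mulr_ge0 ?powR_ge0//; congr (_ * _).
by rewrite -powRrM; congr (_ `^ _); field.
Qed.

End one_class.

End class_bounds.

(** * Multi-parameter telescoping *)

Section tensor_differences.
Context (R : realType) (k : nat).
Implicit Types (s h : 'rV[R]_k) (a : 'rV[R]_k -> R[i]).

Definition flip (j : 'I_k) (s : {ffun 'I_k -> bool}) : {ffun 'I_k -> bool} :=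
  [ffun i => if i == j then ~~ s i else s i].

Lemma flipK j : involutive (flip j).
Proof.
by move=> s; apply/ffunP => i; rewrite !ffunE; case: eqP => // _; rewrite negbK.
Qed.

Lemma sum_flip (V : nmodType) (j : 'I_k) (F : {ffun 'I_k -> bool} -> V) :
  \sum_(s : {ffun 'I_k -> bool} | ~~ s j) F s = \sum_(s : {ffun 'I_k -> bool} | s j) F (flip j s).
Proof.
rewrite (reindex_inj (inv_inj (flipK j))); apply: eq_bigl => s.
by rewrite ffunE eqxx negbK.
Qed.

(** The sign of the corner z of a mixed difference in the directions K, with [true] for the shifted
    end. In a direction outside K only [true] counts, so that sums may run over all boolean
    vectors. *)
Definition diff_coef (K : pred 'I_k) (s : {ffun 'I_k -> bool}) : R[i] :=
  \prod_i (if s i then 1 else if K i then -1 else 0).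

Lemma diff_coef_flip (K : pred 'I_k) j (s : {ffun 'I_k -> bool}) : K j -> s j ->
  diff_coef K (flip j s) = - diff_coef K s.
Proof.
move=> Kj sj; rewrite /diff_coef (bigD1 j)//= [in RHS](bigD1 j)//= ffunE eqxx sj/= Kj mulN1r mul1r.
congr (- _); apply: eq_bigr => i ij.
by rewrite ffunE (negbTE ij).
Qed.

Lemma foldr_diff1E h a (l : seq 'I_k) s : uniq l ->
  foldr (diff1 h) a l s = \sum_(z : {ffun 'I_k -> bool}) diff_coef (mem l) z *
    a (\row_i (s ord0 i + (if (i \in l) && z i then h ord0 i else 0))).
Proof.
elim: l s => [|j l ih] s /=.
  move=> _; rewrite (bigD1 [ffun=> true])//= big1 ?addr0.
    rewrite /diff_coef big1 ?mul1r; last by move=> i _; rewrite ffunE.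
    by congr (a _); apply/rowP => i; rewrite mxE addr0.
  move=> z zn; rewrite /diff_coef; have [i zi] : exists i, ~~ z i.
    apply/existsP; apply: contraNT zn; rewrite negb_exists => /forallP h1.
    by apply/eqP/ffunP => i; rewrite ffunE; have := h1 i; rewrite negbK.
  by rewrite (bigD1 i)//= (negbTE zi) mul0r mul0r.
move=> /andP[jl ul]; rewrite /diff1 !ih//.
have ps (F : {ffun 'I_k -> bool} -> R[i]) : (forall z : {ffun 'I_k -> bool}, ~~ z j -> F z = 0) ->
    \sum_z F z = \sum_(z : {ffun 'I_k -> bool} | z j) F z.
  by move=> F0; rewrite [LHS](bigID (fun z : {ffun 'I_k -> bool} => z j))/= [X in _ + X]big1 ?addr0.
have c0 (z : {ffun 'I_k -> bool}) : ~~ z j -> diff_coef (mem l) z = 0.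
  move=> zj; rewrite /diff_coef (bigD1 j)//= (negbTE zj).
  by rewrite (negbTE jl) mul0r.
have ce (z : {ffun 'I_k -> bool}) : z j -> diff_coef (mem (j :: l)) z = diff_coef (mem l) z.
  move=> zj; rewrite /diff_coef; apply: eq_bigr => i _.
  rewrite /= in_cons; have [->|ij] := eqVneq i j; first by rewrite zj.
  by rewrite orFb.
rewrite ps; last by move=> z /c0 ->; rewrite mul0r.
rewrite (ps (fun z : {ffun 'I_k -> bool} => diff_coef (mem l) z * a (\row_i (s ord0 i + _)))); last first.
  by move=> z /c0 ->; rewrite mul0r.
rewrite [RHS](bigID (fun z : {ffun 'I_k -> bool} => z j))/=; congr (_ + _).
  apply: eq_bigr => z zj; rewrite ce//; congr (_ * a _); apply/rowP => i.
  rewrite !mxE eqxx/= inE; have [->|ij] := eqVneq i j.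
    by rewrite (negbTE jl) zj mulr1 addr0.
  by rewrite mulr0 addr0 orFb.
rewrite sum_flip -sumrN; apply: eq_bigr => z zj.
rewrite [diff_coef _ (flip j z)](_ : _ = - diff_coef (mem l) z); last first.
  by rewrite -ce//; apply: diff_coef_flip => //=; exact: mem_head.
rewrite mulNr; congr (- (_ * a _)); apply/rowP => i.
rewrite !mxE inE ffunE; have [->|ij] := eqVneq i j; last by rewrite orFb.
by rewrite (negbTE jl) zj.
Qed.

Lemma mixed_diff_tensor h (K : {set 'I_k}) a s :
  mixed_diff h K a s = \sum_(z : {ffun 'I_k -> bool}) diff_coef (mem K) z *
    a (\row_i (s ord0 i + (if (i \in K) && z i then h ord0 i else 0))).
Proof.
rewrite /mixed_diff foldr_diff1E ?enum_uniq//; apply: eq_bigr => z _.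
congr (_ * a _); last by apply/rowP => i; rewrite !mxE mem_enum.
by apply: eq_bigr => i _; rewrite /= mem_enum.
Qed.

Section telescoping.
Variables (N : nat).

Definition lower_level (q : 'I_N.+1) (b : bool) : 'I_N.+1 := if b then q else inord q.-1.

(** Telescoping in one variable, written for indicators: the indicator of N is that of 0 plus the
    successive differences. At q = 0 the coefficient of the lower term is 0, so the default value of
    the predecessor is harmless. *)
Lemma telescope_indicator (m : 'I_N.+1) :
  \sum_(q : 'I_N.+1) \sum_(b : bool)
    (if b then 1 else if (0 < q)%N then -1 else 0) * (m == lower_level q b)%:R =
  (m == ord_max)%:R :> R[i].
Proof.
under eq_bigr do rewrite big_bool/= mul1r.
rewrite big_split/=; have -> : \sum_(q < N.+1) (m == q)%:R = 1 :> R[i].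
  by rewrite (bigD1 m)//= eqxx big1 ?addr0// => q /negbTE qm; rewrite eq_sym qm.
rewrite big_ord_recl/= mul0r add0r.
have -> : \sum_(i < N) (if (0 < lift ord0 i)%N then -1 else 0) * (m == inord (lift ord0 i).-1)%:R =
    - (m < N)%:R :> R[i].
  under eq_bigr do rewrite /= mulN1r.
  rewrite sumrN; congr (- _).
  have e (i : 'I_N) : (m == inord (bump 0 i).-1) = (i == m :> nat).
    rewrite (_ : (bump 0 i).-1 = i)// -val_eqE/= inordK; first exact: eq_sym.
    exact: leqW (ltn_ord i).
  under eq_bigr do rewrite e.
  have [mN|Nm] := ltnP m N; last first.
    by rewrite big1// => i _; rewrite ltn_eqF// (leq_trans _ Nm).
  rewrite (bigD1 (Ordinal mN))//= eqxx big1 ?addr0// => i im.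
  by rewrite -val_eqE/= in im; rewrite (negbTE im).
rewrite -val_eqE/=; have := ltn_ord m; rewrite ltnS leq_eqVlt => /orP[/eqP ->|mN].
  by rewrite eqxx ltnn subr0.
by rewrite mN subrr ltn_eqF.
Qed.

(** The product over the k coordinates of the one-variable identity, multiplied out and paired with
    A. *)
Lemma tensor_telescope (A : {ffun 'I_k -> 'I_N.+1} -> R[i]) :
  A [ffun=> ord_max] = \sum_(n : {ffun 'I_k -> 'I_N.+1}) \sum_(z : {ffun 'I_k -> bool})
    diff_coef (fun i => (0 < n i)%N) z * A [ffun i => lower_level (n i) (z i)].
Proof.
have ind (m m' : {ffun 'I_k -> 'I_N.+1}) : \prod_i (m i == m' i)%:R = (m == m')%:R :> R[i].
  have [->|mm] := eqVneq m m'; first by rewrite big1// => i _; rewrite eqxx.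
  have [i /negbTE mi] : exists i, m i != m' i.
    apply/existsP; apply: contraNT mm; rewrite negb_exists => /forallP h.
    by apply/eqP/ffunP => i; have := h i; rewrite negbK => /eqP.
  by rewrite (bigD1 i)//= mi mul0r.
have pick m' : A m' = \sum_m A m * \prod_i (m i == m' i)%:R.
  by rewrite (bigD1 m')//= ind eqxx mulr1 big1 ?addr0// => m /negbTE mm; rewrite ind mm mulr0.
rewrite pick; transitivity (\sum_(m : {ffun 'I_k -> 'I_N.+1}) A m *
    \sum_(n : {ffun 'I_k -> 'I_N.+1}) \sum_(z : {ffun 'I_k -> bool})
    \prod_i ((if z i then 1 else if (0 < n i)%N then -1 else 0) *
    (m i == lower_level (n i) (z i))%:R)).
  apply: eq_bigr => m _; congr (_ * _).
  under eq_bigr do rewrite ffunE -telescope_indicator.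
  rewrite bigA_distr_bigA; apply: eq_bigr => n _.
  by rewrite bigA_distr_bigA.
under eq_bigr do rewrite mulr_sumr.
rewrite exchange_big; apply: eq_bigr => n _.
under eq_bigr do rewrite mulr_sumr.
rewrite exchange_big; apply: eq_bigr => z _.
rewrite pick mulr_sumr; apply: eq_bigr => m _.
rewrite big_split/= mulrCA; congr (_ * (_ * _)).
by apply: eq_bigr => i _; rewrite ffunE.
Qed.

End telescoping.

End tensor_differences.

Section grid_expansion.
Context (R : realType) (k L : nat) (l : 'rV[R]_k) (a : 'rV[R]_k -> R[i]).

Definition diff_at (n : {ffun 'I_k -> nat}) (v : grid n) : R[i] :=
  mixed_diff (step_size L l n) (positive_level n) a (grid_point L l v).

Definition grid_pred (n : {ffun 'I_k -> nat}) (u : grid n) : grid n :=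
  finfun (fun i => Ordinal (leq_ltn_trans (leq_subr (0 < n i)%N (u i)) (ltn_ord (u i)))).

Definition odd_grid (n : {ffun 'I_k -> nat}) (u : grid n) := [forall i, (0 < n i)%N ==> odd (u i)].

(* The increment of a from level n - (1,...,1) to level n vanishes unless u is odd. *)
Definition increment (n : {ffun 'I_k -> nat}) (u : grid n) : R[i] :=
  if odd_grid u then diff_at (grid_pred u) else 0.

(** The remainder only makes the index fit its type: for y below 2^N it changes nothing
    ([grid_floor_val]). *)
Definition grid_floor N (y : 'I_k -> nat) (n : {ffun 'I_k -> nat}) : grid n :=
  finfun (fun i => Ordinal (ltn_pmod (y i %/ 2 ^ (N - n i)) (expn_gt0 2 (n i)))).

Definition nat_level N (n : {ffun 'I_k -> 'I_N.+1}) : {ffun 'I_k -> nat} :=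
  [ffun i => n i : nat].

Let lvl N (m y : nat) : R := (y %/ 2 ^ (N - m))%:R / 2 ^+ m.

Let p2 m : 2 ^+ m != 0 :> R. Proof. by rewrite expf_neq0. Qed.

Let lvl_pred N m y : (0 < m)%N -> (m <= N)%N ->
  lvl N m.-1 y = (y %/ 2 ^ (N - m) - odd (y %/ 2 ^ (N - m)))%:R / 2 ^+ m.
Proof.
case: m => // m _ mN; rewrite /lvl /=.
rewrite -(subnSK mN) expnSr divnMA divn2; set u := (_ %/ _)%N.
rewrite -[X in _ = (X - _)%:R / _](odd_double_half u) addKn.
rewrite -mul2n natrM exprS; field; exact: p2.
Qed.

Lemma grid_floorE N y n i : grid_floor N y n i = ((y i %/ 2 ^ (N - n i)) %% 2 ^ n i)%N :> nat.
Proof. by rewrite /grid_floor ffunE. Qed.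

Let grid_predE (n : {ffun 'I_k -> nat}) (u : grid n) i : grid_pred u i = (u i - (0 < n i))%N :> nat.
Proof. by rewrite /grid_pred ffunE. Qed.

Lemma grid_floor_val N (y : 'I_k -> nat) (n : {ffun 'I_k -> 'I_N.+1}) i : (y i < 2 ^ N)%N ->
  grid_floor N y (nat_level n) i = (y i %/ 2 ^ (N - n i))%N :> nat.
Proof.
move=> yN; rewrite grid_floorE /nat_level ffunE modn_small// ltn_divLR ?expn_gt0//.
by rewrite -expnD subnKC// -ltnS ltn_ord.
Qed.

Definition fine_point N (y : 'I_k -> nat) : 'rV[R]_k :=
  \row_i (l ord0 i * (1 + 2 ^+ L * (y i)%:R / 2 ^+ N)).

(** Rounding y down to level m keeps its leading binary digits. Between the levels m - 1 and m the
    rounded value changes only if u = y %/ 2^(N - m) is odd, and then the coarser value is that of u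
    - 1. If u is odd in all directions of positive level, the corners are those of the mixed
    difference based at [grid_pred u]; an even entry makes the corners cancel in pairs. *)
Lemma grid_expansion N (y : 'I_k -> nat) : (forall i, (y i < 2 ^ N)%N) ->
  a (fine_point N y) =
  \sum_(n : {ffun 'I_k -> 'I_N.+1}) increment (grid_floor N y (nat_level n)).
Proof.
move=> yN.
pose A (m : {ffun 'I_k -> 'I_N.+1}) := a (\row_i (l ord0 i * (1 + 2 ^+ L * lvl N (m i) (y i)))).
have -> : a (fine_point N y) = A [ffun=> ord_max].
  congr (a _); apply/rowP => i; rewrite !mxE ffunE/= /lvl subnn expn0 divn1.
  by rewrite mulrA.
rewrite tensor_telescope; apply: eq_bigr => n _.
set u := grid_floor N y (nat_level n).
have uE i : u i = (y i %/ 2 ^ (N - n i))%N :> nat by exact: grid_floor_val.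
have nN i : (n i <= N)%N by rewrite -ltnS ltn_ord.
have low0 (i : 'I_k) b : n i = 0%N :> nat -> lower_level (n i) b = 0%N :> nat.
  by case: b => //= -> /=; rewrite inordK.
have lowS (i : 'I_k) : lower_level (n i) false = (n i).-1 :> nat.
  by rewrite /= inordK// (leq_ltn_trans (leq_pred _)).
rewrite /increment; case: ifPn => [/forallP od|].
  rewrite /diff_at mixed_diff_tensor; apply: eq_bigr => z _; congr (_ * a _).
    by apply: eq_bigr => i _; rewrite /= inE ffunE.
  have nE i : nat_level n i = n i by rewrite ffunE.
  apply/rowP => i; rewrite !mxE [in LHS]ffunE inE grid_predE uE nE.
  have := od i; rewrite uE nE; set w := (_ %/ _)%N => odi.
  have [n0|np] := posnP (n i).
    rewrite low0// /lvl n0 subn0 divn_small//.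
    have -> : w = 0%N by rewrite /w n0 subn0 divn_small.
    by rewrite sub0n !(mul0r, mulr0, addr0).
  rewrite np implyTb in odi *; have w0 : (0 < w)%N by case: (w) odi.
  case: (z i); rewrite [_ && _]/=.
    rewrite /= /lvl -/w natrB//.
    by field; exact: p2.
  by rewrite lowS lvl_pred// -/w odi addr0 mulrA.
rewrite negb_forall => /existsP[i0]; rewrite negb_imply uE {1}/nat_level ffunE => /andP[np ev].
pose F (z : {ffun 'I_k -> bool}) := diff_coef R (fun i => (0 < n i)%N) z *
  A [ffun i => lower_level (n i) (z i)].
have FN (z : {ffun 'I_k -> bool}) : z i0 -> F (flip i0 z) = - F z.
  move=> zi; rewrite /F diff_coef_flip// mulNr; congr (- (_ * a _)); apply/rowP => i.
  rewrite !mxE !ffunE; have [->|//] := eqVneq i i0; rewrite zi.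
  by rewrite lowS lvl_pred// (negbTE ev) subn0.
rewrite -/F [LHS](bigID (fun z : {ffun 'I_k -> bool} => z i0))/= sum_flip -big_split/=.
rewrite big1// => z zi; have := FN z zi; rewrite /F => ->.
exact: subrr.
Qed.

(** On odd grid points the predecessor subtracts exactly 1 in every direction of positive level,
    hence is injective. *)
Lemma sum_increment_le (n : {ffun 'I_k -> nat}) :
  \sum_(u : grid n) nrm (increment u) ^+ 2 <= \sum_(v : grid n) nrm (diff_at v) ^+ 2.
Proof.
rewrite (bigID (@odd_grid n))/= [X in _ + X]big1 ?addr0; last first.
  by move=> u /negbTE ou; rewrite /increment ou nrm0 expr0n.
have inj : {in @odd_grid n &, injective (@grid_pred n)}.
  move=> u u'; rewrite /odd_grid !unfold_in => /forallP ou /forallP ou' uu.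
  apply/ffunP => i; apply/val_inj; have := congr1 (fun g : grid n => val (g i)) uu.
  rewrite !ffunE/=; have := ou i; have := ou' i.
  case: (0 < n i)%N => /=; last by rewrite !subn0.
  by case: (nat_of_ord (u i)) (nat_of_ord (u' i)) => [//|x] [//|x'] _ _; rewrite !subn1/= => ->.
rewrite (eq_bigr (fun u => nrm (diff_at (grid_pred u)) ^+ 2)); last first.
  by move=> u ou; rewrite /increment ou.
rewrite -(big_imset (fun v => nrm (diff_at v) ^+ 2) inj)/=.
rewrite [leRHS](bigID (mem (grid_pred (n := n) @: odd_grid (n := n))))/= lerDl.
by apply: sumr_ge0 => v _; exact: sqr_ge0.
Qed.

End grid_expansion.

Lemma nrm_distC (R : realType) (u v : R[i]) : nrm (u - v) = nrm (v - u).
Proof. by rewrite -nrmN opprB. Qed.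

(** A monotone chain in a partial order never returns to a value it has left, so each |G u|^2 is
    charged at most twice, once on arrival and once on departure; |a - b|^2 <= 2 |a|^2 + 2 |b|^2
    doubles this to 4. In the strengthened induction the current value has not been charged for its
    departure yet. *)
Lemma sum_sqr_chain_le (R : realType) (V : finType) (ord : rel V) (G : V -> R[i])
  (v : nat -> V) (J : nat) :
  reflexive ord -> transitive ord -> antisymmetric ord ->
  (forall j, (j < J)%N -> ord (v j) (v j.+1)) ->
  \sum_(1 <= j < J.+1) nrm (G (v j) - G (v j.-1)) ^+ 2 <= 4 * \sum_u nrm (G u) ^+ 2.
Proof.
move=> rf tr an; pose g u : R := nrm (G u) ^+ 2.
have g0 u : 0 <= g u by exact: sqr_ge0.
pose S (p : pred V) : R := \sum_(u | p u) g u.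
have Sle p : S p <= \sum_u g u by rewrite [leRHS](bigID p)/= lerDl sumr_ge0.
have SS (p q : pred V) w : p w = false -> q w -> (forall u, p u -> q u) -> S p + g w <= S q.
  move=> pw qw pq; rewrite /S [leRHS](bigD1 w qw)/= [leLHS]addrC; apply: lerD => //.
  rewrite [leRHS](bigID p)/= -[leLHS]addr0; apply: lerD; last exact: sumr_ge0.
  rewrite le_eqVlt; apply/orP; left; apply/eqP; apply: eq_bigl => u.
  case pu: (p u); rewrite ?andbF ?andbT//= pq//.
  by apply/esym/eqP => uw; rewrite -uw pu in pw.
move=> hv; suff h : \sum_(1 <= j < J.+1) nrm (G (v j) - G (v j.-1)) ^+ 2 <=
    2 * S (fun u => ord u (v J)) + 2 * S (fun u => ord u (v J) && (u != v J)).
  apply: (le_trans h); rewrite (_ : 4 = 2 + 2 :> R); last by rewrite -natrD.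
  by rewrite [leRHS]mulrDl; apply: lerD; rewrite ler_wpM2l.
elim: J hv => [|J ih] hv.
  rewrite big_geq//; apply: addr_ge0; apply: mulr_ge0 => //; exact: sumr_ge0.
rewrite big_nat_recr//=; set a := v J; set b := v J.+1.
have ab : ord a b by exact: hv.
have {ih} := ih (fun j jJ => hv j (ltnW jJ)).
have [e|ba] := eqVneq b a.
  by rewrite /b -/b e subrr nrm0 expr0n addr0 /a.
set t := \sum_(_ <= _ < _) _ => ih.
have h2 : nrm (G b - G a) ^+ 2 <= 2 * g b + 2 * g a.
  have h := nrmB (G b) (G a).
  apply: (@le_trans _ _ ((nrm (G b) + nrm (G a)) ^+ 2)).
    by rewrite lerXn2r ?nnegrE ?addr_ge0 ?nrm_ge0.
  rewrite -subr_ge0 /g (_ : _ - _ = (nrm (G b) - nrm (G a)) ^+ 2) ?sqr_ge0//.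
  by ring.
have nba : ord b a = false.
  by apply/negP => ba'; move/eqP: ba; apply; apply: an; rewrite ba' ab.
have s1 := SS (fun u => ord u a) (fun u => ord u b) b nba (rf b) (fun u ua => tr _ _ _ ua ab).
have s2 : S (fun u => ord u a && (u != a)) + g a <= S (fun u => ord u b && (u != b)).
  apply: SS; first by rewrite eqxx andbF.
    by rewrite ab eq_sym.
  move=> u /andP[ua _]; rewrite (tr _ _ _ ua ab)/=; apply/eqP => ub.
  by rewrite -ub ua in nba.
apply: (le_trans (lerD ih h2)).
rewrite addrACA -[2 * _ + 2 * g b]mulrDr -[2 * _ + 2 * g a]mulrDr.
by apply: lerD; rewrite ler_wpM2l.
Qed.

(** After symmetrising the double sum, each pair (i, j) reduces to (w_j y - w_i x)^2 >= 0. *)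
Lemma weighted_cauchy_schwarz (R : realType) (I : finType) (z : I -> R[i]) (w : I -> R) :
  (forall i, 0 < w i) ->
  nrm (\sum_i z i) ^+ 2 <= (\sum_i (w i)^-1) * \sum_i w i * nrm (z i) ^+ 2.
Proof.
move=> w0; apply: (@le_trans _ _ ((\sum_i nrm (z i)) ^+ 2)).
  rewrite lerXn2r ?nnegrE ?nrm_ge0 ?nrm_sum//.
  by apply: sumr_ge0 => i _; exact: nrm_ge0.
rewrite expr2 big_distrlr/= [leRHS]big_distrlr/=.
set A : R := (X in X <= _); set B : R := (X in _ <= X).
have BE : B = \sum_i \sum_j (w j)^-1 * (w i * nrm (z i) ^+ 2) by rewrite /B exchange_big.
suff : A + A <= B + B by rewrite -[A + A]mulr2n -[B + B]mulr2n lerMn2r.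
rewrite {2}BE /A /B -big_split -[leRHS]big_split; apply: ler_sum => i _ /=.
rewrite -big_split -[leRHS]big_split; apply: ler_sum => j _ /=.
set x := nrm (z i); set y := nrm (z j); have wi := w0 i; have wj := w0 j.
rewrite -subr_ge0.
rewrite (_ : _ - _ = (w j * y - w i * x) ^+ 2 / (w i * w j)).
  by rewrite divr_ge0 ?sqr_ge0 ?mulr_ge0// ltW.
by field; rewrite !gt_eqF.
Qed.

Lemma sum_weight_le (R : realType) (k N : nat) (rho : R) : 0 <= rho -> rho < 1 ->
  \sum_(n : {ffun 'I_k -> 'I_N.+1}) rho ^+ weight (nat_level n) <= ((1 - rho)^-1) ^+ k.
Proof.
move=> r0 r1; have r1' : 0 < 1 - rho by rewrite subr_gt0.
rewrite (eq_bigr (fun n : {ffun 'I_k -> 'I_N.+1} => \prod_i rho ^+ n i)); last first.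
  by move=> n _; rewrite /weight -prodrXr; apply: eq_bigr => i _; rewrite ffunE.
rewrite -(bigA_distr_bigA (fun (i : 'I_k) (q : 'I_N.+1) => rho ^+ q)).
rewrite -[X in _ ^+ X](card_ord k) -prodr_const; apply: ler_prod => i _.
rewrite sumr_ge0 ?exprn_ge0//=; last by move=> q _; rewrite exprn_ge0.
rewrite -[leRHS]mul1r ler_pdivlMr//.
have := subrX1 rho N.+1; rewrite -opprB -[rho - 1]opprB mulNr => /oppr_inj e.
by rewrite mulrC -e lerBlDr lerDl exprn_ge0.
Qed.

Section grid_bounds.
Context (R : realType) (k L : nat) (l : 'rV[R]_k) (a : 'rV[R]_k -> R[i]).
Variables (rho Y : R).
Hypotheses (rho0 : 0 < rho) (rho1 : rho < 1).

(* The weights rho ^- weight n leave room for the Cauchy-Schwarz inequality over the levels n. *)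
Definition level_energy (n : {ffun 'I_k -> nat}) : R :=
  rho ^- weight n * \sum_(v : grid n) nrm (diff_at L l a v) ^+ 2.

Hypothesis hY : forall N, \sum_(n : {ffun 'I_k -> 'I_N.+1}) level_energy (nat_level n) <= Y.

Let C := ((1 - rho)^-1) ^+ k.

Let C0 : 0 <= C. Proof. by rewrite exprn_ge0// invr_ge0 subr_ge0 ltW. Qed.

Let w0 (n : {ffun 'I_k -> nat}) : 0 < rho ^- weight n.
Proof. by rewrite invr_gt0 exprn_gt0. Qed.

Let sum_winv N : \sum_(n : {ffun 'I_k -> 'I_N.+1}) (rho ^- weight (nat_level n))^-1 <= C.
Proof.
under eq_bigr do rewrite invrK.
by apply: sum_weight_le => //; exact: ltW.
Qed.

Lemma fine_point_bound N (y : 'I_k -> nat) : (forall i, (y i < 2 ^ N)%N) ->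
  nrm (a (fine_point L l N y)) ^+ 2 <= C * Y.
Proof.
move=> yN; rewrite (grid_expansion L l a yN).
apply: (le_trans (weighted_cauchy_schwarz _ (fun n => w0 (nat_level n)))).
apply: ler_pM.
- by apply: sumr_ge0 => n _; rewrite invr_ge0 ltW.
- by apply: sumr_ge0 => n _; rewrite mulr_ge0 ?sqr_ge0 ?ltW.
- exact: sum_winv.
apply: le_trans (hY N); apply: ler_sum => n _; rewrite ler_wpM2l ?(ltW (w0 _))//.
apply: le_trans (@sum_increment_le R k L l a (nat_level n)).
by rewrite [leRHS](bigD1 (grid_floor N y (nat_level n)))//= lerDl sumr_ge0// => u _; exact: sqr_ge0.
Qed.

(** Weighted Cauchy-Schwarz takes the sum over levels out of the squares. At each level the rounded
    chain is weakly increasing in the product order of the grid, so its increments are controlled by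
    the values at single grid points. *)
Lemma fine_chain_bound N J (y : nat -> 'I_k -> nat) : (forall j i, (y j i < 2 ^ N)%N) ->
  (forall j i, (j < J)%N -> (y j i <= y j.+1 i)%N) ->
  \sum_(1 <= j < J.+1) nrm (a (fine_point L l N (y j)) - a (fine_point L l N (y j.-1))) ^+ 2 <=
  4 * (C * Y).
Proof.
move=> yN ym.
pose z j (n : {ffun 'I_k -> 'I_N.+1}) := increment L l a (grid_floor N (y j) (nat_level n)) -
  increment L l a (grid_floor N (y j.-1) (nat_level n)).
apply: (@le_trans _ _ (\sum_(1 <= j < J.+1) C * \sum_(n : {ffun 'I_k -> 'I_N.+1})
    rho ^- weight (nat_level n) * nrm (z j n) ^+ 2)).
  apply: ler_sum => j _; rewrite !(grid_expansion L l a (yN _)) -sumrB.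
  apply: (le_trans (weighted_cauchy_schwarz _ (fun n => w0 (nat_level n)))).
  rewrite ler_wpM2r//; apply: sumr_ge0 => n _; by rewrite mulr_ge0 ?sqr_ge0 ?ltW.
rewrite -mulr_sumr mulrCA ler_wpM2l// exchange_big/=.
apply: (@le_trans _ _ (4 * \sum_(n : {ffun 'I_k -> 'I_N.+1}) level_energy (nat_level n))); last first.
  by rewrite ler_wpM2l.
rewrite mulr_sumr; apply: ler_sum => n _; rewrite -mulr_sumr mulrCA ler_wpM2l ?(ltW (w0 _))//.
pose ord (u v : grid (nat_level n)) := [forall i, (u i <= v i)%N].
apply: (@le_trans _ _ (4 * \sum_(u : grid (nat_level n)) nrm (increment L l a u) ^+ 2)); last first.
  by rewrite ler_wpM2l//; exact: sum_increment_le.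
apply: (@sum_sqr_chain_le _ _ ord (@increment R k L l a _) (fun j => grid_floor N (y j) (nat_level n))).
- by move=> u; apply/forallP => i.
- move=> v u w /forallP uv /forallP vw; apply/forallP => i.
  exact: leq_trans (uv i) (vw i).
- move=> u v /andP[/forallP uv /forallP vu]; apply/ffunP => i; apply/val_inj/eqP.
  by rewrite eqn_leq uv vu.
- move=> j jJ; apply/forallP => i.
  rewrite !grid_floor_val ?yN//; exact: leq_div2r (ym _ _ jJ).
Qed.

Hypothesis l0 : posorthant l.
Hypothesis ca : {within cube L l, continuous (a : 'rV[R]_k -> (R[i] : numFieldType))}.

Let lp i : 0 < l ord0 i. Proof. by have := l0 i; rewrite mxE. Qed.
Let p2 m : 0 < 2 ^+ m :> R. Proof. by rewrite exprn_gt0. Qed.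

Let pos (s : 'rV[R]_k) i : R := (s ord0 i / l ord0 i - 1) / 2 ^+ L.

(** The cap 2^N - 1 assigns the upper faces of the cube to the last cells. *)
Definition grid_round N (s : 'rV[R]_k) (i : 'I_k) : nat :=
  minn (Num.truncn (pos s i * 2 ^+ N)) (2 ^ N).-1.

Let pos_itv s i : cube L l s -> 0 <= pos s i <= 1.
Proof.
move=> [_ s1 s2]; have := s1 i; have := s2 i; rewrite mxE => h2 h1.
rewrite /pos divr_ge0 ?(ltW (p2 _))//=; last by rewrite subr_ge0 ler_pdivlMr// mul1r.
by rewrite ler_pdivrMr// mul1r lerBlDl ler_pdivrMr.
Qed.

Lemma grid_round_lt N s i : (grid_round N s i < 2 ^ N)%N.
Proof.
rewrite /grid_round gtn_min; apply/orP; right.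
by rewrite prednK// expn_gt0.
Qed.

Lemma grid_round_mono N (s s' : 'rV[R]_k) i : s ord0 i <= s' ord0 i ->
  (grid_round N s i <= grid_round N s' i)%N.
Proof.
move=> ss; rewrite /grid_round leq_min geq_minr andbT (leq_trans (geq_minl _ _))//.
by apply: le_truncn; rewrite ler_pM2r// /pos ler_pM2r ?invr_gt0// lerD2r ler_pM2r ?invr_gt0.
Qed.

Let grid_round_dist N s i : cube L l s ->
  `|(grid_round N s i)%:R / 2 ^+ N - pos s i| <= (2 ^+ N)^-1.
Proof.
move=> cs; have /andP[h0 h1] := pos_itv i cs.
have t0 : 0 <= pos s i * 2 ^+ N by rewrite mulr_ge0// ltW.
have tl : (Num.truncn (pos s i * 2 ^+ N))%:R <= pos s i * 2 ^+ N by rewrite truncn_le.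
have tg : pos s i * 2 ^+ N < (Num.truncn (pos s i * 2 ^+ N)).+1%:R by exact: truncnS_gt.
set t := Num.truncn _ in tl tg *.
have le1 : (grid_round N s i)%:R <= pos s i * 2 ^+ N.
  by apply: le_trans tl; rewrite ler_nat geq_minl.
have ge1 : pos s i * 2 ^+ N - 1 <= (grid_round N s i)%:R.
  rewrite lerBlDr natr1 /grid_round -/t; case: (leqP t (2 ^ N).-1) => _; first exact: ltW.
  by rewrite prednK ?expn_gt0// natrX ler_piMl// ltW.
rewrite distrC ger0_norm; last by rewrite subr_ge0 ler_pdivrMr.
by rewrite -(ler_pM2r (p2 N)) mulrBl divfK ?gt_eqF// mulVf ?gt_eqF// lerBlDr -lerBlDl.
Qed.

Lemma cvg_fine_point s : cube L l s ->
  fine_point L l N (grid_round N s) @[N --> \oo] --> s.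
Proof.
move=> cs; have [M M0 hM] := fin_upper_bound (fun i => l ord0 i * 2 ^+ L).
have h : (2^-1 : R) ^+ N @[N --> \oo] --> (0 : R).
  by apply: cvg_expr; rewrite ger0_norm ?invr_ge0// invf_lt1// ltr1n.
apply/cvg_ballP => e e0.
have eM : 0 < e / (M + 1) by rewrite divr_gt0// addr_gt0.
move/cvgrPdist_lt : h => /(_ _ eM); apply: filterS => N.
rewrite sub0r normrN exprVn ger0_norm ?invr_ge0 ?(ltW (p2 _))// => hN.
split=> // i j; rewrite (ord1 i) /ball/= /fine_point mxE.
have -> : s ord0 j = l ord0 j * (1 + 2 ^+ L * pos s j).
  rewrite /pos mulrCA mulfV ?gt_eqF// mulr1 addrCA subrr addr0 mulrCA mulfV ?mulr1//.
  by rewrite gt_eqF.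
rewrite -mulrBr opprD addrACA subrr add0r -mulrA -mulrBr mulrA normrM.
rewrite ger0_norm; last by rewrite mulr_ge0 ?ltW.
rewrite distrC; apply: (@le_lt_trans _ _ (M * (2 ^+ N)^-1)).
  apply: ler_pM => //; first by rewrite mulr_ge0 ?ltW.
  exact: grid_round_dist.
rewrite mulrC -ltr_pdivlMr//; apply: (lt_le_trans hN).
by rewrite ler_pM2l// lef_pV2 ?posrE ?addr_gt0// lerDl.
Qed.

Lemma fine_point_cube s N : cube L l (fine_point L l N (grid_round N s)).
Proof.
split => i; rewrite !mxE.
- by rewrite mulr_gt0// ltr_wpDr// divr_ge0 ?mulr_ge0 ?(ltW (p2 _)).
- by rewrite -[leLHS]mulr1 ler_pM2l// lerDl divr_ge0 ?mulr_ge0 ?(ltW (p2 _)).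
- rewrite [leRHS]mulrC ler_pM2l// lerD2l -mulrA ler_piMr ?(ltW (p2 _))//.
  by rewrite ler_pdivrMr// mul1r -natrX ler_nat ltnW// grid_round_lt.
Qed.

Lemma cvg_within_cube s : cube L l s ->
  nrm (a (fine_point L l N (grid_round N s)) - a s) @[N --> \oo] --> (0 : R).
Proof.
move=> cs; have /subspace_continuousP/(_ _ cs) h := ca.
have h2 : (a (fine_point L l N (grid_round N s)) : (R[i] : numFieldType)) @[N --> \oo] -->
    (a s : (R[i] : numFieldType)).
  apply: cvg_trans h => A /= hA.
  have /(_ _ hA) hN := cvg_fine_point cs.
  have hN' : \forall N \near \oo, cube L l (fine_point L l N (grid_round N s)) ->
    A (a (fine_point L l N (grid_round N s))) by exact: hN.
  have : \forall N \near \oo, A (a (fine_point L l N (grid_round N s))).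
    by apply: filterS hN' => N; apply; exact: fine_point_cube.
  exact.
apply/cvgrPdist_lt => e e0.
have ec0 : 0 < e%:C by rewrite ltcR.
move/cvgrPdist_lt : h2 => /(_ _ ec0); apply: filterS => N.
move=> hn; rewrite sub0r normrN ger0_norm ?nrm_ge0// nrm_distC -ltcR.
exact: hn.
Qed.

Lemma cube_point_bound s : cube L l s -> nrm (a s) ^+ 2 <= C * Y.
Proof.
move=> cs; have h := cvg_within_cube cs.
have CY0 : 0 <= C * Y.
  apply: le_trans (fine_point_bound (N := 0) (y := fun=> 0%N) _); first exact: sqr_ge0.
  by move=> i; rewrite expn0.
have nb N : nrm (a s) <= Num.sqrt (C * Y) + nrm (a (fine_point L l N (grid_round N s)) - a s).
  rewrite -[X in nrm X](subrK (a (fine_point L l N (grid_round N s)))).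
  rewrite (le_trans (nrmD _ _))// nrm_distC addrC lerD2r.
  rewrite -[leLHS]ger0_norm ?nrm_ge0// -sqrtr_sqr ler_wsqrtr//.
  by apply: fine_point_bound => i; exact: grid_round_lt.
have : Num.sqrt (C * Y) + nrm (a (fine_point L l N (grid_round N s)) - a s) @[N --> \oo] -->
    Num.sqrt (C * Y) + 0 by apply: cvgD => //; exact: cvg_cst.
rewrite addr0 => h3.
have : nrm (a s) <= Num.sqrt (C * Y).
  rewrite -(cvg_lim _ h3)//; apply: limr_ge; first by apply: cvgP h3.
  exact: nearW.
by move=> h4; rewrite -[leRHS]sqr_sqrtr// lerXn2r ?nnegrE ?nrm_ge0 ?sqrtr_ge0.
Qed.

(** Rounding each point of the chain to the grid of mesh 2^-N makes it weakly increasing among grid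
    points, with a bound independent of N; continuity on the cube gives the limit. *)
Lemma cube_chain_bound J (I : nat -> 'rV[R]_k) : fin_chain (cube L l) J I ->
  \sum_(1 <= j < J.+1) nrm (a (I j) - a (I j.-1)) ^+ 2 <= 4 * (C * Y).
Proof.
move=> [cI pI]; pose b N j := a (fine_point L l N (grid_round N (I j))).
have hN N : \sum_(1 <= j < J.+1) nrm (b N j - b N j.-1) ^+ 2 <= 4 * (C * Y).
  apply: (fine_chain_bound (y := fun j => grid_round N (I j))) => j i.
    exact: grid_round_lt.
  by move=> jJ; apply: grid_round_mono; apply: ltW; exact: pI.
have bc j : (j <= J)%N -> nrm (b N j - a (I j)) @[N --> \oo] --> (0 : R).
  by move=> jJ; apply: cvg_within_cube; exact: cI.
have lim : \sum_(1 <= j < J.+1) nrm (b N j - b N j.-1) ^+ 2 @[N --> \oo] -->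
    \sum_(1 <= j < J.+1) nrm (a (I j) - a (I j.-1)) ^+ 2.
  rewrite [X in _ --> X]big_nat; under eq_fun do rewrite big_nat.
  apply: cvg_big => [|j /andP[j1 jJ]]; first exact: add_continuous.
  have jJ' : (j.-1 <= J)%N by rewrite (leq_trans (leq_pred _)).
  have : nrm (b N j - b N j.-1) @[N --> \oo] --> nrm (a (I j) - a (I j.-1)).
    have h0 : nrm (b N j - a (I j)) + nrm (b N j.-1 - a (I j.-1)) @[N --> \oo] --> (0 : R).
      by rewrite -[X in _ --> X](addr0 (0 : R)); apply: cvgD; exact: bc.
    apply/cvgrPdist_le => e e0; move/cvgrPdist_le : h0 => /(_ e e0); apply: filterS => N.
    rewrite sub0r normrN ger0_norm ?addr_ge0 ?nrm_ge0// => h; apply: le_trans h.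
    have tri (u v u' v' : R[i]) : nrm (u - v) <= nrm (u' - v') + (nrm (u' - u) + nrm (v' - v)).
      rewrite (_ : u - v = (u' - v') + (- (u' - u) + (v' - v))); last by ring.
      by rewrite (le_trans (nrmD _ _))// lerD2l (le_trans (nrmD _ _))// nrmN.
    rewrite ler_norml lerBrDl lerBlDr; apply/andP; split; last first.
      by rewrite lerBlDl; exact: tri.
    have := tri (b N j) (b N j.-1) (a (I j)) (a (I j.-1)).
    by rewrite (nrm_distC (a (I j)) (b N j)) (nrm_distC (a (I j.-1)) (b N j.-1)).
  by move=> c; exact: (cvgM c c).
rewrite -(cvg_lim _ lim)//; apply: limr_le; first by apply: cvgP lim.
exact: nearW.
Qed.

End grid_bounds.

(** * Summation over cubes and levels *)

Lemma le_sum_sub_uniq (R : realType) (I : eqType) (s s' : seq I) (a : I -> R) :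
  (forall i, 0 <= a i) -> uniq s -> uniq s' -> {subset s <= s'} ->
  \sum_(i <- s) a i <= \sum_(i <- s') a i.
Proof.
move=> a0 us us' ss; rewrite [leRHS](bigID (mem s))/= -[leLHS]addr0; apply: lerD; last first.
  by apply: sumr_ge0 => i _; exact: a0.
rewrite -[leRHS]big_filter le_eqVlt; apply/orP; left; apply/eqP; apply: perm_big.
apply: uniq_perm; rewrite ?filter_uniq// => i.
by rewrite mem_filter; apply/idP/andP => [iK|[]//]; split => //; exact: ss.
Qed.

Lemma le_sum_fsubset (R : realType) (I : choiceType) (K K' : {fset I}) (a : I -> R) :
  (forall i, 0 <= a i) -> (K `<=` K')%fset -> \sum_(i <- K) a i <= \sum_(i <- K') a i.
Proof.
by move=> a0 /fsubsetP KK; apply: le_sum_sub_uniq; rewrite ?fset_uniq.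
Qed.

Lemma esum_le_fset (R : realType) (I : choiceType) (a : I -> \bar R) (c : \bar R) :
  (forall i, 0 <= a i)%E -> (forall K : {fset I}, (\sum_(i <- K) a i <= c)%E) ->
  (\esum_(i in [set: I]) a i <= c)%E.
Proof.
move=> a0 h; rewrite /esum; apply: ge_ereal_sup => _ [A [fA _] <-].
by rewrite fsbig_finite//=; exact: h.
Qed.

Section countable_sums.
Context d (T : measurableType d) (R : realType) (mu : {measure set T -> \bar R}).
Context (I : countType) (a : I -> T -> R).
Hypotheses (a0 : forall i x, 0 <= a i x) (ma : forall i, measurable_fun setT (a i)).

Let K m : {fset I} := [fset i in pmap (@pickle_inv I) (iota 0 m)]%fset.

Let K_sub m m' : (m <= m')%N -> (K m `<=` K m')%fset.
Proof.
move=> mm; apply/fsubsetP => i; rewrite !inE/= !mem_pmap => /mapP[j]; rewrite mem_iota => /andP[_ jm] ->.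
by apply: map_f; rewrite mem_iota (leq_trans jm).
Qed.

Let K_cover (A : {fset I}) : exists m, (A `<=` K m)%fset.
Proof.
have [m hm] : exists m, forall i, i \in A -> (choice.pickle i < m)%N.
  exists (\max_(i <- A) choice.pickle i)%N.+1 => i iA.
  by rewrite ltnS (big_rem i iA)/= leq_maxl.
exists m; apply/fsubsetP => i iA; rewrite /K !inE/= mem_pmap; apply/mapP.
by exists (choice.pickle i); rewrite ?pickleK_inv// mem_iota/= add0n hm.
Qed.

(** Monotone convergence along the finite sets of the indices with code below m, which absorb every
    finite set of indices. *)
Lemma int_esum_powR_le (e : R) (c : \bar R) : 0 < e ->
  (forall A : {fset I}, (\int[mu]_x ((\sum_(i <- A) a i x) `^ e)%:E <= c)%E) ->
  (\int[mu]_x ((\esum_(i in [set: I]) (a i x)%:E) `^ e) <= c)%E.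
Proof.
move=> e0 h; pose S m x := \sum_(i <- K m) a i x.
have S0 m x : 0 <= S m x by apply: sumr_ge0.
have mS m : measurable_fun setT (fun x => (S m x `^ e)%:E).
  apply/measurable_EFinP; apply: (measurableT_comp (measurable_powR _)).
  exact: measurable_sum.
have S_nd x : {homo (fun m => (S m x `^ e)%:E) : m m' / (m <= m')%N >-> (m <= m')%E}.
  move=> m m' mm; rewrite lee_fin ge0_ler_powR ?nnegrE ?(ltW e0)//.
  by apply: le_sum_fsubset => //; exact: K_sub.
have S_cvg x := ereal_nondecreasing_is_cvgn (S_nd x).
apply: (@le_trans _ _ (\int[mu]_x limn (fun m => (S m x `^ e)%:E))%E); last first.
  rewrite (monotone_convergence mu measurableT mS); last 2 first.
  - by move=> m x _; rewrite lee_fin powR_ge0.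
  - by move=> x _; exact: S_nd.
  apply: lime_le; last by apply: nearW => m; exact: h.
  apply: ereal_nondecreasing_is_cvgn => m m' mm; apply: int_le => x; first exact: powR_ge0.
  by have := S_nd x _ _ mm; rewrite lee_fin.
apply: le_lower_integral => x; first exact: poweR_ge0.
have Sl m : ((S m x `^ e)%:E <= limn (fun m => (S m x `^ e)%:E))%E.
  apply: lime_ge; first exact: S_cvg.
  by near=> m'; apply: S_nd; near: m'; exact: nbhs_infty_ge.
move: Sl; case: (limn _) => [s| |] Sl.
- have s0 : 0 <= s by have := Sl 0%N; rewrite lee_fin; apply: le_trans; exact: powR_ge0.
  have es : (\esum_(i in [set: I]) (a i x)%:E <= (s `^ e^-1)%:E)%E.
    apply: esum_le_fset => [i|A]; first by rewrite lee_fin.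
    have [m Am] := K_cover A; rewrite sumEFin lee_fin.
    apply: (le_trans (le_sum_fsubset (fun i => a0 i x) Am)).
    rewrite -[leLHS]powRr1; last exact: S0.
    rewrite -(mulfV (lt0r_neq0 e0)) powRrM.
    by apply: ge0_ler_powR; rewrite ?nnegrE ?powR_ge0 ?invr_ge0 ?(ltW e0)//; have := Sl m; rewrite lee_fin.
  have E0 : (0 <= \esum_(i in [set: I]) (a i x)%:E)%E by apply: esum_ge0 => i _; rewrite lee_fin.
  apply: (@le_trans _ _ ((s `^ e^-1)%:E `^ e)%E).
    by apply: gt0_ler_poweR; rewrite ?(ltW e0)//; rewrite in_itv/= ?E0 ?lee_fin ?powR_ge0 leey.
  by rewrite poweR_EFin -powRrM mulVf ?gt_eqF// powRr1.
- exact: leey.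
- by have := Sl 0%N; rewrite leeNy_eq.
Unshelve. all: by end_near.
Qed.

End countable_sums.

Lemma sum_weight_fset_le (R : realType) (k : nat) (th : R) (Ns : {fset {ffun 'I_k -> nat}}) :
  0 <= th -> th < 1 -> \sum_(n <- Ns) th ^+ weight n <= ((1 - th)^-1) ^+ k.
Proof.
move=> t0 t1; pose N := (\max_(n <- Ns) \max_i n i)%N.
apply: le_trans (sum_weight_le k N t0 t1).
pose B : {fset {ffun 'I_k -> nat}} := [fset nat_level n | n in [set: {ffun 'I_k -> 'I_N.+1}]%SET]%fset.
have w0 (n : {ffun 'I_k -> nat}) : 0 <= th ^+ weight n by rewrite exprn_ge0.
apply: (@le_trans _ _ (\sum_(n <- B) th ^+ weight n)).
  apply: le_sum_fsubset => //; apply/fsubsetP => n nN.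
  apply/imfsetP; exists [ffun i => inord (n i)]; first by rewrite /= inE.
  apply/ffunP => i; rewrite !ffunE inordK// ltnS.
  apply: (@leq_trans (\max_i n i)%N); first exact: (leq_bigmax i).
  by rewrite /N (big_rem n nN)/= leq_maxl.
rewrite big_imfset/=; last first.
  move=> n n' _ _ nn; apply/ffunP => i; apply/val_inj.
  by have := congr1 (fun f : {ffun 'I_k -> nat} => f i) nn; rewrite !ffunE.
by rewrite le_eqVlt; apply/orP; left; apply/eqP; rewrite big_enum/=; apply: eq_bigl => n; rewrite inE.
Qed.

Section square_function_energy.
Context d (T : measurableType d) (R : realType) (mu : {sigma_finite_measure set T -> \bar R}).
Context (k r L : nat) (lft : 'rV[int]_r -> 'rV[R]_k).
Context (H : 'rV[R]_k -> (T -> R[i]) -> (T -> R[i])).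
Variables (p Kc th : R) (f : T -> R[i]).
Hypotheses (p1 : 1 <= p) (Kc0 : 0 <= Kc) (th0 : 0 < th) (th1 : th < 1).

Let U g (n : {ffun 'I_k -> nat}) (v : grid n) := dyadic_op L lft H g v f.

Hypothesis mU : forall g n (v : grid n), cmeasurable (U g v).
Hypothesis class_bd : forall (G : finType) (io : G -> 'rV[int]_r) (n : {ffun 'I_k -> nat}),
  injective io ->
  (\int[mu]_x (nrm2 (fun w : G * grid n => U (io w.1) w.2) x `^ (p / 2))%:E <=
   ((Kc * (th ^+ 2) ^+ weight n) `^ p)%:E * pint mu p f)%E.

Let p0 : 0 < p. Proof. exact: lt_le_trans p1. Qed.

(** Of the decay th^(2 weight n) at level n, one half pays for the weights of the Cauchy-Schwarz
    inequality over levels; the other half remains for the summation of norms over levels by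
    Minkowski's inequality. *)
Definition energy g (n : {ffun 'I_k -> nat}) x : R :=
  (th ^+ 2) ^- weight n * \sum_(v : grid n) nrm (dyadic_op L lft H g v f x) ^+ 2.

Lemma energy_ge0 g n x : 0 <= energy g n x.
Proof.
rewrite mulr_ge0 ?invr_ge0 ?exprn_ge0 ?(ltW th0)//.
by apply: sumr_ge0 => v _; exact: sqr_ge0.
Qed.

Lemma measurable_energy g n : measurable_fun setT (energy g n).
Proof.
apply: measurable_funM => //; apply: measurable_sum => v.
by apply: measurable_funX; apply: measurable_nrm; exact: mU.
Qed.

Let cf0 : (0 <= cnorm mu p%:E f)%E. Proof. by rewrite cnorm_poweR// poweR_ge0. Qed.

Let lev (Gs : {fset 'rV[int]_r}) n x : R := (\sum_(g <- Gs) energy g n x) `^ 2^-1.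
Let levs Gs (s : seq {ffun 'I_k -> nat}) x : R := \sum_(n <- s) lev Gs n x.

Let level_norm (Gs : {fset 'rV[int]_r}) n :
  ('N[mu]_p%:E[EFin \o lev Gs n] <=
   (Kc * th ^+ weight n)%:E * cnorm mu p%:E f)%E.
Proof.
have tw : 0 < th ^+ weight n by rewrite exprn_gt0.
apply/(Lnorm_leP _ _ _ p0); first by rewrite mulr_ge0// ltW.
have := class_bd n (@val_inj _ _ Gs : injective (fun g : Gs => val g)).
have E0 x : 0 <= \sum_(g <- Gs) energy g n x by apply: sumr_ge0 => g _; exact: energy_ge0.
set u := nrm2 _ => hu.
have eE x : (`|(EFin \o lev Gs n) x| `^ p)%E =
    ((th ^+ weight n) `^ (- p) * u x `^ (p / 2))%:E.
  rewrite /comp abse_EFin /lev ger0_norm ?powR_ge0// poweR_EFin -powRrM; congr (_%:E).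
  rewrite -mulr_sumr powRM ?invr_ge0 ?exprn_ge0 ?(ltW th0)//; last first.
    by apply: sumr_ge0 => g _; apply: sumr_ge0 => v _; exact: sqr_ge0.
  congr (_ * _).
    rewrite -exprM mulnC exprM -powR_inv1 ?exprn_ge0 ?(ltW th0)//.
    by rewrite -powR_mulrn ?(ltW tw)// -!powRrM; congr (_ `^ _); field.
  rewrite (mulrC 2^-1); congr (_ `^ _); rewrite /u /nrm2 big_seq_fsetE/=.
  by rewrite -(pair_bigA _ (fun (g : Gs) (v : grid n) => nrm (U (val g) v x) ^+ 2)).
under eq_integral do rewrite eE.
rewrite (intZ _ (powR_ge0 _ _)); last 2 first.
- by move=> x; exact: powR_ge0.
- by apply: (measurableT_comp (measurable_powR _)); apply: measurable_nrm2 => w; exact: mU.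
apply: (le_trans (lee_wpmul2l _ hu)); first by rewrite lee_fin powR_ge0.
rewrite muleA -EFinM le_eqVlt; apply/orP; left; apply/eqP; congr (_%:E * _)%E.
have tw0 := ltW tw; have t2 : 0 <= (th ^+ 2) ^+ weight n by rewrite !exprn_ge0// ltW.
rewrite (powRM _ Kc0 t2) (powRM _ Kc0 tw0) mulrCA; congr (_ * _).
have -> : (th ^+ 2) ^+ weight n = (th ^+ weight n) `^ 2 by rewrite powR_mulrn// -!exprM mulnC.
rewrite -powRrM -powRD; last by rewrite (gt_eqF tw) implybT.
by congr (_ `^ _); ring.
Qed.

Let mlevel (Gs : {fset 'rV[int]_r}) n :
  measurable_fun setT (lev Gs n).
Proof.
apply: (measurableT_comp (measurable_powR _)); apply: measurable_sum => g.
exact: measurable_energy.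
Qed.

Let sum_norm (Gs : {fset 'rV[int]_r}) (s : seq {ffun 'I_k -> nat}) :
  ('N[mu]_p%:E[EFin \o levs Gs s] <=
   (Kc * \sum_(n <- s) th ^+ weight n)%:E * cnorm mu p%:E f)%E.
Proof.
elim: s => [|n s ih].
  rewrite (_ : _ \o _ = cst 0%E); last by apply/funext => x; rewrite /= /levs big_nil.
  by rewrite big_nil mulr0 mul0e Lnorm0// gt_eqF.
rewrite (_ : EFin \o levs _ _ = EFin \o (lev Gs n \+ levs Gs s)%R); last first.
  by apply/funext => x; rewrite /= /levs big_cons.
apply: (le_trans (minkowski_EFin mu (mlevel Gs n) _ p1)).
  by apply: measurable_sum => n'; exact: mlevel.
rewrite big_cons mulrDr EFinD ge0_muleDl ?lee_fin//.
- by apply: leeD; [exact: level_norm|exact: ih].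
- by rewrite mulr_ge0// exprn_ge0// ltW.
- by rewrite mulr_ge0// sumr_ge0// => n' _; rewrite exprn_ge0// ltW.
Qed.

(** A finite set of pairs (cube, level) is enclosed in a product. There the norm of the sum over
    levels of the l^2 norms over cubes is under control, and it dominates the joint l^2 norm,
    because a sum of squares of nonnegative numbers is at most the square of their sum. *)
Lemma int_energy_le :
  (\int[mu]_x ((\esum_(w in [set: 'rV[int]_r * {ffun 'I_k -> nat}])
     (energy w.1 w.2 x)%:E) `^ (p / 2)) <=
   ((Kc * ((1 - th)^-1) ^+ k) `^ p)%:E * pint mu p f)%E.
Proof.
apply: (int_esum_powR_le (a := fun (w : 'rV[int]_r * {ffun 'I_k -> nat}) x => energy w.1 w.2 x)).
- by move=> w x; exact: energy_ge0.
- by move=> w; exact: measurable_energy.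
- by rewrite divr_gt0.
move=> A; pose Gs : {fset 'rV[int]_r} := [fset w.1 | w in A]%fset.
pose Ns : {fset {ffun 'I_k -> nat}} := [fset w.2 | w in A]%fset.
pose C := Kc * \sum_(n <- Ns) th ^+ weight n.
have C0 : 0 <= C by rewrite mulr_ge0// sumr_ge0// => n _; rewrite exprn_ge0// ltW.
have := sum_norm Gs Ns; move/(Lnorm_leP _ _ _ p0 C0) => h.
apply: (@le_trans _ _ ((C `^ p)%:E * pint mu p f)%E); last first.
  apply: lee_wpmul2r; first exact: pint_ge0.
  rewrite lee_fin; apply: ge0_ler_powR; rewrite ?nnegrE ?(ltW p0)//.
    by rewrite mulr_ge0// exprn_ge0// invr_ge0 subr_ge0 ltW.
  by rewrite ler_wpM2l//; apply: sum_weight_fset_le => //; exact: ltW.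
apply: le_trans h; apply: le_lower_integral => x; first by rewrite lee_fin powR_ge0.
rewrite /comp abse_EFin poweR_EFin lee_fin.
pose Z n := lev Gs n x; rewrite -[levs Gs Ns x]/(\sum_(n <- Ns) Z n).
have Z0 n : 0 <= Z n by exact: powR_ge0.
have S0 : 0 <= \sum_(n <- Ns) Z n by apply: sumr_ge0.
rewrite ger0_norm//.
apply: (@le_trans _ _ (((\sum_(n <- Ns) Z n) ^+ 2) `^ (p / 2))); last first.
  by rewrite -powR_mulrn// -powRrM mulrC divfK.
apply: ge0_ler_powR; rewrite ?nnegrE ?sqr_ge0 ?divr_ge0 ?(ltW p0)//.
  by apply: sumr_ge0 => w _; exact: energy_ge0.
apply: (@le_trans _ _ (\sum_(n <- Ns) Z n ^+ 2)); last first.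
  elim: (enum_fset Ns) => [|n s ih]; first by rewrite !big_nil expr0n.
  rewrite !big_cons sqrrD; have s0 : 0 <= \sum_(n <- s) Z n by apply: sumr_ge0.
  by rewrite -addrA lerD2l (le_trans ih)// lerDr mulrn_wge0// mulr_ge0.
have ZE n : Z n ^+ 2 = \sum_(g <- Gs) energy g n x.
  rewrite /Z -powR_mulrn ?powR_ge0// -powRrM mulVf// powRr1//.
  by apply: sumr_ge0 => g _; exact: energy_ge0.
under [leRHS]eq_bigr do rewrite ZE.
rewrite exchange_big/=.
rewrite -(big_allpairs (r1 := Gs) (r2 := Ns) (F := fun w => energy w.1 w.2 x))/=.
apply: le_sum_sub_uniq; rewrite ?fset_uniq//.
- by move=> w; exact: energy_ge0.
- by apply: allpairs_uniq; rewrite ?fset_uniq// => -[a b] [a' b'] _ _ [-> ->].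
- move=> [g n] gA; apply/allpairsP; exists (g, n); split => //=.
    by apply/imfsetP; exists (g, n).
  by apply/imfsetP; exists (g, n).
Qed.

End square_function_energy.

(** * Variations and oscillations *)

Lemma nrm_sub_sqr (R : realType) (u v : R[i]) :
  nrm (u - v) ^+ 2 <= 2 * nrm u ^+ 2 + 2 * nrm v ^+ 2.
Proof.
have h : nrm (u - v) <= nrm u + nrm v by exact: nrmB.
apply: (@le_trans _ _ ((nrm u + nrm v) ^+ 2)).
  by rewrite lerXn2r ?nnegrE ?addr_ge0 ?nrm_ge0.
have := sqr_ge0 (nrm u - nrm v); nra.
Qed.

Section V2_basic.
Context (R : realType) (E : numDomainType) (m : nat).
Implicit Types (D : set 'rV[E]_m) (a : 'rV[E]_m -> R[i]).

Lemma V2_le D a (M : R) :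
  (forall J I, fin_chain D J I -> \sum_(1 <= j < J.+1) nrm (a (I j) - a (I j.-1)) ^+ 2 <= M) ->
  (V2 D a <= (Num.sqrt M)%:E)%E.
Proof.
move=> h; apply: ge_ereal_sup => _ [J [I [_ cI ->]]].
by rewrite lee_fin ler_wsqrtr// h.
Qed.

Lemma V2_ge D a J I : (0 < J)%N -> fin_chain D J I ->
  ((Num.sqrt (\sum_(1 <= j < J.+1) nrm (a (I j) - a (I j.-1)) ^+ 2))%:E <= V2 D a)%E.
Proof. by move=> J0 cI; apply: ereal_sup_ubound; exists J, I. Qed.

(** The supremum of the empty set is -oo, so a two-point chain has to be exhibited. *)
Lemma V2_ge0 D a s s' : D s -> D s' -> prec s s' -> (0 <= V2 D a)%E.
Proof.
move=> Ds Ds' ss; pose I j := if j == 0%N then s else s'.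
apply: le_trans (@V2_ge D a 1 I _ _); rewrite ?lee_fin ?sqrtr_ge0//.
by split => [[|[|]]//|[|]//].
Qed.

End V2_basic.

Section pointwise_domination.
Context (R : realType) (k r L : nat) (lft sg : 'rV[int]_r -> 'rV[R]_k) (a : 'rV[R]_k -> R[i]).
Variable rho : R.
Hypotheses (rho0 : 0 < rho) (rho1 : rho < 1) (r0 : (0 < r)%N).
Hypothesis lft0 : forall g, posorthant (lft g).
Hypothesis sgC : forall g, cube L (lft g) (sg g).
Hypothesis ca : forall g,
  {within cube L (lft g), continuous (a : 'rV[R]_k -> (R[i] : numFieldType))}.

Definition total_energy : \bar R :=
  (\esum_(w in [set: 'rV[int]_r * {ffun 'I_k -> nat}]) (level_energy L (lft w.1) a rho w.2)%:E)%E.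

Let C : R := ((1 - rho)^-1) ^+ k.

Let C0 : 0 < C. Proof. by rewrite exprn_gt0// invr_gt0 subr_gt0. Qed.

Let le0 g n : 0 <= level_energy L (lft g) a rho n.
Proof.
rewrite mulr_ge0 ?invr_ge0 ?exprn_ge0 ?(ltW rho0)//.
by apply: sumr_ge0 => v _; exact: sqr_ge0.
Qed.

Let F g : \bar R := (\esum_(n in [set: {ffun 'I_k -> nat}]) (level_energy L (lft g) a rho n)%:E)%E.

Let F0 g : (0 <= F g)%E. Proof. by apply: esum_ge0 => n _; rewrite lee_fin. Qed.

Let totalE : total_energy = (\esum_(g in [set: 'rV[int]_r]) F g)%E.
Proof.
rewrite /total_energy /F esum_esum; last by move=> g n; rewrite lee_fin.
by congr esum; apply/seteqP; split.
Qed.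

Let cube_V2_ge0 g : (0 <= V2 (cube L (lft g)) a)%E.
Proof.
pose s := lft g; pose s' := (1 + 2 ^+ L) *: lft g.
have lp i : 0 < lft g ord0 i by have := lft0 g i; rewrite mxE.
have b1 : 1 < 1 + 2 ^+ L :> R by rewrite ltrDl exprn_gt0.
have ss i : s ord0 i < s' ord0 i by rewrite /s' mxE -[ltLHS]mul1r ltr_pM2r.
apply: (@V2_ge0 _ _ _ (cube L (lft g)) a s s').
- by split => [i|i|i]; [rewrite mxE; exact: lp|exact: lexx|exact: ltW (ss i)].
- split => [i|i|i]; [|exact: ltW (ss i)|exact: lexx].
  by rewrite mxE; apply: lt_trans (ss i); exact: lp.
- exact: ss.
Qed.

Section finite_energy.
Variable Y : R.
Hypothesis hY : total_energy = Y%:E.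

Let Ff g : F g \is a fin_num.
Proof.
rewrite ge0_fin_numE//; apply: (@le_lt_trans _ _ total_energy); last by rewrite hY ltry.
rewrite totalE; have := @sum_fset_le_esum R _ F [fset g]%fset F0.
by rewrite big_seq_fset1.
Qed.

Let f g : R := fine (F g).
Let f0 g : 0 <= f g. Proof. exact: fine_ge0. Qed.

Let sum_f_le (s : seq 'rV[int]_r) : uniq s -> \sum_(g <- s) f g <= Y.
Proof.
move=> us; pose K : {fset 'rV[int]_r} := [fset g in s]%fset.
apply: (@le_trans _ _ (\sum_(g <- K) f g)).
  by apply: le_sum_sub_uniq; rewrite ?fset_uniq// => g gs; rewrite /K !inE.
rewrite -lee_fin -hY totalE -sumEFin.
rewrite (eq_bigr F) => [|g _]; last by rewrite /f fineK.
exact: sum_fset_le_esum.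
Qed.

Let Y0 : 0 <= Y. Proof. by have := sum_f_le (isT : uniq [::]); rewrite big_nil. Qed.

Let box_le g N : \sum_(n : {ffun 'I_k -> 'I_N.+1}) level_energy L (lft g) a rho (nat_level n) <= f g.
Proof.
rewrite -lee_fin /f fineK//.
pose B : {fset {ffun 'I_k -> nat}} := [fset nat_level n | n in [set: {ffun 'I_k -> 'I_N.+1}]%SET]%fset.
apply: (@le_trans _ _ (\sum_(n <- B) level_energy L (lft g) a rho n)%:E); last first.
  by rewrite -sumEFin; apply: sum_fset_le_esum => n; rewrite lee_fin.
rewrite lee_fin big_imfset/=; last first.
  move=> n n' _ _ nn; apply/ffunP => i; apply/val_inj.
  by have := congr1 (fun h : {ffun 'I_k -> nat} => h i) nn; rewrite !ffunE.
by rewrite le_eqVlt; apply/orP; left; apply/eqP; rewrite big_enum/=; apply: eq_bigl => n; rewrite inE.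
Qed.

Let cube_V2 g : (V2 (cube L (lft g)) a <= (Num.sqrt (4 * (C * f g)))%:E)%E.
Proof.
apply: V2_le => J I cI.
exact: (cube_chain_bound rho0 rho1 (box_le g) (lft0 g) (@ca g) cI).
Qed.

Lemma l2sum_short_le_real :
  (l2sum (fun g => V2 (cube L (lft g)) a) <= (Num.sqrt (4 * (C * Y)))%:E)%E.
Proof.
have CY0 : 0 <= 4 * (C * Y) by rewrite mulr_ge0// mulr_ge0// ltW.
have V2sq g : (V2 (cube L (lft g)) a ^+ 2 <= (4 * (C * f g))%:E)%E.
  have := cube_V2 g; have := cube_V2_ge0 g.
  case: (V2 _ _) => [v| |]//; rewrite -EFin_expe !lee_fin => v0 vs.
  rewrite -[leRHS]sqr_sqrtr; first by rewrite lerXn2r ?nnegrE ?sqrtr_ge0.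
  by rewrite mulr_ge0// mulr_ge0// ltW.
have V20 g : (0 <= V2 (cube L (lft g)) a ^+ 2)%E.
  by rewrite expe_ge0// cube_V2_ge0.
have h : (\esum_(g in [set: 'rV[int]_r]) (V2 (cube L (lft g)) a ^+ 2) <= (4 * (C * Y))%:E)%E.
  apply: esum_le_fset => // K.
  apply: (@le_trans _ _ (\sum_(g <- K) (4 * (C * f g)))%:E).
    by rewrite -sumEFin; apply: lee_sum => g _.
  rewrite lee_fin -!mulr_sumr ler_wpM2l// ler_wpM2l ?(ltW C0)// sum_f_le//.
  exact: fset_uniq.
rewrite -powR12_sqrt// -poweR_EFin /l2sum.
have e0 : (0 <= \esum_(g in [set: 'rV[int]_r]) (V2 (cube L (lft g)) a ^+ 2))%E.
  by apply: esum_ge0 => g _.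
apply: gt0_ler_poweR => //; rewrite in_itv/= leey andbT// lee_fin//.
Qed.

(** No cancellation is used between different cubes: each difference is bounded by the two values.
    Along the chain the first coordinates increase strictly, so the indices are pairwise distinct
    and the energies of their cubes add up to at most the total energy. *)
Lemma V2_long_le_real :
  (V2 [set: 'rV[int]_r] (fun g => a (sg g)) <= (Num.sqrt (4 * (C * Y)))%:E)%E.
Proof.
apply: V2_le => J I [_ cI]; pose z : 'I_r := Ordinal r0.
pose b g := a (sg g).
have b_le g : nrm (b g) ^+ 2 <= C * f g.
  exact: (cube_point_bound rho0 rho1 (box_le g) (lft0 g) (@ca g) (sgC g)).
have mono i j : (i < j <= J)%N -> I i ord0 z < I j ord0 z.
  elim: j => // j IH /andP[ij jJ]; move: ij; rewrite ltnS leq_eqVlt => /orP[/eqP ->|ij].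
    exact: cI.
  by apply: (lt_trans (IH _)); rewrite ?ij ?(ltnW jJ)//; apply: cI.
have uI : uniq (map I (iota 0 J.+1)).
  rewrite map_inj_in_uniq ?iota_uniq// => i j; rewrite !mem_iota !add0n !ltnS => /andP[_ iJ] /andP[_ jJ] e.
  case: (ltngtP i j) => // h.
    by have := @mono i j; rewrite h jJ e ltxx => /(_ isT).
  by have := @mono j i; rewrite h iJ e ltxx => /(_ isT).
have sb : \sum_(i < J.+1) nrm (b (I i)) ^+ 2 <= C * Y.
  apply: (@le_trans _ _ (\sum_(i < J.+1) C * f (I i))); first by apply: ler_sum.
  rewrite -mulr_sumr ler_wpM2l ?(ltW C0)//.
  by have := sum_f_le uI; rewrite big_map -[iota 0 _]/(index_iota 0 J.+1) big_mkord.
apply: (@le_trans _ _ (\sum_(j < J) (2 * nrm (b (I j.+1)) ^+ 2 + 2 * nrm (b (I j)) ^+ 2))).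
  rewrite big_add1/= big_mkord; apply: ler_sum => j _.
  exact: nrm_sub_sqr.
rewrite big_split/= -!mulr_sumr.
have s1 : \sum_(j < J) nrm (b (I j.+1)) ^+ 2 <= C * Y.
  by apply: le_trans sb; rewrite big_ord_recl/= lerDr sqr_ge0.
have s2 : \sum_(j < J) nrm (b (I j)) ^+ 2 <= C * Y.
  by apply: le_trans sb; rewrite big_ord_recr/= lerDl sqr_ge0.
lra.
Qed.

End finite_energy.

Let total0 : (0 <= total_energy)%E.
Proof. by apply: esum_ge0 => w _; rewrite lee_fin. Qed.

Let sqrtE Y : total_energy = Y%:E -> (Num.sqrt (4 * (C * Y)))%:E =
  ((Num.sqrt (4 * C))%:E * total_energy `^ 2^-1)%E.
Proof.
move=> hY; have Y0 : 0 <= Y by rewrite -lee_fin -hY.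
have C40 : 0 <= 4 * C by rewrite mulr_ge0// ltW.
by rewrite hY poweR_EFin -EFinM powR12_sqrt// -sqrtrM// mulrA.
Qed.

Let total_pinfty (x : \bar R) : total_energy = +oo%E ->
  (x <= (Num.sqrt (4 * C))%:E * total_energy `^ 2^-1)%E.
Proof.
move=> ->; rewrite poweRyr ?invr_eq0// gt0_muley ?leey// lte_fin sqrtr_gt0.
by rewrite mulr_gt0.
Qed.

Lemma l2sum_short_le : (l2sum (fun g => V2 (cube L (lft g)) a) <=
  (Num.sqrt (4 * C))%:E * total_energy `^ 2^-1)%E.
Proof.
have := total0; case hY : total_energy => [Y| |]// _; rewrite -hY.
  by rewrite -(sqrtE hY); apply: l2sum_short_le_real.
exact: total_pinfty.
Qed.

Lemma V2_long_le : (V2 [set: 'rV[int]_r] (fun g => a (sg g)) <=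
  (Num.sqrt (4 * C))%:E * total_energy `^ 2^-1)%E.
Proof.
have := total0; case hY : total_energy => [Y| |]// _; rewrite -hY.
  by rewrite -(sqrtE hY); apply: V2_long_le_real.
exact: total_pinfty.
Qed.

End pointwise_domination.

(** * Oscillation dominated by variation *)

Section oscillation.
Context (R : realType) (k : nat).
Implicit Types (D : set 'rV[R]_k) (a : 'rV[R]_k -> R[i]) (I u w s : nat -> 'rV[R]_k).

Lemma alternating_chain_le D a (V : R) u w J : 0 <= V -> (V2 D a <= V%:E)%E ->
  (forall i, D (u i)) -> (forall i, D (w i)) ->
  (forall i, prec (u i) (w i)) -> (forall i, prec (w i) (u i.+1)) ->
  \sum_(i < J) nrm (a (w i) - a (u i)) ^+ 2 <= V ^+ 2.
Proof.
move=> V0 hV Du Dw uw wu; case: (posnP J) => [->|J0]; first by rewrite big_ord0 sqr_ge0.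
pose c j := if odd j then w j./2 else u j./2.
have cc : fin_chain D J.*2 c.
  split => [j _|j _]; first by rewrite /c; case: ifP.
  by rewrite /c /= uphalf_half; case: (odd j) => /=; [exact: wu|exact: uw].
pose g j := nrm (a (c j) - a (c j.-1)) ^+ 2.
have g0 j : 0 <= g j by exact: sqr_ge0.
have sE : \sum_(i < J) nrm (a (w i) - a (u i)) ^+ 2 <= \sum_(0 <= j < J.*2) g j.
  elim: (J) => [|m IH]; first by rewrite big_ord0 big_geq.
  rewrite big_ord_recr/= doubleS !big_nat_recr//= -addrA lerD//.
  by rewrite -[leLHS]add0r lerD// /g /c /= odd_double/= uphalf_double doubleK.
have h := le_trans (V2_ge _ _ cc) hV; move: h; rewrite double_gt0 => /(_ J0).
rewrite lee_fin => h; apply: (le_trans sE).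
apply: (@le_trans _ _ (\sum_(1 <= j < J.*2.+1) g j)).
  rewrite [leRHS]big_nat_recr/=; last by rewrite double_gt0.
  rewrite (big_ltn (_ : 0 < J.*2)%N) ?double_gt0// [leLHS]addrC lerD2l.
  by rewrite {1}/g subrr nrm0 expr0n g0.
by rewrite -(@sqr_sqrtr _ (\sum_(1 <= j < J.*2.+1) g j)) ?sumr_ge0// lerXn2r ?nnegrE ?sqrtr_ge0.
Qed.

(* The points u i between s (i - 1) and I i satisfy u i < I i <= s i < u (i + 1), with strict
   inequalities around u i even where s i and I i share coordinates. Hence (u, s) and (u, I)
   are alternating chains although (I, s) is not. *)
Lemma selection_oscillation_le a (V : R) I s J : 0 <= V ->
  (V2 posorthant a <= V%:E)%E -> inf_chain posorthant I ->
  (forall i, box I i.+1 (s i)) ->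
  \sum_(i < J) nrm (a (s i) - a (I i)) ^+ 2 <= 4 * V ^+ 2.
Proof.
move=> V0 hV [I0 II] sI.
have sl i m : I i ord0 m <= s i ord0 m by case: (sI i) => h _; exact: h.
have sr i m : s i ord0 m < I i.+1 ord0 m by case: (sI i) => _ h; exact: h.
pose u j := 2^-1 *: (if j is i.+1 then s i + I i.+1 else I 0%N).
have Ip i m : 0 < I i ord0 m by have := I0 i m; rewrite mxE.
have us i m : u i ord0 m < I i ord0 m.
  rewrite /u; case: i => [|i]; rewrite !mxE.
    by have := Ip 0%N m; lra.
  by have := sr i m; lra.
have su i m : s i ord0 m < u i.+1 ord0 m by rewrite /u !mxE; have := sr i m; lra.
have up i : posorthant (u i).
  move=> m; rewrite mxE /u; case: i => [|i]; rewrite !mxE.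
    by have := Ip 0%N m; lra.
  by have := sl i m; have := Ip i m; have := Ip i.+1 m; lra.
have h1 : \sum_(i < J) nrm (a (s i) - a (u i)) ^+ 2 <= V ^+ 2.
  apply: (alternating_chain_le J V0 hV up) => i m.
  - by rewrite mxE; apply: lt_le_trans (sl i m).
  - by apply: lt_le_trans (sl i m).
  - exact: su.
have h2 : \sum_(i < J) nrm (a (I i) - a (u i)) ^+ 2 <= V ^+ 2.
  apply: (alternating_chain_le J V0 hV up) => // i m.
  by apply: le_lt_trans (sl i m) _.
apply: (@le_trans _ _ (\sum_(i < J) (2 * nrm (a (s i) - a (u i)) ^+ 2 + 2 * nrm (a (I i) - a (u i)) ^+ 2))).
  apply: ler_sum => i _.
  rewrite (_ : a (s i) - a (I i) = (a (s i) - a (u i)) - (a (I i) - a (u i))); first exact: nrm_sub_sqr.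
  by rewrite opprB addrA subrK.
rewrite big_split/= -!mulr_sumr; lra.
Qed.

(** The suprema over boxes need not be attained, so points are selected in all boxes simultaneously,
    each reaching its squared supremum up to a factor c < 1; the bound for selections applies, and c
    is arbitrary. *)
Lemma O2_le_V2 a I : inf_chain posorthant I -> (O2 I a <= 2%:E * V2 posorthant a)%E.
Proof.
move=> cI; have [I0 II] := cI.
have V0 : (0 <= V2 posorthant a)%E by exact: V2_ge0 (I0 0%N) (I0 1%N) (II 0%N).
move: V0; case hV : (V2 _ a) => [V| |]//; rewrite ?lee_fin => V0; last first.
  by rewrite gt0_muley ?leey// lte_fin.
have {}hV : (V2 posorthant a <= V%:E)%E by rewrite hV.
pose X j := [set (nrm (a s - a (I j)))%:E | s in box I j.+1].
have Ibox j : box I j.+1 (I j) by split; [move=> m; exact: lexx|exact: II].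
have X0 j : (0 <= ereal_sup (X j))%E.
  by apply: ereal_sup_ubound; exists (I j) => //; rewrite subrr nrm0.
(* Near-optimal points can be selected only below finite suprema. Finiteness comes from selections
   that differ from the chain in a single box. *)
have Xle j : (ereal_sup (X j) <= (2 * V)%:E)%E.
  apply: ge_ereal_sup => _ [s sb <-]; rewrite lee_fin.
  pose t i := if i == j then s else I i.
  have tb i : box I i.+1 (t i) by rewrite /t; case: eqP => [->|_].
  have := selection_oscillation_le j.+1 V0 hV cI tb.
  rewrite big_ord_recr/= {2}/t eqxx => h.
  rewrite -(@ler_pXn2r _ 2%N) ?nnegrE ?nrm_ge0 ?mulr_ge0// exprMn.
  rewrite (_ : 2 ^+ 2 = 4 :> R); last by ring.
  by apply: le_trans h; rewrite lerDr sumr_ge0// => i _; exact: sqr_ge0.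
have Xf j : ereal_sup (X j) \is a fin_num.
  by rewrite ge0_fin_numE// (le_lt_trans (Xle j))// ltry.
pose y j := fine (ereal_sup (X j)).
have yE j : ereal_sup (X j) = (y j)%:E by rewrite /y fineK.
have y0 j : 0 <= y j by rewrite -lee_fin -yE.
have part J : \sum_(i < J) y i ^+ 2 <= 4 * V ^+ 2.
  have key c : 0 < c -> c < 1 -> c * \sum_(i < J) y i ^+ 2 <= 4 * V ^+ 2.
    move=> c0 c1.
    have ex i : exists s : 'rV[R]_k, box I i.+1 s /\ c * y i ^+ 2 <= nrm (a s - a (I i)) ^+ 2.
      have := y0 i; rewrite le_eqVlt => /orP[/eqP yi|yi].
        by exists (I i); split; rewrite -?yi ?expr0n ?mulr0 ?sqr_ge0//=.
      have : ((Num.sqrt (c * y i ^+ 2))%:E < ereal_sup (X i))%E.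
        rewrite yE lte_fin -[ltRHS]ger0_norm// -sqrtr_sqr ltr_sqrt ?exprn_gt0//.
        by rewrite gtr_pMl ?exprn_gt0.
      move=> /ereal_sup_gt[_ [s sb <-]]; rewrite lte_fin => h; exists s; split=> //.
      rewrite -[leLHS]sqr_sqrtr ?mulr_ge0 ?sqr_ge0 ?(ltW c0)//.
      by rewrite lerXn2r ?nnegrE ?sqrtr_ge0 ?nrm_ge0 ?(ltW h).
    have [s hs] := choice ex.
    apply: le_trans (selection_oscillation_le J V0 hV cI (fun i => (hs i).1)).
    by rewrite mulr_sumr; apply: ler_sum => i _; exact: (hs i).2.
  rewrite leNgt; apply/negP => lt; set Y := \sum_(i < J) _ in lt key.
  have B0 : 0 <= 4 * V ^+ 2 by rewrite mulr_ge0 ?sqr_ge0.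
  have Y0 : 0 < Y by exact: le_lt_trans B0 lt.
  (* If Y > 4 V^2, this c lies below 1 and c Y is the midpoint of 4 V^2 and Y, which contradicts
     [key]. *)
  have := @key ((4 * V ^+ 2 + Y) / (2 * Y)).
  rewrite divr_gt0 ?mulr_gt0 ?ltr_wpDl// ltr_pdivrMr ?mulr_gt0//.
  rewrite (_ : (4 * V ^+ 2 + Y) / (2 * Y) * Y = (4 * V ^+ 2 + Y) / 2); last first.
    by field; rewrite gt_eqF.
  by move=> /(_ isT); lra.
rewrite /O2 (_ : (2%:E * V%:E)%E = ((4 * V ^+ 2)%:E `^ 2^-1)%E); last first.
  rewrite poweR_EFin powR12_sqrt ?mulr_ge0 ?sqr_ge0// -EFinM; congr EFin.
  rewrite (_ : 4 * V ^+ 2 = (2 * V) ^+ 2); last by ring.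
  by rewrite sqrtr_sqr ger0_norm// mulr_ge0.
have sq0 j : (0 <= ereal_sup [set (nrm (a s - a (I j.-1)))%:E | s in box I j] ^+ 2)%E.
  exact: sqre_ge0.
have le : (\sum_(1 <= j <oo)
     (ereal_sup [set (nrm (a s - a (I j.-1)))%:E | s in box I j]) ^+ 2 <= (4 * V ^+ 2)%:E)%E.
  apply: lime_le; first by apply: is_cvg_nneseries => n _ _.
  apply: nearW => n; case: n => [|n]; first by rewrite big_geq// lee_fin mulr_ge0 ?sqr_ge0.
  rewrite big_add1/= big_mkord.
  apply: (@le_trans _ _ (\sum_(i < n) y i ^+ 2)%:E); last by rewrite lee_fin.
  rewrite -sumEFin le_eqVlt; apply/orP; left; apply/eqP; apply: eq_bigr => i _.
  by rewrite -/(X i) yE EFin_expe.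
apply: gt0_ler_poweR => //; rewrite in_itv/= leey andbT; last by rewrite lee_fin mulr_ge0 ?sqr_ge0.
by apply: nneseries_ge0 => n _ _; exact: (sq0 n).
Qed.

End oscillation.

Section norm_domination.
Context d (T : measurableType d) (R : realType) (mu : {measure set T -> \bar R}).

(** F may be non-measurable: the lower integral is monotone with respect to almost everywhere
    inequalities, and homogeneous in the direction used. *)
Lemma Lnorm_dominated (F G : T -> \bar R) (f : T -> R[i]) (p c K : R) :
  0 < p -> 0 < c -> 0 <= K ->
  (forall x, (0 <= F x)%E) -> (forall x, (0 <= G x)%E) ->
  {ae mu, forall x, (F x <= c%:E * G x)%E} ->
  (\int[mu]_x (G x `^ p) <= (K `^ p)%:E * pint mu p f)%E ->
  ('N[mu]_p%:E[F] <= (c * K)%:E * cnorm mu p%:E f)%E.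
Proof.
move=> p0 c0 K0 F0 G0 FG hG; apply/Lnorm_leP; rewrite ?mulr_ge0 ?(ltW c0)//.
have cp0 : 0 < c `^ p by rewrite powR_gt0.
apply: (@le_trans _ _ (\int[mu]_x ((c `^ p)%:E * G x `^ p))%E).
  apply: ae_le_lower_integral => [x|x|]; first exact: poweR_ge0.
    by rewrite mule_ge0 ?poweR_ge0// lee_fin ltW.
  move: FG; apply: filterS => x h; rewrite gee0_abs//.
  rewrite -poweR_EFin -poweRM ?lee_fin ?(ltW c0)//.
  apply: gt0_ler_poweR; rewrite ?(ltW p0)// in_itv/= leey andbT//.
  by rewrite mule_ge0// lee_fin ltW.
apply: (le_trans (lower_integralZl _ cp0 _)); first by move=> x; exact: poweR_ge0.
rewrite powRM ?(ltW c0)// EFinM -muleA.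
by apply: lee_wpmul2l; rewrite // lee_fin ltW.
Qed.

End norm_domination.

Section variation_from_classes.
Context d (T : measurableType d) (R : realType) (mu : {sigma_finite_measure set T -> \bar R}).
Context (k r L : nat) (lft sg : 'rV[int]_r -> 'rV[R]_k).
Variables (H : 'rV[R]_k -> (T -> R[i]) -> T -> R[i]) (p Kc th : R) (f : T -> R[i]).
Hypotheses (r0 : (0 < r)%N) (p1 : 1 <= p) (Kc0 : 0 <= Kc) (th0 : 0 < th) (th1 : th < 1).
Hypothesis lft0 : forall g, posorthant (lft g).
Hypothesis sgC : forall g, cube L (lft g) (sg g).
Hypothesis contH : forall g, {ae mu, forall x, {within cube L (lft g),
  continuous (fun s => H s f x : (R[i] : numFieldType))}}.
Hypothesis mU : forall g (n : {ffun 'I_k -> nat}) (v : grid n), cmeasurable (dyadic_op L lft H g v f).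
Hypothesis class_bd : forall (G : finType) (io : G -> 'rV[int]_r) (n : {ffun 'I_k -> nat}),
  injective io ->
  (\int[mu]_x (nrm2 (fun w : G * grid n => dyadic_op L lft H (io w.1) w.2 f) x `^ (p / 2))%:E <=
   ((Kc * (th ^+ 2) ^+ weight n) `^ p)%:E * pint mu p f)%E.

(** The first factor is the pointwise constant of the chain bounds with weight rho = th^2; the
    second one bounds the norm of the square root of the total energy. *)
Definition variation_const : R :=
  Num.sqrt (4 * ((1 - th ^+ 2)^-1) ^+ k) * (Kc * ((1 - th)^-1) ^+ k).

Let th20 : 0 < th ^+ 2. Proof. by rewrite exprn_gt0. Qed.
Let th21 : th ^+ 2 < 1. Proof. by rewrite exprn_ilt1// ltW. Qed.

Let G x : \bar R := (total_energy L lft (fun s => H s f x) (th ^+ 2) `^ 2^-1)%E.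

Let G0 x : (0 <= G x)%E. Proof. exact: poweR_ge0. Qed.

Let c0 : 0 < Num.sqrt (4 * ((1 - th ^+ 2)^-1) ^+ k).
Proof. by rewrite sqrtr_gt0 mulr_gt0// exprn_gt0// invr_gt0 subr_gt0. Qed.

Let Kk0 : 0 <= Kc * ((1 - th)^-1) ^+ k.
Proof. by rewrite mulr_ge0// exprn_ge0// invr_ge0 subr_ge0 ltW. Qed.

Let int_G : (\int[mu]_x (G x `^ p) <= ((Kc * ((1 - th)^-1) ^+ k) `^ p)%:E * pint mu p f)%E.
Proof.
apply: le_trans (int_energy_le p1 Kc0 th0 th1 mU class_bd).
apply: le_lower_integral => x; first exact: poweR_ge0.
by rewrite /G -poweRrM mulrC.
Qed.

(** Z^r is countable, so the exceptional null sets may be united; the union is indexed by codes in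
    [nat]. *)
Let cont_all : {ae mu, forall x, forall g, {within cube L (lft g),
  continuous (fun s => H s f x : (R[i] : numFieldType))}}.
Proof.
have h : {ae mu, forall x, forall n : nat, if choice.unpickle n is Some g then
    {within cube L (lft g), continuous (fun s => H s f x : (R[i] : numFieldType))} else True}.
  apply: ae_foralln => n; case: (choice.unpickle n) => [g|]; first exact: contH.
  exact: nearW.
move: h; apply: filterS => x hx g.
by have := hx (choice.pickle g); rewrite choice.pickleK.
Qed.

Lemma Lnorm_long_variation_le :
  ('N[mu]_p%:E[(fun x => V2 [set: 'rV[int]_r] (fun g => H (sg g) f x))] <=
   variation_const%:E * cnorm mu p%:E f)%E.
Proof.
apply: (Lnorm_dominated (lt_le_trans ltr01 p1) c0 Kk0 _ G0 _ int_G) => [x|].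
  apply: (@V2_ge0 _ _ _ _ _ 0 (const_mx 1)) => // i; by rewrite !mxE.
move: cont_all; apply: filterS => x cx.
exact: (V2_long_le th20 th21 r0 lft0 sgC cx).
Qed.

Lemma Lnorm_short_variation_le :
  ('N[mu]_p%:E[(fun x => l2sum (fun g => V2 (cube L (lft g)) (fun s => H s f x)))] <=
   variation_const%:E * cnorm mu p%:E f)%E.
Proof.
apply: (Lnorm_dominated (lt_le_trans ltr01 p1) c0 Kk0 _ G0 _ int_G) => [x|].
  exact: poweR_ge0.
move: cont_all; apply: filterS => x cx.
exact: (l2sum_short_le th20 th21 lft0 cx).
Qed.

Lemma Lnorm_variation_le A2 :
  ('N[mu]_p%:E[(fun x => V2 posorthant (fun s => H s f x))] <=
     A2%:E * ('N[mu]_p%:E[(fun x => V2 [set: 'rV[int]_r] (fun g => H (sg g) f x))] +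
             'N[mu]_p%:E[(fun x => l2sum (fun g =>
                           V2 (cube L (lft g)) (fun s => H s f x)))]))%E ->
  ('N[mu]_p%:E[(fun x => V2 posorthant (fun s => H s f x))] <=
   (2 * `|A2| * variation_const)%:E * cnorm mu p%:E f)%E.
Proof.
have vc0 : 0 <= variation_const by rewrite mulr_ge0// ltW.
move=> h; apply: (le_trans h).
apply: (@le_trans _ _ (`|A2|%:E * (variation_const%:E * cnorm mu p%:E f + variation_const%:E * cnorm mu p%:E f))%E).
  apply: (le_trans (lee_wpmul2r (_ : (0 <= _)%E) (_ : (A2%:E <= `|A2|%:E)%E))).
  - by rewrite adde_ge0// Lnorm_ge0.
  - by rewrite lee_fin ler_norm.
  apply: lee_wpmul2l; first by rewrite lee_fin.
  apply: leeD; [exact: Lnorm_long_variation_le|exact: Lnorm_short_variation_le].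
rewrite -ge0_muleDl ?lee_fin ?vc0// muleA -EFinD -EFinM.
rewrite (_ : `|A2| * (variation_const + variation_const) = 2 * `|A2| * variation_const)//.
by ring.
Qed.

End variation_from_classes.

Section oscillation_from_variation.
Context d (T : measurableType d) (R : realType) (mu : {measure set T -> \bar R}).

Lemma oscillation_of_variation (k : nat) (H : 'rV[R]_k -> (T -> R[i]) -> T -> R[i]) (p A : R) :
  0 < p -> 0 <= A -> variation_inequality mu p A H -> oscillation_inequality mu p (2 * A) H.
Proof.
move=> p0 A0 hV f Lf; apply: ge_ereal_sup => _ [I cI <-].
pose G x : \bar R := V2 posorthant (fun s => H s f x).
have G0 x : (0 <= G x)%E.
  by case: cI => I0 II; exact: V2_ge0 (I0 0%N) (I0 1%N) (II 0%N).
apply: (@Lnorm_dominated _ _ _ _ _ G) => // [x||].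
- exact: poweR_ge0.
- by apply: nearW => x; exact: O2_le_V2.
- have /Lnorm_leP := hV f Lf; move=> /(_ p0 A0).
  apply: le_trans; apply: le_lower_integral => x; first exact: poweR_ge0.
  by rewrite (gee0_abs (G0 x)).
Qed.

End oscillation_from_variation.

(** * Exponents and constants *)

Section hoelder_conjugates.
Context (R : realType).
Implicit Types p q : R.

Lemma hoelder_conjugate_EFin p : 1 < p -> hoelder_conjugate p%:E = (p / (p - 1))%:E.
Proof.
move=> p1; have p0 : p != 0 by rewrite gt_eqF// (lt_trans _ p1).
rewrite /hoelder_conjugate /= eqe (negbTE p0) -EFinB inver subr_eq0 gt_eqF//.
Qed.

Lemma conjugate_exponents p : 1 < p -> p^-1 + (p / (p - 1))^-1 = 1.
Proof.
by move=> p1; field; rewrite subr_eq0 !gt_eqF// (lt_trans _ p1).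
Qed.

Lemma le_hoelder_conjugate p q : 1 < q -> 0 < p ->
  (p%:E <= hoelder_conjugate q%:E)%E = (1 - q^-1 <= p^-1).
Proof.
move=> q1 p0; have q0 : 0 < q by rewrite (lt_trans _ q1).
have e : (q / (q - 1))^-1 = 1 - q^-1 by field; rewrite subr_eq0 !gt_eqF.
rewrite hoelder_conjugate_EFin// lee_fin -e lef_pV2// posrE// divr_gt0// subr_gt0//.
Qed.

Lemma lt_hoelder_conjugate p q : 1 <= q -> 0 < p -> 1 - q^-1 < p^-1 ->
  (p%:E < hoelder_conjugate q%:E)%E.
Proof.
rewrite le_eqVlt => /orP[/eqP <-|q1] p0; first by rewrite hoelder_conjugate1 ltry.
have q0 : 0 < q by rewrite (lt_trans _ q1).
have e : (q / (q - 1))^-1 = 1 - q^-1 by field; rewrite subr_eq0 !gt_eqF.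
by rewrite hoelder_conjugate_EFin// lte_fin -e ltf_pV2// posrE// divr_gt0// subr_gt0.
Qed.

End hoelder_conjugates.

Section adjoint_forms.
Context d (T : measurableType d) (R : realType) (mu : {measure set T -> \bar R}).

(** The form of the adjoints with its two arguments exchanged is the complex conjugate of the form,
    and the exchange turns P into 1 - P. *)
Lemma form_bound_adjoint (E G1 G2 : finType) (s : E -> G1) (t : E -> G2)
    (U U' : E -> (T -> R[i]) -> T -> R[i]) (P M : R) :
  (forall e f g, Lp mu 2%:E f -> Lp mu 2%:E g ->
    [/\ Lp mu 2%:E (U e f), Lp mu 2%:E (U' e g) &
        cinner mu (U e f) g = cinner mu f (U' e g)]) ->
  form_bound mu t s U' P M -> form_bound mu s t U (1 - P) M.
Proof.
move=> adj h A B idx idx' mi mi' x y fx fy bx.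
rewrite subKr => bY; have := h _ _ _ _ mi' mi _ _ fy fx bY bx.
rewrite (_ : form mu s t U _ _ = (form mu t s U' (fun g => y g \o idx') (fun g => x g \o idx))^*) ?nrm_conj//.
rewrite /form rmorph_sum; apply: eq_bigr => e _ /=.
have Lx : Lp mu 2%:E (x (s e) \o idx) by exact: (Lp_comp_idx mi _ (fx (s e))).
have Ly : Lp mu 2%:E (y (t e) \o idx') by exact: (Lp_comp_idx mi' _ (fy (t e))).
by have [_ L' ->] := adj e _ _ Lx Ly; rewrite (cinnerC L' Lx).
Qed.

End adjoint_forms.

(** * Assembly of the variation inequality *)

Section variation_from_forms.
Context d (T : measurableType d) (R : realType) (mu : {sigma_finite_measure set T -> \bar R}).
Context (k r L : nat) (lft sg : 'rV[int]_r -> 'rV[R]_k) (p0 A2 A5 a2 aQ B eps t tau Q M p : R).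
Variables (H : 'rV[R]_k -> (T -> R[i]) -> T -> R[i]) (S : 'rV[int]_r -> (T -> R[i]) -> T -> R[i]).
Variable c : 'rV[int]_r -> R.
Hypotheses (r0 : (0 < r)%N) (hp0 : 1 <= p0) (hp02 : p0 < 2).
Hypothesis lft0 : forall g, posorthant (lft g).
Hypothesis sgC : forall g, cube L (lft g) (sg g).
Hypothesis Hlin : forall s, posorthant s -> linear_operator mu (Lp_add mu p0%:E 2%:E) (H s).
Hypothesis Hc2 : cancellation mu 2 A5 L H lft.
Hypothesis Slin : forall g, linear_operator mu (Lp_above mu p0) (S g).
Hypothesis SR : resolution_of_identity mu S.
Hypothesis LP2 : LP_estimate mu 2 a2 S.
Hypothesis LPQ : LP_estimate mu Q^-1 aQ S.
Hypothesis c0 : forall h, 0 < c h.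
Hypothesis AO : almost_orthogonality mu L H lft S c.
Hypotheses (Q0 : 0 < Q) (Q1 : Q < 1) (t0 : 0 < t) (ttau : t <= tau) (tau1 : tau <= 1).
Hypotheses (eps0 : 0 < eps) (eps1 : eps < 2^-1).
Hypothesis hB : (\esum_(h in [set: 'rV[int]_r]) (c h `^ ((2^-1 - eps) * t))%:E <= B%:E)%E.
Hypothesis hform : forall (G : finType) (io : G -> 'rV[int]_r) (n : {ffun 'I_k -> nat}),
  form_bound mu (fun w : G * grid n => w.1) id
    (fun w : G * grid n => dyadic_op L lft H (io w.1) w.2) Q M.
Hypotheses (p1 : 1 <= p) (pE : p^-1 = (1 - tau) * Q + tau * 2^-1).
Hypothesis approx : forall (G : finType) (io : G -> 'rV[int]_r) (n : {ffun 'I_k -> nat}) f,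
  Lp mu p%:E f ->
  weakly_approximable mu (fun w : G * grid n => dyadic_op L lft H (io w.1) w.2) f.
Hypothesis hsplit : splitting mu p A2 L H lft sg.
Hypothesis hcont : cube_continuity mu p L H lft.

Lemma variation_from_forms : variation_inequality mu p
  (2 * `|A2| * variation_const k (class_const k L A5 a2 aQ B eps t tau M) (2 `^ (- (eps * tau / 2)))) H.
Proof.
have pg : 0 < p by exact: lt_le_trans p1.
have et0 : 0 < eps * tau by rewrite mulr_gt0// (lt_le_trans t0).
have B0 : 0 <= B.
  rewrite -lee_fin; apply: le_trans hB; apply: esum_ge0 => h _.
  by rewrite lee_fin powR_ge0.
move=> f hf; apply: (Lnorm_variation_le r0 p1 _ _ _ lft0 sgC _ _ _ (hsplit hf)).
- by rewrite /class_const !mulr_ge0// powR_ge0.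
- by rewrite powR_gt0.
- have h : (1 : R) `^ (eps * tau / 2) < 2 `^ (eps * tau / 2).
    by apply: gt0_ltr_powR; rewrite ?nnegrE ?divr_gt0// ltr1n.
  by rewrite powRN invf_lt1 ?powR_gt0 //; rewrite powR1 in h.
- by move=> g; exact: hcont.
- move=> g n v; have [h _ _] := @approx unit (fun=> g) n f hf; exact: (h (tt, v)).
- move=> G io n ioI.
  have hf' : Lp mu (((1 - tau) * Q + tau * 2^-1)^-1)%:E f by rewrite -pE invrK.
  have := class_bound hp0 hp02 lft0 Hlin Hc2 Slin SR LP2 LPQ c0 AO Q0 Q1 t0 ttau tau1 eps0 eps1 hB
    (@ioI) (@hform G io n) hf' (@approx G io n f hf).
  rewrite -pE invrK.
  rewrite (_ : (2 * p^-1)^-1 = p / 2); last by field; rewrite gt_eqF.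
  (* The choice th = 2^-(eps tau / 2) makes (th^2)^(weight n) equal to the decay of one level in
     [class_bound]. *)
  suff -> : ((2 `^ (- (eps * tau / 2))) ^+ 2) ^+ weight n = (2 ^+ weight n) `^ (- (eps * tau)) :> R by [].
  pose b : R := - (eps * tau); have two0 : (0 : R) <= 2 by [].
  have e1 : (2 `^ (- (eps * tau / 2)) : R) ^+ 2 = 2 `^ b.
    by rewrite -(powR_mulrn 2 (powR_ge0 _ _)) -[LHS]powRrM mulNr divfK.
  rewrite e1 -(powR_mulrn (weight n) (powR_ge0 2 b)) -(powR_mulrn (weight n) two0).
  by rewrite -[LHS]powRrM -[RHS]powRrM mulrC.
Qed.

End variation_from_forms.

Section exponents.
Context (R : realType) (p0 p1 : R).
Hypotheses (hp0 : 1 <= p0) (hp01 : p0 < p1) (hp1 : p1 <= 2).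

(* 1 / endpoint lies in (p0, p1) and is the exponent at which the maximal estimate on L^p1
   and the cancellation on L^p0 interpolate to an l^2-valued bound. *)
Definition endpoint : R := (1 - p0 / 2) / p1 + p0 / 2 / p0.

(** The parameter at which x is reached on the way from [endpoint] to 1/2; see [interp_paramK]. *)
Definition interp_param (x : R) : R := (endpoint - x) / (endpoint - 2^-1).

Let t := (p1 - p0) / (2 - p0).
Let p0g : 0 < p0. Proof. exact: lt_le_trans hp0. Qed.
Let p1g : 0 < p1. Proof. exact: lt_trans hp01. Qed.
Let p02 : 0 < 2 - p0. Proof. by rewrite subr_gt0 (lt_le_trans hp01). Qed.

Let endpointE : endpoint - 2^-1 = (2 - p0) / (2 * p1).
Proof. by rewrite /endpoint; field; rewrite !gt_eqF. Qed.

Let gap : 0 < endpoint - 2^-1.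
Proof. by rewrite endpointE divr_gt0// mulr_gt0. Qed.

Lemma endpoint_gt_half : 2^-1 < endpoint.
Proof. by rewrite -subr_gt0. Qed.

Lemma endpoint_lt_inv : endpoint < p0^-1.
Proof.
rewrite -subr_gt0 (_ : _ - _ = (2 - p0) * (p1 - p0) / (2 * p0 * p1)).
  by rewrite divr_gt0 ?mulr_gt0// subr_gt0.
by rewrite /endpoint; field; rewrite !gt_eqF.
Qed.

Lemma endpoint_gt0 : 0 < endpoint.
Proof. by rewrite (lt_trans _ endpoint_gt_half)// invr_gt0. Qed.

Lemma endpoint_lt1 : endpoint < 1.
Proof. by rewrite (lt_le_trans endpoint_lt_inv)// invf_le1. Qed.

Lemma interp_paramK x : x = (1 - interp_param x) * endpoint + interp_param x * 2^-1.
Proof.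
have g : endpoint - 2^-1 != 0 by rewrite gt_eqF.
have e : interp_param x * (endpoint - 2^-1) = endpoint - x by rewrite /interp_param divfK.
apply/eqP; rewrite -subr_eq0.
rewrite (_ : x - _ = interp_param x * (endpoint - 2^-1) - (endpoint - x)); last by ring.
by rewrite e subrr.
Qed.

(** The parameter decreases in x, and at x = 1 / p1 it equals (p1 - p0) / (2 - p0). This is the
    origin of the exponent in the summability condition on c. *)
Lemma interp_param_ge x : x <= p1^-1 -> t <= interp_param x.
Proof.
move=> h; rewrite /interp_param ler_pdivlMr// endpointE.
apply: (@le_trans _ _ (endpoint - p1^-1)); last by rewrite lerD2l lerN2.
by rewrite le_eqVlt; apply/orP; left; apply/eqP; rewrite /endpoint /t; field; rewrite !gt_eqF.
Qed.

Lemma interp_param_le1 x : 2^-1 <= x -> interp_param x <= 1.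
Proof. by move=> h; rewrite /interp_param ler_pdivrMr// mul1r lerD2l lerN2. Qed.

Lemma interp_threshold_gt0 : 0 < t.
Proof. by rewrite divr_gt0// subr_gt0. Qed.

End exponents.

Lemma variation_inequality_le d (T : measurableType d) (R : realType)
    (mu : {measure set T -> \bar R}) (k : nat) (H : 'rV[R]_k -> (T -> R[i]) -> T -> R[i]) (p A A' : R) :
  A <= A' -> variation_inequality mu p A H -> variation_inequality mu p A' H.
Proof.
move=> AA hV f hf; apply: (le_trans (hV f hf)).
by apply: lee_wpmul2r; [exact: Lnorm_ge0|rewrite lee_fin].
Qed.

Section variation_range.
Context d (T : measurableType d) (R : realType) (mu : {sigma_finite_measure set T -> \bar R}).
Context (k r L : nat) (lft sg : 'rV[int]_r -> 'rV[R]_k) (p0 p1 A5 B eps : R) (ALP : R -> R).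
Variables (H : 'rV[R]_k -> (T -> R[i]) -> T -> R[i]) (S : 'rV[int]_r -> (T -> R[i]) -> T -> R[i]).
Variable c : 'rV[int]_r -> R.
Hypotheses (hp0 : 1 <= p0) (hp01 : p0 < p1) (hp1 : p1 <= 2) (hr : (0 < r)%N).
Hypotheses (eps0 : 0 < eps) (eps1 : eps < 2^-1).
Hypothesis Hlin : forall s, posorthant s -> linear_operator mu (Lp_add mu p0%:E 2%:E) (H s).
Hypothesis lft0 : forall g, posorthant (lft g).
Hypothesis sgC : forall g, cube L (lft g) (sg g).
Hypothesis Slin : forall g, linear_operator mu (Lp_above mu p0) (S g).
Hypothesis SR : resolution_of_identity mu S.
Hypothesis LP : forall p, p0 < p -> p <= 2 -> LP_estimate mu p (ALP p) S.
Hypothesis c0 : forall h, 0 < c h.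
Hypothesis AO : almost_orthogonality mu L H lft S c.
Hypothesis hB : (\esum_(h in [set: 'rV[int]_r])
  (c h `^ ((2^-1 - eps) * ((p1 - p0) / (2 - p0))))%:E <= B%:E)%E.
Hypothesis Hc2 : cancellation mu 2 A5 L H lft.

Let Q := endpoint p0 p1.
Let t := (p1 - p0) / (2 - p0).
Let hp02 : p0 < 2. Proof. exact: lt_le_trans hp1. Qed.
Let Q0 : 0 < Q. Proof. exact: endpoint_gt0. Qed.
Let Q1 : Q < 1. Proof. exact: endpoint_lt1. Qed.
Let t0 : 0 < t. Proof. exact: interp_threshold_gt0. Qed.
Let LP2 : LP_estimate mu 2 (ALP 2) S. Proof. exact: LP. Qed.
Let p1g1 : 1 < p1. Proof. exact: le_lt_trans hp01. Qed.

Definition form_const (A1 A5 : R) : R :=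
  maximal_const k A1 `^ (1 - p0 / 2) * cancel_const k L A5 `^ (p0 / 2).

(* Here q = 1/p for p <= 2 and q = 1 - 1/p for p >= 2. *)
Definition range_const (A2 aQ M q : R) : R :=
  2 * `|A2| * variation_const k
    (class_const k L A5 (ALP 2) aQ B eps t (interp_param p0 p1 q) M)
    (2 `^ (- (eps * interp_param p0 p1 q / 2))).

Lemma variation_low A1 A2 p : maximal_estimate mu p1 A1 H -> cancellation mu p0 A5 L H lft ->
  p1 <= p -> p <= 2 -> splitting mu p A2 L H lft sg -> cube_continuity mu p L H lft ->
  variation_inequality mu p (range_const A2 (ALP Q^-1) (form_const A1 A5) p^-1) H.
Proof.
move=> Hmax Hc0 pp1 p2 hs hc.
have pg : 0 < p by rewrite (lt_le_trans _ pp1)// (lt_trans _ p1g1).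
have p0p : p0 < p by exact: lt_le_trans pp1.
have p0g : 0 < p0 by exact: lt_le_trans hp0.
have Qp0 : p0 < Q^-1 by rewrite -[ltLHS]invrK ltf_pV2 ?posrE ?invr_gt0//; exact: endpoint_lt_inv.
have Q2 : Q^-1 <= 2.
  by rewrite -[leRHS]invrK lef_pV2 ?posrE ?invr_gt0// ltW//; exact: endpoint_gt_half.
apply: (variation_from_forms hr hp0 hp02 lft0 sgC Hlin Hc2 Slin SR LP2 (LP Qp0 Q2) c0 AO Q0 Q1 t0
  _ _ eps0 eps1 hB _ _ _ _ hs hc).
- by apply: interp_param_ge => //; rewrite lef_pV2 ?posrE// (lt_trans _ p1g1).
- by apply: interp_param_le1 => //; rewrite lef_pV2 ?posrE.
- by move=> G io n; exact: (class_form_direct hp0 hp01 hp1 lft0 Hlin Hmax Hc0 Hc2 io (n := n)).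
- by rewrite (le_trans _ pp1)// ltW.
- exact: interp_paramK.
- move=> G io n f hf.
  apply: (weakly_approximable_low (p0 := p0) (p := p)
    (M := (cancel_const k L A5 / 2 ^+ weight n) `^ p0) _ hp0 p0p p2 _ _ _ hf).
  + by move=> w; exact: (dyadic_op_L2bounded hp0 lft0 Hlin Hc2).
  + by rewrite powR_gt0// divr_gt0 ?exprn_gt0// cancel_const_gt0.
  + by move=> w; exact: dyadic_op_linear.
  + by move=> w g hg; exact: (dyadic_op_pint lft0 _ _ p0g Hc0 hg).
Qed.

(** The form of H at 1 - [Q] inherits the bound at [Q] of the form of the adjoints with input and
    test families exchanged, whence [class_form_dual]. The L^2 bounds are those of H itself, and 1 /
    p = (1 - tau)(1 - Q) + tau / 2 for the parameter tau of the conjugate value 1 - 1 / p. *)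
Lemma variation_high H' A1' A5' ALP' A2 p :
  (forall s, posorthant s -> linear_operator mu (Lp_add mu p0%:E 2%:E) (H' s)) ->
  (forall s q, posorthant s -> p1 <= q -> (q%:E <= hoelder_conjugate p1%:E)%E ->
     adjoint_on mu q%:E (H s) (H' s)) ->
  maximal_estimate mu p1 A1' H' ->
  cancellation mu p0 A5' L H' lft -> cancellation mu 2 A5' L H' lft ->
  (forall q, 2 <= q -> (q%:E < hoelder_conjugate p0%:E)%E -> LP_estimate mu q (ALP' q) S) ->
  2 <= p -> (p%:E <= hoelder_conjugate p1%:E)%E ->
  splitting mu p A2 L H lft sg -> cube_continuity mu p L H lft ->
  variation_inequality mu p (range_const A2 (ALP' (1 - Q)^-1) (form_const A1' A5') (1 - p^-1)) H.
Proof.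
move=> Hlin' adj Hmax' Hc0' Hc2' LP' p2 pc hs hc.
have pg : 0 < p by exact: lt_le_trans p2.
have p1p : p1 <= p by exact: le_trans p2.
have pg1 : 1 < p by exact: lt_le_trans p1p.
have p0g : 0 < p0 by exact: lt_le_trans hp0.
have Q1' : 0 < 1 - Q by rewrite subr_gt0.
have Qh := endpoint_gt_half hp0 hp01 hp1.
have LPQ : LP_estimate mu (1 - Q)^-1 (ALP' (1 - Q)^-1) S.
  apply: LP'; first by rewrite -[leLHS]invrK lef_pV2 ?posrE ?invr_gt0// /Q; lra.
  apply: lt_hoelder_conjugate; rewrite ?invr_gt0// invrK ltrD2l ltrN2.
  exact: endpoint_lt_inv.
have pV : 1 - p1^-1 <= p^-1 by rewrite -le_hoelder_conjugate.
have p2V : p^-1 <= 2^-1 by rewrite lef_pV2 ?posrE.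
have adj_points q g n (v : grid n) (f f' : T -> R[i]) : p1 <= q -> (q%:E <= hoelder_conjugate p1%:E)%E ->
    Lp mu q%:E f -> Lp mu (q / (q - 1))%:E f' ->
    [/\ Lp mu q%:E (dyadic_op L lft H g v f), Lp mu (q / (q - 1))%:E (dyadic_op L lft H' g v f') &
      cinner mu (dyadic_op L lft H g v f) f' = cinner mu f (dyadic_op L lft H' g v f')].
  move=> q1 qc; have q1' : 1 < q by exact: lt_le_trans q1.
  rewrite !dyadic_opE; apply: (signed_sum_adjoint q1' (conjugate_exponents q1')) => e h h' he.
  rewrite -hoelder_conjugate_EFin//; apply: adj => //.
  by have [] := grid_points_cube (lft0 _) he.
apply: (variation_from_forms hr hp0 hp02 lft0 sgC Hlin Hc2 Slin SR LP2 LPQ c0 AO Q1' _ t0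
  _ _ eps0 eps1 hB _ _ _ _ hs hc).
- by rewrite gtrBl.
- by apply: interp_param_ge => //; lra.
- by apply: interp_param_le1 => //; lra.
- move=> G io n.
  apply: (form_bound_adjoint (U' := fun w : G * grid n => dyadic_op L lft H' (io w.1) w.2)).
    move=> w f f' hf hf'; have e2 : (2 / (2 - 1) : R) = 2 by field.
    have := @adj_points 2 (io w.1) n w.2 f f' hp1; rewrite e2; apply => //.
    rewrite le_hoelder_conjugate//; have : 2^-1 <= p1^-1 by rewrite lef_pV2 ?posrE// (lt_trans _ p1g1).
    lra.
  exact: (class_form_dual hp0 hp01 hp1 lft0 Hlin' Hmax' Hc0' Hc2' io (n := n)).
- exact: ltW.
- by have := interp_paramK hp0 hp01 hp1 (1 - p^-1); rewrite -/Q; lra.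
- move=> G io n f hf.
  apply: (weakly_approximable_high (U' := fun w : G * grid n => dyadic_op L lft H' (io w.1) w.2) p2
    (conjugate_exponents pg1) _ hf) => w h h'.
  exact: adj_points.
Qed.

End variation_range.

Lemma variation_oscillation d (T : measurableType d) (R : realType)
    (mu : {measure set T -> \bar R}) (k : nat) (H : 'rV[R]_k -> (T -> R[i]) -> T -> R[i]) (p A : R) :
  0 < p -> variation_inequality mu p A H ->
  variation_inequality mu p (2 * `|A|) H /\ oscillation_inequality mu p (2 * `|A|) H.
Proof.
move=> p0 hV; split.
  by apply: variation_inequality_le hV; rewrite mulr_natl mulr2n (le_trans (ler_norm A))// lerDl.
by apply: oscillation_of_variation => //; apply: variation_inequality_le hV; exact: ler_norm.
Qed.

Theorem theorem3p1 (R : realType) (p0 p1 eps : R) (k r L : nat)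
    (hp0 : 1 <= p0) (hp01 : p0 < p1) (hp1 : p1 <= 2)
    (hk : (0 < k)%N) (hr : (0 < r)%N) (hL : (0 < L)%N)
    (heps0 : 0 < eps) (heps1 : eps < 2^-1)
    (A1 A2 B A5 : R) (ALP : R -> R) :
  exists C : R,
  forall (A1' A5' : R) (A2' ALP' : R -> R),
  exists C' : R -> R,
  forall (d : measure_display) (T : measurableType d)
    (mu : {sigma_finite_measure set T -> \bar R})
    (H : 'rV[R]_k -> (T -> R[i]) -> (T -> R[i]))
    (lft sg : 'rV[int]_r -> 'rV[R]_k)
    (S : 'rV[int]_r -> (T -> R[i]) -> (T -> R[i]))
    (c : 'rV[int]_r -> R),
  (forall s, posorthant s ->
     linear_operator mu (Lp_add mu p0%:E 2%:E) (H s)) ->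
  (forall g, posorthant (lft g)) ->
  (forall g, cube L (lft g) (sg g)) ->
  maximal_estimate mu p1 A1 H ->
  splitting mu p1 A2 L H lft sg ->
  cube_continuity mu p1 L H lft ->
  (forall g, linear_operator mu (Lp_above mu p0) (S g)) ->
  (forall s g, posorthant s -> commute_on mu (Lp_above mu p0) (H s) (S g)) ->
  resolution_of_identity mu S ->
  (forall p, p0 < p -> p <= 2 -> LP_estimate mu p (ALP p) S) ->
  (forall h, 0 < c h) ->
  almost_orthogonality mu L H lft S c ->
  (\esum_(h in [set: 'rV[int]_r])
     (c h `^ ((2^-1 - eps) * ((p1 - p0) / (2 - p0))))%:E <= B%:E)%E ->
  cancellation mu p0 A5 L H lft ->
  cancellation mu 2 A5 L H lft ->
  [/\ variation_inequality mu p1 C H,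
      oscillation_inequality mu p1 C H &
      forall H' : 'rV[R]_k -> (T -> R[i]) -> (T -> R[i]),
      (* H' s is the adjoint of H s *)
      (forall s, posorthant s ->
         linear_operator mu (Lp_add mu p0%:E 2%:E) (H' s)) ->
      (forall s p, posorthant s -> p1 <= p ->
         (p%:E <= hoelder_conjugate p1%:E)%E ->
         adjoint_on mu p%:E (H s) (H' s)) ->
      maximal_estimate mu p1 A1' H' ->
      (forall p, p1 <= p -> (p%:E <= hoelder_conjugate p1%:E)%E ->
         splitting mu p (A2' p) L H lft sg) ->
      (forall p, p1 <= p -> (p%:E <= hoelder_conjugate p1%:E)%E ->
         cube_continuity mu p L H lft) ->
      cancellation mu p0 A5' L H' lft ->
      cancellation mu 2 A5' L H' lft ->
      (forall p, 2 <= p -> (p%:E < hoelder_conjugate p0%:E)%E ->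
         LP_estimate mu p (ALP' p) S) ->
      forall p, p1 <= p -> (p%:E <= hoelder_conjugate p1%:E)%E ->
        variation_inequality mu p (C' p) H /\
        oscillation_inequality mu p (C' p) H].
Proof.
pose Q := endpoint p0 p1.
(* The constants are built from the exponents and the assumed bounds before any space or operator is
   introduced. [low] serves p <= 2 and [high] serves p > 2. *)
pose low a := range_const k L p0 p1 A5 B eps ALP a (ALP Q^-1) (form_const k L p0 A1 A5).
exists (2 * `|low A2 p1^-1|) => A1' A5' A2' ALP'.
pose high a := range_const k L p0 p1 A5 B eps ALP a (ALP' (1 - Q)^-1) (form_const k L p0 A1' A5').
exists (fun p => 2 * `|if p <= 2 then low (A2' p) p^-1 else high (A2' p) (1 - p^-1)|).
move=> d T mu H lft sg S c Hlin lft0 sgC Hmax hs hc Slin _ SR LP c0 AO hB Hc0 Hc2.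
have p1g : 0 < p1 by rewrite (lt_trans _ hp01)// (lt_le_trans _ hp0).
have vlow a p := variation_low hp0 hp01 hp1 hr heps0 heps1 Hlin lft0 sgC Slin SR LP c0 AO hB Hc2
  (A2 := a) (p := p) Hmax Hc0.
have [h1 h2] := variation_oscillation p1g (@vlow A2 p1 (lexx _) hp1 hs hc).
split=> // H' Hlin' adj Hmax' hs' hc' Hc0' Hc2' LP' p p1p pc.
have pg : 0 < p by exact: lt_le_trans p1p.
apply: variation_oscillation => //; case: (leP p 2) => p2.
  by apply: vlow => //; [exact: hs'|exact: hc'].
apply: (variation_high hp0 hp01 hp1 hr heps0 heps1 Hlin lft0 sgC Slin SR LP c0 AO hB Hc2
  Hlin' adj Hmax' Hc0' Hc2' LP' (ltW p2) pc); [exact: hs'|exact: hc'].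
Qed.
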